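(* Let $n\ge 3$ be an integer, $m>1$, $\alpha=m+2/n$, $\chi>0$, $M_0>0$. Let $u_0$ satisfy $u_0\ge 0$, $u_0\in L^1(\mathbb{R}^n;(1+|x|^2)dx)\cap L^\infty(\mathbb{R}^n)$, $\nabla u_0^m\in L^2(\mathbb{R}^n)$ and $m_0:=\int_{\mathbb{R}^n}u_0\,dx<M_0$. Suppose that $M_0\le M_\ast$, where $$M_\ast=\left(\frac{S_n(\alpha-m)}{\chi}\right)^{\frac{1}{\alpha-m+1}}\frac{\alpha-m+1}{\alpha-m},\qquad S_n=\frac{n(n-2)}{4}\,2^{\frac2n}\,\pi^{1+\frac1n}\,\Gamma\!\left(\frac{n+1}{2}\right)^{-\frac2n}.$$ Then there exists a global weak solution $u$ of $$u_t=\Delta u^m+\chi u^\alpha\left(M_0-\int_{\mathbb{R}^n}u(x,t)\,dx\right),\quad x\in\mathbb{R}^n,\ t>0,\qquad u(x,0)=u_0(x),$$ such that for any $t>0$ $$\|u(\cdot,t)\|_{L^k(\mathbb{R}^n)}\le C_1(1+t)^{-\frac{k-1}{k(m+2/n-1)}}\quad\text{for every }1<k<\infty,\qquad \|u(\cdot,t)\|_{L^\infty(\mathbb{R}^n)}\le C_2,$$ where $C_1,C_2$ are constants depending only on $\|u_0\|_{L^1\cap L^\infty(\mathbb{R}^n)},m,n,\chi,m_0,M_0$ (and, for $C_1$, on $k$).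
   Context: Weak solution: for $T\in(0,\infty]$, a non-negative function $u$ defined on $\mathbb{R}^n\times[0,T)$ is a weak solution of the Cauchy problem on $[0,T)$ if (i) $u\in L^\infty(0,T;L^1\cap L^\infty(\mathbb{R}^n))$ and $u^m\in L^2(0,T;H^1(\mathbb{R}^n))$; and (ii) for every continuously differentiable function $\varphi$ with compact support in $\mathbb{R}^n\times[0,T)$, $$\int_0^T\!\!\int_{\mathbb{R}^n}\nabla u^m\cdot\nabla\varphi\,dxdt-\chi\int_0^T\left(\int_{\mathbb{R}^n}u^\alpha\varphi\,dx\right)\left(M_0-\int_{\mathbb{R}^n}u\,dx\right)dt=\int_{\mathbb{R}^n}u_0(x)\varphi(x,0)\,dx+\int_0^T\!\!\int_{\mathbb{R}^n}u\,\varphi_t\,dxdt.$$ A global weak solution is a function on $\mathbb{R}^n\times[0,\infty)$ that is a weak solution on $[0,T)$ for every $0<T<\infty$. *)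

(* Defs.v *)
From HB Require Import structures.
From mathcomp Require Import all_boot all_order all_algebra.
From mathcomp Require Import all_classical all_reals all_analysis.

Set Implicit Arguments.
Unset Strict Implicit.
Unset Printing Implicit Defensive.

Import Order.TTheory GRing.Theory Num.Theory.
Import numFieldNormedType.Exports.

Local Open Scope classical_set_scope.
Local Open Scope ring_scope.

Fact rV_display : measure_display. Proof. exact: default_measure_display. Qed.

(* The Borel sigma-algebra of R^n, generated by the coordinate projections. *)
Section measurable_rV.
Context {R : realType} (n : nat).

Definition rV_coord (i : 'I_n) (x : 'rV[R]_n) : measurableTypeR R := x 0 i.

Let rV_set0 : g_sigma_preimage rV_coord set0.
Proof. exact: sigma_algebra0. Qed.

Let rV_setC A : g_sigma_preimage rV_coord A ->
  g_sigma_preimage rV_coord (~` A).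
Proof. exact: sigma_algebraC. Qed.

Let rV_bigcup (F : (set 'rV[R]_n)^nat) :
  (forall i, g_sigma_preimage rV_coord (F i)) ->
  g_sigma_preimage rV_coord (\bigcup_i (F i)).
Proof. exact: sigma_algebra_bigcup. Qed.

HB.instance Definition _ := @isMeasurable.Build rV_display
  'rV[R]_n (g_sigma_preimage rV_coord) rV_set0 rV_setC rV_bigcup.

Lemma measurable_rV_coord i : measurable_fun [set: 'rV[R]_n] (rV_coord i).
Proof.
move=> _ Y mY; rewrite setTI; apply: sub_sigma_algebra => /=.
rewrite -bigcup_seq/=; exists i => /=; first by rewrite mem_index_enum.
by exists Y => //; rewrite setTI.
Qed.

Lemma measurable_fun_rV d (S : measurableType d) (f : S -> 'rV[R]_n) :
  (forall i, measurable_fun setT (rV_coord i \o f)) -> measurable_fun setT f.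
Proof.
move=> mf.
suff sub : measurable `<=` [set B | measurable (f @^-1` B)].
  by move=> _ B mB; rewrite setTI; exact: (sub _ mB).
apply: smallest_sub.
- split => /=.
  + by rewrite preimage_set0.
  + by move=> A mA; rewrite setTD preimage_setC; exact: measurableC.
  + by move=> F mF; rewrite preimage_bigcup; exact: bigcup_measurable.
- rewrite -bigcup_seq; apply: bigcup_sub => i _ A [B mB <-] /=.
  by rewrite setTI; have := mf i measurableT B mB; rewrite setTI.
Qed.

End measurable_rV.

Lemma sigma_finite_product d1 d2 (T1 : measurableType d1)
    (T2 : measurableType d2) (R : realType)
    (m1 : {sigma_finite_measure set T1 -> \bar R})
    (m2 : {sigma_finite_measure set T2 -> \bar R}) :
  sigma_finite setT (m1 \x m2)%E.
Proof.
have /sigma_finiteP[F [TF ndF Foo]] := sigma_finiteT m1.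
have /sigma_finiteP[G [TG ndG Goo]] := sigma_finiteT m2.
exists (fun n => F n `*` G n).
  rewrite -setXTT TF TG predeqE => -[x y]; split.
    move=> [/= [n _ Fnx] [k _ Gky]]; exists (maxn n k) => //; split.
    - by move: x Fnx; exact/subsetPset/ndF/leq_maxl.
    - by move: y Gky; exact/subsetPset/ndG/leq_maxr.
  by move=> [n _ []/= ? ?]; split; exists n.
move=> k; have [? ?] := Foo k; have [? ?] := Goo k.
split; first exact: measurableX.
by rewrite product_measure1E// lte_mul_pinfty// ge0_fin_numE.
Qed.

Section lebesgue_rV.
Context {R : realType}.

Definition rcons0 n (p : measurableTypeR R * 'rV[R]_n) : 'rV[R]_n.+1 :=
  \row_i (if unlift ord0 i is Some j then p.2 0 j else p.1).

Definition runcons0 n (x : 'rV[R]_n.+1) : measurableTypeR R * 'rV[R]_n :=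
  (x 0 ord0, \row_j x 0 (lift ord0 j)).

Lemma rcons0K n : cancel (@rcons0 n) (@runcons0 n).
Proof.
case=> a x; congr pair; first by rewrite mxE unlift_none.
by apply/rowP => j; rewrite !mxE liftK.
Qed.

Lemma measurable_rcons0 n : measurable_fun setT (@rcons0 n).
Proof.
apply: measurable_fun_rV => i.
case: (unliftP ord0 i) => [j ->|->].
- rewrite (_ : _ \o _ = rV_coord j \o snd); last first.
    by apply/funext => p; rewrite /rV_coord /= mxE liftK.
  by apply: measurableT_comp => //; exact: measurable_rV_coord.
- rewrite (_ : _ \o _ = fst) //.
  by apply/funext => p; rewrite /rV_coord /= mxE unlift_none.
Qed.

HB.instance Definition _ n := isMeasurableFun.Build _ _ _ _ (@rcons0 n)
  (@measurable_rcons0 n).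

Lemma measurable_runcons0 n : measurable_fun setT (@runcons0 n).
Proof.
apply: measurable_fun_pair; first exact: (measurable_rV_coord ord0).
apply: measurable_fun_rV => j.
rewrite (_ : _ \o _ = rV_coord (lift ord0 j)); last first.
  by apply/funext => p; rewrite /rV_coord /= mxE.
exact: measurable_rV_coord.
Qed.

Section step.
Variables (n : nat) (mu : {sigma_finite_measure set 'rV[R]_n -> \bar R}).

Definition lebesgue_rV_step : set 'rV[R]_n.+1 -> \bar R :=
  pushforward (lebesgue_measure \x mu)%E (@rcons0 n).

Let step0 : lebesgue_rV_step set0 = 0%E.
Proof. exact: measure0. Qed.

Let step_ge0 A : (0 <= lebesgue_rV_step A)%E.
Proof. exact: measure_ge0. Qed.

Let step_sigma_additive : semi_sigma_additive lebesgue_rV_step.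
Proof. exact: measure_semi_sigma_additive. Qed.

HB.instance Definition _ := isMeasure.Build _ _ _ lebesgue_rV_step
  step0 step_ge0 step_sigma_additive.

Let step_sigma_finite : sigma_finite setT lebesgue_rV_step.
Proof.
have [F FT Ffin] := sigma_finite_product (@lebesgue_measure R) mu.
exists (fun i => @runcons0 n @^-1` F i).
  by rewrite -preimage_bigcup -FT preimage_setT.
move=> i; have [mF Flt] := Ffin i; split.
  by rewrite -[X in measurable X]setTI; exact: measurable_runcons0.
rewrite /lebesgue_rV_step /pushforward -comp_preimage.
rewrite (_ : _ \o _ = id) //.
by apply/funext => p /=; rewrite rcons0K.
Qed.

HB.instance Definition _ := Measure_isSigmaFinite.Build _ _ _ lebesgue_rV_step
  step_sigma_finite.

End step.

(* Lebesgue measure on R^n, as an iterated product along the identification of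
   R^n.+1 with R * R^n; see lebesgue_rV_box for its value on boxes. *)
Fixpoint lebesgue_rV n : {sigma_finite_measure set 'rV[R]_n -> \bar R} :=
  match n with
  | 0 => \d_(0 : 'rV[R]_0)
  | n'.+1 => lebesgue_rV_step (lebesgue_rV n')
  end.

End lebesgue_rV.
Arguments lebesgue_rV : clear implicits.

Lemma lebesgue_rV_box (R : realType) n (A : 'I_n -> set (measurableTypeR R)) :
  (forall i, measurable (A i)) ->
  lebesgue_rV R n [set x | forall i, A i (x 0 i)] =
  (\prod_(i < n) lebesgue_measure (A i))%E.
Proof.
elim: n A => [|n IH] A mA.
  by rewrite big_ord0 /= diracE mem_set// => -[].
have mbox : measurable [set x : 'rV[R]_n | forall i, A (lift ord0 i) (x 0 i)].
  rewrite (_ : [set x | _] =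
      \bigcap_(i in [set: 'I_n]) (rV_coord i @^-1` A (lift ord0 i))).
    apply: fin_bigcap_measurable => // i _; rewrite -[X in measurable X]setTI.
    exact: measurable_rV_coord.
  by apply/seteqP; split => x /= Ax i; [move=> _|]; exact: Ax.
rewrite big_ord_recl -IH // -product_measure1E //.
rewrite /= /lebesgue_rV_step /pushforward; congr product_measure1.
apply/seteqP; split => [[a x] /= Aax|[a x] /= [Aa Ax] i].
  split=> [|i]; first by have := Aax ord0; rewrite mxE unlift_none.
  by have := Aax (lift ord0 i); rewrite mxE liftK.
by rewrite mxE; case: unliftP => [j ->|->].
Qed.

Section notions.
Context {R : realType}.
Local Notation dx n := (lebesgue_rV R n).
Local Notation dt := (@lebesgue_measure R).

(* In finite dimension, existence and continuity of all directional derivatives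
   up to order k is the usual C^k. *)
Fixpoint Ck (V : normedModType R) k (f : V -> R) : Prop :=
  continuous f /\
  if k is k'.+1 then
    forall v : V, (forall x, derivable f x v) /\ Ck k' ('D_v f)
  else True.

Definition Cinfty (V : normedModType R) (f : V -> R) := forall k, Ck k f.

Section space.
Variable n : nat.
Local Notation Rn := 'rV[R]_n.

Definition dotv (x y : Rn) : R := \sum_i x 0 i * y 0 i.

Definition grad (f : Rn -> R) (x : Rn) : Rn := \row_i 'D_(delta_mx 0 i) f x.

(* g is the distributional gradient of f, both being locally integrable. *)
Definition weak_gradient (f : Rn -> R) (g : Rn -> Rn) : Prop :=
  [/\ forall K, compact K -> (dx n).-integrable K (EFin \o f),
      forall K i, compact K -> (dx n).-integrable K (fun x => (g x 0 i)%:E) &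
      forall (psi : Rn -> R) K i, Cinfty psi -> compact K ->
        (forall x, ~ K x -> psi x = 0) ->
        \int[dx n]_x (f x * grad psi x 0 i) = - \int[dx n]_x (g x 0 i * psi x)].

Definition has_L2_gradient (f : Rn -> R) : Prop :=
  exists g : Rn -> Rn,
    [/\ weak_gradient f g, measurable_fun setT g &
        (\int[dx n]_x (dotv (g x) (g x))%:E < +oo)%E].

Definition norm_L1Linfty (f : Rn -> R) : \bar R :=
  ('N[dx n]_1[EFin \o f] + 'N[dx n]_+oo[EFin \o f])%E.

(* ]0, T[, where T may be +oo. *)
Definition time (T : \bar R) : set R := [set t | 0 < t /\ (t%:E < T)%E].

Definition spacetime (T : \bar R) : set (Rn * measurableTypeR R) :=
  [set: Rn] `*` time T.

(* u \in L^oo(0, T; L^1 \cap L^oo). *)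
Definition Linfty_L1Linfty (T : \bar R) (u : Rn * R -> R) : Prop :=
  measurable_fun (spacetime T) u /\
  exists C : R, \forall t \ae dt, time T t ->
    (norm_L1Linfty (fun x => u (x, t)) <= C%:E)%E.

(* f \in L^2(0, T; H^1), with spatial weak gradient g. Since H^1 is separable,
   strong measurability in time amounts to joint measurability of f and g. *)
Definition L2_H1 (T : \bar R) (f : Rn * R -> R) (g : Rn * R -> Rn) : Prop :=
  [/\ measurable_fun (spacetime T) f, measurable_fun (spacetime T) g,
      (\int[dx n \x dt]_(z in spacetime T)
         (f z ^+ 2 + dotv (g z) (g z))%:E < +oo)%E &
      \forall t \ae dt, time T t ->
        weak_gradient (fun x => f (x, t)) (fun x => g (x, t))].

(* phi is C^1 with compact support in R^n x [0, T[: it is the restriction to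
   that set of a C^1 function on R^n x R, whose values at negative times are
   unconstrained (so phi need not vanish at t = 0). *)
Definition test_function (T : \bar R) (phi : Rn * R -> R) : Prop :=
  Ck 1 phi /\
  exists K : set (Rn * R),
    [/\ compact K, K `<=` [set z | 0 <= z.2 /\ (z.2%:E < T)%E] &
        forall z, 0 <= z.2 -> ~ K z -> phi z = 0].

(* u is a total function on R^n x R, of which only the values on R^n x [0, T[
   matter; g is the weak gradient of u^m, unique almost everywhere. *)
Definition weak_solution (m alpha chi M0 : R) (u0 : Rn -> R) (T : \bar R)
    (u : Rn * R -> R) : Prop :=
  [/\ forall x t, 0 <= t -> (t%:E < T)%E -> 0 <= u (x, t),
      Linfty_L1Linfty T u &
      exists2 g : Rn * R -> Rn, L2_H1 T (fun z => u z `^ m) g &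
        forall phi, test_function T phi ->
          \int[dt]_(t in time T) \int[dx n]_x
             dotv (g (x, t)) (grad (fun y => phi (y, t)) x)
          - chi * \int[dt]_(t in time T)
              ((\int[dx n]_x (u (x, t) `^ alpha * phi (x, t)))
               * (M0 - \int[dx n]_x u (x, t)))
          = \int[dx n]_x (u0 x * phi (x, 0))
            + \int[dt]_(t in time T) \int[dx n]_x
                (u (x, t) * derive1 (fun s => phi (x, s)) t)].

Definition global_weak_solution (m alpha chi M0 : R) (u0 : Rn -> R)
    (u : Rn * R -> R) : Prop :=
  forall T : R, 0 < T -> weak_solution m alpha chi M0 u0 T%:E u.

End space.

Definition Gamma (x : R) : R :=
  \int[dt]_(t in [set t : R | 0 < t]) (t `^ (x - 1) * expR (- t)).

Definition sobolev_const (n : nat) : R :=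
  n%:R * (n%:R - 2) / 4 * 2 `^ (2 / n%:R) * pi `^ (1 + n%:R^-1)
  * Gamma ((n%:R + 1) / 2) `^ (- (2 / n%:R)).

Definition M_star (n : nat) (m alpha chi : R) : R :=
  (sobolev_const n * (alpha - m) / chi) `^ (alpha - m + 1)^-1
  * ((alpha - m + 1) / (alpha - m)).

End notions.

(* Main.v *)
(* A lattice scheme with mesh size h on a box growing with 1/h (implicit in the
   porous medium diffusion, explicit in the reaction) is analysed by discrete
   energy estimates. The total mass cannot exceed M0, since the growth rate is
   proportional to the mass deficit; so the time integral of the reaction is
   controlled by M0 and a discrete Nash-type interpolation inequality turns the
   L^k energy identity into a differential inequality, which gives the decay rate,
   and an iteration over truncation levels gives the uniform bound. No smallness of M0 is involved.
   Translates of the discrete solutions are controlled in L^1 and the second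
   moment prevents mass from escaping, so a subsequence converges in L^1 on
   bounded time intervals, fast enough for almost every time slice to converge;
   the gradients converge weakly, realised by strong convergence of convex
   combinations. The weak formulation is summation by parts passed to the limit. *)
Require Import Defs.
From HB Require Import structures.
From mathcomp Require Import all_boot all_order all_algebra.
From mathcomp Require Import all_classical all_reals all_analysis.
From mathcomp Require Import measurable_realfun.
From mathcomp Require Import ring lra zify.

Set Implicit Arguments.
Unset Strict Implicit.
Unset Printing Implicit Defensive.

Import Order.TTheory GRing.Theory Num.Theory.
Import numFieldNormedType.Exports.

Local Open Scope ring_scope.

(** The reaction has the critical exponent: with p = k + m - 1, the integrand u^(k+alpha-1) is
    u^(p+2/n), exactly what the energy of u^(p/2) controls through the volume of level sets. Every
    functional inequality is therefore drawn from one Faber-Krahn inequality applied to truncations.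
    The factor left over is the mass produced in the step, so Gronwall's lemma runs in the produced
    mass, bounded by M0, and not in time: the constants are uniform in time. The explicit reaction
    is harmless only if the step is small against a sup bound, which is what is to be proved. The a
    priori bounds do not depend on the sup bound assumed so far and reach one step further than it;
    induction on the steps closes the circle. In the limit, statements at single times are wanted,
    while the estimates are integrals over space-time. One integrable function [W] dominates all the
    fast converging sequences: they converge where [W] is finite, and on whole slices at the times
    where the slice of [W] is integrable. *)

(** * Elementary inequalities and sign tactics *)

Lemma le_of_eq (R : numDomainType) (x y : R) : x = y -> x <= y.
Proof. by move->. Qed.

Lemma sqr_le (R : numDomainType) (x y : R) : 0 <= x -> x <= y -> x ^+ 2 <= y ^+ 2.
Proof. by move=> x0 xy; rewrite lerXn2r // nnegrE (le_trans x0). Qed.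

Lemma plus_lip (R : realDomainType) (a b : R) :
  `|Num.max a 0 - Num.max b 0| <= `|a - b|.
Proof.
wlog ab : a b / a <= b => [H|].
  have [ab|/ltW ba] := leP a b; first exact: H.
  by rewrite distrC [leRHS]distrC; exact: H.
have mm : Num.max a 0 <= Num.max b 0 by rewrite ge_max !le_max ab lexx !orbT.
rewrite distrC [leRHS]distrC ger0_norm ?subr_ge0 // ger0_norm ?subr_ge0 //.
by case: (leP a 0) mm; case: (leP b 0); lra.
Qed.

Ltac gt0 :=
  first [assumption |
  lazymatch goal with
  | |- is_true (_ < ?t) =>
    lazymatch t with
    | _ * _ => apply: mulr_gt0; gt0
    | _ ^-1 => rewrite invr_gt0; gt0
    | _ ^+ _ => apply: exprn_gt0; gt0
    | _ `^ _ => apply: powR_gt0; gt0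
    | _ + _ => apply: addr_gt0; gt0
    | _%:R => by rewrite ltr0n
    | _ => by []
    end
  | _ => idtac
  end | idtac].

Ltac nneg :=
  intros; first [assumption |
  lazymatch goal with
  | |- is_true (_ <= ?t) =>
    lazymatch t with
    | _ * _ => apply: mulr_ge0; nneg
    | _ ^-1 => rewrite invr_ge0; nneg
    | _ ^+ 2 => exact: sqr_ge0
    | _ ^+ _ => apply: exprn_ge0; nneg
    | _ `^ _ => exact: powR_ge0
    | _ + _ => apply: addr_ge0; nneg
    | `| _ | => exact: normr_ge0
    | _%:R => exact: ler0n
    | _ => first [by apply: ltW | by []]
    end
  | _ => idtac
  end | idtac].

(** * Inequalities for real powers *)

Section powR_inequalities.
Context {R : realType}.
Implicit Types a b c k m r s t x y : R.

Lemma powR_le r x y : 0 <= r -> 0 <= x -> x <= y -> x `^ r <= y `^ r.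
Proof.
by move=> r0 x0 xy; apply: ge0_ler_powR; rewrite // nnegrE // (le_trans x0).
Qed.

Lemma powRM1 x k : 0 <= x -> 0 < k -> x `^ (k - 1) * x = x `^ k.
Proof. by move=> x0 k0; rewrite mulrC mulr_powRB1. Qed.

Lemma powR_addp x r s : 0 <= x -> 0 < r -> 0 <= s ->
  x `^ (r + s) = x `^ r * x `^ s.
Proof.
by move=> x0 r0 s0; rewrite powRD //; apply/implyP => /eqP; lra.
Qed.

Lemma powR_sqr x r : (x `^ r) ^+ 2 = x `^ (2 * r).
Proof. by rewrite -powR_mulrn ?powR_ge0 // -powRrM mulrC. Qed.

Lemma sqr_powR x r : 0 <= x -> (x ^+ 2) `^ r = x `^ (2 * r).
Proof. by move=> x0; rewrite -powR_mulrn // -powRrM. Qed.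

(** Young's inequality for x^(k-1) and y, with the conjugate exponents k/(k-1) and k, already is the
    tangent inequality of the convex power. *)
Lemma powR_tangent k x y : 1 <= k -> 0 <= x -> 0 <= y ->
  x `^ k - y `^ k <= k * (x `^ (k - 1) * (x - y)).
Proof.
move=> k1 x0 y0; have k0 : 0 < k by lra.
have [<-|kn1] := eqVneq 1 k; first by rewrite subrr powRr0 !powRr1 // !mul1r.
have {k1 kn1}k1 : 1 < k by rewrite lt_neqAle kn1.
have P : 0 < k / (k - 1) by rewrite divr_gt0 //; lra.
have E : (k / (k - 1))^-1 + k^-1 = 1 by field; lra.
have := conjugate_powR (powR_ge0 x (k - 1)) y0 P k0 E.
rewrite -powRrM (_ : (k - 1) * (k / (k - 1)) = k); last by field; lra.
move=> Y; have X := powRM1 x0 k0.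
rewrite mulrBr X; have := ler_wpM2l (ltW k0) Y.
rewrite mulrDr (_ : k * (x `^ k / (k / (k - 1))) = (k - 1) * x `^ k); last first.
  by field; rewrite !gt_eqF //; lra.
rewrite (_ : k * (y `^ k / k) = y `^ k); last by field; lra.
by move=> ?; lra.
Qed.

(** Young's inequality again, for x^r and 1 with the exponents 1/r and 1/(1-r). *)
Lemma powR_concave r x : 0 < r <= 1 -> 0 <= x -> x `^ r <= 1 + r * (x - 1).
Proof.
move=> /andP[r0 r1] x0.
have [->|rn1] := eqVneq r 1; first by rewrite powRr1 //; lra.
have {r1 rn1}r1 : r < 1 by rewrite lt_neqAle rn1.
have := @conjugate_powR R (x `^ r) 1 r^-1 (1 - r)^-1 (powR_ge0 _ _) ler01.
rewrite -powRrM mulfV ?gt_eqF // powRr1 // powR1 !invrK !mul1r mulr1.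
rewrite !invr_gt0 => /(_ r0) H.
have : x `^ r <= x * r + (1 - r) by apply: H; lra.
by move=> ?; lra.
Qed.

Lemma powR_superadd m a b : 1 <= m -> 0 <= a -> a <= b ->
  (b - a) `^ m <= b `^ m - a `^ m.
Proof.
move=> m1 a0 ab; have m0 : 0 < m by lra.
rewrite -(@powRM1 b m) -?(@powRM1 a m) -?(@powRM1 (b - a) m) //; try lra.
have h1 : (b - a) `^ (m - 1) <= b `^ (m - 1) by apply: powR_le; lra.
have h2 : a `^ (m - 1) <= b `^ (m - 1) by apply: powR_le; lra.
by nra.
Qed.

Lemma powR_diff_lower m b c : 1 <= m -> 0 <= c -> c <= b ->
  c `^ (m - 1) * (b - c) <= b `^ m - c `^ m.
Proof.
move=> m1 c0 cb; have m0 : 0 < m by lra.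
rewrite -(@powRM1 b m) -?(@powRM1 c m) //; try lra.
have h2 : c `^ (m - 1) <= b `^ (m - 1) by apply: powR_le; lra.
by nra.
Qed.

Lemma powR_diff_norm m a b : 1 <= m -> 0 <= a -> 0 <= b ->
  `|b - a| `^ m <= `|b `^ m - a `^ m|.
Proof.
move=> m1; wlog ab : a b / a <= b => [H a0 b0|a0 b0].
  have [ab|/ltW ba] := leP a b; first exact: H.
  by rewrite distrC [leRHS]distrC; exact: H.
rewrite ger0_norm ?subr_ge0 // ger0_norm ?subr_ge0; first exact: powR_superadd.
by apply: powR_le => //; lra.
Qed.

(** Strong monotonicity of the porous medium nonlinearity: it recovers the density itself from its
    duality product with u^m. *)
Lemma powR_diff_mono m a b : 1 <= m -> 0 <= a -> 0 <= b ->
  `|b - a| `^ (m + 1) <= (b - a) * (b `^ m - a `^ m).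
Proof.
move=> m1; wlog ab : a b / a <= b => [H a0 b0|a0 b0].
  have [ab|/ltW ba] := leP a b; first exact: H.
  by rewrite distrC -mulrNN !opprB; exact: H.
rewrite ger0_norm ?subr_ge0 // powR_addp; [|lra..].
by rewrite powRr1 ?subr_ge0 // mulrC ler_wpM2l ?subr_ge0 // powR_superadd.
Qed.

(** The Stroock-Varopoulos inequality: testing the diffusion of u^m with u^(k-1) controls the energy
    of u^((k+m-1)/2). For the powers p = (s+t)/2 of a and b, the exponents become r <= 1 and 2 - r;
    concavity bounds the first difference from below, monotonicity the second, and the powers of B
    in front cancel. *)
Lemma powR_cross s t a b : 0 < s -> 0 < t -> 0 <= a -> 0 <= b ->
  Num.min (2 * s / (s + t)) (2 * t / (s + t)) *
    (b `^ ((s + t) / 2) - a `^ ((s + t) / 2)) ^+ 2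
  <= (b `^ s - a `^ s) * (b `^ t - a `^ t).
Proof.
move=> s0 t0.
wlog st : s t s0 t0 / s <= t => [H a0 b0|].
  have [st|/ltW ts] := leP s t; first exact: H.
  by rewrite minC [leRHS]mulrC [s + t]addrC; exact: H.
wlog ab : a b / a <= b => [H a0 b0|a0 b0].
  have [ab|/ltW ba] := leP a b; first exact: H.
  by rewrite -sqrrN -[leRHS]mulrNN !opprB; exact: H.
set p := (s + t) / 2; have p0 : 0 < p by rewrite /p; lra.
set r := 2 * s / (s + t).
have r0 : 0 < r by rewrite /r divr_gt0 //; lra.
have r1 : r <= 1 by rewrite /r ler_pdivrMr; lra.
have rs : p * r = s by rewrite /p /r; field; lra.
have rt : p * (2 - r) = t by rewrite /p /r; field; lra.
have -> : Num.min r (2 * t / (s + t)) = r.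
  by apply/min_idPl; rewrite /r ler_pM2r ?invr_gt0; lra.
clearbody p r; rewrite -rs -rt !powRrM.
have A0 : 0 <= a `^ p := powR_ge0 _ _.
have AB : a `^ p <= b `^ p by apply: powR_le => //; lra.
move: (a `^ p) (b `^ p) A0 AB => A B A0 AB.
have [B0|B0] := leP B 0.
  have -> : A = 0 by lra.
  have -> : B = 0 by lra.
  by rewrite subrr expr0n /= mulr0 !powR0 ?subrr ?mulr0 //; lra.
have e1 : A `^ r <= B `^ r + r * (B `^ (r - 1) * (A - B)).
  have AE : A = B * (A / B) by field; lra.
  rewrite {1}AE powRM; [|lra|by apply: divr_ge0; lra].
  have := @powR_concave r (A / B) _ _; rewrite r0 r1 divr_ge0 // ?(ltW B0) //.
  move=> /(_ isT isT) h.
  apply: (le_trans (ler_wpM2l (powR_ge0 _ _) h)).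
  have X := powRM1 (ltW B0) r0.
  rewrite -X; apply: le_of_eq; field; lra.
have e2 : B `^ (1 - r) * (B - A) <= B `^ (2 - r) - A `^ (2 - r).
  have -> : 1 - r = (2 - r) - 1 by lra.
  have h2 : A `^ (2 - r - 1) <= B `^ (2 - r - 1) by apply: powR_le; lra.
  rewrite -(@powRM1 B (2 - r)) //; try lra.
  rewrite -(@powRM1 A (2 - r)) //; try lra; nra.
have e3 : B `^ (r - 1) * B `^ (1 - r) = 1.
  rewrite -powRD; last by apply/implyP => _; lra.
  by rewrite (_ : r - 1 + (1 - r) = 0) ?powRr0 //; lra.
apply: (@le_trans _ _ ((r * (B `^ (r - 1) * (B - A))) * (B `^ (1 - r) * (B - A)))).
  rewrite (_ : r * (B `^ (r - 1) * (B - A)) * (B `^ (1 - r) * (B - A)) =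
     r * (B `^ (r - 1) * B `^ (1 - r)) * (B - A) ^+ 2); last by ring.
  by rewrite e3 mulr1.
apply: ler_pM => //.
- by rewrite !mulr_ge0 ?powR_ge0 //; lra.
- by rewrite !mulr_ge0 ?powR_ge0 //; lra.
- by move: e1; lra.
Qed.

End powR_inequalities.

(** * Sums of squares *)

Section finite_sums.
Context {R : realType}.

Lemma sqr_sum_in_le (I : finType) (A : {pred I}) (a : I -> R) :
  (\sum_(i in A) a i) ^+ 2 <= #|A|%:R * \sum_(i in A) a i ^+ 2.
Proof.
have -> : (\sum_(i in A) a i) ^+ 2 = \sum_(i in A) \sum_(j in A) a i * a j.
  by rewrite expr2 mulr_suml; apply: eq_bigr => i _; rewrite mulr_sumr.
apply: (@le_trans _ _ (\sum_(i in A) \sum_(j in A) (a i ^+ 2 + a j ^+ 2) / 2)).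
  apply: ler_sum => i _; apply: ler_sum => j _.
  have H : 0 <= (a i - a j) * (a i - a j) by exact: sqr_ge0.
  rewrite !expr2; move: (a i) (a j) H => x y H; lra.
apply: le_of_eq.
transitivity (\sum_(i in A) (#|A|%:R * (a i ^+ 2) / 2 + (\sum_(j in A) a j ^+ 2) / 2)).
  apply: eq_bigr => i _; rewrite -mulr_suml big_split /= mulrDl sumr_const.
  by rewrite -[_ *+ #|A|]mulr_natl.
rewrite big_split /= -mulr_suml -mulr_sumr sumr_const -[_ *+ #|A|]mulr_natl.
lra.
Qed.

Lemma sqr_sum_le (I : finType) (a : I -> R) :
  (\sum_i a i) ^+ 2 <= #|I|%:R * \sum_i a i ^+ 2.
Proof. exact: (sqr_sum_in_le predT). Qed.

Lemma sum_sqr_le (I : finType) (a : I -> R) : (forall i, 0 <= a i) ->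
  \sum_i a i ^+ 2 <= (\sum_i a i) ^+ 2.
Proof.
move=> a0; rewrite expr2 mulr_suml; apply: ler_sum => i _.
rewrite expr2 ler_wpM2l // (bigD1 i) //= lerDl; exact: sumr_ge0.
Qed.

Lemma sqr_sum_nat_le (k : nat) (a : nat -> R) :
  (\sum_(i < k) a i) ^+ 2 <= k%:R * \sum_(i < k) a i ^+ 2.
Proof. by have := sqr_sum_le (fun i : 'I_k => a i); rewrite card_ord. Qed.

End finite_sums.

(** * Discrete calculus on a periodic lattice and its Faber-Krahn inequality *)

Section lattice.
Context {R : realType} {n P : nat}.
Notation G := {ffun 'I_n -> 'I_P.+2}.
Implicit Types (f g : G -> R) (x y z w v : G) (i j : 'I_n).

Definition ev i : G := [ffun j => if j == i then 1 else 0].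
Definition dd i f x : R := f (x + ev i) - f x.
Definition dform f g : R := \sum_i \sum_(x : G) dd i f x * dd i g x.
(** Differences are undivided: with time step h^2 the implicit diffusion step has coefficient 1, and
    powers of h enter only in the estimates. *)
Definition lap f x : R := \sum_i ((f (x + ev i) - f x) + (f (x - ev i) - f x)).
(** The index type is a group, so translations are bijections and summation by parts has no boundary
    term; vanishing on this cut of the torus is the Dirichlet condition of the box. *)
Definition wall x : bool := [exists i, x i == 0].

Lemma sum_shift (F : G -> R) v : \sum_(x : G) F (x + v) = \sum_(x : G) F x.
Proof. by rewrite [RHS](reindex_inj (addIr v)). Qed.

Lemma sum_by_parts f g : \sum_(x : G) lap f x * g x = - dform f g.
Proof.
rewrite /dform -sumrN.
transitivity (\sum_i \sum_(x : G) ((f (x + ev i) - f x) + (f (x - ev i) - f x)) * g x).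
  by rewrite exchange_big /=; apply: eq_bigr => x _; rewrite mulr_suml.
apply: eq_bigr => i _.
transitivity (\sum_(x : G) (f (x + ev i) - f x) * g x +
              \sum_(x : G) (f (x - ev i) - f x) * g x).
  by rewrite -big_split; apply: eq_bigr => x _; rewrite mulrDl.
rewrite -[X in _ + X](sum_shift _ (ev i)) -big_split -sumrN.
by apply: eq_bigr => x _ /=; rewrite /dd addrK; ring.
Qed.

Lemma dform_ge0 f : 0 <= dform f f.
Proof. by apply: sumr_ge0 => i _; apply: sumr_ge0 => x _; rewrite -expr2 sqr_ge0. Qed.

Lemma dformC f g : dform f g = dform g f.
Proof. by apply: eq_bigr => i _; apply: eq_bigr => x _; rewrite mulrC. Qed.

Lemma line_diff_le f i (c : nat) x :
  (f (x + ev i *+ c) - f x) ^+ 2 <= c%:R * \sum_(k < c) dd i f (x + ev i *+ k) ^+ 2.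
Proof.
have -> : f (x + ev i *+ c) - f x = \sum_(k < c) dd i f (x + ev i *+ k).
  elim: c => [|c IH]; first by rewrite big_ord0 mulr0n addr0 subrr.
  by rewrite big_ord_recr /= -IH /dd mulrSr addrA; ring.
exact: (sqr_sum_nat_le _ (fun k => dd i f (x + ev i *+ k))).
Qed.

Lemma shift1_le f i (c : nat) :
  \sum_(x : G) (f (x + ev i *+ c) - f x) ^+ 2 <= c%:R ^+ 2 * \sum_(x : G) dd i f x ^+ 2.
Proof.
apply: (le_trans (ler_sum _ (fun x _ => line_diff_le f i c x))).
rewrite -mulr_sumr exchange_big /=.
rewrite (eq_bigr (fun=> \sum_(x : G) dd i f x ^+ 2)); last first.
  by move=> k _; exact: (sum_shift (fun x => dd i f x ^+ 2)).
by rewrite sumr_const card_ord -[X in _ * X <= _]mulr_natl mulrA expr2.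
Qed.

Definition coord i (a : 'I_P.+2) : G := [ffun j => if j == i then a else 0].

Lemma coordE i (a : 'I_P.+2) : coord i a = ev i *+ a.
Proof.
apply/ffunP => j; rewrite !ffunE ffunMnE !ffunE.
case: ifP => _; last by rewrite mul0rn.
by rewrite -[LHS]natr_Zp.
Qed.

(* The displacements all of whose coordinates are at most r in absolute value,
   on the discrete torus. *)
Definition small (r : nat) (v : G) : bool :=
  [forall i, (v i <= r)%N || (- v i <= r)%N].

Lemma coord_shift_le f i (a : 'I_P.+2) (r : nat) :
  (a <= r)%N || (- a <= r)%N ->
  \sum_(x : G) (f (x + coord i a) - f x) ^+ 2 <= r%:R ^+ 2 * \sum_(x : G) dd i f x ^+ 2.
Proof.
have S0 : 0 <= \sum_(x : G) dd i f x ^+ 2 by apply: sumr_ge0 => x _; exact: sqr_ge0.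
have main (b : 'I_P.+2) : (b <= r)%N ->
    \sum_(x : G) (f (x + coord i b) - f x) ^+ 2 <= r%:R ^+ 2 * \sum_(x : G) dd i f x ^+ 2.
  move=> br; rewrite coordE; apply: (le_trans (shift1_le _ _ _)).
  by rewrite ler_wpM2r // lerXn2r ?nnegrE // ler_nat.
move=> /orP[|ar]; first exact: main.
(* The displacement is the opposite of a short one; translating the sum reverses it. *)
apply: le_trans (main _ ar); rewrite -[leRHS](sum_shift _ (coord i a)).
apply: le_of_eq; apply: eq_bigr => x _.
rewrite -addrA (_ : coord i a + coord i (- a) = 0) ?addr0; first by rewrite -sqrrN opprB.
apply/ffunP => j; rewrite !ffunE; case: ifP => _; last by rewrite addr0.
by rewrite subrr.
Qed.

(** The path [p] from 0 to [v] changes one coordinate at a time; Cauchy-Schwarz over its n segments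
    gives the factor n. *)
Lemma shift_le f v r : small r v ->
  \sum_(x : G) (f (x + v) - f x) ^+ 2
  <= n%:R * r%:R ^+ 2 * dform f f.
Proof.
move=> /forallP vr.
pose p (k : nat) : G := [ffun j : 'I_n => if (j < k)%N then v j else 0].
have p0 : p 0 = 0 by apply/ffunP => j; rewrite !ffunE.
have pn : p n = v by apply/ffunP => j; rewrite !ffunE ltn_ord.
have pS (i : 'I_n) : p i.+1 = p i + coord i (v i).
  apply/ffunP => j; rewrite !ffunE ltnS leq_eqVlt.
  have [->|ji] := eqVneq j i; first by rewrite eqxx ltnn add0r.
  by rewrite (negbTE (_ : (j : nat) != i)) ?addr0.
have tel x : f (x + v) - f x = \sum_(i < n) (f (x + p i.+1) - f (x + p i)).
  rewrite -[in LHS]pn -{2}[x]addr0 -p0.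
  rewrite -(big_mkord xpredT (fun k => f (x + p k.+1) - f (x + p k))).
  by rewrite telescope_sumr.
apply: (@le_trans _ _ (\sum_(x : G) n%:R * \sum_(i < n) (f (x + p i.+1) - f (x + p i)) ^+ 2)).
  apply: ler_sum => x _; rewrite tel.
  exact: (sqr_sum_nat_le _ (fun k => f (x + p k.+1) - f (x + p k))).
rewrite -mulr_sumr exchange_big /= -mulrA ler_wpM2l // /dform mulr_sumr.
apply: ler_sum => i _.
apply: le_trans (_ : r%:R ^+ 2 * \sum_(x : G) dd i f x ^+ 2 <= _); last first.
  by apply: le_of_eq; congr (_ * _); apply: eq_bigr => x _; rewrite expr2.
apply: le_trans (coord_shift_le f i (vr i)).
rewrite -[leRHS](sum_shift _ (p i)).
by apply: le_of_eq; apply: eq_bigr => x _; rewrite pS addrA.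
Qed.

Lemma dformE f : dform f f = \sum_i \sum_(x : G) dd i f x ^+ 2.
Proof. by apply: eq_bigr => i _; apply: eq_bigr => x _; rewrite expr2. Qed.

(** Walking from any point in the direction [i0] reaches the wall within one period, so this is the
    one-dimensional Poincare inequality on each line. *)
Lemma wall_poincare f : (0 < n)%N -> (forall x, wall x -> f x = 0) ->
  \sum_(x : G) f x ^+ 2 <= P.+2%:R ^+ 2 * dform f f.
Proof.
move=> n0 f0; pose i0 := Ordinal n0.
set N := P.+2; pose F k x := dd i0 f (x + ev i0 *+ k) ^+ 2.
have F0 k x : 0 <= F k x by exact: sqr_ge0.
apply: (@le_trans _ _ (\sum_(x : G) N%:R * \sum_(k < N) F k x)).
  apply: ler_sum => x _; pose c : nat := - x i0.
  have cN : (c < N)%N by exact: ltn_ord.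
  have fc : f (x + ev i0 *+ c) = 0.
    apply: f0; apply/existsP; exists i0; rewrite !ffunE ffunMnE ffunE eqxx.
    by rewrite natr_Zp subrr.
  have := line_diff_le f i0 c x; rewrite fc sub0r sqrrN => /le_trans; apply.
  apply: ler_pM => //; first by apply: sumr_ge0 => k _; exact: F0.
    by rewrite ler_nat ltnW.
  rewrite -!(big_mkord xpredT (F^~ x)) (big_cat_nat (leq0n c) (ltnW cN)) /=.
  by rewrite lerDl sumr_ge0.
rewrite -mulr_sumr exchange_big /= expr2 -mulrA ler_wpM2l //.
rewrite (eq_bigr (fun=> \sum_(x : G) dd i0 f x ^+ 2)); last first.
  by move=> k _; exact: (sum_shift (fun x => dd i0 f x ^+ 2)).
rewrite sumr_const card_ord -[X in X <= _]mulr_natl ler_wpM2l // dformE (bigD1 i0) //= lerDl.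
by apply: sumr_ge0 => i _; apply: sumr_ge0 => x _; exact: sqr_ge0.
Qed.

(* Averaging [f x ^+ 2 <= f x ^+ 2 / 2 + (f (x + v) - f x) ^+ 2 / 2 + f x * f (x + v)]
   over the cube of displacements v with coordinates smaller than r. *)
Lemma cube_average_le f (r : nat) : (0 < r)%N -> (r <= P.+2)%N ->
  (forall x, 0 <= f x) ->
  \sum_(x : G) f x ^+ 2 <= n%:R * r%:R ^+ 2 * dform f f
                     + 2 * (\sum_(x : G) f x) ^+ 2 / r%:R ^+ n.
Proof.
move=> r0 rN f0.
pose Sr : {pred 'I_P.+2} := [pred a : 'I_P.+2 | (a < r)%N].
pose S : {set G} := [set v : G in ffun_on Sr].
have cS : #|S| = (r ^ n)%N.
  rewrite cardsE card_ffun_on card_ord; congr (_ ^ _)%N.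
  rewrite -sum1_card -[RHS]card_ord -[RHS]sum1_card.
  by rewrite (big_ord_widen _ (fun=> 1%N) rN).
have r0' : 0 < r%:R :> R by rewrite ltr0n.
have rn0 : 0 < r%:R ^+ n :> R by rewrite exprn_gt0.
set A := \sum_(x : G) f x ^+ 2; set D := dform f f; set B := \sum_(x : G) f x.
have H v : v \in S -> A <= n%:R * r%:R ^+ 2 * D + 2 * \sum_(x : G) f x * f (x + v).
  rewrite inE => /ffun_onP vS.
  have /(shift_le f) h : small r v.
    by apply/forallP => i; have := vS i; rewrite inE => /ltnW ->.
  apply: (@le_trans _ _ (\sum_(x : G) (f (x + v) - f x) ^+ 2 + 2 * \sum_(x : G) f x * f (x + v))).
    rewrite mulr_sumr -big_split /=.
    apply: ler_sum => x _; move: (f x) (f (x + v)) => a b.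
    by have := sqr_ge0 b; rewrite (_ : (b - a) ^+ 2 + _ = a ^+ 2 + b ^+ 2); [lra|ring].
  by rewrite lerD2r.
have : \sum_(v in S) A <=
  \sum_(v in S) (n%:R * r%:R ^+ 2 * D + 2 * \sum_(x : G) f x * f (x + v)).
  by apply: ler_sum => v; exact: H.
rewrite sumr_const cS big_split /= sumr_const cS -mulr_sumr.
have C : \sum_(v in S) \sum_(x : G) f x * f (x + v) <= B ^+ 2.
  rewrite exchange_big /= expr2 mulr_suml; apply: ler_sum => x _.
  rewrite -mulr_sumr ler_wpM2l //.
  have -> : B = \sum_(v : G) f (x + v).
    by rewrite /B (reindex_inj (addrI x)).
  rewrite big_mkcond /=; apply: ler_sum => v _.
  by case: ifP.
rewrite -[X in X <= _]mulr_natl -[X in _ <= X + _]mulr_natl natrX => K.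
rewrite -(ler_pM2l rn0); apply: (le_trans K).
rewrite mulrDr lerD2l mulrCA divff ?gt_eqF // mulr1.
by rewrite ler_wpM2l.
Qed.

Lemma dform_le f g : (forall x y, `|g x - g y| <= `|f x - f y|) ->
  dform g g <= dform f f.
Proof.
move=> fg; rewrite !dformE; apply: ler_sum => i _; apply: ler_sum => x _.
by rewrite -real_normK ?num_real // -[leRHS]real_normK ?num_real // lerXn2r ?nnegrE //; exact: fg.
Qed.

(** Averaging over cubes of side slightly above rho: as f lives on [S], Cauchy-Schwarz bounds the
    squared sum by the cardinal of [S] times the sum of squares, and the volume hypothesis makes
    this term at most half of the left-hand side. It replaces the Sobolev inequality, with a
    constant that sees only the volume of the support. *)
Lemma faber_krahn f (h rho : R) : (0 < n)%N -> 0 < h -> 0 < rho ->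
  (forall x, wall x -> f x = 0) -> (forall x, 0 <= f x) ->
  4 * h ^+ n * #|[set x : G | 0 < f x]|%:R <= rho ^+ n ->
  \sum_(x : G) f x ^+ 2 <= 8 * n%:R * rho ^+ 2 / h ^+ 2 * dform f f.
Proof.
move=> n0 h0 rho0 fw f0; set S := [set x | _]; set D := dform f f => hS.
have D0 : 0 <= D := dform_ge0 f.
have n1 : 1 <= n%:R :> R by rewrite ler1n.
have K0 : 0 <= 8 * n%:R * rho ^+ 2 / h ^+ 2.
  by rewrite divr_ge0 ?sqr_ge0 // mulr_ge0 ?sqr_ge0 // mulr_ge0 //.
have suppE (F : R -> R) : F 0 = 0 ->
    \sum_(x : G) F (f x) = \sum_(x in S) F (f x).
  move=> F0; rewrite [RHS]big_mkcond; apply: eq_bigr => x _.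
  rewrite inE; have := f0 x; rewrite le_eqVlt => /orP[/eqP <-|->] //.
  by rewrite ltxx.
have [S0|S0] := posnP #|S|.
  rewrite (suppE (fun t => t ^+ 2)) ?expr0n // big1; first exact: mulr_ge0.
  by move=> x; rewrite (cards0_eq S0) inE.
have hn0 : 0 < h ^+ n by rewrite exprn_gt0.
have h_rho : h <= rho.
  rewrite -(@ler_pXn2r _ n n0) ?nnegrE; [|exact: ltW..].
  apply: le_trans hS; have : 1 <= #|S|%:R :> R by rewrite ler1n.
  by move: hn0; nra.
(* The side r h lies between rho and 2 rho; the upper bound uses h <= rho, which a nonempty support
   forces. *)
set r := (Num.truncn (rho / h)).+1.
have rh0 : 0 <= rho / h by rewrite divr_ge0 ?ltW.
have r_lt : rho / h < r%:R by have /andP[] := truncn_itv rh0.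
have r_le : r%:R <= 2 * (rho / h) :> R.
  have h1 : 1 <= rho / h by rewrite ler_pdivlMr // mul1r.
  have /andP[h2 _] := truncn_itv rh0.
  by rewrite /r -natr1; lra.
have r2 : r%:R ^+ 2 <= 4 * rho ^+ 2 / h ^+ 2 :> R.
  rewrite (_ : 4 * rho ^+ 2 / h ^+ 2 = (2 * (rho / h)) ^+ 2); last by field; rewrite gt_eqF.
  by apply: sqr_le => //; nneg.
(* A cube that does not fit is wider than the box, and the Poincare inequality from the wall is good
   enough. *)
have [rN|Nr] := leqP r P.+2; last first.
  apply: (le_trans (wall_poincare n0 fw)); rewrite ler_wpM2r //.
  apply: (@le_trans _ _ (r%:R ^+ 2)).
    by apply: sqr_le => //; rewrite ler_nat ltnW.
  apply: (le_trans r2); rewrite ler_wpM2r ?invr_ge0 ?sqr_ge0 //.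
  by rewrite ler_wpM2r //; nneg; lra.
have := @cube_average_le f r isT rN f0; rewrite -/D.
set A := \sum_(x : G) f x ^+ 2; set B := \sum_(x : G) f x => H.
have BA : B ^+ 2 <= #|S|%:R * A.
  rewrite /A /B (suppE (fun t => t)) // (suppE (fun t => t ^+ 2)) ?expr0n //.
  exact: sqr_sum_in_le.
have rn0 : 0 < r%:R ^+ n :> R by rewrite exprn_gt0 // ltr0n.
have A0 : 0 <= A by apply: sumr_ge0 => x _; exact: sqr_ge0.
have cr : 4 * #|S|%:R <= r%:R ^+ n :> R.
  rewrite -(ler_pM2l hn0) mulrA [_ * 4]mulrC; apply: (le_trans hS).
  rewrite -exprMn lerXn2r ?nnegrE ?ltW // ?mulr_gt0 // ?ltr0n //.
  by rewrite mulrC -ltr_pdivrMr.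
have BA' : 2 * B ^+ 2 / r%:R ^+ n <= A / 2.
  rewrite ler_pdivrMr //.
  apply: (@le_trans _ _ (2 * (#|S|%:R * A))); first by rewrite ler_wpM2l.
  rewrite (_ : 2 * _ = A / 2 * (4 * #|S|%:R)); last by field.
  by rewrite ler_wpM2l // divr_ge0.
have : A <= 2 * (n%:R * r%:R ^+ 2 * D) by lra.
move=> /le_trans; apply.
rewrite (_ : 8 * _ * _ / _ * D = 2 * (n%:R * (4 * rho ^+ 2 / h ^+ 2) * D)); last first.
  by field; rewrite gt_eqF.
by rewrite ler_wpM2l // ler_wpM2r // ler_wpM2l.
Qed.

End lattice.

(** * Truncation in dyadic layers *)

Section functional_inequalities.
Context {R : realType} {n P : nat} (n0 : (0 < n)%N).
Notation G := {ffun 'I_n -> 'I_P.+2}.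
Implicit Types (u : G -> R) (x y : G).

Local Notation a := (2 / n%:R : R).

Let nR0 : 0 < n%:R :> R. Proof. by rewrite ltr0n. Qed.
Let a0 : 0 < a. Proof. by rewrite divr_gt0. Qed.

Lemma powR_root (X : R) : 0 <= X -> (X `^ n%:R^-1) ^+ n = X.
Proof.
move=> X0; rewrite -powR_mulrn ?powR_ge0 // -powRrM mulVf ?gt_eqF //.
by rewrite powRr1.
Qed.

Lemma powR_root2 (X : R) : (X `^ n%:R^-1) ^+ 2 = X `^ a.
Proof.
by rewrite -powR_mulrn ?powR_ge0 // -powRrM mulrC.
Qed.

Lemma faber_krahn_powR (f : G -> R) (h X : R) : 0 < h -> 0 < X ->
  (forall x, wall x -> f x = 0) -> (forall x, 0 <= f x) ->
  4 * h ^+ n * #|[set x : G | 0 < f x]|%:R <= X ->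
  \sum_(x : G) f x ^+ 2 <= 8 * n%:R * X `^ a / h ^+ 2 * dform f f.
Proof.
move=> h0 X0 fw f0 hX; rewrite -powR_root2; apply: faber_krahn => //.
  by apply: powR_gt0.
by rewrite powR_root // ltW.
Qed.

Lemma le_mul_exp2 (s : R) i : 0 < s -> s <= s * 2 ^+ i.
Proof. by move=> s0; rewrite ler_pMr // exprn_ege1 // ler1n. Qed.

Definition layer (s : R) (i : nat) (t : R) : R :=
  Num.min t (s * 2 ^+ i.+1) - Num.min t (s * 2 ^+ i).

(** The increments of all layers between two values have the same sign and add up to the increment
    of a 1-Lipschitz function. Hence the energies of the layers of f add up to at most the energy of
    f. *)
Lemma layer_sqr_sum (s t1 t2 : R) (M : nat) : 0 < s ->
  \sum_(i < M) (layer s i t2 - layer s i t1) ^+ 2 <= (t2 - t1) ^+ 2.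
Proof.
move=> s0; pose T := layer s; wlog t12 : t1 t2 / t1 <= t2 => [H|].
  have [t12|/ltW t21] := leP t1 t2; first exact: H.
  rewrite (eq_bigr (fun i : 'I_M => (T i t1 - T i t2) ^+ 2)); last first.
    by move=> i _; rewrite -sqrrN opprB.
  by rewrite -[leRHS]sqrrN opprB; exact: H.
apply: (le_trans (sum_sqr_le _)).
  move=> i; rewrite subr_ge0 /layer exprS.
  have : 0 < s * 2 ^+ i by gt0.
  move: (2 ^+ i) => z; rewrite (_ : s * (2 * z) = 2 * (s * z)); last by ring.
  move: (s * z) => w w0.
  by case: (leP t2 w); case: (leP t1 w); case: (leP t1 (2 * w));
    case: (leP t2 (2 * w)); lra.
have tel t : \sum_(i < M) T i t = Num.min t (s * 2 ^+ M) - Num.min t s.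
  rewrite /T /layer -(big_mkord xpredT (fun i => Num.min t (s * 2 ^+ i.+1) - Num.min t (s * 2 ^+ i))).
  by rewrite (telescope_sumr (fun i => Num.min t (s * 2 ^+ i))) // expr0 mulr1.
rewrite sumrB -!/(T _ _) !tel.
have := le_mul_exp2 M s0.
move: (s * 2 ^+ M) => w sw.
suff /andP[h1 h2] : 0 <= Num.min t2 w - Num.min t2 s - (Num.min t1 w - Num.min t1 s)
    <= t2 - t1 by exact: sqr_le.
case: (leP t1 s) => h1.
  rewrite (min_l (le_trans h1 sw)); case: (leP t2 s) => h2.
    by rewrite (min_l (le_trans h2 sw)); apply/andP; split; lra.
  by case: (leP t2 w) => h3; apply/andP; split; lra.
rewrite (min_r (ltW (lt_le_trans h1 t12))).
by case: (leP t2 w) => h2; case: (leP t1 w) => h3; apply/andP; split; lra.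
Qed.

Lemma layer_exists (s t : R) (M : nat) : 0 < s -> 2 * s < t -> t <= s * 2 ^+ M.+1 ->
  exists2 i, (i < M)%N & s * 2 ^+ i.+1 < t <= s * 2 ^+ i.+2.
Proof.
move=> s0 st; elim: M => [|M IH] tM; first by move: tM; rewrite expr1; lra.
have [tM'|tM'] := leP t (s * 2 ^+ M.+1).
  by have [i iM hi] := IH tM'; exists i => //; rewrite ltnS ltnW.
by exists M => //; rewrite tM' tM.
Qed.

Definition pw (r : R) u x : R := u x `^ r.

(** Maz'ya's truncation argument. The layer of f = u^(p/2) above the height [S i] is supported where
    u exceeds [th i], a set whose volume Chebyshev's inequality bounds through the integral of
    u^alpha; this gives the constant of Faber-Krahn. Where f is at the top of the layer, the weight
    u^a is of the order of the a-th power of [th i]. The product is a negative power of [th i],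
    largest at the bottom level, and the layer energies add up. *)
Lemma high_level_le (p alpha h E Lam : R) u : 0 < p -> 1 < alpha -> 0 < h ->
  0 < Lam -> 0 < E ->
  (forall x, 0 <= u x) -> (forall x, wall x -> u x = 0) ->
  h ^+ n * \sum_(x : G) u x `^ alpha <= E ->
  \sum_(x | 2 * Lam `^ (p / 2) < pw (p / 2) u x) u x `^ (p + a)
  <= 128 * n%:R * 16 `^ (a / p) * (4 * E) `^ a * Lam `^ (- ((alpha - 1) * a))
     / h ^+ 2 * dform (pw (p / 2) u) (pw (p / 2) u).
Proof.
move=> p0 al1 h0 L0 E0 u0 uw hE; set f := pw _ u.
have p20 : 0 < p / 2 by lra.
set s := Lam `^ (p / 2); have s0 : 0 < s by exact: powR_gt0.
have f0 x : 0 <= f x by exact: powR_ge0.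
have fw x : wall x -> f x = 0 by move=> /uw; rewrite /f /pw => ->; rewrite powR0 ?gt_eqF.
pose S i := s * 2 ^+ i; have S0 i : 0 < S i by rewrite /S; gt0.
have SS i : S i.+1 = 2 * S i by rewrite /S exprS; ring.
pose T := layer s.
have TE i t : T i t = Num.min t (2 * S i) - Num.min t (S i) by rewrite -SS.
have S2 i : S i <= 2 * S i by have := S0 i; lra.
pose th i := S i `^ (2 / p); have th0 i : 0 < th i by exact: powR_gt0.
have fth x i : (S i < f x) -> th i <= u x.
  move=> /ltW h1; have -> : u x = f x `^ (2 / p).
    by rewrite /f /pw -powRrM (_ : p / 2 * (2 / p) = 1) ?powRr1 //; field; rewrite gt_eqF.
  by apply: powR_le => //; [rewrite divr_ge0 ?ltW|exact: ltW].
(* Finitely many layers reach the largest value of f; the sum over the lattice serves as a crude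
   maximum. *)
have [M hM] : exists M : nat, forall x, f x <= s * 2 ^+ M.+1.
  exists (Num.truncn ((\sum_x f x) / s)) => x; set B := \sum_x f x.
  apply: (@le_trans _ _ B).
    by rewrite /B (bigD1 x) //= lerDl sumr_ge0.
  rewrite mulrC -ler_pdivrMr //; apply: (le_trans (ltW (truncnS_gt _))).
  by rewrite -natrX ler_nat ltnW // ltn_expl.
have Tpos x i : 0 < T i (f x) -> S i < f x.
  rewrite TE; have := S0 i; case: (leP (f x) (2 * S i)); last by lra.
  by case: (leP (f x) (S i)); lra.
have T0 i t : 0 <= t -> 0 <= T i t.
  rewrite TE; have := S0 i; case: (leP t (2 * S i)); case: (leP t (S i)); lra.
have FK i : \sum_(x : G) T i (f x) ^+ 2 <=
    8 * n%:R * (4 * E * th i `^ (- alpha)) `^ a / h ^+ 2 *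
    dform (fun x => T i (f x)) (fun x => T i (f x)).
  apply: faber_krahn_powR => //.
  - by gt0.
  - by move=> x /fw ->; rewrite TE !min_l ?subrr //; have := S0 i; lra.
  - by move=> x; exact: T0.
  rewrite -!mulrA ler_pM2l // -ler_pdivrMr ?powR_gt0 // powRN invrK.
  apply: le_trans hE; rewrite -mulrA ler_pM2l; last by gt0.
  set A := [set x | _].
  apply: (@le_trans _ _ (\sum_(x in A) u x `^ alpha)); last first.
    rewrite [leLHS]big_mkcond /=; apply: ler_sum => x _; case: ifP => // _.
    exact: powR_ge0.
  rewrite mulrC mulr_natr -sumr_const; apply: ler_sum => x.
  rewrite inE => /Tpos /fth h1; apply: powR_le => //; first by lra.
  exact: ltW.
(* Where f lies in ]2 S i, 4 S i], the layer is full, u^p <= 16 (S i)^2 and u^a <= 16^(a/p) (th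
   i)^a. *)
set c := 16 * 16 `^ (a / p).
have pt x : 2 * s < f x ->
    u x `^ (p + a) <= \sum_(i < M) c * th i `^ a * T i (f x) ^+ 2.
  move=> sx; have [i iM /andP[i1 i2]] := layer_exists s0 sx (hM x).
  rewrite (bigD1 (Ordinal iM)) //=.
  apply: (@le_trans _ _ (c * th i `^ a * T i (f x) ^+ 2)); last first.
    rewrite lerDl; apply: sumr_ge0 => j _.
    by apply: mulr_ge0; [rewrite /c; nneg|nneg].
  have -> : T i (f x) = S i.
    have := i1; rewrite -/(S i.+1) SS => /ltW h1.
    by rewrite TE !min_r //; [lra|have := S0 i; lra].
  have fS : f x <= 4 * S i.
    by apply: (le_trans i2); rewrite -/(S i.+2) !SS; lra.
  have u1 : u x `^ p <= 16 * S i ^+ 2.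
    have -> : u x `^ p = f x ^+ 2.
      by rewrite /f /pw powR_sqr; congr (_ `^ _); lra.
    have := sqr_le (f0 x) fS; rewrite exprMn; lra.
  have u2 : u x `^ a <= 16 `^ (a / p) * th i `^ a.
    have -> : u x `^ a = (f x ^+ 2) `^ (a / p).
      rewrite /f /pw powR_sqr -powRrM; congr (_ `^ _).
      by field; rewrite !gt_eqF.
    have -> : th i `^ a = (S i ^+ 2) `^ (a / p).
      rewrite sqr_powR ?ltW // /th -powRrM; congr (_ `^ _).
      by field; rewrite !gt_eqF.
    rewrite -powRM //; [|nneg].
    apply: powR_le; [by rewrite divr_ge0 // ltW|nneg|].
    by have := sqr_le (f0 x) fS; rewrite exprMn; lra.
  rewrite powR_addp // ?(ltW a0) //.
  apply: (le_trans (ler_pM (powR_ge0 _ _) (powR_ge0 _ _) u1 u2)).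
  rewrite /c; move: (16 `^ _) (th i `^ a) => X1 X2.
  by apply: le_of_eq; ring.
apply: (@le_trans _ _ (\sum_(x | 2 * s < f x) \sum_(i < M) c * th i `^ a * T i (f x) ^+ 2)).
  by apply: ler_sum => x; exact: pt.
apply: (@le_trans _ _ (\sum_(x : G) \sum_(i < M) c * th i `^ a * T i (f x) ^+ 2)).
  rewrite [leLHS]big_mkcond /=; apply: ler_sum => x _; case: ifP => // _.
  by apply: sumr_ge0 => i _; apply: mulr_ge0; [rewrite /c; nneg|nneg].
rewrite exchange_big /=.
set K := 128 * _ * _ * _ * _ / _.
apply: (@le_trans _ _ (\sum_(i < M) K * dform (fun x => T i (f x)) (fun x => T i (f x)))).
  apply: ler_sum => i _; rewrite -mulr_sumr.
  have c0 : 0 <= c * th i `^ a by rewrite /c; nneg.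
  apply: (le_trans (ler_wpM2l c0 (FK i))).
  rewrite mulrA ler_wpM2r ?dform_ge0 //.
  have -> : c * th i `^ a * (8 * n%:R * (4 * E * th i `^ (- alpha)) `^ a / h ^+ 2) =
     128 * n%:R * 16 `^ (a / p) * (4 * E) `^ a * (th i `^ (- ((alpha - 1) * a))) / h ^+ 2.
    rewrite powRM; [|nneg..].
    have -> : th i `^ (- ((alpha - 1) * a)) = th i `^ a * (th i `^ (- alpha)) `^ a.
      rewrite -powRrM -powRD; last by apply/implyP => _; rewrite gt_eqF.
      by congr (_ `^ _); ring.
    rewrite /c; move: (th i `^ a) (_ `^ a) (_ `^ a) (16 `^ _) => X1 X2 X3 X4.
    by ring.
  rewrite /K ler_wpM2r ?invr_ge0 ?sqr_ge0 // ler_wpM2l; [by []|nneg|].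
  rewrite !powRN lef_pV2 ?posrE ?powR_gt0 //.
  apply: powR_le; [by rewrite mulr_ge0 //; lra|exact: ltW|].
  have -> : Lam = s `^ (2 / p).
    rewrite /s -powRrM (_ : p / 2 * (2 / p) = 1) ?powRr1 ?ltW //.
    by field; rewrite gt_eqF.
  apply: powR_le; [by rewrite divr_ge0 // ltW|exact: ltW|].
  exact: le_mul_exp2.
rewrite -mulr_sumr ler_wpM2l //.
  by rewrite /K; nneg.
under eq_bigr do rewrite dformE.
rewrite exchange_big dformE /=; apply: ler_sum => i _.
rewrite exchange_big; apply: ler_sum => x _.
exact: layer_sqr_sum.
Qed.

End functional_inequalities.

(** * Interpolation inequalities for the reaction and for the decay *)

Section interpolation.
Context {R : realType} {n : nat} (n0 : (0 < n)%N).
Local Notation a := (2 / n%:R : R).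
Variables (m k : R).
Local Notation p := (k + m - 1).

Let nR0 : 0 < n%:R :> R. Proof. by rewrite ltr0n. Qed.
Let a0 : 0 < a. Proof. by rewrite divr_gt0. Qed.

(** The exponent m + a is critical: k + (m + a) - 1 = p + a is the power handled above a level by
    truncation. There the coefficient is a multiple of (E / Lam^(alpha-1))^a, made equal to eps by
    the choice of [Lam]; below the level, u^(alpha-1) is at most a multiple of Lam^(alpha-1), that
    is of E. *)
Lemma reaction_le (eps : R) : 1 < m -> 1 < k -> 0 < eps ->
  exists2 C : R, 0 < C &
  forall (P : nat) (h : R) (u : {ffun 'I_n -> 'I_P.+2} -> R), 0 < h ->
    (forall x, 0 <= u x) -> (forall x, wall x -> u x = 0) ->
    \sum_x u x `^ (k + (m + a) - 1) <=
      eps / h ^+ 2 * dform (pw (p / 2) u) (pw (p / 2) u)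
      + C * (h ^+ n * \sum_x u x `^ (m + a)) * \sum_x u x `^ k.
Proof.
move=> m1 k1 eps0; have p0 : 0 < p by lra.
set alpha := m + a.
have al1 : 1 < alpha by rewrite /alpha; move: a0; lra.
pose K : R := 128 * n%:R * 16 `^ (a / p) * 4 `^ a.
have K0 : 0 < K by rewrite /K; gt0.
pose c := (K / eps) `^ a^-1; have c0 : 0 < c by rewrite powR_gt0 // divr_gt0.
exists (2 `^ (2 / p * (alpha - 1)) * c); first by gt0.
move=> P h u h0 u0 uw; set E := h ^+ n * _.
have hn0 : 0 < h ^+ n by gt0.
have S0 : 0 <= \sum_x u x `^ alpha by apply: sumr_ge0 => x _; exact: powR_ge0.
(* For E = 0 the level [Lam] would be 0; but then u vanishes. *)
have := mulr_ge0 (ltW hn0) S0; rewrite -/E le_eqVlt => /orP[/eqP E0|E0].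
  have : \sum_x u x `^ alpha = 0.
    by move/esym/eqP: E0; rewrite mulf_eq0 gt_eqF //= => /eqP.
  move=> /psumr_eq0P u00.
  have u0' x : u x = 0.
    by apply: (@powR_eq0_eq0 _ _ alpha); apply: u00 => // z _; exact: powR_ge0.
  rewrite big1; last by move=> x _; rewrite u0' powR0 // gt_eqF //; lra.
  rewrite -E0 mulr0 mul0r addr0; apply: mulr_ge0; last exact: dform_ge0.
  by rewrite divr_ge0 ?sqr_ge0 ?ltW.
have hE : h ^+ n * \sum_x u x `^ alpha <= E by [].
clearbody E.
pose Lam := (c * E) `^ (alpha - 1)^-1.
have L0 : 0 < Lam by rewrite powR_gt0 // mulr_gt0.
have LamE : Lam `^ (alpha - 1) = c * E.
  rewrite /Lam -powRrM mulVf ?powRr1 //; first by nneg.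
  by rewrite gt_eqF //; lra.
rewrite (bigID (fun x => 2 * Lam `^ (p / 2) < pw (p / 2) u x)) /=; apply: lerD.
  have := high_level_le n0 p0 al1 h0 L0 E0 u0 uw hE.
  have -> : p + a = k + alpha - 1 by rewrite /alpha; ring.
  move=> /le_trans; apply; rewrite ler_wpM2r ?dform_ge0 //.
  rewrite ler_wpM2r ?invr_ge0 ?sqr_ge0 //; apply: le_of_eq.
  rewrite powRN [Lam `^ (_ * _)]powRrM LamE !powRM //; try exact: ltW.
  have -> : c `^ a = K / eps.
    rewrite /c -powRrM mulVf ?powRr1 ?gt_eqF //; nneg.
  have := powR_gt0 a E0; move: (E `^ a) => F F0.
  rewrite /K; have := powR_gt0 (a / p) (ltr0n _ 16).
  have := powR_gt0 a (ltr0n R 4); move: (4 `^ a) (16 `^ _) => X Y X0 Y0.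
  by field; rewrite !gt_eqF.
rewrite mulr_sumr [leLHS]big_mkcond /=; apply: ler_sum => x _.
case: ifPn => [|_]; last by apply: mulr_ge0; nneg.
rewrite -leNgt => ul.
have -> : k + alpha - 1 = k + (alpha - 1) by ring.
rewrite powR_addp //; [|lra..].
rewrite mulrC ler_wpM2r ?powR_ge0 //.
have -> : 2 `^ (2 / p * (alpha - 1)) * c * E = (2 `^ (2 / p) * Lam) `^ (alpha - 1).
  by rewrite powRM ?powR_ge0 // LamE -powRrM; ring.
apply: powR_le => //; first by lra.
have -> : u x = pw (p / 2) u x `^ (2 / p).
  by rewrite /pw -powRrM (_ : p / 2 * (2 / p) = 1) ?powRr1 //; field; rewrite gt_eqF.
have -> : Lam = (Lam `^ (p / 2)) `^ (2 / p).
  rewrite -powRrM (_ : p / 2 * (2 / p) = 1) ?powRr1 ?ltW //.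
  by field; rewrite gt_eqF.
rewrite -powRM ?powR_ge0 //; apply: powR_le; rewrite ?powR_ge0 //.
by rewrite divr_ge0 // ltW.
Qed.

(** A Nash inequality proved by one truncation. The level [lam] is such that lam^(k-1) M is half of
    y, so at least half of y comes from {u > lam}, and Faber-Krahn for a truncation [g] supported on
    a volume of order M / lam bounds that share. The powers of [lam] that appear are powers of y. *)
Lemma energy_lower_bound (M : R) : 1 < m -> 1 < k -> 0 < M ->
  exists2 C : R, 0 < C &
  forall (P : nat) (h : R) (u : {ffun 'I_n -> 'I_P.+2} -> R), 0 < h ->
    (forall x, 0 <= u x) -> (forall x, wall x -> u x = 0) ->
    h ^+ n * \sum_x u x <= M ->
    (h ^+ n * \sum_x u x `^ k) `^ (1 + (m - 1 + a) / (k - 1)) <=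
      C * (h ^+ n / h ^+ 2 * dform (pw (p / 2) u) (pw (p / 2) u)).
Proof.
move=> m1 k1 M0; have p0 : 0 < p by lra.
set th := _ / (k - 1).
pose W : R := 4 * 2 `^ (2 / p) * M.
have W0 : 0 < W by rewrite /W; gt0.
exists (64 * n%:R * W `^ a * (2 * M) `^ th); first by gt0.
move=> P h u h0 u0 uw hM; set y := h ^+ n * _; set D := dform _ _.
have hn0 : 0 < h ^+ n by gt0.
have D0 : 0 <= D by exact: dform_ge0.
have : 0 <= y by apply: mulr_ge0 => //; [exact: ltW|apply: sumr_ge0 => x _; exact: powR_ge0].
have th0 : 0 < th by rewrite /th divr_gt0 //; [move: a0; lra|lra].
rewrite le_eqVlt => /orP[/eqP <-|y0].
  rewrite powR0; last by rewrite gt_eqF //; lra.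
  by rewrite !mulr_ge0 //; nneg.
pose lam := (y / (2 * M)) `^ (k - 1)^-1.
have yM : 0 < y / (2 * M) by rewrite divr_gt0 // mulr_gt0.
have l0 : 0 < lam by exact: powR_gt0.
have lamE : lam `^ (k - 1) = y / (2 * M).
  rewrite /lam -powRrM mulVf ?powRr1 ?ltW //; first by rewrite gt_eqF //; lra.
pose f := pw (p / 2) u; have f0 x : 0 <= f x by exact: powR_ge0.
have p20 : 0 < p / 2 by lra.
pose s := lam `^ (p / 2); have s0 : 0 < s by exact: powR_gt0.
(* Cutting at half the height keeps f <= 2 g where u > lam; the support {f > s / 2} still has volume
   at most 2^(2/p) M / lam. *)
pose g x : R := Num.max (f x - s / 2) 0.
have inv (t : R) : 0 <= t -> (t `^ (p / 2)) `^ (2 / p) = t.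
  move=> t0; rewrite -powRrM (_ : p / 2 * (2 / p) = 1) ?powRr1 //.
  by field; rewrite gt_eqF.
have g0 x : 0 <= g x by rewrite /g le_max lexx orbT.
have gw x : wall x -> g x = 0.
  move=> /uw ux; rewrite /g /f /pw ux powR0 ?gt_eqF // sub0r max_r //.
  by rewrite oppr_le0; lra.
have gf x : u x > lam -> f x <= 2 * g x.
  move=> ul; have : s <= f x by apply: powR_le; rewrite ?ltW.
  by rewrite /g; case: (leP (f x - s / 2) 0); lra.
have FK : \sum_x g x ^+ 2 <= 8 * n%:R * (W / lam) `^ a / h ^+ 2 * dform g g.
  apply: (@faber_krahn_powR _ _ _ n0 g h) => //; first by gt0.
  rewrite ler_pdivlMr //; set A := [set x | _].
  suff H : #|A|%:R * lam <= 2 `^ (2 / p) * \sum_x u x.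
    rewrite (_ : 4 * h ^+ n * _ * _ = 4 * h ^+ n * (#|A|%:R * lam)); last by ring.
    have h4 : 0 <= 4 * h ^+ n by nneg.
    apply: (le_trans (ler_wpM2l h4 H)).
    have -> : 4 * h ^+ n * (2 `^ (2 / p) * \sum_x u x) =
       4 * 2 `^ (2 / p) * (h ^+ n * \sum_x u x) by ring.
    by rewrite /W ler_wpM2l //; nneg.
  rewrite -mulr_natl mulr1 mulr_sumr.
  apply: (@le_trans _ _ (\sum_(x in A) 2 `^ (2 / p) * u x)); last first.
    rewrite [leLHS]big_mkcond /=; apply: ler_sum => x _; case: ifP => // _.
    by nneg.
  rewrite -sumr_const mulr_suml; apply: ler_sum => x.
  rewrite inE /g lt_max ltxx orbF mul1r subr_gt0 => fx.
  rewrite -(inv lam (ltW l0)) -(inv (u x) (u0 x)) -powRM ?powR_ge0 //.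
  apply: powR_le; [by rewrite divr_ge0 // ltW|exact: powR_ge0|].
  by change (s <= 2 * f x); lra.
have gD : dform g g <= D.
  apply: dform_le => x z; rewrite /g -/f.
  by apply: (le_trans (plus_lip _ _)); rewrite opprB addrA subrK.
have low : \sum_(x | u x <= lam) u x `^ k <= (h ^+ n)^-1 * (y / 2).
  apply: (@le_trans _ _ (\sum_x lam `^ (k - 1) * u x)).
    rewrite [leLHS]big_mkcond /=; apply: ler_sum => x _; case: ifP => [ul|_]; last by nneg.
    rewrite -(@powRM1 _ (u x) k) //; last by lra.
    by rewrite ler_wpM2r // powR_le //; lra.
  rewrite -mulr_sumr lamE -(ler_pM2l hn0) mulrA [h ^+ n * (_ / _)]mulrC -mulrA.
  rewrite mulVKf ?gt_eqF //; apply: (le_trans (ler_wpM2l (ltW yM) hM)).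
  by apply: le_of_eq; field; rewrite gt_eqF.
have high : \sum_(x | ~~ (u x <= lam)) u x `^ k <= 4 * lam `^ (- (m - 1)) * \sum_x g x ^+ 2.
  rewrite mulr_sumr [leLHS]big_mkcond /=; apply: ler_sum => x _.
  case: ifPn => [|_]; last by nneg.
  rewrite -ltNge => ul.
  have ux0 : 0 < u x by lra.
  have -> : u x `^ k = f x ^+ 2 * u x `^ (- (m - 1)).
    rewrite /f /pw -powR_mulrn ?powR_ge0 // -powRrM -powRD; last first.
      by apply/implyP => _; rewrite gt_eqF.
    by congr (_ `^ _); lra.
  have h1 : u x `^ (- (m - 1)) <= lam `^ (- (m - 1)).
    by rewrite !powRN lef_pV2 ?posrE ?powR_gt0 // powR_le ?ltW //; lra.
  have h2 := sqr_le (f0 x) (gf x ul).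
  apply: (le_trans (ler_pM (sqr_ge0 _) (powR_ge0 _ _) h2 h1)).
  by apply: le_of_eq; ring.
have yE : y <= h ^+ n * (4 * lam `^ (- (m - 1)) * \sum_x g x ^+ 2) + y / 2.
  rewrite {1}/y (bigID (fun x => u x <= lam)) /= mulrDr addrC; apply: lerD.
    by rewrite ler_pM2l.
  by rewrite -(ler_pM2l hn0) mulVKf ?gt_eqF // in low.
have yth : y `^ (1 + th) = y * (lam `^ (m - 1 + a)) * (2 * M) `^ th.
  rewrite (powR_addp (ltW y0) ltr01 (ltW th0)) powRr1 ?(ltW y0) // -mulrA.
  congr (_ * _).
  have -> : lam `^ (m - 1 + a) = (y / (2 * M)) `^ th.
    have kn : k - 1 != 0 by rewrite gt_eqF //; lra.
    have nn : n%:R != 0 :> R by rewrite gt_eqF.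
    by rewrite -lamE -powRrM /th; congr (_ `^ _); field; rewrite ?kn ?nn.
  rewrite -powRM; [|exact: ltW|by nneg].
  by rewrite mulfVK // gt_eqF // mulr_gt0.
have gD' : \sum_x g x ^+ 2 <= 8 * n%:R * (W / lam) `^ a / h ^+ 2 * D.
  by apply: (le_trans FK); rewrite ler_wpM2l //; nneg.
have K0 : 0 <= h ^+ n * (4 * lam `^ (- (m - 1))) by nneg.
have := ler_wpM2l K0 gD'.
have -> : (W / lam) `^ a = W `^ a * lam `^ (- a).
  have li : 0 <= lam^-1 by rewrite invr_ge0 ltW.
  by rewrite (powRM _ (ltW W0) li) -(powR_inv1 (ltW l0)) -powRrM mulN1r.
have e1 : lam `^ (m - 1 + a) * (lam `^ (- (m - 1)) * lam `^ (- a)) = 1.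
  have l1 : lam != 0 by rewrite gt_eqF.
  rewrite -!powRD; try (by apply/implyP).
  by rewrite (_ : _ + _ = 0) ?powRr0 //; ring.
rewrite yth; move: e1 yE; have := powR_gt0 (m - 1 + a) l0.
have := powR_gt0 th (mulr_gt0 (ltr0n R 2) M0).
move: (lam `^ (m - 1 + a)) (lam `^ (- (m - 1))) (lam `^ (- a)) ((2 * M) `^ th)
  (\sum_x g x ^+ 2) (W `^ a) => X1 X2 X3 Q Sg Wa Q0 X10 e1 yE H.
have H2 : y <= 2 * (h ^+ n * (4 * X2) * (8 * n%:R * (Wa * X3) / h ^+ 2 * D)).
  by move: yE H; rewrite mulrA; lra.
have QX : 0 <= X1 * Q by rewrite mulr_ge0 // ltW.
rewrite -mulrA; apply: (le_trans (ler_wpM2r QX H2)).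
apply: le_of_eq; transitivity (64 * n%:R * Wa * Q * (h ^+ n / h ^+ 2 * D) * (X1 * (X2 * X3))).
  by ring.
by rewrite e1 mulr1.
Qed.

End interpolation.

(** * Limits of finite sums and of geometric Cauchy sequences *)

Section limits.
Context {R : realType}.

Lemma cvgn_sum (I : Type) (r : seq I) (Q : pred I) (f : I -> nat -> R) (l : I -> R) :
  (forall i, f i k @[k --> \oo] --> l i)%classic ->
  (\sum_(i <- r | Q i) f i k @[k --> \oo] --> \sum_(i <- r | Q i) l i)%classic.
Proof.
move=> fl; elim: r => [|i r IH].
  by under eq_fun do rewrite big_nil; rewrite big_nil; exact: cvg_cst.
under eq_fun do rewrite big_cons; rewrite big_cons.
by case: (Q i) => //; exact: cvgD.
Qed.

Lemma geometric_cauchy (u : nat -> R) (B q : R) : 0 <= q < 1 ->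
  (forall k, `|u k.+1 - u k| <= B * q ^+ k) ->
  cvgn u /\ forall k, `|limn u - u k| <= B * q ^+ k / (1 - q).
Proof.
move=> /andP[q0 q1] hu.
have B0 : 0 <= B by have := hu 0%N; rewrite expr0 mulr1; apply: le_trans.
have cu : cvgn u.
  have -> : u = (fun k => u 0%N + series (fun k => u k.+1 - u k) k).
    apply/funext => k; rewrite seriesEnat /= telescope_sumr // addrC subrK.
    by [].
  apply: is_cvgD; first exact: is_cvg_cst.
  apply: normed_cvg; apply: (@series_le_cvg _ _ (geometric B q)).
  - by move=> k; exact: normr_ge0.
  - by move=> k; rewrite /geometric /= mulr_ge0 // exprn_ge0.
  - by move=> k; exact: hu.
  - by apply: is_cvg_geometric_series; rewrite ger0_norm.
split=> // k.
have near i : `|u (k + i)%N - u k| <= B * q ^+ k * ((1 - q ^+ i) / (1 - q)).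
  elim: i => [|i IH]; first by rewrite addn0 subrr normr0 expr0 subrr mul0r mulr0.
  rewrite addnS (_ : u _ - u k = (u (k + i).+1 - u (k + i)%N) + (u (k + i)%N - u k)); last by ring.
  apply: (le_trans (ler_normD _ _)).
  apply: (le_trans (lerD (hu _) IH)); apply: le_of_eq.
  by rewrite exprD exprS; field; rewrite gt_eqF // subr_gt0.
have -> : limn u - u k = limn (fun j => u j - u k).
  by apply/esym/cvg_lim => //; apply: cvgB => //; exact: cvg_cst.
have cuk : cvgn (fun j => u j - u k) by apply: is_cvgB => //; exact: is_cvg_cst.
rewrite -lim_norm //; apply: limr_le; first exact: is_cvg_norm.
exists k => // j /= kj.
rewrite -(subnKC kj); apply: (le_trans (near _)).
rewrite ler_wpM2l ?mulr_ge0 ?exprn_ge0 // ler_pdivrMr ?subr_gt0 //.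
by rewrite mulVf ?gt_eqF ?subr_gt0 // gerBl exprn_ge0.
Qed.

End limits.

(** * Solvability of the implicit diffusion step *)

Section resolvent.
Context {R : realType} {n P : nat}.
Notation G := {ffun 'I_n -> 'I_P.+2}.
Implicit Types (f g u v : G -> R) (x y : G).

Lemma lapE f x : lap f x = \sum_i (f (x + ev i) + f (x - ev i)) - (2 * n)%:R * f x.
Proof.
rewrite /lap (_ : (2 * n)%:R * f x = \sum_(i < n) 2 * f x); last first.
  by rewrite sumr_const card_ord -mulr_natr natrM; ring.
rewrite -sumrB; apply: eq_bigr => i _; ring.
Qed.

Variables (m c K : R) (v : G -> R).
Let L : R := m * K `^ (m - 1).
Let s : R := (1 + (2 * n)%:R * c * L)^-1.
Let phi u x : R :=
  if wall x then 0 else u x + s * (v x - u x + c * lap (pw m u) x).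

(** The solution is the fixed point of the damped explicit iteration [phi]. The damping [s], taken
    from the Lipschitz constant [L] of the m-th power on [0, K], makes [phi] nondecreasing in all
    values of u, so it preserves the bounds 0 and K; and it contracts the l^1 distance by 1 - s,
    because what the m-th powers take from a point they give to its neighbours. *)
Lemma resolvent_exists : 1 < m -> 0 <= c ->
  (forall x, 0 <= v x <= K) -> (forall x, wall x -> v x = 0) ->
  exists u, [/\ forall x, 0 <= u x <= K, forall x, wall x -> u x = 0 &
    forall x, ~~ wall x -> u x - c * lap (pw m u) x = v x].
Proof.
move=> m1 c0 vK vw.
have K0 : 0 <= K by have /andP[h1 h2] := vK 0; exact: le_trans h2.
have L0 : 0 <= L by rewrite /L mulr_ge0 ?powR_ge0 //; lra.
have N0 : 0 <= (2 * n)%:R * c :> R by apply: mulr_ge0.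
have Q0 : 0 <= (2 * n)%:R * c * L by exact: mulr_ge0.
have Q1 : 0 < 1 + (2 * n)%:R * c * L by lra.
have s0 : 0 < s by rewrite invr_gt0.
have sE : s * (1 + (2 * n)%:R * c * L) = 1 by rewrite mulVf // gt_eqF.
have s1 : s <= 1 by rewrite -sE ler_peMr ?(ltW s0) // lerDl.
have lip (a b : R) : 0 <= a -> a <= b -> b <= K -> b `^ m - a `^ m <= L * (b - a).
  move=> a0 ab bK; have b0 : 0 <= b by exact: le_trans ab.
  apply: (le_trans (powR_tangent (ltW m1) b0 a0)); rewrite /L mulrA.
  rewrite ler_wpM2r ?subr_ge0 // ler_wpM2l; [by []|lra|].
  by apply: powR_le => //; lra.
(* The dependence of [phi] on the value at the point itself; [s] is what makes it nondecreasing on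
   [0, K]. *)
pose psi t := (1 - s) * t - s * ((2 * n)%:R * c) * t `^ m.
have psi_mono (a b : R) : 0 <= a -> a <= b -> b <= K -> psi a <= psi b.
  move=> a0 ab bK; have := lip a b a0 ab bK; rewrite /psi => h.
  have := ler_wpM2l (mulr_ge0 (ltW s0) N0) h.
  rewrite (_ : s * ((2 * n)%:R * c) * (L * (b - a)) =
    (s * (1 + (2 * n)%:R * c * L) - s) * (b - a)); last by ring.
  by rewrite sE; lra.
pose nb u x := \sum_i (pw m u (x + ev i) + pw m u (x - ev i)).
have phiE u x : ~~ wall x -> phi u x = psi (u x) + s * v x + s * c * nb u x.
  by move=> xw; rewrite /phi (negbTE xw) lapE /psi /nb /pw; ring.
have nb0 u x : 0 <= nb u x by apply: sumr_ge0 => i _; rewrite addr_ge0 ?powR_ge0.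
have nbK u x : (forall x, 0 <= u x <= K) -> nb u x <= (2 * n)%:R * K `^ m.
  move=> uK; rewrite /nb (_ : (2 * n)%:R * K `^ m = \sum_(i < n) (K `^ m + K `^ m)); last first.
    by rewrite sumr_const card_ord -[RHS]mulr_natr natrM; ring.
  apply: ler_sum => i _.
  by apply: lerD; apply: powR_le; have /andP[] := uK (x + ev i);
     have /andP[] := uK (x - ev i) => //; lra.
have phiK u : (forall x, 0 <= u x <= K) -> forall x, 0 <= phi u x <= K.
  move=> uK x; have [xw|xw] := boolP (wall x); first by rewrite /phi xw lexx.
  rewrite phiE //; have /andP[u0 uK'] := uK x; have /andP[v0 vK'] := vK x.
  have p0 : psi 0 = 0 by rewrite /psi powR0 ?mulr0 ?subrr //; rewrite gt_eqF //; lra.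
  have h1 := psi_mono 0 (u x) (lexx _) u0 uK'; have h2 := psi_mono (u x) K u0 uK' (lexx _).
  have h3 : 0 <= s * v x by rewrite mulr_ge0 // ltW.
  have h4 : 0 <= s * c * nb u x by rewrite !mulr_ge0 // ltW.
  have h5 : s * v x <= s * K by rewrite ler_wpM2l // ltW.
  have h6 : s * c * nb u x <= s * c * ((2 * n)%:R * K `^ m).
    by rewrite ler_wpM2l ?nbK // mulr_ge0 // ltW.
  rewrite p0 in h1; apply/andP; split; first lra.
  have -> : K = psi K + s * K + s * c * ((2 * n)%:R * K `^ m) by rewrite /psi; ring.
  lra.
pose d u w := \sum_(x : G) `|u x - w x|.
have contr u w : (forall x, 0 <= u x <= K) -> (forall x, 0 <= w x <= K) ->
    d (phi u) (phi w) <= (1 - s) * d u w.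
  move=> uK wK; pose e x : R := `|pw m u x - pw m w x|.
  have loc x : `|psi (u x) - psi (w x)| <= (1 - s) * `|u x - w x| - s * ((2 * n)%:R * c) * e x.
    rewrite /e /pw; have := uK x; have := wK x; move: (u x) (w x) => a b.
    wlog ab : a b / b <= a => [H ha hb|].
      have [ab|/ltW ba] := leP b a; first exact: H.
      by rewrite distrC [`|a - b|]distrC [`|a `^ m - _|]distrC; exact: H.
    move=> /andP[b0 bK] /andP[a0 aK].
    have := psi_mono b a b0 ab aK; have := powR_le (_ : 0 <= m) b0 ab.
    move=> /(_ (ltW (lt_trans ltr01 m1))) h1 h2.
    rewrite !ger0_norm ?subr_ge0 //; apply: le_of_eq; rewrite /psi; ring.
  have e0 x : 0 <= e x by exact: normr_ge0.
  have nbd x : `|nb u x - nb w x| <= \sum_i (e (x + ev i) + e (x - ev i)).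
    rewrite /nb -sumrB; apply: (le_trans (ler_norm_sum _ _ _)).
    apply: ler_sum => i _; apply: le_trans (ler_normD _ _).
    by apply: le_of_eq; congr (`| _ |); ring.
  have sumnb : \sum_(x : G) \sum_i (e (x + ev i) + e (x - ev i)) = (2 * n)%:R * \sum_(x : G) e x.
    rewrite exchange_big /=.
    rewrite (eq_bigr (fun i : 'I_n => 2 * \sum_(x : G) e x)); last first.
      by move=> i _; rewrite big_split /= !sum_shift; ring.
    by rewrite sumr_const card_ord -mulr_natl natrM; ring.
  apply: (@le_trans _ _ (\sum_(x : G) ((1 - s) * `|u x - w x| - s * ((2 * n)%:R * c) * e x +
      s * c * \sum_i (e (x + ev i) + e (x - ev i))))).
    apply: ler_sum => x _; have [xw|xw] := boolP (wall x).
      rewrite /phi xw subrr normr0; apply: addr_ge0.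
        exact: le_trans (loc x).
      by rewrite !mulr_ge0 ?(ltW s0) // sumr_ge0 // => i _; rewrite addr_ge0.
    rewrite !phiE // (_ : _ - _ = (psi (u x) - psi (w x)) + s * c * (nb u x - nb w x)); last by ring.
    apply: (le_trans (ler_normD _ _)); apply: lerD => //.
    by rewrite normrM ger0_norm ?mulr_ge0 ?(ltW s0) // ler_wpM2l ?mulr_ge0 ?(ltW s0).
  rewrite !big_split /= sumrN -!mulr_sumr sumnb; apply: le_of_eq; rewrite /d; ring.
pose it k : G -> R := iter k phi (fun=> 0).
have itK k : forall x, 0 <= it k x <= K.
  by elim: k => [x|k IH] /=; [rewrite lexx|exact: phiK].
have itw k x : wall x -> it k x = 0 by case: k => //= k xw; rewrite /phi xw.
pose B := d (it 1%N) (it 0%N).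
have q01 : 0 <= 1 - s < 1 by apply/andP; split; lra.
have itd k : d (it k.+1) (it k) <= B * (1 - s) ^+ k.
  elim: k => [|k IH]; first by rewrite expr0 mulr1.
  apply: (le_trans (contr _ _ (itK k.+1) (itK k))).
  by rewrite exprS mulrCA ler_wpM2l //; lra.
have itdx x k : `|it k.+1 x - it k x| <= B * (1 - s) ^+ k.
  apply: le_trans (itd k); rewrite /d (bigD1 x) //= lerDl.
  by apply: sumr_ge0 => y _; exact: normr_ge0.
pose w (x : G) : R := limn (fun k => it k x).
have cw x : (it k x @[k --> \oo] --> w x)%classic.
  by have [cv _] := geometric_cauchy q01 (itdx x).
have wK x : 0 <= w x <= K.
  have [cv _] := geometric_cauchy q01 (itdx x); apply/andP; split.
    by apply: limr_ge => //; apply: nearW => k; have /andP[] := itK k x.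
  by apply: limr_le => //; apply: nearW => k; have /andP[] := itK k x.
have ww x : wall x -> w x = 0.
  by move=> xw; apply/cvg_lim => //; under eq_fun do rewrite itw //; exact: cvg_cst.
have d0 : (d w (it k) @[k --> \oo] --> (0 : R))%classic.
  rewrite (_ : 0 = \sum_(x : G) `|w x - w x|); last first.
    by rewrite big1 // => x _; rewrite subrr normr0.
  apply: cvgn_sum => x; apply: cvg_norm; apply: cvgB; [exact: cvg_cst|exact: cw].
have fix_w : d (phi w) w <= 0.
  have d1 : (d w (it k.+1) @[k --> \oo] --> (0 : R))%classic.
    by rewrite (cvg_shiftS (fun k => d w (it k))).
  have d2 : ((d w (it k) + d w (it k.+1)) @[k --> \oo] --> (0 + 0 : R))%classic.
    exact: cvgD.
  rewrite addr0 in d2.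
  rewrite -(cvg_lim _ d2) //; apply: limr_ge; first by apply/cvg_ex; exists 0.
  apply: nearW => k /=; rewrite addrC; apply: (@le_trans _ _ (d (phi w) (it k.+1) + d w (it k.+1))).
    rewrite /d -big_split; apply: ler_sum => x _ /=.
    rewrite (distrC (w x) (it k.+1 x)); apply: le_trans (ler_normD _ _).
    by apply: le_of_eq; congr (`| _ |); rewrite (_ : phi (it k) x = it k.+1 x) //; ring.
  rewrite [leLHS]addrC lerD2l; apply: (le_trans (contr _ _ wK (itK k))).
  by rewrite ler_piMl ?gerBl ?(ltW s0) // /d sumr_ge0.
have fw x : phi w x = w x.
  have : d (phi w) w = 0.
    by apply/eqP; rewrite eq_le fix_w /d sumr_ge0.
  move=> /psumr_eq0P H; apply/eqP; rewrite -subr_eq0 -normr_eq0; apply/eqP.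
  by apply: H => // z _; exact: normr_ge0.
exists w; split => // x xw; have := fw x; rewrite /phi (negbTE xw).
move=> /(canRL (addKr _)); rewrite addNr => /eqP.
rewrite mulf_eq0 (gt_eqF s0) /= => /eqP; lra.
Qed.

End resolvent.

(** * Estimates for one implicit step *)

Section one_step.
Context {R : realType} {n P : nat}.
Notation G := {ffun 'I_n -> 'I_P.+2}.
Implicit Types (f g u v : G -> R) (x y : G).

Definition diffusion_step (m c : R) v u :=
  [/\ forall x, 0 <= u x, forall x, wall x -> u x = 0 &
    forall x, ~~ wall x -> u x - c * lap (pw m u) x = v x].

Variables (m c : R) (u v : G -> R).
Let w := pw m u.

Lemma step_test g : diffusion_step m c v u -> (forall x, wall x -> v x = 0) ->
  (forall x, wall x -> g x = 0) ->
  \sum_(x : G) (u x - v x) * g x = - c * dform w g.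
Proof.
move=> [u0 uw ue] vw gw; rewrite mulNr -mulrN -sum_by_parts mulr_sumr.
apply: eq_bigr => x _; have [xw|xw] := boolP (wall x).
  by rewrite gw // !mulr0.
by rewrite -ue //; ring.
Qed.

Lemma lap_wall_ge0 x : 1 < m -> diffusion_step m c v u -> wall x -> 0 <= lap w x.
Proof.
move=> m1 [u0 uw _] xw; have w0 : w x = 0.
  by rewrite /w /pw uw // powR0 // gt_eqF //; lra.
apply: sumr_ge0 => i _; rewrite w0 !subr0.
by rewrite addr_ge0 // /w /pw powR_ge0.
Qed.

(** Weights that do not vanish on the wall pick up the flux through it. The weight 1 gives the loss
    of mass, the squared distance to the centre the evolution of the second moment. *)
Lemma step_weight g : 1 < m -> diffusion_step m c v u ->
  (forall x, wall x -> v x = 0) ->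
  \sum_(x : G) (u x - v x) * g x =
  c * (\sum_(x : G) w x * lap g x - \sum_(x : G | wall x) lap w x * g x).
Proof.
move=> m1 [u0 uw ue] vw.
have -> : \sum_(x : G) w x * lap g x = \sum_(x : G) lap w x * g x.
  by rewrite sum_by_parts dformC -sum_by_parts; apply: eq_bigr => x _; rewrite mulrC.
rewrite (bigID (fun x => wall x)) /= big1 ?add0r; last first.
  by move=> x xw; rewrite uw // vw // subrr mul0r.
rewrite [X in c * (X - _)](bigID (fun x => wall x)) /= addrAC subrr add0r.
by rewrite mulr_sumr; apply: eq_bigr => x xw; rewrite -ue //; ring.
Qed.

Lemma step_mass : 1 < m -> 0 <= c -> diffusion_step m c v u ->
  (forall x, wall x -> v x = 0) ->
  \sum_(x : G) v x - \sum_(x : G) u x = c * \sum_(x : G | wall x) lap w x.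
Proof.
move=> m1 c0 du vw; have := step_weight (fun=> 1) m1 du vw.
rewrite (_ : \sum_(x : G) w x * lap (fun=> 1) x = 0); last first.
  by rewrite big1 // => x _; rewrite /lap big1 ?mulr0 // => i _; rewrite subrr addr0.
under eq_bigr do rewrite mulr1; rewrite sumrB.
under [X in _ = c * (_ - X)]eq_bigr do rewrite mulr1.
by move=> h; lra.
Qed.

Lemma step_mass_le : 1 < m -> 0 <= c -> diffusion_step m c v u ->
  (forall x, wall x -> v x = 0) -> \sum_(x : G) u x <= \sum_(x : G) v x.
Proof.
move=> m1 c0 du vw; rewrite -subr_ge0 step_mass // mulr_ge0 // sumr_ge0 // => x.
exact: lap_wall_ge0 du.
Qed.

Definition cross_const (k : R) : R :=
  Num.min (2 * (k - 1) / (k - 1 + m)) (2 * m / (k - 1 + m)).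

Lemma cross_const_gt0 k : 1 < m -> 1 < k -> 0 < cross_const k.
Proof. by move=> m1 k1; rewrite lt_min !divr_gt0 //; lra. Qed.

(** The test function is u^(k-1): the tangent inequality turns the time difference into a difference
    of k-th powers, and [powR_cross] bounds the dissipation from below. *)
Lemma step_power k : 1 < m -> 0 <= c -> 1 < k -> diffusion_step m c v u ->
  (forall x, wall x -> v x = 0) -> (forall x, 0 <= v x) ->
  \sum_(x : G) u x `^ k
  + k * c * cross_const k * dform (pw ((k + m - 1) / 2) u) (pw ((k + m - 1) / 2) u)
  <= \sum_(x : G) v x `^ k.
Proof.
move=> m1 c0 k1 du vw v0; have [u0 uw ue] := du.
have gw x : wall x -> pw (k - 1) u x = 0.
  by move=> xw; rewrite /pw uw // powR0 // gt_eqF //; lra.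
have := step_test du vw gw.
have dd_le : cross_const k * dform (pw ((k + m - 1) / 2) u) (pw ((k + m - 1) / 2) u)
    <= dform w (pw (k - 1) u).
  rewrite /dform mulr_sumr; apply: ler_sum => i _.
  rewrite mulr_sumr; apply: ler_sum => x _; rewrite -expr2 /dd /w /pw.
  have -> : (k + m - 1) / 2 = (k - 1 + m) / 2 by ring.
  by rewrite [leRHS]mulrC; apply: powR_cross => //; lra.
have conv : \sum_(x : G) u x `^ k - \sum_(x : G) v x `^ k <=
    k * \sum_(x : G) (u x - v x) * pw (k - 1) u x.
  rewrite -sumrB mulr_sumr; apply: ler_sum => x _.
  by rewrite [(_ - _) * _]mulrC; apply: powR_tangent => //; lra.
move=> h; rewrite h in conv.
have kc : 0 <= k * c by rewrite mulr_ge0 //; lra.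
have := ler_wpM2l kc dd_le; rewrite mulrA.
by move: conv; lra.
Qed.

Definition above (l : R) f x : R := Num.max (f x - l) 0.

(** Above a level l >= 1 the m-th power has slope at least 1, so on the truncation the degenerate
    diffusion dominates the linear one. *)
Lemma step_above l : 1 < m -> 0 <= c -> 1 <= l -> diffusion_step m c v u ->
  (forall x, wall x -> v x = 0) ->
  \sum_(x : G) above l u x ^+ 2 + 2 * c * dform (above l u) (above l u)
  <= \sum_(x : G) above l v x ^+ 2.
Proof.
move=> m1 c0 l1 du vw; have [u0 uw ue] := du.
have a0 f x : 0 <= above l f x by rewrite /above le_max lexx orbT.
have gw x : wall x -> above l u x = 0.
  by move=> xw; rewrite /above uw // max_r //; lra.
have := step_test du vw gw.
have dd_le : dform (above l u) (above l u) <= dform w (above l u).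
  apply: ler_sum => i _; apply: ler_sum => x _; rewrite /dd /w /pw /above.
  have := u0 (x + ev i); have := u0 x; move: (u x) (u (x + ev i)) => a b.
  wlog ab : a b / a <= b => [H|a00 b00].
    have [ab|/ltW ba] := leP a b; first exact: H.
    by move=> a00 b00; rewrite -mulrNN -[leRHS]mulrNN !opprB; exact: H.
  have [bl|lb] := leP b l.
    rewrite !max_r ?subr_le0 // ?(le_trans ab) // ?subrr ?mulr0 //; lra.
  rewrite (@max_l _ _ (b - l)) ?subr_ge0 ?(ltW lb) //.
  have key q : a <= q -> l <= q -> q <= b -> b - q <= b `^ m - a `^ m.
    move=> aq lq qb; have q0 : 0 <= q by exact: le_trans aq.
    have := powR_diff_lower (ltW m1) q0 qb.
    have h1 : 1 <= q `^ (m - 1).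
      have := @powR_le _ (m - 1) 1 q _ ler01 (le_trans l1 lq).
      by rewrite powR1; apply; lra.
    have h2 : a `^ m <= q `^ m by apply: powR_le => //; lra.
    by move=> h3; have := ler_wpM2r (_ : 0 <= b - q) h1; rewrite subr_ge0 => /(_ qb); lra.
  have [al|la] := leP (a - l) 0.
    by rewrite subr0 ler_wpM2r ?subr_ge0 ?(ltW lb) //; apply: key; lra.
  rewrite (_ : b - l - (a - l) = b - a); last by ring.
  by rewrite ler_wpM2r ?subr_ge0 //; apply: key; lra.
have conv : \sum_(x : G) above l u x ^+ 2 - \sum_(x : G) above l v x ^+ 2 <=
    2 * \sum_(x : G) (u x - v x) * above l u x.
  rewrite -sumrB mulr_sumr; apply: ler_sum => x _.
  have h := a0 v x; have h2 : v x - l <= above l v x by rewrite /above le_max lexx.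
  have : above l u x * (above l u x - above l v x) <= (u x - v x) * above l u x.
    rewrite [leRHS]mulrC; move: h h2; move: (above l v x) => b b0 vb.
    rewrite /above; case: (leP (u x - l) 0) => ul; first by rewrite !mul0r.
    by rewrite ler_wpM2l ?(ltW ul) //; lra.
  move: (above l u x) (above l v x) ((u x - v x) * _) => a b z hz.
  have h3 : 0 <= (a - b) * (a - b) by exact: sqr_ge0.
  by rewrite !expr2; lra.
move=> h; rewrite h in conv.
by have := ler_wpM2l c0 dd_le; move: conv; lra.
Qed.

End one_step.

(** * Algebraic decay from a discrete differential inequality *)

Section decay.
Context {R : realType}.

Lemma pow1D_le (k x : R) : 1 <= k -> 0 <= x <= 1 ->
  (1 + x) `^ k <= 1 + k * 2 `^ (k - 1) * x.
Proof.
move=> k1 /andP[x0 x1]; have := @powR_tangent _ k (1 + x) 1 k1 _ ler01.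
have x10 : 0 <= 1 + x by lra.
move=> /(_ x10); rewrite powR1 (addrC 1 x) addrK => h.
have h2 : (x + 1) `^ (k - 1) <= 2 `^ (k - 1) by apply: powR_le; lra.
have := ler_wpM2l (_ : 0 <= k * x) h2; rewrite mulr_ge0 //; last by lra.
by move=> /(_ isT); move: ((x + 1) `^ (k - 1)) (2 `^ (k - 1)) h h2 => X Y; nra.
Qed.

(** Comparison with the barrier K (1 + t)^(-1/th). If the next value exceeded the barrier, the
    damping term, increasing in it, would be at least the decrease of the barrier over the step,
    which contradicts the bound at the previous step. *)
Lemma decay_iter (c th Zm : R) : 0 < c -> 0 < th -> 0 <= Zm ->
  exists2 K : R, 0 < K & forall (tau : R) (J : nat) (Z : nat -> R),
    0 < tau <= 1 -> (forall j, 0 <= Z j) -> Z 0%N <= Zm ->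
    (forall j, (j < J)%N -> Z j.+1 + c * tau * Z j.+1 `^ (1 + th) <= Z j) ->
    forall j, (j <= J)%N -> Z j <= K * (1 + j%:R * tau) `^ (- th^-1).
Proof.
move=> c0 th0 Zm0; set g := th^-1; have g0 : 0 < g by rewrite invr_gt0.
(* The decrease of s^(-g) over one step is at most D tau s'^(-g-1); [K] lies above the initial value
   and satisfies c K^th >= D. *)
pose D := (g + 1) * 2 `^ (g + 1).
have D0 : 0 < D by rewrite /D mulr_gt0 ?powR_gt0 //; lra.
pose K := Zm + (D / c) `^ g.
have Dc0 : 0 < D / c by rewrite divr_gt0.
have K0 : 0 < K by rewrite /K; have := powR_gt0 g Dc0; lra.
have Kth : D <= c * K `^ th.
  rewrite mulrC -ler_pdivrMr //.
  have -> : D / c = ((D / c) `^ g) `^ th.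
    by rewrite -powRrM /g mulVf ?gt_eqF // powRr1 // ltW.
  apply: powR_le; [exact: ltW|exact: powR_ge0|by rewrite /K; lra].
exists K => // tau J Z /andP[t0 t1] Z0 Zi Zs j jJ.
elim: j jJ => [|j IH] jJ.
  rewrite mul0r addr0 powR1 mulr1; apply: (le_trans Zi).
  by rewrite /K lerDl powR_ge0.
have {IH}IH := IH (ltnW jJ); have hj := Zs j jJ.
pose s := 1 + j%:R * tau; pose s' := 1 + j.+1%:R * tau.
have jt : 0 <= j%:R * tau by rewrite mulr_ge0 // ltW.
have ss' : s' = s + tau by rewrite /s /s' -natr1; ring.
have s1 : 1 <= s by rewrite /s; lra.
have s0 : 0 < s by lra.
have s'0 : 0 < s' by rewrite ss'; lra.
rewrite leNgt; apply/negP => bad; rewrite -/s' in bad; rewrite -/s in IH.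
have step : s `^ (- g) - s' `^ (- g) <= D * tau * s' `^ (- g - 1).
  pose t := tau / s; have t01 : 0 <= t <= 1.
    by rewrite /t divr_ge0 ?(ltW t0) ?(ltW s0) //= ler_pdivrMr //; lra.
  have s'E : s' = s * (1 + t) by rewrite ss' /t; field; rewrite gt_eqF.
  have t10 : 0 < 1 + t by case/andP: t01; lra.
  have e1 : s `^ (- g) = s' `^ (- g) * (1 + t) `^ g.
    rewrite s'E (powRM _ (ltW s0) (ltW t10)) -mulrA -powRD ?addNr ?powRr0 ?mulr1 //.
    by apply/implyP => _; rewrite gt_eqF.
  (* The exponent g may be below 1, where [pow1D_le] does not apply; it is first raised to g + 1. *)
  have e2 : (1 + t) `^ g <= 1 + (g + 1) * 2 `^ g * t.
    have g1 : 1 <= g + 1 by lra.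
    have := pow1D_le g1 t01; rewrite addrK => h; apply: le_trans h.
    by apply: ler_powR; case/andP: t01; lra.
  have e3 : s' `^ (- g - 1) = s' `^ (- g) / s'.
    rewrite powRD; last by apply/implyP => _; rewrite gt_eqF.
    by rewrite powR_inv1 // ltW.
  have e4 : t <= 2 * (tau / s').
    rewrite /t mulrA ler_pdivrMr // mulrAC ler_pdivlMr // [2 * _]mulrC -mulrA.
    by rewrite ler_wpM2l ?(ltW t0) // ss'; lra.
  rewrite e1 e3; have e5 : 2 `^ (g + 1) = 2 * 2 `^ g :> R.
    by rewrite powR_addp // ?powRr1 // mulrC.
  have q0 := powR_gt0 (- g) s'0; have q1 : 0 < 2 `^ g :> R by exact: powR_gt0.
  have h1 : (g + 1) * 2 `^ g * t <= (g + 1) * 2 `^ g * (2 * (tau / s')).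
    by rewrite ler_wpM2l // mulr_ge0 ?(ltW q1) //; lra.
  rewrite /D e5; have := ler_wpM2l (ltW q0) (le_trans e2 (lerD (lexx 1) h1)).
  move: (s' `^ (- g)) (2 `^ g) => X Y h.
  rewrite (_ : (g + 1) * (2 * Y) * tau * (X / s') = X * ((g + 1) * Y * (2 * (tau / s')))); last by ring.
  by move: h; rewrite mulrDr mulr1; lra.
pose B := K * s' `^ (- g).
have B0 : 0 < B by rewrite /B mulr_gt0 // powR_gt0.
have e6 : D * K * tau * s' `^ (- g - 1) <= c * tau * B `^ (1 + th).
  have -> : B `^ (1 + th) = K `^ (1 + th) * s' `^ (- g - 1).
    rewrite /B powRM ?(ltW K0) ?powR_ge0 // -powRrM; congr (_ * _ `^ _).
    by rewrite /g; field; rewrite gt_eqF.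
  rewrite (powR_addp (ltW K0) ltr01 (ltW th0)) powRr1 ?(ltW K0) //.
  rewrite (_ : c * tau * _ = c * K `^ th * (K * tau * s' `^ (- g - 1))); last by ring.
  rewrite (_ : D * K * _ * _ = D * (K * tau * s' `^ (- g - 1))); last by ring.
  by rewrite ler_wpM2r // !mulr_ge0 ?powR_ge0 ?(ltW K0) ?(ltW t0).
have e7 : B `^ (1 + th) <= Z j.+1 `^ (1 + th).
  by apply: powR_le; [lra|exact: ltW|exact: ltW].
have e8 := ler_wpM2l (mulr_ge0 (ltW c0) (ltW t0)) e7.
have e9 := ler_wpM2l (ltW K0) step.
move: bad; rewrite -/B => bad; rewrite /B in bad.
move: e6 e8 e9; rewrite !mulrBr => e6 e8 e9.
have : Z j.+1 <= K * s' `^ (- g); last by rewrite leNgt bad.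
rewrite (_ : K * (D * tau * s' `^ (- g - 1)) = D * K * tau * s' `^ (- g - 1)) in e9; last by ring.
by lra.
Qed.

End decay.

(** * The scheme and its first properties *)

Section scheme.
Context {R : realType} {n P : nat} (n0 : (0 < n)%N).
Notation G := {ffun 'I_n -> 'I_P.+2}.
Implicit Types (u v : G -> R) (x y : G).
Local Notation a := (2 / n%:R : R).

(** The cut at 0 keeps the rate nonnegative before q <= M0 is known. *)
Definition reaction_rate (chi M0 q : R) : R := chi * Num.max (M0 - q) 0.

Lemma reaction_rate_ge0 (chi M0 q : R) : 0 <= chi -> 0 <= reaction_rate chi M0 q.
Proof. by move=> chi0; rewrite mulr_ge0 // le_max lexx orbT. Qed.

(* With mesh size h in space and h ^+ 2 in time, [V j] is the density at time
   [j * h ^+ 2], [U j] the density after the implicit diffusion step, and [q j]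
   the initial mass increased by the mass produced so far: it exceeds the actual
   mass by what has been lost through the wall. *)
Definition scheme (m chi M0 m0 h : R) (U V : nat -> G -> R) (q : nat -> R) :=
  [/\ q 0%N = m0,
      forall j, diffusion_step m 1 (V j) (U j) /\
        forall K, (forall x, V j x <= K) -> forall x, U j x <= K,
      forall j x, V j.+1 x = U j x +
        h ^+ 2 * reaction_rate chi M0 (q j) * U j x `^ (m + a) &
      forall j, q j.+1 = q j +
        h ^+ 2 * reaction_rate chi M0 (q j) * (h ^+ n * \sum_(x : G) U j x `^ (m + a))].

Definition admissible (m chi M0 m0 A : R) :=
  [/\ 1 < m, 0 < chi, 0 < M0, 0 <= m0 <= M0 & 0 <= A].

(** Only an upper bound for the mass: the averages of the datum lose what lies outside the box or in
    wall cells. *)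
Definition initial (A m0 h : R) v :=
  [/\ forall x, 0 <= v x <= A, forall x, wall x -> v x = 0 &
      h ^+ n * \sum_(x : G) v x <= m0].

Lemma scheme_exists (m chi M0 m0 h : R) v : 1 < m -> 0 <= chi ->
  (forall x, 0 <= v x) -> (forall x, wall x -> v x = 0) ->
  exists U V q, scheme m chi M0 m0 h U V q /\ V 0%N = v.
Proof.
move=> m1 chi0 v0 vw.
have a0 : 0 < a by rewrite divr_gt0 // ltr0n.
have H (w : G -> R) : exists u : G -> R, (forall x, 0 <= w x) -> (forall x, wall x -> w x = 0) ->
    diffusion_step m 1 w u /\ forall K : R, (forall x, w x <= K) -> forall x, u x <= K.
  have [w0|nw0] := pselect (forall x, 0 <= w x); last by exists w.
  have [ww|nww] := pselect (forall x, wall x -> w x = 0); last by exists w.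
  (* Solving with the maximum of w as bound gives the bound by any other K' above w. *)
  pose K : R := \big[Num.max/w 0]_x w x.
  have wK x : 0 <= w x <= K by rewrite w0 /K; apply: le_bigmax.
  have [u [uK uw ue]] := resolvent_exists m1 ler01 wK ww.
  exists u => _ _; split; first by split => // x; have /andP[] := uK x.
  move=> K' wK' x; have /andP[_ h1] := uK x; apply: (le_trans h1).
  by apply/bigmax_leP; split.
have [F HF] := choice H.
pose step (s : (G -> R) * R) : (G -> R) * R :=
  let u := F s.1 in let r := h ^+ 2 * reaction_rate chi M0 s.2 in
  ((fun x => u x + r * u x `^ (m + a)), s.2 + r * (h ^+ n * \sum_(x : G) u x `^ (m + a))).
pose st j := iter j step (v, m0).
have st0 j : (forall x, 0 <= (st j).1 x) /\ (forall x, wall x -> (st j).1 x = 0).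
  elim: j => [|j [IH1 IH2]] //=; have [[u0 uw ue] _] := HF _ IH1 IH2; split=> x.
    have r0 := reaction_rate_ge0 M0 (st j).2 chi0; have := u0 x; nneg.
  by move=> xw; rewrite uw // powR0 ?mulr0 ?addr0 // gt_eqF //; lra.
exists (fun j => F (st j).1), (fun j => (st j).1), (fun j => (st j).2).
split=> //; split=> // j.
by have [h1 h2] := st0 j; apply: HF.
Qed.

Section estimates.
Variables (m chi M0 m0 A h K : R) (U V : nat -> G -> R) (q : nat -> R) (J : nat).
Local Notation mass v := (h ^+ n * \sum_(x : G) v x).
Local Notation kap j := (reaction_rate chi M0 (q j)).
Local Notation alpha := (m + a).

(* All hypotheses under which the first J steps are controlled; the bound K does
   not enter the constants of the estimates below. *)
Definition controlled :=
  [/\ admissible m chi M0 m0 A, 0 < h, scheme m chi M0 m0 h U V q,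
      initial A m0 h (V 0%N) &
      h ^+ 2 * chi * M0 * K `^ (alpha - 1) <= 1 /\
      forall j x, (j <= J)%N -> V j x <= K].

Hypothesis ctr : controlled.

Let m1 : 1 < m. Proof. by have [[]] := ctr. Qed.
Let chi0 : 0 < chi. Proof. by have [[]] := ctr. Qed.
Let M00 : 0 < M0. Proof. by have [[]] := ctr. Qed.
Let h0 : 0 < h. Proof. by have [] := ctr. Qed.
Let hn0 : 0 < h ^+ n. Proof. by rewrite exprn_gt0. Qed.
Let a0 : 0 < a. Proof. by rewrite divr_gt0 // ltr0n. Qed.
Let al1 : 1 < alpha. Proof. by move: m1 a0; lra. Qed.
Let sch : scheme m chi M0 m0 h U V q. Proof. by have [] := ctr. Qed.

Lemma kap_ge0 j : 0 <= kap j.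
Proof. exact/reaction_rate_ge0/ltW. Qed.

Lemma U_ge0 j x : 0 <= U j x.
Proof. by have [_ /(_ j)[[]]] := sch. Qed.

Lemma U_wall j x : wall x -> U j x = 0.
Proof. by have [_ /(_ j)[[_ H _] _] _ _] := sch; exact: H. Qed.

Lemma V_ge0 j x : 0 <= V j x.
Proof.
case: j => [|j]; first by have [_ _ _ [/(_ x)/andP[]]] := ctr.
have [_ _ -> _] := sch; have u0 := U_ge0 j x; have k0 := kap_ge0 j; nneg.
Qed.

Lemma V_wall j x : wall x -> V j x = 0.
Proof.
case: j => [|j] xw; first by have [_ _ _ [_ ->]] := ctr.
have [_ _ -> _] := sch; rewrite U_wall // powR0 ?mulr0 ?addr0 // gt_eqF //.
by move: al1; lra.
Qed.

Lemma step_ok j : diffusion_step m 1 (V j) (U j).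
Proof. by have [_ /(_ j)[]] := sch. Qed.

Lemma U_leV j B : (forall x, V j x <= B) -> forall x, U j x <= B.
Proof. by have [_ /(_ j)[_ H] _ _] := sch; exact: H. Qed.

Lemma U_leV_next j x : U j x <= V j.+1 x.
Proof.
have [_ _ -> _] := sch; rewrite lerDl; have k0 := kap_ge0 j; nneg.
Qed.

Lemma q_mono j : q j <= q j.+1.
Proof.
have [_ _ _ ->] := sch; rewrite lerDl; have k0 := kap_ge0 j.
by have := ltW h0; nneg; apply: sumr_ge0 => x _; exact: powR_ge0.
Qed.

Lemma mass_U_leV j : mass (U j) <= mass (V j).
Proof.
by rewrite ler_pM2l //; apply: (step_mass_le m1 ler01 (step_ok j)) => x; exact: V_wall.
Qed.

Lemma mass_V_next j : mass (V j.+1) = mass (U j) + (q j.+1 - q j).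
Proof.
have [_ _ HV Hq] := sch; rewrite Hq; under eq_bigr do rewrite HV.
by rewrite big_split /= -mulr_sumr; ring.
Qed.

Lemma q_ge0 j : 0 <= q j.
Proof.
elim: j => [|j IH]; last exact: le_trans (q_mono j).
by have [-> _ _ _] := sch; have [[_ _ _ /andP[]]] := ctr.
Qed.

Lemma mass_le_q j : mass (V j) <= q j.
Proof.
elim: j => [|j IH].
  by have [-> _ _ _] := sch; have [_ _ _ []] := ctr.
rewrite mass_V_next; have := mass_U_leV j; lra.
Qed.

Lemma K_ge0 : 0 <= K.
Proof.
have [_ _ _ _ [_ /(_ 0%N 0 isT)]] := ctr; apply: le_trans; exact: V_ge0.
Qed.

Lemma U_leK j x : (j <= J)%N -> U j x <= K.
Proof.
by move=> jJ; apply: U_leV => y; have [_ _ _ _ [_ H]] := ctr; exact: H.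
Qed.

Lemma kap_le j : kap j <= chi * M0.
Proof.
rewrite ler_pM2l // ge_max (ltW M00) andbT gerBl; exact: q_ge0.
Qed.

Lemma growth_le1 j x : (j <= J)%N -> 0 <= h ^+ 2 * kap j * U j x `^ (alpha - 1) <= 1.
Proof.
move=> jJ; have k0 := kap_ge0 j; apply/andP; split; first by nneg.
have [_ _ _ _ [H _]] := ctr; apply: le_trans H.
rewrite -[X in _ <= X * _]mulrA; apply: ler_pM; [by nneg|by nneg| |].
  by rewrite ler_wpM2l ?sqr_ge0 ?kap_le.
by apply: powR_le; rewrite ?U_ge0 ?U_leK //; move: al1; lra.
Qed.

Lemma V_nextE j x : V j.+1 x = U j x * (1 + h ^+ 2 * kap j * U j x `^ (alpha - 1)).
Proof.
have [_ _ -> _] := sch.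
rewrite -(@powRM1 _ (U j x) alpha) ?U_ge0 //; last by move: al1; lra.
by ring.
Qed.

(** The deficit M0 - q is multiplied by 1 - h^2 chi E, where E is the discrete integral of U^alpha,
    at most M0 K^(alpha-1) because the mass is at most q; the step size condition in [controlled]
    keeps this factor nonnegative. *)
Lemma q_leM0 j : (j <= J.+1)%N -> q j <= M0.
Proof.
elim: j => [|j IH] jJ.
  by have [-> _ _ _] := sch; have [[_ _ _ /andP[]]] := ctr.
have qj := IH (ltnW jJ); have [_ _ _ ->] := sch.
have -> : kap j = chi * (M0 - q j) by rewrite /reaction_rate max_l ?subr_ge0.
suff : h ^+ 2 * chi * mass (fun x => U j x `^ alpha) <= 1.
  move: qj; rewrite -subr_ge0 => qj h1; have := ler_wpM2l qj h1.
  set E := h ^+ n * _; rewrite mulr1.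
  rewrite (_ : (M0 - q j) * (h ^+ 2 * chi * E) = h ^+ 2 * (chi * (M0 - q j)) * E); last by ring.
  by lra.
have [_ _ _ _ [H _]] := ctr; apply: le_trans H.
rewrite -[leRHS]mulrA; apply: ler_wpM2l; first by have := ltW chi0; nneg.
apply: (@le_trans _ _ (mass (U j) * K `^ (alpha - 1))).
  rewrite -mulrA ler_pM2l // mulr_suml; apply: ler_sum => x _.
  rewrite -(@powRM1 _ (U j x) alpha) ?U_ge0 //; last by move: al1; lra.
  rewrite mulrC ler_wpM2l ?U_ge0 // powR_le ?U_ge0 ?U_leK //.
  by move: al1; lra.
rewrite ler_wpM2r ?powR_ge0 // (le_trans (mass_U_leV j)) // (le_trans (mass_le_q j)) //.
Qed.

End estimates.

End scheme.

(** * Bounds and decay of the L^k norms *)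

Section power_estimates.
Context {R : realType} {n : nat} (n0 : (0 < n)%N).
Local Notation a := (2 / n%:R : R).
Implicit Types (m chi A h K k : R) (P J j : nat) (q : nat -> R).

(** The explicit reaction multiplies U by at most 2, so the growth of the k-th power is linear in
    the rate. By [reaction_le], half of the dissipation absorbs one part of this growth; the other
    part carries h^2 times the rate times the integral of U^alpha, which is exactly the increment of
    q. *)
Lemma power_step m chi (M0 : R) k : 1 < m -> 0 < chi -> 0 < M0 -> 1 < k ->
  exists C c : R, [/\ 0 < C, 0 < c &
    forall P (m0 : R) A h K (U V : nat -> {ffun 'I_n -> 'I_P.+2} -> R) q J,
    controlled m chi M0 m0 A h K U V q J -> forall j, (j <= J)%N ->
    [/\ h ^+ n * \sum_x V j.+1 x `^ k
          + c * (h ^+ n * dform (pw ((k + m - 1) / 2) (U j)) (pw ((k + m - 1) / 2) (U j)))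
        <= (1 + C * (q j.+1 - q j)) * (h ^+ n * \sum_x V j x `^ k),
        h ^+ n * \sum_x V j.+1 x `^ k <= 2 `^ k * (h ^+ n * \sum_x U j x `^ k) &
        h ^+ n * \sum_x U j x `^ k <= h ^+ n * \sum_x V j x `^ k]].
Proof.
move=> m1 chi0 M00 k1.
have ck0 := cross_const_gt0 m1 k1; set ck := cross_const m k in ck0.
pose b : R := k * 2 `^ (k - 1).
have b0 : 0 < b by rewrite /b mulr_gt0 ?powR_gt0 //; lra.
(* With this choice b chi M0 eps is half of k ck, the coefficient of the dissipation. *)
pose eps : R := k * ck / 2 / (b * (chi * M0)).
have bcm : 0 < b * (chi * M0) by gt0.
have k0 : 0 < k by lra.
have eps0 : 0 < eps by rewrite /eps; gt0.
have [C C0 HC] := reaction_le n0 m1 k1 eps0.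
exists (b * C), (k * ck / 2); split; [by gt0|by gt0|].
move=> P m0 A h K U V q J ctr j jJ.
have h0 : 0 < h by have [] := ctr.
have hn0 : 0 < h ^+ n by rewrite exprn_gt0.
have h20 : 0 < h ^+ 2 by rewrite exprn_gt0.
have Uge x : 0 <= U j x := U_ge0 ctr j x.
have Uw x : wall x -> U j x = 0 by exact: (U_wall ctr).
set f := pw _ (U j); set r := reaction_rate chi M0 (q j).
have r0 : 0 <= r by exact: (kap_ge0 ctr j).
have rM : r <= chi * M0 by exact: (kap_le ctr j).
have gr x : 0 <= h ^+ 2 * r * U j x `^ (m + a - 1) <= 1 by exact: (growth_le1 n0 ctr).
have D0 : 0 <= dform f f := dform_ge0 f.
have dif := step_power m1 ler01 k1 (step_ok ctr j) (V_wall n0 ctr j) (V_ge0 ctr j).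
rewrite mulr1 -/f -/ck in dif.
have Vk x : V j.+1 x `^ k = U j x `^ k * (1 + h ^+ 2 * r * U j x `^ (m + a - 1)) `^ k.
  by rewrite (V_nextE n0 ctr) powRM //; have /andP[] := gr x; rewrite -/r; lra.
have qE : q j.+1 - q j = h ^+ 2 * r * (h ^+ n * \sum_x U j x `^ (m + a)).
  by have [_ _ [_ _ _ ->] _ _] := ctr; rewrite -/r; ring.
have UV : h ^+ n * \sum_x U j x `^ k <= h ^+ n * \sum_x V j x `^ k.
  rewrite ler_pM2l //; apply: le_trans dif; rewrite lerDl; nneg.
split=> //; last first.
  rewrite mulrCA ler_pM2l // mulr_sumr; apply: ler_sum => x _; rewrite Vk mulrC.
  rewrite ler_wpM2r ?powR_ge0 //; apply: powR_le; [lra| |];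
    by have /andP[] := gr x; lra.
have Vsum : \sum_x V j.+1 x `^ k <=
    \sum_x U j x `^ k + b * (h ^+ 2 * r) * \sum_x U j x `^ (k + (m + a) - 1).
  rewrite mulr_sumr -big_split /=; apply: ler_sum => x _; rewrite Vk.
  have := pow1D_le (ltW k1) (gr x) => h1.
  apply: (le_trans (ler_wpM2l (powR_ge0 _ _) h1)).
  have -> : k + (m + a) - 1 = k + (m + a - 1) by ring.
  have a0 : 0 < a by rewrite divr_gt0 // ltr0n.
  have am : 0 <= m + a - 1 by lra.
  rewrite (powR_addp (Uge x) k0 am) -/b; move: (U j x `^ _) (U j x `^ _) => X Z.
  by apply: le_of_eq; ring.
have := HC P h (U j) h0 Uge Uw; rewrite -/f.
set E := h ^+ n * _; set S := \sum_x U j x `^ (_ - 1).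
set Y := \sum_x U j x `^ k; set D := dform f f => HR.
rewrite -/S -/Y in Vsum; rewrite -/Y -/D in dif; rewrite -/E in qE.
have Y0 : 0 <= Y by apply: sumr_ge0 => x _; exact: powR_ge0.
have E0 : 0 <= E.
  by rewrite mulr_ge0 ?(ltW hn0) // sumr_ge0 // => x _; exact: powR_ge0.
have brh : 0 <= b * (h ^+ 2 * r) by nneg.
have H1 := ler_wpM2l brh HR.
have H2 : b * (h ^+ 2 * r) * (eps / h ^+ 2 * D) <= k * ck / 2 * D.
  rewrite (_ : b * (h ^+ 2 * r) * (eps / h ^+ 2 * D) = eps * b * r * D); last first.
    by field; rewrite gt_eqF.
  rewrite ler_wpM2r //.
  have -> : k * ck / 2 = eps * b * (chi * M0) by rewrite /eps; field; rewrite !gt_eqF.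
  by rewrite ler_wpM2l //; nneg.
rewrite mulrDr in H1.
have H3 : \sum_x V j.+1 x `^ k + k * ck / 2 * D <=
    (1 + b * C * (q j.+1 - q j)) * \sum_x V j x `^ k.
  have VY : Y <= \sum_x V j x `^ k by rewrite -(ler_pM2l hn0).
  have H4 : b * (h ^+ 2 * r) * (C * E * Y) <= b * C * (q j.+1 - q j) * \sum_x V j x `^ k.
    rewrite qE (_ : b * (h ^+ 2 * r) * (C * E * Y) = b * C * (h ^+ 2 * r * E) * Y); last by ring.
    by rewrite ler_wpM2l //; nneg.
  move: dif Vsum H1 H2 H4; rewrite mulrDl mul1r.
  move: (b * C * _ * _) (b * _ * _) (b * (h ^+ 2 * r) * _) => X1 X2 X3.
  by lra.
have := ler_wpM2l (ltW hn0) H3; rewrite mulrDr !mulrA => H5; apply: le_trans (le_trans _ H5) _.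
  by apply: le_of_eq; ring.
by apply: le_of_eq; ring.
Qed.

Lemma initial_power m chi (M0 m0 : R) A h K P
    (U V : nat -> {ffun 'I_n -> 'I_P.+2} -> R) q J k : 1 < k ->
  controlled m chi M0 m0 A h K U V q J ->
  h ^+ n * \sum_x V 0%N x `^ k <= A `^ (k - 1) * m0.
Proof.
move=> k1 ctr; have [_ h0 _ [VA _ Vm] _] := ctr.
apply: (@le_trans _ _ (A `^ (k - 1) * (h ^+ n * \sum_x V 0%N x))); last first.
  by rewrite ler_wpM2l ?powR_ge0.
rewrite mulrCA ler_pM2l ?exprn_gt0 // mulr_sumr; apply: ler_sum => x _.
have /andP[v0 vA] := VA x; rewrite -(@powRM1 _ (V 0%N x) k) //; last lra.
by rewrite ler_wpM2r // powR_le //; lra.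
Qed.

(** Gronwall's lemma in the variable q: the growth factors multiply to at most exp (C M0) whatever
    the number of steps, and the dissipation is then summed by telescoping. *)
Lemma power_bound m chi (M0 m0 : R) A k : admissible m chi M0 m0 A -> 1 < k ->
  exists Y D : R, [/\ 0 < Y, 0 < D &
    forall P h K (U V : nat -> {ffun 'I_n -> 'I_P.+2} -> R) q J,
    controlled m chi M0 m0 A h K U V q J ->
    (forall j, (j <= J.+1)%N -> h ^+ n * \sum_x V j x `^ k <= Y) /\
    \sum_(j < J.+1) h ^+ n * dform (pw ((k + m - 1) / 2) (U j)) (pw ((k + m - 1) / 2) (U j))
    <= D].
Proof.
move=> [m1 chi0 M00 m0M A0] k1.
have [C [c [C0 c0 H]]] := power_step m1 chi0 M00 k1.
(* The added 1 keeps the bound positive when A or m0 is 0. *)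
pose Y0 := A `^ (k - 1) * m0 + 1; pose Y := Y0 * expR (C * M0).
have Y00 : 0 < Y0.
  by rewrite /Y0 ltr_wpDl // mulr_ge0 ?powR_ge0 //; case/andP: m0M.
have Y1 : 0 < Y by rewrite mulr_gt0 // expR_gt0.
exists Y, (c^-1 * (Y + C * Y * M0)); split=> //.
  by gt0.
move=> P h K U V q J ctr.
have h0 : 0 < h by have [] := ctr.
have hn0 : 0 < h ^+ n by rewrite exprn_gt0.
pose y j := h ^+ n * \sum_x V j x `^ k.
have y0 j : 0 <= y j.
  by rewrite mulr_ge0 ?(ltW hn0) // sumr_ge0 // => x _; exact: powR_ge0.
have q0 : 0 <= q 0%N by exact: (q_ge0 ctr 0%N).
have yE j : (j <= J.+1)%N -> y j <= Y0 * expR (C * (q j - q 0%N)).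
  elim: j => [_|j IH jJ].
    rewrite subrr mulr0 expR0 mulr1 /Y0; have := initial_power k1 ctr; rewrite -/(y _); lra.
  have [h1 _ _] := H _ _ _ _ _ _ _ _ _ ctr j jJ.
  have D0 := dform_ge0 (pw ((k + m - 1) / 2) (U j)).
  have dq : 0 <= C * (q j.+1 - q j).
    by rewrite mulr_ge0 ?(ltW C0) // subr_ge0; exact: (q_mono ctr).
  apply: (@le_trans _ _ ((1 + C * (q j.+1 - q j)) * y j)).
    by apply: le_trans h1; rewrite lerDl; nneg.
  apply: (@le_trans _ _ (expR (C * (q j.+1 - q j)) * (Y0 * expR (C * (q j - q 0%N))))).
    apply: ler_pM => //; [lra|exact: expR_ge1Dx|exact: IH (ltnW jJ)].
  rewrite mulrCA -expRD; apply: le_of_eq; congr (_ * expR _); ring.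
have yY j : (j <= J.+1)%N -> y j <= Y.
  move=> jJ; apply: (le_trans (yE j jJ)); rewrite ler_pM2l // ler_expR ler_pM2l //.
  have := q_leM0 n0 ctr jJ; lra.
split=> //.
rewrite -(ler_pM2l c0) mulrA divff ?gt_eqF // mul1r mulr_sumr.
apply: (@le_trans _ _ (\sum_(j < J.+1) ((y j - y j.+1) + C * Y * (q j.+1 - q j)))).
  apply: ler_sum => j _; have jJ : (j <= J)%N by rewrite -ltnS.
  have [h1 _ _] := H _ _ _ _ _ _ _ _ _ ctr j jJ.
  have h2 : C * (q j.+1 - q j) * y j <= C * (q j.+1 - q j) * Y.
    rewrite ler_wpM2l ?yY ?mulr_ge0 ?(ltW C0) ?subr_ge0 ?(q_mono ctr) //.
    exact: leqW.
  have h3 : y j.+1 + c * _ <= (1 + C * (q j.+1 - q j)) * y j := h1.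
  rewrite [(1 + _) * _]mulrDl mul1r in h3; lra.
rewrite big_split /= -mulr_sumr.
rewrite -(big_mkord xpredT (fun j => y j - y j.+1)) -(big_mkord xpredT (fun j => q j.+1 - q j)).
rewrite telescope_sumr // -[X in X + _]opprK -sumrN.
under eq_bigr do rewrite opprB; rewrite telescope_sumr // opprB.
apply: lerD; first by have := y0 J.+1; have := yY 0%N isT; lra.
have qM := q_leM0 n0 ctr (leqnn J.+1).
by apply: ler_wpM2l; [nneg|lra].
Qed.

(** The weight exp (- C (q - q 0)) makes the recursion decreasing, with the dissipation bounded
    below by the Nash inequality for U; the factor 2^k lost in passing from U to the next V is
    absorbed in [c4]. [decay_iter] then applies with tau = h^2. *)
Lemma power_decay m chi (M0 m0 : R) A k : admissible m chi M0 m0 A -> 1 < k ->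
  exists2 C : R, 0 < C &
    forall P h K (U V : nat -> {ffun 'I_n -> 'I_P.+2} -> R) q J,
    controlled m chi M0 m0 A h K U V q J -> h <= 1 ->
    forall j, (j <= J.+1)%N -> h ^+ n * \sum_x V j x `^ k <=
      C * (1 + j%:R * h ^+ 2) `^ (- ((k - 1) / (m + a - 1))).
Proof.
move=> [m1 chi0 M00 m0M A0] k1.
have a0 : 0 < a by rewrite divr_gt0 // ltr0n.
have [C [c [C0 c0 H]]] := power_step m1 chi0 M00 k1.
have [C3 C30 HE] := energy_lower_bound n0 m1 k1 M00.
pose th := (m - 1 + a) / (k - 1).
have th0 : 0 < th by rewrite divr_gt0 //; lra.
pose Zm := A `^ (k - 1) * m0.
have Zm0 : 0 <= Zm by rewrite mulr_ge0 ?powR_ge0 //; case/andP: m0M.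
pose c4 := c * expR (- (C * M0)) / C3 * (2 `^ k) `^ (- (1 + th)).
have c40 : 0 < c4 by rewrite /c4; gt0; exact: expR_gt0.
have [Kc Kc0 HK] := decay_iter c40 th0 Zm0.
exists (Kc * expR (C * M0)); first by rewrite mulr_gt0 // expR_gt0.
move=> P h K U V q J ctr h1 j jJ.
have h0 : 0 < h by have [] := ctr.
have hn0 : 0 < h ^+ n by rewrite exprn_gt0.
pose y j := h ^+ n * \sum_x V j x `^ k.
have y0 i : 0 <= y i.
  by rewrite mulr_ge0 ?(ltW hn0) // sumr_ge0 // => x _; exact: powR_ge0.
have q0 : 0 <= q 0%N by exact: (q_ge0 ctr 0%N).
pose Z i := y i * expR (- (C * (q i - q 0%N))).
have Z0 i : 0 <= Z i by rewrite mulr_ge0 // expR_ge0.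
have qm i : 0 <= q i - q 0%N.
  elim: i => [|i IH]; first by rewrite subrr.
  have := q_mono ctr i; lra.
have -> : - ((k - 1) / (m + a - 1)) = - th^-1.
  by rewrite /th invf_div; congr (- (_ / _)); ring.
have yZ : y j <= expR (C * M0) * Z j.
  rewrite /Z mulrCA -expRD ler_peMr // -expR0 ler_expR.
  rewrite subr_ge0 ler_pM2l //; have := q_leM0 n0 ctr jJ; have := q0; lra.
apply: (le_trans yZ); rewrite (mulrC Kc) -mulrA ler_pM2l ?expR_gt0 //.
apply: (HK (h ^+ 2) J.+1 Z) => //.
- by rewrite exprn_gt0 //= exprn_ile1 // ltW.
- by rewrite /Z subrr mulr0 oppr0 expR0 mulr1; exact: initial_power ctr.
move=> i iJ; have [e1 e2 e3] := H _ _ _ _ _ _ _ _ _ ctr i iJ.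
set D := h ^+ n * dform _ _ in e1.
have {}e1 : y i.+1 + c * D <= (1 + C * (q i.+1 - q i)) * y i := e1.
set yU := h ^+ n * \sum_x U i x `^ k in e2.
have {}e2 : y i.+1 <= 2 `^ k * yU := e2.
have D0 : 0 <= D by rewrite mulr_ge0 ?dform_ge0 // ltW.
have lower : yU `^ (1 + th) <= C3 * (D / h ^+ 2).
  have := HE P h (U i) h0 (U_ge0 ctr i) (fun x => @U_wall _ _ _ _ _ _ _ _ _ _ _ _ _ _ ctr i x).
  rewrite -/th -/yU; move=> /(_ _)/le_trans; apply.
    apply: (le_trans (mass_U_leV n0 ctr i)); apply: (le_trans (mass_le_q n0 ctr i)).
    exact: (q_leM0 n0 ctr (leqW iJ)).
  by apply: le_of_eq; rewrite /D; ring.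
have Zi : Z i.+1 <= 2 `^ k * yU.
  apply: le_trans e2; rewrite /Z ler_piMr // -expR0 ler_expR oppr_le0.
  by rewrite mulr_ge0 // ltW.
have Zpow : (2 `^ k) `^ (- (1 + th)) * Z i.+1 `^ (1 + th) <= C3 * (D / h ^+ 2).
  apply: le_trans lower.
  have := powR_le (_ : 0 <= 1 + th) (Z0 i.+1) Zi; rewrite addr_ge0 ?(ltW th0) // => /(_ isT).
  rewrite powRM ?powR_ge0 //; last first.
    by rewrite mulr_ge0 ?(ltW hn0) // sumr_ge0 // => x _; exact: powR_ge0.
  by rewrite powRN ler_pdivrMl // !powR_gt0.
set e := expR (- (C * (q i.+1 - q 0%N))).
have e0 : 0 < e by exact: expR_gt0.
have eM : expR (- (C * M0)) <= e.
  rewrite ler_expR lerN2 ler_pM2l //; have := q_leM0 n0 ctr (_ : (i.+1 <= J.+1)%N).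
  by move=> /(_ iJ); lra.
have h20 : 0 < h ^+ 2 by rewrite exprn_gt0.
have f1 : c4 * h ^+ 2 * Z i.+1 `^ (1 + th) <= c * e * D.
  have ex0 : 0 <= expR (- (C * M0)) by exact: expR_ge0.
  have w0 : 0 <= c * expR (- (C * M0)) / C3 * h ^+ 2 by nneg.
  have f2 := ler_wpM2l w0 Zpow.
  apply: (@le_trans _ _ (c * expR (- (C * M0)) * D)); last first.
    by rewrite ler_wpM2r // ler_wpM2l // ltW.
  apply: le_trans (le_trans f2 _); apply: le_of_eq; first by rewrite /c4; ring.
  by field; rewrite !gt_eqF.
apply: (le_trans (lerD (lexx _) f1)); rewrite /Z -/e.
have f3 : (y i.+1 + c * D) * e <= y i * expR (- (C * (q i - q 0%N))).
  apply: (le_trans (ler_wpM2r (ltW e0) e1)).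
  rewrite mulrAC mulrC; apply: ler_wpM2l => //.
  apply: (@le_trans _ _ (expR (C * (q i.+1 - q i)) * e)).
    by rewrite ler_wpM2r ?(ltW e0) // expR_ge1Dx.
  by rewrite /e -expRD ler_expR; apply: le_of_eq; ring.
by apply: le_trans f3; apply: le_of_eq; ring.
Qed.

End power_estimates.

(** * Uniform bound by iteration over levels *)

Section sup_estimate.
Context {R : realType} {n : nat} (n0 : (0 < n)%N).
Local Notation a := (2 / n%:R : R).

Lemma le_split_pow (X s : R) : 0 <= X -> 0 < s -> X <= s + X ^+ n / s ^+ n.-1.
Proof.
move=> X0 s0; have [Xs|sX] := leP X s.
  by apply: (le_trans Xs); rewrite lerDl divr_ge0 ?exprn_ge0 // ltW.
have : X <= X ^+ n / s ^+ n.-1; last by move=> h; apply: (le_trans h); rewrite lerDr ltW.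
rewrite ler_pdivlMr ?exprn_gt0 // -[in leRHS](prednK n0) exprS ler_wpM2l //.
by rewrite lerXn2r ?nnegrE // ltW.
Qed.

Lemma sqrD_le (p r d : R) : 0 < d <= 1 ->
  (p + r) ^+ 2 <= (1 + d) * p ^+ 2 + 2 / d * r ^+ 2.
Proof.
move=> /andP[d0 d1]; rewrite -(ler_pM2l d0).
rewrite mulrDr (_ : d * (2 / d * r ^+ 2) = 2 * r ^+ 2); last by field; rewrite gt_eqF.
have h1 : 0 <= (d * p - r) ^+ 2 by exact: sqr_ge0.
have h2 : 0 <= (1 - d) * r ^+ 2 by rewrite mulr_ge0 ?sqr_ge0 //; lra.
have -> : d * (p + r) ^+ 2 = d * ((1 + d) * p ^+ 2) + 2 * r ^+ 2
   - (d * p - r) ^+ 2 - (1 - d) * r ^+ 2 by ring.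
lra.
Qed.

(** One De Giorgi step. If {V > l} has volume at most b at all times, Faber-Krahn makes each
    diffusion step contract the squared norm above l by 1 + 2 d, with d of order h^2 b^(-2/n), while
    the reaction costs a factor 1 + d and adds a constant F of order h^2 b^(2/n) b^(1-1/n). The
    equilibrium, of size F / d, has the superlinear order b^(1+3/n). *)
Lemma above_bound (m chi M0 m0 A Ys : R) : admissible m chi M0 m0 A -> 0 <= Ys ->
  exists2 B : R, 0 < B &
    forall P h K (U V : nat -> {ffun 'I_n -> 'I_P.+2} -> R) q J,
    controlled m chi M0 m0 A h K U V q J ->
    (forall j, (j <= J.+1)%N -> h ^+ n * \sum_x V j x `^ (2 * (m + a) * n%:R) <= Ys) ->
    forall l b : R, 1 <= l -> A <= l -> 0 <= b ->
    (forall j, (j <= J.+1)%N ->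
       h ^+ n * #|[set x : {ffun 'I_n -> 'I_P.+2} | l < V j x]|%:R <= b) ->
    forall j, (j <= J.+1)%N ->
      h ^+ n * \sum_x above l (V j) x ^+ 2 <= B * b `^ (1 + 3 / n%:R).
Proof.
move=> [m1 chi0 M00 m0M A0] Ys0.
have nR0 : 0 < n%:R :> R by rewrite ltr0n.
have n1 : 1 <= n%:R :> R by rewrite ler1n.
have a0 : 0 < a by rewrite divr_gt0.
pose B : R := 384 * n%:R ^+ 2 * 4 `^ (2 * a) * (chi * M0) ^+ 2 * (1 + Ys).
have Ys1 : 0 < 1 + Ys by lra.
exists B; first by rewrite /B; gt0.
move=> P h K U V q J ctr HY l b l1 Al b0 Hb.
have h0 : 0 < h by have [] := ctr.
have hn0 : 0 < h ^+ n by rewrite exprn_gt0.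
have h20 : 0 < h ^+ 2 by rewrite exprn_gt0.
have nn0 : n%:R != 0 :> R by rewrite gt_eqF.
have ab0 (v : {ffun 'I_n -> 'I_P.+2} -> R) x : 0 <= above l v x by rewrite /above le_max lexx orbT.
have abE (v : {ffun 'I_n -> 'I_P.+2} -> R) x : (0 < above l v x) = (l < v x).
  by rewrite /above lt_max ltxx orbF subr_gt0.
(* One lattice point already has volume h^n, so a smaller b means that nothing exceeds l; otherwise
   h^2 <= rho2, which gives d <= 1. *)
have [bh|hb] := ltP b (h ^+ n).
  move=> j jJ; rewrite big1 ?mulr0; first by rewrite /B; nneg.
  move=> x _; have [xl|] := leP (V j x) l; first by rewrite /above max_r ?expr0n // subr_le0.
  move=> lx; suff : h ^+ n <= b by rewrite leNgt bh.
  apply: le_trans (Hb j jJ); rewrite ler_pMr // ler1n; apply/card_gt0P.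
  by exists x; rewrite inE.
have bp : 0 < b by exact: lt_le_trans hb.
pose rho2 := (4 * b) `^ a; have rho0 : 0 < rho2 by rewrite /rho2; gt0.
have hrho : h ^+ 2 <= rho2.
  have -> : h ^+ 2 = (h ^+ n) `^ a.
    rewrite -!powR_mulrn ?ltW // -powRrM; congr (_ `^ _); field; exact: nn0.
  apply: powR_le; [exact: ltW|exact: ltW|lra].
pose d := h ^+ 2 / (8 * n%:R * rho2).
have nrho : 0 < 8 * n%:R * rho2 by gt0.
have d01 : 0 < d <= 1.
  rewrite /d divr_gt0 //= ler_pdivrMr // mul1r (le_trans hrho) // ler_peMl ?(ltW rho0) //.
  by have := n1; lra.
have [d0 d1] := andP d01.
(* This threshold balances the two parts of X <= s + X^n / s^(n-1) on a set of volume b; the n-th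
   power is the reason for the exponent 2 (m + a) n in the hypothesis. *)
pose s := b `^ (- n%:R^-1); have s0 : 0 < s by exact: powR_gt0.
pose bq := b `^ (1 - n%:R^-1).
have bq0 : 0 < bq by exact: powR_gt0.
have sb : s * b = bq.
  rewrite /bq powRD; last by apply/implyP => _; rewrite gt_eqF.
  by rewrite powRr1 ?(ltW bp) // mulrC.
have sn : (s ^+ n.-1)^-1 = bq.
  rewrite -powR_mulrn ?(ltW s0) // -powRN /s -powRrM; congr (_ `^ _).
  by rewrite -subn1 natrB //; field; exact: nn0.
pose F := 16 * n%:R * rho2 * h ^+ 2 * (chi * M0) ^+ 2 * (1 + Ys) * bq.
have F0 : 0 < F by rewrite /F; gt0.
suff main j : (j <= J.+1)%N -> h ^+ n * \sum_x above l (V j) x ^+ 2 <= 3 * F / d.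
  move=> j jJ; apply: (le_trans (main j jJ)); apply: le_of_eq.
  have -> : b `^ (1 + 3 / n%:R) = bq * b `^ (2 * a).
    rewrite /bq -powRD; last by apply/implyP => _; rewrite gt_eqF.
    by congr (_ `^ _); field; exact: nn0.
  have r2 : rho2 ^+ 2 = 4 `^ (2 * a) * b `^ (2 * a).
    by rewrite /rho2 powR_sqr powRM // ltW.
  transitivity (384 * n%:R ^+ 2 * rho2 ^+ 2 * (chi * M0) ^+ 2 * (1 + Ys) * bq).
    by rewrite /F /d; field; rewrite !gt_eqF.
  by rewrite r2 /B; ring.
elim: j => [_|j IH jJ].
  rewrite big1 ?mulr0; first by rewrite divr_ge0 // ?(ltW d0) // mulr_ge0 // ltW.
  move=> x _; have [_ _ _ [/(_ x)/andP[_ vA] _ _] _] := ctr.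
  by rewrite /above max_r ?expr0n // subr_le0 (le_trans vA).
have {IH}IH := IH (ltnW jJ).
set r := reaction_rate chi M0 (q j).
have r0 : 0 <= r by exact: (kap_ge0 ctr j).
have rM : r <= chi * M0 by exact: (kap_le ctr j).
have Uge x : 0 <= U j x := U_ge0 ctr j x.
pose YU := h ^+ n * \sum_x above l (U j) x ^+ 2.
have dif : (1 + 2 * d) * YU <= h ^+ n * \sum_x above l (V j) x ^+ 2.
  have := step_above m1 ler01 l1 (step_ok ctr j) (V_wall n0 ctr j); rewrite mulr1 => h1.
  rewrite /YU mulrCA ler_pM2l //; apply: le_trans h1; rewrite mulrDl mul1r lerD2l -mulrA ler_pM2l //.
  have b40 : 0 < 4 * b by gt0.
  have awall x : wall x -> above l (U j) x = 0.
    by move=> xw; rewrite /above (U_wall ctr) // max_r //; lra.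
  have supp : 4 * h ^+ n * #|[set x : {ffun 'I_n -> 'I_P.+2} | 0 < above l (U j) x]|%:R <= 4 * b.
    rewrite -mulrA ler_pM2l //; apply: le_trans (Hb j.+1 jJ); rewrite ler_pM2l // ler_nat.
    apply: subset_leq_card; apply/fintype.subsetP => x; rewrite !inE abE => lU.
    by apply: (lt_le_trans lU); exact: (U_leV_next ctr).
  have FK := faber_krahn_powR n0 h0 b40 awall (ab0 _) supp.
  have := ler_wpM2l (ltW d0) FK; rewrite -/rho2 mulrA.
  by rewrite (_ : d * (8 * n%:R * rho2 / h ^+ 2) = 1) ?mul1r // /d; field; rewrite !gt_eqF.
have YU0 : 0 <= YU.
  by rewrite mulr_ge0 ?(ltW hn0) // sumr_ge0 // => x _; exact: sqr_ge0.
pose X x := U j x `^ (2 * (m + a)).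
have X0 x : 0 <= X x by exact: powR_ge0.
have XE x : X x ^+ n = U j x `^ (2 * (m + a) * n%:R).
  by rewrite /X -powR_mulrn ?powR_ge0 // -powRrM.
have Xsum : h ^+ n * \sum_(x | l < V j.+1 x) X x <= bq * (1 + Ys).
  apply: (@le_trans _ _ (h ^+ n * \sum_(x | l < V j.+1 x) (s + X x ^+ n / s ^+ n.-1))).
    by rewrite ler_pM2l //; apply: ler_sum => x _; exact: le_split_pow.
  rewrite big_split /= mulrDr mulrDr mulr1; apply: lerD.
    rewrite sumr_const -mulr_natl mulrA -sb mulrC ler_pM2l //.
    by apply: le_trans (Hb j.+1 jJ); rewrite ler_pM2l // ler_nat cardsE.
  rewrite -mulr_suml sn mulrA mulrC ler_pM2l //; apply: le_trans (HY j.+1 jJ).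
  rewrite ler_pM2l // [leLHS]big_mkcond /=; apply: ler_sum => x _.
  case: ifP => _; last exact: powR_ge0.
  rewrite XE; apply: powR_le => //; last exact: (U_leV_next ctr).
  by rewrite !mulr_ge0 //; lra.
have next : h ^+ n * \sum_x above l (V j.+1) x ^+ 2 <= (1 + d) * YU + F.
  have key x : above l (V j.+1) x ^+ 2 <= (1 + d) * above l (U j) x ^+ 2 +
      (if l < V j.+1 x then 2 / d * (h ^+ 2 * (chi * M0)) ^+ 2 * X x else 0).
    have d1' : 0 <= (1 + d) * above l (U j) x ^+ 2 by rewrite mulr_ge0 ?sqr_ge0 //; lra.
    case: ifPn => [lV|]; last first.
      by rewrite -leNgt => Vl; rewrite /above [in leLHS]max_r ?expr0n /= ?subr_le0 // addr0.
    pose rr := h ^+ 2 * r * U j x `^ (m + a).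
    have rr0 : 0 <= rr by rewrite /rr; nneg.
    have VE : V j.+1 x = U j x + rr by have [_ _ [_ _ -> _] _ _] := ctr.
    have : above l (V j.+1) x <= above l (U j) x + rr.
      rewrite /above max_l ?subr_ge0 ?(ltW lV) // VE.
      have : U j x - l <= Num.max (U j x - l) 0 by rewrite le_max lexx.
      lra.
    move=> /(sqr_le (ab0 _ _)) h1; apply: (le_trans h1).
    apply: (le_trans (sqrD_le _ _ d01)); rewrite lerD2l -[leRHS]mulrA.
    apply: ler_wpM2l; first by rewrite divr_ge0 // ltW.
    rewrite /rr exprMn /X powR_sqr ler_wpM2r ?powR_ge0 //.
    by apply: sqr_le; [rewrite mulr_ge0 ?sqr_ge0|rewrite ler_pM2l].
  apply: (@le_trans _ _ (h ^+ n * \sum_x ((1 + d) * above l (U j) x ^+ 2 +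
      (if l < V j.+1 x then 2 / d * (h ^+ 2 * (chi * M0)) ^+ 2 * X x else 0)))).
    by rewrite ler_pM2l //; apply: ler_sum => x _; exact: key.
  rewrite big_split /= mulrDr -mulr_sumr mulrCA lerD2l -big_mkcond -mulr_sumr.
  rewrite mulrCA; have W0 : 0 <= 2 / d * (h ^+ 2 * (chi * M0)) ^+ 2.
    by rewrite mulr_ge0 ?sqr_ge0 // divr_ge0 // ltW.
  apply: (le_trans (ler_wpM2l W0 Xsum)); apply: le_of_eq.
  by rewrite /F /d; field; rewrite !gt_eqF.
apply: (le_trans next).
have dYU : (1 + 2 * d) * YU <= 3 * F / d by exact: le_trans IH.
have d2 : 0 < 1 + 2 * d by lra.
have YUle : YU <= 3 * F / d / (1 + 2 * d) by rewrite ler_pdivlMr // mulrC.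
apply: (@le_trans _ _ ((1 + d) * (3 * F / d / (1 + 2 * d)) + F)).
  by rewrite lerD2r ler_wpM2l //; lra.
(* Contraction by 1 + 2 d, expansion by 1 + d and the source F leave the bound 3 F / d invariant as
   soon as d <= 1. *)
rewrite -subr_ge0 (_ : 3 * F / d - _ = F * (2 * (1 - d)) / (1 + 2 * d)); last first.
  by field; rewrite !gt_eqF.
have d3 : 0 <= 1 - d by lra.
by apply: mulr_ge0; [nneg|rewrite invr_ge0 ltW].
Qed.

Lemma exp_small (M sg e : R) : 0 <= M -> 0 <= sg < 1 -> 0 < e ->
  exists i, M * sg ^+ i < e.
Proof.
move=> M0 /andP[s0 s1] e0; have H : (M * sg ^+ k @[k --> \oo] --> M * 0)%classic.
  by apply: cvgMr; apply: cvg_expr; rewrite ger0_norm.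
rewrite mulr0 in H; have /cvgrPdist_lt /(_ e e0) [i _ Hi] := H.
exists i; have := Hi i (leqnn i); rewrite sub0r normrN ger0_norm //.
by rewrite mulr_ge0 // exprn_ge0.
Qed.

(** De Giorgi's iteration over the levels l0 + d (1 - 2^-i). Chebyshev's inequality over the gaps
    costs a factor 4^i, which the superlinear power of the volume repays. A volume below h^n belongs
    to the empty set, so finitely many levels suffice on the lattice. The bound does not involve [K]
    and holds one step further than [controlled] assumes. *)
Lemma sup_bound (m chi M0 m0 A : R) : admissible m chi M0 m0 A ->
  exists C : R, [/\ 0 < C, A <= C &
    forall P h K (U V : nat -> {ffun 'I_n -> 'I_P.+2} -> R) q J,
    controlled m chi M0 m0 A h K U V q J ->
    forall j x, (j <= J.+1)%N -> V j x <= C].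
Proof.
move=> adm; have [m1 chi0 M00 m0M A0] := adm.
have nR0 : 0 < n%:R :> R by rewrite ltr0n.
have n1 : 1 <= n%:R :> R by rewrite ler1n.
have a0 : 0 < a by rewrite divr_gt0.
have k1 : 1 < 2 * (m + a) * n%:R.
  have ma : 1 < m + a by lra.
  have man : m + a <= (m + a) * n%:R by rewrite ler_peMr //; lra.
  rewrite -mulrA; lra.
have [Ys [D [Ys0 _ HYs]]] := power_bound n0 adm k1.
have [B B0 HB] := above_bound adm (ltW Ys0).
pose g : R := 3 / n%:R; have g0 : 0 < g by rewrite divr_gt0.
(* The ratio of successive volumes, with sg^g = 1/4 to match the squares of the gaps. *)
pose sg : R := 4 `^ (- g^-1).
have sg0 : 0 < sg by exact: powR_gt0.
have sg1 : sg < 1.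
  rewrite /sg powRN invf_lt1 ?powR_gt0 //.
  have := @gt0_ltr_powR R g^-1 _ 1 4; rewrite invr_gt0 powR1 => /(_ g0); apply.
  - by rewrite nnegrE.
  - by rewrite nnegrE.
  - by rewrite ltr1n.
have sgg : sg `^ g = 4^-1.
  by rewrite /sg -powRrM mulNr mulVf ?gt_eqF // powRN powRr1.
(* The total height is dictated by 4 B M0^g <= d^2 sg, the condition that carries the volume bound
   from one level to the next. *)
pose d := 1 + 4 * B * M0 `^ g / sg.
have w0 : 0 < 4 * B * M0 `^ g / sg by gt0.
have d1 : 1 <= d by rewrite /d; lra.
have d0 : 0 < d by lra.
have dd : 4 * B * M0 `^ g <= d ^+ 2 * sg.
  rewrite -ler_pdivrMr //; apply: (@le_trans _ _ d); first by rewrite /d; lra.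
  by rewrite expr2 ler_peMl // ltW.
(* Above A the truncated datum vanishes; above 1 [step_above] applies. *)
pose l0 := Num.max A 1.
have l01 : 1 <= l0 by rewrite le_max lexx orbT.
have l0A : A <= l0 by rewrite le_max lexx.
exists (l0 + d); split; [lra|lra|].
move=> P h K U V q J ctr.
have h0 : 0 < h by have [] := ctr.
have hn0 : 0 < h ^+ n by rewrite exprn_gt0.
have [HY _] := HYs _ _ _ _ _ _ _ ctr.
pose lev i : R := l0 + d * (1 - (2^-1 : R) ^+ i).
have half i : 0 <= (2^-1 : R) ^+ i <= 1.
  rewrite exprn_ge0 ?invr_ge0 //= exprn_ile1 ?invr_ge0 // invf_le1 //.
  by rewrite ler1n.
have lev0 i : l0 <= lev i.
  by rewrite lerDl mulr_ge0 ?(ltW d0) //; have /andP[] := half i; lra.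
have levd i : lev i <= l0 + d.
  by rewrite lerD2l ler_piMr ?(ltW d0) //; have /andP[] := half i; lra.
have main i : forall j, (j <= J.+1)%N ->
    h ^+ n * #|[set x : {ffun 'I_n -> 'I_P.+2} | lev i < V j x]|%:R <= M0 * sg ^+ i.
  elim: i => [|i IH] j jJ.
    rewrite expr0 mulr1.
    apply: (@le_trans _ _ (h ^+ n * \sum_x V j x)); last first.
      by apply: le_trans (mass_le_q n0 ctr j) _; exact: (q_leM0 n0 ctr jJ).
    rewrite ler_pM2l // -[X in X%:R]sum1_card natr_sum big_mkcond /=.
    apply: ler_sum => x _; rewrite inE; case: ifP => [|_]; last exact: (V_ge0 ctr).
    by move=> /ltW; apply: le_trans; apply: le_trans (lev0 _).
  have Mi : 0 <= M0 * sg ^+ i by rewrite mulr_ge0 ?exprn_ge0 // ltW.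
  have li1 : 1 <= lev i by exact: le_trans (lev0 i).
  have liA : A <= lev i by exact: le_trans (lev0 i).
  have := HB _ _ _ _ _ _ _ ctr HY (lev i) _ li1 liA Mi IH j jJ.
  have -> : (M0 * sg ^+ i) `^ (1 + 3 / n%:R) = M0 * sg ^+ i * (M0 `^ g * (4^-1) ^+ i).
    rewrite powR_addp // ?(ltW g0) // powRr1 // powRM ?exprn_ge0 ?(ltW M00) ?(ltW sg0) //.
    congr (_ * (_ * _)); rewrite -/g -powR_mulrn ?(ltW sg0) // -powRrM [_ * g]mulrC powRrM.
    by rewrite sgg powR_mulrn // invr_ge0.
  move=> h1; pose e := lev i.+1 - lev i.
  have eE : e = d * 2^-1 * (2^-1 : R) ^+ i by rewrite /e /lev exprS; field.
  have e0 : 0 < e by rewrite eE !mulr_gt0 ?exprn_gt0 ?invr_gt0.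
  have e2 : 0 < e ^+ 2 by rewrite exprn_gt0.
  rewrite -(ler_pM2l e2).
  apply: (@le_trans _ _ (h ^+ n * \sum_x above (lev i) (V j) x ^+ 2)).
    rewrite mulrCA ler_pM2l // -[X in _ * X%:R]sum1_card natr_sum mulr_sumr big_mkcond /=.
    apply: ler_sum => x _; rewrite inE mulr1; case: ifP => [lV|_]; last exact: sqr_ge0.
    apply: sqr_le; first exact: ltW.
    by rewrite /above le_max /e; apply/orP; left; lra.
  apply: (le_trans h1).
  have q40 : 0 <= (4^-1 : R) ^+ i by rewrite exprn_ge0 // invr_ge0.
  have e2E : e ^+ 2 = d ^+ 2 / 4 * (4^-1) ^+ i.
    rewrite eE exprMn exprMn -!exprM mulnC exprM (_ : 2^-1 ^+ 2 = 4^-1 :> R) //.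
    by rewrite exprVn -natrX.
  rewrite e2E (exprS sg).
  have ci : 0 <= M0 * sg ^+ i * (4^-1) ^+ i / 4 by nneg.
  have := ler_wpM2l ci dd; move: (4^-1 ^+ i) (sg ^+ i) (M0 `^ g) => X1 X2 X3 h2.
  rewrite (_ : B * _ = M0 * X2 * X1 / 4 * (4 * B * X3)); last by field.
  by apply: (le_trans h2); apply: le_of_eq; field.
move=> j x jJ; rewrite leNgt; apply/negP => bad.
have sg01 : 0 <= sg < 1 by rewrite (ltW sg0).
have [i hi] := exp_small (ltW M00) sg01 hn0.
suff : h ^+ n <= M0 * sg ^+ i by rewrite leNgt hi.
apply: le_trans (main i j jJ); rewrite ler_pMr // ler1n; apply/card_gt0P.
by exists x; rewrite inE (le_lt_trans (levd i)).
Qed.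

(** Induction on the number of steps with K = C, possible because C does not depend on the bound
    assumed: control of J steps gives V <= C at step J + 1, which is control of J + 1 steps. *)
Lemma scheme_controlled (m chi M0 m0 A : R) : admissible m chi M0 m0 A ->
  exists C h1 : R, [/\ 0 < C, 0 < h1 <= 1 &
    forall P h (U V : nat -> {ffun 'I_n -> 'I_P.+2} -> R) q,
    0 < h <= h1 -> scheme m chi M0 m0 h U V q -> initial A m0 h (V 0%N) ->
    forall J, controlled m chi M0 m0 A h C U V q J].
Proof.
move=> adm; have [m1 chi0 M00 m0M A0] := adm.
have [C [C0 AC HC]] := sup_bound adm.
pose W := chi * M0 * C `^ (m + a - 1).
have W0 : 0 < W by rewrite /W; gt0.
exists C, (1 + W)^-1; split=> //.
  by rewrite invr_gt0 invf_le1 ?lerDl ?(ltW W0) ?andbT; lra.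
move=> P h U V q /andP[h0 h1] sch ini.
have small : h ^+ 2 * chi * M0 * C `^ (m + a - 1) <= 1.
  have -> : h ^+ 2 * chi * M0 * C `^ (m + a - 1) = h * (h * W) by rewrite /W; ring.
  have hW : h * (1 + W) <= 1 by rewrite -ler_pdivlMr ?mul1r //; lra.
  have hh : h <= 1 by nra.
  by nra.
elim=> [|J IH]; split=> //; split=> //.
  move=> j x; rewrite leqn0 => /eqP ->.
  by have [/(_ x)/andP[_ h2] _ _] := ini; exact: le_trans AC.
by move=> j x jJ; exact: HC IH _ _ jJ.
Qed.

End sup_estimate.

(** * Translates of the discrete densities and their sampling *)

Section lattice_compactness.
Context {R : realType} {n P : nat} (n0 : (0 < n)%N).
Notation G := {ffun 'I_n -> 'I_P.+2}.
Implicit Types (x y v : G).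
Local Notation a := (2 / n%:R : R).

Lemma dform_sub_le (f g1 g2 : G -> R) :
  - dform f (fun x => g1 x - g2 x) <= dform f f + (dform g1 g1 + dform g2 g2) / 2.
Proof.
rewrite /dform -sumrN -!big_split /= mulr_suml -big_split; apply: ler_sum => i _ /=.
rewrite -sumrN -big_split /= mulr_suml -big_split; apply: ler_sum => x _ /=.
rewrite /dd; move: (f (x + ev i) - f x) => z.
rewrite (_ : g1 (x + ev i) - g2 (x + ev i) - (g1 x - g2 x) =
  (g1 (x + ev i) - g1 x) - (g2 (x + ev i) - g2 x)); last by ring.
move: (g1 (x + ev i) - g1 x) (g2 (x + ev i) - g2 x) => b c.
have h1 : 0 <= (z + b) * (z + b) by exact: sqr_ge0.
have h2 : 0 <= (z - c) * (z - c) by exact: sqr_ge0.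
lra.
Qed.

Lemma card_small (r : nat) : (0 < r)%N -> (#|[set v : G | small r v]| <= (4 * r) ^ n)%N.
Proof.
move=> r0; pose Q : {pred 'I_P.+2} := [pred b : 'I_P.+2 | (b <= r)%N || (- b <= r)%N].
pose S : {set G} := [set v : G in ffun_on Q].
apply: (@leq_trans #|S|).
  apply: subset_leq_card; apply/fintype.subsetP => v; by rewrite !inE => /forallP vr; apply/forallP.
rewrite cardsE card_ffun_on card_ord leq_exp2r ?n0 //.
have c1 : (#|[set b : 'I_P.+2 | (b <= r)%N]| <= r.+1)%N.
  have -> : [set b : 'I_P.+2 | (b <= r)%N] = [set b : 'I_P.+2 | (b < r.+1)%N].
    by apply/setP => b; rewrite !inE.
  have [rN|Nr] := leqP r.+1 P.+2; last first.
    by apply: leq_trans (ltnW Nr); rewrite (leq_trans (max_card _)) // card_ord.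
  rewrite -sum1_card -[X in (_ <= X)%N]card_ord -[X in (_ <= X)%N]sum1_card.
  rewrite [X in (_ <= X)%N](big_ord_widen _ (fun=> 1%N) rN).
  by rewrite leq_eqVlt; apply/orP; left; apply/eqP; apply: eq_bigl => b; rewrite inE.
have c2 : (#|[set b : 'I_P.+2 | (- b <= r)%N]| <= r.+1)%N.
  apply: leq_trans c1; rewrite -(card_imset (mem [set b : 'I_P.+2 | (- b <= r)%N]) (@oppr_inj _)).
  apply: subset_leq_card; apply/fintype.subsetP => b /imsetP[b' b'r ->].
  by move: b'r; rewrite !inE.
apply: (@leq_trans #|[set b : 'I_P.+2 | (b <= r)%N] :|: [set b : 'I_P.+2 | (- b <= r)%N]|).
  by apply: subset_leq_card; apply/fintype.subsetP => b; rewrite !inE.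
apply: leq_trans (leq_card_setU _ _) _; apply: leq_trans (leq_add c1 c2) _; lia.
Qed.

Lemma ord_small_sub (c o : 'I_P.+2) (r : nat) :
  ((c + o)%R < r)%N -> (o < r)%N -> (c <= r)%N || ((- c)%R <= r)%N.
Proof.
have -> : ((c + o)%R : nat) = ((c + o) %% P.+2)%N by [].
have -> : ((- c)%R : nat) = ((P.+2 - c) %% P.+2)%N by [].
have := ltn_ord c; have := ltn_ord o; move: (c : nat) (o : nat) => {}c {}o oN cN.
have [coN|Nco] := ltnP (c + o) P.+2; first by rewrite modn_small //; lia.
by move=> _ or; apply/orP; right; rewrite modn_small; lia.
Qed.

(** Trades an L^k bound for an L^1 bound, at the cost of e per unit of volume. *)
Lemma young_power (d e : R) (k : R) : 0 <= d -> 0 < e -> 1 <= k ->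
  d <= e + e `^ (1 - k) * d `^ k.
Proof.
move=> d0 e0 k1; have [de|ed] := leP d e.
  by apply: (le_trans de); rewrite lerDl mulr_ge0 ?powR_ge0.
have h : d <= e `^ (1 - k) * d `^ k; last by apply: (le_trans h); rewrite lerDr ltW.
have dp : 0 < d by exact: lt_trans ed.
have -> : 1 - k = - (k - 1) by ring.
rewrite powRN ler_pdivlMl ?powR_gt0 // -(@powRM1 _ d k) //; last by lra.
by rewrite ler_wpM2r // powR_le ?(ltW e0) ?(ltW ed) //; lra.
Qed.

Variables (m chi M0 m0 A h C : R) (U V : nat -> G -> R) (q : nat -> R).
Hypothesis ctr : forall J, controlled m chi M0 m0 A h C U V q J.
Variable D : R.
Hypothesis HD : forall J, \sum_(j < J) h ^+ n * dform (pw m (U j)) (pw m (U j)) <= D.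

Let h0 : 0 < h. Proof. by have [] := ctr 0. Qed.
Let hn0 : 0 < h ^+ n. Proof. by rewrite exprn_gt0. Qed.
Let m1 : 1 < m. Proof. by have [[]] := ctr 0. Qed.
Let chi0 : 0 < chi. Proof. by have [[]] := ctr 0. Qed.
Let M00 : 0 < M0. Proof. by have [[]] := ctr 0. Qed.
Let a0 : 0 < a. Proof. by rewrite divr_gt0 // ltr0n. Qed.
Let C0 : 0 <= C. Proof. exact: (K_ge0 (ctr 0)). Qed.
Let b : R := chi * M0 * C `^ (m + a - 1).
Let b0 : 0 <= b. Proof. by rewrite /b; have := ltW chi0; have := ltW M00; nneg. Qed.

Lemma bound_U j x : 0 <= U j x <= C.
Proof. by rewrite (U_ge0 (ctr j)) (U_leK (ctr j)). Qed.

Lemma bound_mass_U j : h ^+ n * \sum_(x : G) U j x <= M0.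
Proof.
apply: (le_trans (mass_U_leV n0 (ctr j) j)); apply: (le_trans (mass_le_q n0 (ctr j) j)).
exact: (q_leM0 n0 (ctr j)).
Qed.

Lemma V_next_le j x : V j.+1 x - U j x <= h ^+ 2 * b * U j x.
Proof.
rewrite (V_nextE n0 (ctr j)) mulrDr mulr1 addrC addKr mulrC.
have /andP[u0 uC] := bound_U j x; rewrite ler_wpM2r // -mulrA ler_wpM2l ?sqr_ge0 //.
rewrite /b; apply: ler_pM; [exact: (kap_ge0 (ctr 0))|exact: powR_ge0|exact: (kap_le (ctr 0))|].
by apply: powR_le => //; move: m1 a0; lra.
Qed.

Lemma energy_shift i J :
  \sum_(j < J) h ^+ n * dform (pw m (U (j + i))) (pw m (U (j + i))) <= D.
Proof.
apply: le_trans (HD (i + J)); rewrite big_split_ord /= -[leLHS]add0r; apply: lerD.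
  by apply: sumr_ge0 => j _; rewrite mulr_ge0 ?dform_ge0 // ltW.
by apply: le_of_eq; apply: eq_bigr => j _; rewrite addnC.
Qed.

(** The successive differences of U between the steps j and j + s are all tested with w (j + s) - w
    j, so they telescope into the monotone product of [powR_diff_mono]. The dissipation terms are
    energies at shifted steps, each summing to at most D over j, and the production is bounded
    through the mass. *)
Lemma time_shift s J :
  \sum_(j < J) h ^+ n * \sum_(x : G) `|U (j + s) x - U j x| `^ (m + 1)
  <= s%:R * (J%:R * h ^+ 2 * (b * C `^ m * M0) + 2 * D).
Proof.
pose w j := pw m (U j).
have wC j x : 0 <= w j x <= C `^ m.
  by rewrite powR_ge0 powR_le //; have /andP[] := bound_U j x; move: m1; lra.
pose E j : R := h ^+ n * dform (w j) (w j).
have step j i : h ^+ n * \sum_(x : G) (U (j + i).+1 x - U (j + i) x) * (w (j + s)%N x - w j x)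
    <= h ^+ 2 * (b * C `^ m * M0) + (E (j + i).+1 + (E (j + s)%N + E j) / 2).
  set k := (j + i)%N; pose g x := w (j + s)%N x - w j x.
  have gw x : wall x -> g x = 0.
    by move=> xw; rewrite /g /w /pw !(U_wall (ctr 0)) // subrr.
  have gC x : g x <= C `^ m.
    by rewrite /g; have /andP[] := wC (j + s)%N x; have /andP[] := wC j x; lra.
  have gt := step_test (step_ok (ctr 0) k.+1) (V_wall n0 (ctr 0) k.+1) gw.
  have e1 : \sum_(x : G) (U k.+1 x - U k x) * g x =
      \sum_(x : G) (V k.+1 x - U k x) * g x - dform (w k.+1) g.
    rewrite -(mul1r (dform _ _)) -mulNr -gt -big_split /=.
    by apply: eq_bigr => x _; ring.
  have e2 : \sum_(x : G) (V k.+1 x - U k x) * g x <= h ^+ 2 * b * C `^ m * \sum_(x : G) U k x.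
    rewrite mulr_sumr; apply: ler_sum => x _.
    have h1 : 0 <= V k.+1 x - U k x by rewrite subr_ge0; exact: (U_leV_next (ctr 0)).
    apply: (le_trans (ler_wpM2l h1 (gC x))).
    apply: (le_trans (ler_wpM2r (powR_ge0 _ _) (V_next_le k x))).
    by apply: le_of_eq; ring.
  have e3 := dform_sub_le (w k.+1) (w (j + s)%N) (w j).
  rewrite -/g in e3.
  have bC : 0 <= h ^+ 2 * b * C `^ m by have := b0; nneg.
  have e4 := ler_wpM2l bC (bound_mass_U k).
  have e5 : \sum_(x : G) (U k.+1 x - U k x) * g x <= h ^+ 2 * b * C `^ m * \sum_(x : G) U k x
      + (dform (w k.+1) (w k.+1) + (dform (w (j + s)%N) (w (j + s)%N) + dform (w j) (w j)) / 2).
    by rewrite e1; apply: lerD.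
  apply: (le_trans (ler_wpM2l (ltW hn0) e5)); rewrite mulrDr; apply: lerD.
    rewrite mulrCA (_ : h ^+ 2 * (b * C `^ m * M0) = h ^+ 2 * b * C `^ m * M0) //.
    by ring.
  by apply: le_of_eq; rewrite /E; field.
have tot j : h ^+ n * \sum_(x : G) `|U (j + s) x - U j x| `^ (m + 1) <=
    \sum_(i < s) (h ^+ 2 * (b * C `^ m * M0) + (E (j + i).+1 + (E (j + s)%N + E j) / 2)).
  apply: le_trans (ler_sum _ (fun (i : 'I_s) _ => step j i)).
  rewrite -mulr_sumr ler_pM2l // exchange_big /=; apply: ler_sum => x _.
  rewrite -mulr_suml -(big_mkord xpredT (fun i => U (j + i).+1 x - U (j + i)%N x)).
  under eq_bigr do rewrite -addnS.
  rewrite (telescope_sumr (fun i => U (j + i)%N x)) // addn0.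
  by apply: powR_diff_mono; [exact: ltW|have /andP[] := bound_U j x|have /andP[] := bound_U (j + s) x].
apply: (le_trans (ler_sum _ (fun (j : 'I_J) _ => tot j))).
have sumc (X : R) : s%:R * X = \sum_(i < s) X by rewrite sumr_const card_ord mulr_natl.
rewrite exchange_big /= sumc.
apply: ler_sum => i _; rewrite big_split /= sumr_const card_ord -[X in X + _]mulr_natl mulrA.
rewrite lerD2l big_split /= -mulr_suml big_split /=.
have f1 : \sum_(j < J) E (j + i).+1 <= D.
  by have := energy_shift i.+1 J; under eq_bigr do rewrite addnS.
have f2 : \sum_(j < J) E (j + s)%N <= D by exact: energy_shift.
have f3 : \sum_(j < J) E j <= D by exact: HD.
by lra.
Qed.

Lemma space_shift r v J : small r v ->
  \sum_(j < J) h ^+ n * \sum_(x : G) `|U j (x + v) - U j x| `^ (2 * m)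
  <= n%:R * r%:R ^+ 2 * D.
Proof.
move=> vr; apply: (@le_trans _ _ (\sum_(j < J) n%:R * r%:R ^+ 2 *
    (h ^+ n * dform (pw m (U j)) (pw m (U j))))); last first.
  by rewrite -mulr_sumr; apply: ler_wpM2l; [nneg|exact: HD].
apply: ler_sum => j _; rewrite mulrCA ler_pM2l //.
apply: le_trans (shift_le (pw m (U j)) vr); apply: ler_sum => x _.
rewrite mulrC powRrM -[leRHS]real_normK ?num_real // -powR_mulrn ?normr_ge0 //.
apply: powR_le; [exact: ler0n|exact: powR_ge0|].
by apply: powR_diff_norm; [exact: ltW|have /andP[] := bound_U j x|
  have /andP[] := bound_U j (x + v)].
Qed.

Lemma sum_blocks (f : nat -> R) s J :
  \sum_(i < J) \sum_(k < s) f (i * s + k)%N = \sum_(j < (J * s)%N) f j.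
Proof.
elim: J => [|J IH]; first by rewrite mul0n !big_ord0.
by rewrite big_ord_recr /= IH mulSn addnC big_split_ord.
Qed.

Lemma sum_pairs_le (f : nat -> nat -> R) s :
  (forall i j, 0 <= f i j) -> (forall i j, f i j = f j i) ->
  \sum_(i < s) \sum_(j < s) f i j <= 2 * \sum_(d < s) \sum_(i < s) f i (i + d)%N.
Proof.
move=> f0 fC; pose g i j := if (i <= j)%N then f i j else 0.
apply: (@le_trans _ _ (2 * \sum_(i < s) \sum_(j < s) g i j)).
  rewrite mulr_natl mulr2n [X in _ <= _ + X]exchange_big -big_split /=; apply: ler_sum => i _.
  rewrite -big_split /=; apply: ler_sum => j _; rewrite /g.
  by case: (leqP i j) => [ij|/ltnW ->]; [rewrite lerDl; case: ifP|rewrite add0r fC].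
rewrite ler_pM2l // [leRHS]exchange_big /=; apply: ler_sum => i _.
rewrite -(big_mkord xpredT (g i)) -(big_mkord xpredT (fun d => f i (i + d)%N)).
have is' : (i <= s)%N by exact: ltnW.
rewrite (big_cat_nat (leq0n i) is') /= big_nat_cond big1 ?add0r; last first.
  by move=> j; rewrite andbT /g => /andP[_]; rewrite ltnNge => /negbTE ->.
rewrite -{1}[(i : nat)]add0n big_addn (big_cat_nat (leq0n (s - i)) (leq_subr i s)) /=.
rewrite -[leLHS]addr0; apply: lerD; last by apply: sumr_ge0.
by apply: ler_sum => j _; rewrite /g addnC; case: ifP.
Qed.

Lemma time_shift_L1 (B : {pred G}) (e : R) d s J : 0 < e -> (d <= s)%N ->
  \sum_(j < J) h ^+ 2 * (h ^+ n * \sum_(x in B) `|U (j + d) x - U j x|) <=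
  e * (h ^+ n * #|B|%:R) * (J%:R * h ^+ 2) +
  e `^ (- m) * (s%:R * h ^+ 2 * (J%:R * h ^+ 2 * (b * C `^ m * M0) + 2 * D)).
Proof.
move=> e0 ds; have D0 : 0 <= D.
  by apply: le_trans (HD 0); rewrite big_ord0.
apply: (@le_trans _ _ (\sum_(j < J) (e * (h ^+ n * #|B|%:R) * h ^+ 2 +
    e `^ (- m) * h ^+ 2 * (h ^+ n * \sum_(x : G) `|U (j + d) x - U j x| `^ (m + 1))))).
  apply: ler_sum => j _.
  apply: (@le_trans _ _ (h ^+ 2 * (h ^+ n * \sum_(x in B) (e + e `^ (- m) * `|U (j + d) x - U j x| `^ (m + 1))))).
    rewrite ler_pM2l ?exprn_gt0 // ler_pM2l //; apply: ler_sum => x _.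
    have -> : - m = 1 - (m + 1) by ring.
    by apply: young_power => //; move: m1; lra.
  rewrite big_split /= sumr_const -[e *+ _]mulr_natr -mulr_sumr.
  have : \sum_(x in B) `|U (j + d) x - U j x| `^ (m + 1) <= \sum_(x : G) `|U (j + d) x - U j x| `^ (m + 1).
    rewrite [leLHS]big_mkcond; apply: ler_sum => x _; case: ifP => // _; exact: powR_ge0.
  have hh : 0 <= e `^ (- m) * h ^+ 2 * h ^+ n by have := ltW h0; nneg.
  by move=> /(ler_wpM2l hh); move: (\sum_(x in B) _) (\sum_x _) => X Y hXY; lra.
rewrite big_split /= sumr_const card_ord -[X in X + _]mulr_natr -mulr_sumr.
apply: lerD; first by apply: le_of_eq; ring.
have eh : 0 <= e `^ (- m) * h ^+ 2 by nneg.
apply: (le_trans (ler_wpM2l eh (time_shift d J))).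
have bb := b0; have MM := ltW M00.
have S0 : 0 <= J%:R * h ^+ 2 * (b * C `^ m * M0) + 2 * D by nneg.
rewrite -[leLHS]mulrA; apply: ler_wpM2l; first exact: powR_ge0.
rewrite [leLHS]mulrA; apply: ler_wpM2r => //.
by rewrite mulrC; apply: ler_wpM2r; [exact: sqr_ge0|rewrite ler_nat].
Qed.

Lemma space_shift_L1 (B : {pred G}) (e : R) r v J : 0 < e -> small r v ->
  \sum_(j < J) h ^+ 2 * (h ^+ n * \sum_(x in B) `|U j (x + v) - U j x|) <=
  e * (h ^+ n * #|B|%:R) * (J%:R * h ^+ 2) +
  e `^ (1 - 2 * m) * (n%:R * (r%:R * h) ^+ 2 * D).
Proof.
move=> e0 vr.
apply: (@le_trans _ _ (\sum_(j < J) (e * (h ^+ n * #|B|%:R) * h ^+ 2 +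
    e `^ (1 - 2 * m) * h ^+ 2 * (h ^+ n * \sum_(x : G) `|U j (x + v) - U j x| `^ (2 * m))))).
  apply: ler_sum => j _.
  apply: (@le_trans _ _ (h ^+ 2 * (h ^+ n * \sum_(x in B) (e + e `^ (1 - 2 * m) * `|U j (x + v) - U j x| `^ (2 * m))))).
    rewrite ler_pM2l ?exprn_gt0 // ler_pM2l //; apply: ler_sum => x _.
    by apply: young_power => //; move: m1; lra.
  rewrite big_split /= sumr_const -[e *+ _]mulr_natr -mulr_sumr.
  have : \sum_(x in B) `|U j (x + v) - U j x| `^ (2 * m) <= \sum_(x : G) `|U j (x + v) - U j x| `^ (2 * m).
    rewrite [leLHS]big_mkcond; apply: ler_sum => x _; case: ifP => // _; exact: powR_ge0.
  have hh : 0 <= e `^ (1 - 2 * m) * h ^+ 2 * h ^+ n by have := ltW h0; nneg.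
  by move=> /(ler_wpM2l hh); move: (\sum_(x in B) _) (\sum_x _) => X Y hXY; lra.
rewrite big_split /= sumr_const card_ord -[X in X + _]mulr_natr -mulr_sumr.
apply: lerD; first by apply: le_of_eq; ring.
have eh : 0 <= e `^ (1 - 2 * m) * h ^+ 2 by nneg.
by apply: (le_trans (ler_wpM2l eh (space_shift J vr))); apply: le_of_eq; ring.
Qed.

Definition offset (r : nat) x : G := [ffun i => inZp (x i %% r)].

(* Some representative of each cell of r x ... x r x s lattice points is good
   for all cells at once, by averaging over all positions in the cell. *)
Lemma sampling (B : {pred G}) (e : R) (r s J : nat) :
  0 < e -> (0 < r <= P.+2)%N -> (0 < s)%N ->
  exists (v : G) (k : nat), [/\ forall i, (v i < r)%N, (k < s)%N &
    \sum_(i < J) \sum_(l < s) h ^+ 2 * (h ^+ n * \sum_(x in B)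
      `|U (i * s + l)%N x - U (i * s + k)%N (x - offset r x + v)|) <=
    2 * (e * (h ^+ n * #|B|%:R) * ((J * s)%:R * h ^+ 2) +
      e `^ (- m) * (s%:R * h ^+ 2 * ((J * s)%:R * h ^+ 2 * (b * C `^ m * M0) + 2 * D)))
    + 4 ^+ n * (e * (h ^+ n * #|B|%:R) * ((J * s)%:R * h ^+ 2) +
      e `^ (1 - 2 * m) * (n%:R * (r%:R * h) ^+ 2 * D))].
Proof.
move=> e0 /andP[r0 rN] s0; set WT := _ + e `^ (- m) * _; set WS := _ + e `^ (1 - 2 * m) * _.
pose S : {set G} := [set v : G | [forall i, (v i < r)%N]].
have cS : #|S| = (r ^ n)%N.
  pose Sr : {pred 'I_P.+2} := [pred a : 'I_P.+2 | (a < r)%N].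
  pose S' : {set G} := [set v : G in ffun_on Sr].
  have -> : #|S| = #|S'|.
    by apply: eq_card => v; rewrite !inE; apply/forallP/forallP.
  rewrite cardsE card_ffun_on card_ord; congr (_ ^ _)%N.
  rewrite -sum1_card -[RHS]card_ord -[RHS]sum1_card.
  by rewrite (big_ord_widen _ (fun=> 1%N) rN).
have h2n : 0 < h ^+ 2 * h ^+ n by rewrite mulr_gt0 // exprn_gt0.
pose F v (k : nat) : R := \sum_(i < J) \sum_(l < s) h ^+ 2 * (h ^+ n * \sum_(x in B)
      `|U (i * s + l)%N x - U (i * s + k)%N (x - offset r x + v)|).
pose F1 (k : nat) : R := \sum_(i < J) \sum_(l < s) h ^+ 2 * (h ^+ n * \sum_(x in B)
      `|U (i * s + l)%N x - U (i * s + k)%N x|).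
pose F2 v (k : nat) : R := \sum_(i < J) h ^+ 2 * (h ^+ n * \sum_(x in B)
      `|U (i * s + k)%N (x - offset r x + v) - U (i * s + k)%N x|).
have FF v k : F v k <= F1 k + s%:R * F2 v k.
  rewrite /F /F1 /F2 mulr_sumr -big_split; apply: ler_sum => i _ /=.
  rewrite -[s in s%:R]card_ord mulr_natl -sumr_const -big_split; apply: ler_sum => l _ /=.
  rewrite -!mulrDr ler_pM2l ?exprn_gt0 // ler_pM2l // -big_split; apply: ler_sum => x _ /=.
  rewrite [X in _ <= _ + X]distrC; apply: le_trans (ler_normD _ _).
  by apply: le_of_eq; congr (`| _ |); ring.
have sF1 : \sum_(k < s) F1 k <= s%:R * (2 * WT).
  pose f i (l k : nat) : R := h ^+ 2 * (h ^+ n * \sum_(x in B) `|U (i * s + k)%N x - U (i * s + l)%N x|).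
  have f0 i l k : 0 <= f i l k.
    by rewrite /f mulrA mulr_ge0 ?(ltW h2n) // sumr_ge0.
  have fC i l k : f i l k = f i k l.
    by rewrite /f; congr (_ * (_ * _)); apply: eq_bigr => x _; rewrite distrC.
  rewrite /F1 exchange_big /=.
  apply: (@le_trans _ _ (\sum_(i < J) (2 * \sum_(d < s) \sum_(l < s) f i l (l + d)%N))).
    apply: ler_sum => i _; exact: (sum_pairs_le s (f0 i) (fC i)).
  rewrite -mulr_sumr mulrCA ler_pM2l // exchange_big /= mulr_natl -[s in _ *+ s]card_ord -sumr_const.
  apply: ler_sum => d _; apply: le_trans (time_shift_L1 B (J * s) e0 (ltnW (ltn_ord d))).
  rewrite -(sum_blocks (fun j => h ^+ 2 * (h ^+ n * \sum_(x in B) `|U (j + d)%N x - U j x|))).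
  by apply: le_of_eq; apply: eq_bigr => i _; apply: eq_bigr => l _; rewrite /f addnA.
have D0 : 0 <= D by apply: le_trans (HD 0); rewrite big_ord0.
have WS0 : 0 <= WS by rewrite /WS; have := ltW e0; have := ltW h0; nneg.
(* For a fixed x, the displacement from x to its representative has coordinates at most r in
   absolute value, so the sum over v is part of a sum over at most (4 r)^n small translations. *)
have sF2 : \sum_(v in S) \sum_(k < s) F2 v k <= (4 ^ n * r ^ n)%:R * WS.
  have : \sum_(v in S) \sum_(k < s) F2 v k <= \sum_(v in [set v : G | small r v]) \sum_(k < s)
     \sum_(i < J) h ^+ 2 * (h ^+ n * \sum_(x in B) `|U (i * s + k)%N (x + v) - U (i * s + k)%N x|).
    rewrite exchange_big [leRHS]exchange_big /=; apply: ler_sum => k _.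
    rewrite /F2 exchange_big [leRHS]exchange_big /=; apply: ler_sum => i _.
    rewrite -!mulr_sumr ler_pM2l ?exprn_gt0 // ler_pM2l // exchange_big [leRHS]exchange_big /=.
    apply: ler_sum => x _; rewrite big_mkcond [leRHS]big_mkcond /=.
    rewrite (reindex_inj (addIr (offset r x))) /=; apply: ler_sum => w _.
    have -> : x - offset r x + (w + offset r x) = x + w.
      by rewrite addrCA -addrA addNr addr0 addrC.
    case: ifPn => [|_]; last by case: ifP.
    rewrite inE => /forallP wS; rewrite inE; case: ifPn => // /negP[].
    apply/forallP => i'; have := wS i'; rewrite !ffunE.
    move: (w i') (x i') => c y0 wr.
    have : ((inZp (y0 %% r) : 'I_P.+2) < r)%N.
      by rewrite /= (leq_ltn_trans (leq_mod _ _)) // ltn_mod.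
    exact: ord_small_sub.
  move=> /le_trans; apply.
  apply: (@le_trans _ _ (\sum_(v in [set v : G | small r v]) WS)).
    apply: ler_sum => v; rewrite inE => vr; rewrite exchange_big /=.
    rewrite (sum_blocks (fun j => h ^+ 2 * (h ^+ n * \sum_(x in B) `|U j (x + v) - U j x|))).
    exact: space_shift_L1.
  rewrite sumr_const -[X in X <= _]mulr_natl; apply: ler_wpM2r => //; rewrite ler_nat -expnMn; exact: card_small.
clearbody WT WS.
(* Otherwise the sum over all r^n s positions would exceed the bound just found for it. *)
have [[v k] /= vk] : exists p : G * 'I_s, (p.1 \in S) && (F p.1 p.2 <= 2 * WT + 4 ^+ n * WS).
  apply/existsP; rewrite -[X in is_true X]negbK negb_exists; apply/negP => /forallP H.
  have : \sum_(v in S) \sum_(k < s) (2 * WT + 4 ^+ n * WS) < \sum_(v in S) \sum_(k < s) F v k.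
    have [v0 v0S] : exists v0, v0 \in S.
      by apply/card_gt0P; rewrite cS expn_gt0 r0.
    apply: ltr_sum; first by apply/hasP; exists v0; rewrite ?mem_index_enum.
    move=> v vS; apply: ltr_sum; first by apply/hasP; exists (Ordinal s0); rewrite ?mem_index_enum.
    by move=> k _; have := H (v, k); rewrite /= vS /= -ltNge.
  apply/negP; rewrite -leNgt.
  apply: (@le_trans _ _ (\sum_(v in S) \sum_(k < s) (F1 k + s%:R * F2 v k))).
    by apply: ler_sum => v _; apply: ler_sum => k _.
  under eq_bigr do rewrite big_split /= -mulr_sumr.
  rewrite big_split /= -mulr_sumr !sumr_const card_ord cS.
  rewrite -[X in X + _ <= _]mulr_natl -[X in _ <= X]mulr_natl -[X in _ <= _ * X]mulr_natl !mulrDr.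
  apply: lerD; first by rewrite ler_wpM2l.
  rewrite mulrCA; apply: ler_wpM2l => //.
  by apply: (le_trans sF2); rewrite natrM natrX mulrA [_%:R * _ ^+ n]mulrC.
case/andP: vk; rewrite inE => /forallP vr Fle.
by exists v, k; split.
Qed.

End lattice_compactness.

(** * Second moment and loss of mass through the wall *)

Section moments.
Context {R : realType} {n P : nat} (n0 : (0 < n)%N).
Notation G := {ffun 'I_n -> 'I_P.+2}.
Implicit Types (x y v : G).
Local Notation a := (2 / n%:R : R).

Variables (m chi M0 m0 A h C : R) (U V : nat -> G -> R) (q : nat -> R).
Hypothesis ctr : forall J, controlled m chi M0 m0 A h C U V q J.
Let h0 : 0 < h. Proof. by have [] := ctr 0. Qed.
Let hn0 : 0 < h ^+ n. Proof. by rewrite exprn_gt0. Qed.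
Let m1 : 1 < m. Proof. by have [[]] := ctr 0. Qed.
Let chi0 : 0 < chi. Proof. by have [[]] := ctr 0. Qed.
Let M00 : 0 < M0. Proof. by have [[]] := ctr 0. Qed.
Let a0 : 0 < a. Proof. by rewrite divr_gt0 // ltr0n. Qed.
Let C0 : 0 <= C. Proof. exact: (K_ge0 (ctr 0)). Qed.
Let b : R := chi * M0 * C `^ (m + a - 1).
Let b0 : 0 <= b. Proof. by rewrite /b; have := ltW chi0; have := ltW M00; nneg. Qed.

(* Lattice points of the torus as points of the box, centred at its middle. *)
Definition position (Nh : nat) i x : R := h * ((x i)%:R - Nh%:R).
Definition moment (Nh : nat) x : R := \sum_i position Nh i x ^+ 2.

Lemma moment_ge0 Nh x : 0 <= moment Nh x.
Proof. by apply: sumr_ge0 => i _; exact: sqr_ge0. Qed.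

(** A step past the last coordinate wraps around to the wall, at the opposite end of the box; the
    centring makes the squares at both ends equal, so the periodic Laplacian of the moment sees no
    jump at the far side. *)
Lemma position_shift Nh i x : P.+2 = (2 * Nh)%N ->
  position Nh i (x + ev i) ^+ 2 = (position Nh i x + h) ^+ 2.
Proof.
move=> PN; rewrite /position !ffunE eqxx.
have -> : nat_of_ord (x i + 1)%R = ((x i + 1) %% P.+2)%N by rewrite /= ?modnDmr.
have := ltn_ord (x i); rewrite leq_eqVlt => /orP[/eqP e|l].
  rewrite addn1 e modnn; have {e} e : (x i : nat)%:R + 1 = 2 * Nh%:R :> R.
    by rewrite natr1 e PN natrM.
  have -> : (x i : nat)%:R = 2 * Nh%:R - 1 :> R by rewrite -e; ring.
  ring.
by rewrite modn_small ?addn1 // -natr1; congr (_ ^+ 2); ring.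
Qed.

Lemma lap_moment Nh x : P.+2 = (2 * Nh)%N -> ~~ wall x ->
  lap (moment Nh) x = (2 * n)%:R * h ^+ 2.
Proof.
move=> PN xw; rewrite /lap.
transitivity (\sum_(i < n) 2 * h ^+ 2); last by rewrite sumr_const card_ord -mulr_natl natrM; ring.
apply: eq_bigr => i _.
have D f : moment Nh f = position Nh i f ^+ 2 + \sum_(k < n | k != i) position Nh k f ^+ 2.
  by rewrite /moment (bigD1 i).
have E1 : \sum_(k < n | k != i) position Nh k (x + ev i) ^+ 2 =
    \sum_(k < n | k != i) position Nh k x ^+ 2.
  by apply: eq_bigr => k ki; rewrite /position !ffunE (negbTE ki) addr0.
have E2 : \sum_(k < n | k != i) position Nh k (x - ev i) ^+ 2 =
    \sum_(k < n | k != i) position Nh k x ^+ 2.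
  by apply: eq_bigr => k ki; rewrite /position !ffunE (negbTE ki) subr0.
have S2 : position Nh i (x - ev i) = position Nh i x - h.
  have x0 : (0 < x i)%N.
    by rewrite lt0n; apply: contra xw => xi; apply/existsP; exists i; exact: xi.
  rewrite /position !ffunE eqxx.
  have -> : nat_of_ord (x i - 1)%R = (x i).-1.
    have := ltn_ord (x i); case: (x i) x0 => -[//|k] /= kP _ _.
    rewrite (@modn_small 1) // subn1 /= (@modn_small P.+1) // addSnnS modnDr.
    by rewrite modn_small // ltnW.
  rewrite -[in RHS](prednK x0) -natr1; ring.
rewrite !D E1 E2 position_shift // S2; ring.
Qed.

(** The functional adds to the moment the lost mass weighted with the squared half-side. Mass that
    leaves through the wall takes at least that much moment with it, so diffusion increases the sum
    by at most [c], as in the whole space, and the reaction multiplies it by at most 1 + h^2 b. Both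
    the tails and the loss are bounded at once. *)
Lemma moment_bound Nh j : P.+2 = (2 * Nh)%N ->
  h ^+ n * \sum_(x : G) V j x * moment Nh x +
    (h * Nh%:R) ^+ 2 * (q j - h ^+ n * \sum_(x : G) V j x) <=
  (1 + h ^+ 2 * b) ^+ j * (h ^+ n * \sum_(x : G) V 0%N x * moment Nh x +
    (h * Nh%:R) ^+ 2 * (q 0%N - h ^+ n * \sum_(x : G) V 0%N x) +
    j%:R * ((2 * n)%:R * h ^+ 2 * (C `^ (m - 1) * M0))).
Proof.
move=> PN; set L2 := (h * Nh%:R) ^+ 2; set c := _ * (_ * M0).
set S := fun j => h ^+ n * \sum_(x : G) V j x * moment Nh x +
  L2 * (q j - h ^+ n * \sum_(x : G) V j x).
rewrite -[leLHS]/(S j) -[X in _ * (X + _)]/(S 0%N).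
have L20 : 0 <= L2 by exact: sqr_ge0.
have c0 : 0 <= c by rewrite /c; have := ltW M00; nneg.
have beta0 : 0 <= h ^+ 2 * b by have := b0; nneg.
elim: j => [|j IH]; first by rewrite expr0 mul1r mul0r addr0.
have M1 := step_weight (moment Nh) m1 (step_ok (ctr 0) j) (V_wall n0 (ctr 0) j).
have M2 := step_mass m1 ler01 (step_ok (ctr 0) j) (V_wall n0 (ctr 0) j).
rewrite mul1r in M1; rewrite mul1r in M2.
set W := \sum_(x | wall x) _ in M2.
have M3 : h ^+ n * \sum_(x : G) pw m (U j) x * lap (moment Nh) x <= c.
  apply: (@le_trans _ _ (h ^+ n * \sum_(x : G) (2 * n)%:R * h ^+ 2 * (C `^ (m - 1) * U j x))).
    rewrite ler_pM2l //; apply: ler_sum => x _.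
    have /andP[u0 uC] := bound_U ctr j x.
    have [xw|xw] := boolP (wall x).
      by rewrite /pw (U_wall (ctr 0)) // powR0 ?mul0r ?mulr0 // gt_eqF //; move: m1; lra.
    rewrite lap_moment // mulrC; apply: ler_wpM2l; first by nneg.
    rewrite /pw -(@powRM1 _ _ m) //; last by move: m1; lra.
    by apply: ler_wpM2r => //; apply: powR_le => //; move: m1; lra.
  rewrite -mulr_sumr -mulr_sumr /c mulrCA; apply: ler_wpM2l; first by nneg.
  by rewrite mulrCA; apply: ler_wpM2l; [exact: powR_ge0|exact: (bound_mass_U n0 ctr j)].
(* On the wall one coordinate equals minus the half-side, so the moment is at least [L2]. *)
have M4 : L2 * W <= \sum_(x | wall x) lap (pw m (U j)) x * moment Nh x.
  rewrite mulr_sumr; apply: ler_sum => x xw; rewrite mulrC.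
  apply: ler_wpM2l; first exact: (lap_wall_ge0 m1 (step_ok (ctr 0) j)).
  case/existsP: xw => i /eqP xi; rewrite /moment (bigD1 i) //= /position xi sub0r mulrN sqrrN.
  by rewrite lerDl sumr_ge0 // => k _; exact: sqr_ge0.
have M5 : h ^+ n * \sum_(x : G) U j x * moment Nh x + L2 * (q j - h ^+ n * \sum_(x : G) U j x)
    <= S j + c.
  have E : \sum_(x : G) (U j x - V j x) * moment Nh x =
      \sum_(x : G) U j x * moment Nh x - \sum_(x : G) V j x * moment Nh x.
    by rewrite -sumrB; apply: eq_bigr => x _; ring.
  rewrite E in M1; move: M1 M2 M3 M4; rewrite /S.
  set a1 := \sum_x _ * moment Nh x; set a2 := \sum_x _ * moment Nh x.
  set a3 := \sum_x _; set a4 := \sum_(x | wall x) _; set a5 := \sum_x _; set a6 := \sum_x _.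
  move=> M1 M2 M3 M4; have M4' := ler_wpM2l (ltW hn0) M4.
  have -> : a1 = a2 + a3 - a4 by lra.
  rewrite -M2 in M4'.
  by lra.
have M6 : S j.+1 <= (1 + h ^+ 2 * b) * (h ^+ n * \sum_(x : G) U j x * moment Nh x +
    L2 * (q j - h ^+ n * \sum_(x : G) U j x)).
  rewrite /S [leRHS]mulrDr; apply: lerD.
    rewrite mulrCA ler_pM2l // mulr_sumr; apply: ler_sum => x _; rewrite mulrA.
    apply: ler_wpM2r; first exact: moment_ge0.
    by have := V_next_le n0 ctr j x; rewrite -/b; lra.
  rewrite (mass_V_next (ctr 0)) (_ : q j.+1 - _ = q j - h ^+ n * \sum_(x : G) U j x); last by ring.
  have : h ^+ n * \sum_(x : G) U j x <= q j.
    exact: le_trans (mass_U_leV n0 (ctr 0) j) (mass_le_q n0 (ctr 0) j).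
  by move=> qU; apply: ler_peMl; [rewrite mulr_ge0 // subr_ge0|rewrite lerDl].
have beta1 : 0 <= 1 + h ^+ 2 * b by rewrite addr_ge0.
apply: (le_trans (le_trans M6 (ler_wpM2l beta1 M5))).
have M8 : c <= (1 + h ^+ 2 * b) ^+ j * c.
  by apply: ler_peMl => //; apply: exprn_ege1; rewrite lerDl.
rewrite [X in _ <= X * _]exprS -[leRHS]mulrA; apply: ler_wpM2l => //.
have -> : S 0%N + j.+1%:R * c = (S 0%N + j%:R * c) + c by rewrite -natr1; ring.
by rewrite [leRHS]mulrDr; apply: (lerD IH M8).
Qed.

End moments.

Local Open Scope classical_set_scope.

(** * Integrals of step functions and fast convergence *)

Lemma fast_cvg (R : realType) (a : nat -> R) (s : R) (k0 : nat) :
  (forall k, (k0 <= k)%N -> `|a k.+1 - a k| <= 2^-1 ^+ k * s) ->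
  cvgn a /\ forall k, (k0 <= k)%N -> `|limn a - a k| <= 2 * 2^-1 ^+ k * s.
Proof.
move=> H; have H' k : `|a (k + k0).+1%N - a (k + k0)%N| <= 2^-1 ^+ k0 * s * 2^-1 ^+ k.
  by have := H (k + k0)%N (leq_addl _ _); rewrite exprD -mulrA mulrC.
have q : 0 <= (2^-1 : R) < 1 by rewrite invr_ge0 ler0n invf_lt1 ?ltr1n.
have [c1 c2] := geometric_cauchy (u := fun k => a (k + k0)%N) q H'.
have ca : a k @[k --> \oo] --> limn (fun k => a (k + k0)%N) by rewrite -(cvg_shiftn k0).
have la := cvg_lim (@Rhausdorff _) ca.
split=> [|k k0k]; first by apply/cvg_ex; eexists; exact: ca.
have := c2 (k - k0)%N; rewrite /= -la subnK // => h; apply: (le_trans h).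
rewrite -{2}(subnK k0k) exprD le_eqVlt; by apply/orP; left; apply/eqP; field.
Qed.

Section integrals.
Context d (T : measurableType d) {R : realType} (mu : {measure set T -> \bar R}).

Lemma integral_step (I : finType) (A : I -> set T) (a c : I -> R) :
  (forall i, measurable (A i)) -> (forall i, mu (A i) = (a i)%:E) ->
  mu.-integrable setT (fun z => (\sum_i c i * \1_(A i) z)%:E) /\
  (\int[mu]_z (\sum_i c i * \1_(A i) z)%:E = (\sum_i c i * a i)%:E)%E.
Proof.
move=> mA muA.
have int1 i : mu.-integrable setT (fun z => (\1_(A i) z)%:E).
  apply/integrableP; split; first by apply/measurable_EFinP; exact: measurable_indic.
  under eq_integral do rewrite gee0_abs ?lee_fin //.
  by rewrite integral_indic // setIT muA ltry.
have intc i : mu.-integrable setT (fun z => (c i * \1_(A i) z)%:E).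
  by under eq_fun do rewrite EFinM; exact: integrableZl.
have E : (fun z => (\sum_i c i * \1_(A i) z)%:E) = (fun z => (\sum_i (c i * \1_(A i) z)%:E)%E).
  by apply/funext => z; rewrite sumEFin.
rewrite E; split; first exact: integrable_sum.
rewrite integral_sum // -sumEFin; apply: eq_bigr => i _.
under eq_integral do rewrite EFinM.
by rewrite integralZl // integral_indic // setIT muA EFinM.
Qed.

(** The sum of the series of 4^k w_k, integrable because the powers of 4/8 are summable. One such
    function yields convergence almost everywhere, its rate and a majorant. *)
Lemma fast_sum (w : nat -> T -> R) (c : R) : 
  (forall k, measurable_fun setT (w k)) -> (forall k z, 0 <= w k z) ->
  (forall k, (\int[mu]_z (w k z)%:E <= (c * 8^-1 ^+ k)%:E)%E) ->
  exists W : T -> \bar R, [/\ measurable_fun setT W, forall z, (0 <= W z)%E,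
    (\int[mu]_z W z < +oo)%E & forall k z, ((4 ^+ k * w k z)%:E <= W z)%E].
Proof.
move=> mw w0 iw; pose f k z : \bar R := (4 ^+ k * w k z)%:E.
have f0 k z : (0 <= f k z)%E by rewrite lee_fin mulr_ge0 // exprn_ge0.
have mf k : measurable_fun setT (f k).
  by apply/measurable_EFinP; apply: measurable_funM => //; exact: measurable_cst.
exists (fun z => (\sum_(k <oo) f k z)%E); split.
- by apply: ge0_emeasurable_sum.
- by move=> z; apply: nneseries_ge0 => k _ _; exact: f0.
- rewrite integral_nneseries //; apply: (@le_lt_trans _ _ (2 * c)%:E); last exact: ltry.
  have c0 : 0 <= c.
    have := le_trans (integral_ge0 _ _) (iw 0%N); rewrite expr0 mulr1 lee_fin; apply.
    by move=> z _; rewrite lee_fin.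
  apply: lime_le; first by apply: is_cvg_nneseries => k _ _; apply: integral_ge0.
  apply: nearW => N.
  apply: (@le_trans _ _ (\sum_(0 <= k < N) c * 2^-1 ^+ k)%:E).
    rewrite -sumEFin; apply: lee_sum => k _.
    rewrite /f; under eq_integral do rewrite EFinM.
    rewrite ge0_integralZl_EFin //; last 2 first.
    - by move=> z _; rewrite lee_fin.
    - exact/measurable_EFinP.
    apply: (le_trans (lee_wpmul2l _ (iw k))); first by rewrite lee_fin exprn_ge0.
    by rewrite -EFinM lee_fin mulrCA -exprMn (_ : 4 * 8^-1 = 2^-1) //; field.
  rewrite lee_fin -mulr_sumr [leRHS]mulrC; apply: ler_wpM2l => //.
  have -> : \sum_(0 <= k < N) 2^-1 ^+ k = 2 * (1 - 2^-1 ^+ N) :> R.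
    elim: N => [|N IH]; first by rewrite big_nil expr0 subrr mulr0.
    by rewrite big_nat_recr //= IH exprS; field.
  have := exprn_ge0 N (_ : 0 <= 2^-1 :> R); rewrite invr_ge0 ler0n => /(_ isT); lra.
- move=> k z; rewrite (@nneseriesD1 _ (f ^~ z) k) //; first by rewrite leeDl // nneseries_ge0.

Qed.

Lemma Rdominated (f : nat -> T -> R) (f0 : T -> R) (g : T -> \bar R) :
  (forall k, measurable_fun setT (f k)) -> measurable_fun setT f0 ->
  {ae mu, forall z, f ^~ z @ \oo --> f0 z} -> mu.-integrable setT g ->
  {ae mu, forall z k, (`|(f k z)%:E| <= g z)%E} ->
  mu.-integrable setT (EFin \o f0) /\
  \int[mu]_z f k z @[k --> \oo] --> \int[mu]_z f0 z.
Proof.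
move=> mf mf0 fc ig fg.
have [i0 _ lim0] := @dominated_convergence _ _ _ mu setT measurableT (fun k => EFin \o f k)
  (EFin \o f0) g (fun k => (measurable_EFinP _ _).2 (mf k)) ((measurable_EFinP _ _).2 mf0)
  ltac:(by apply: filterS fc => z fz _; apply/cvg_EFin => //; exact: nearW)
  ig ltac:(by apply: filterS fg => z fz k _; exact: fz).
split=> //; apply: fine_cvg; rewrite /Rintegral fineK //; exact: integrable_fin_num.
Qed.

End integrals.

Lemma Rfubini d1 d2 (T1 : measurableType d1) (T2 : measurableType d2) (R : realType)
  (m1 : {sigma_finite_measure set T1 -> \bar R}) (m2 : {sigma_finite_measure set T2 -> \bar R})
  (f : T1 * T2 -> R) : (m1 \x m2)%E.-integrable setT (EFin \o f) ->
  \int[m2]_t \int[m1]_x f (x, t) = \int[(m1 \x m2)%E]_z f z.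
Proof.
move=> fi; have fi' : (m1 \x m2)%E.-integrable setT (fun z => (EFin \o f) z) by [].
rewrite [RHS]/Rintegral -(integral21_prod_meas1 fi') /Rintegral; congr fine.
apply: ae_eq_integral => //.
- apply/measurable_EFinP; apply: (measurableT_comp (@fine_measurable _ setT measurableT)).
  exact: (measurable_fubini_G fi').
- exact: (measurable_fubini_G fi').
- have := ae_integrable2 fi'; apply: filterS => t /= it _.
  by rewrite fineK // integrable_fin_num.
Qed.

(** * Strong convergence of convex combinations *)

Section convex_hull.
Context d (T : measurableType d) {R : realType} (mu : {measure set T -> \bar R}).
Variables (I : finType).
Local Notation V := (I -> T -> R).
Implicit Types (f : V).

(** Closure under midpoints is enough for the parallelogram identity, and dyadic weights spare the
    bookkeeping of coefficients. *)
Inductive hull (g : nat -> V) (N : nat) : V -> Prop :=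
| hull_gen k : (N <= k)%N -> hull g N (g k)
| hull_mid f1 f2 : hull g N f1 -> hull g N f2 ->
    hull g N (fun i z => (f1 i z + f2 i z) / 2).

Lemma hull_sub g N N' f : (N <= N')%N -> hull g N' f -> hull g N f.
Proof.
move=> NN'; elim=> [k Nk|f1 f2 _ h1 _ h2]; last exact: hull_mid.
by apply: hull_gen; exact: leq_trans Nk.
Qed.

Definition sqn f z : R := \sum_i f i z ^+ 2.

Lemma sqn_ge0 f z : 0 <= sqn f z.
Proof. by apply: sumr_ge0 => i _; exact: sqr_ge0. Qed.

Lemma measurable_sqn f : (forall i, measurable_fun setT (f i)) -> measurable_fun setT (sqn f).
Proof. by move=> mf; apply: measurable_sum => i; exact: measurable_funX. Qed.

Lemma sqn_mid f1 f2 z : sqn (fun i z => (f1 i z + f2 i z) / 2) z <= (sqn f1 z + sqn f2 z) / 2.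
Proof.
rewrite /sqn -big_split mulr_suml; apply: ler_sum => i _ /=.
by have := sqr_ge0 (f1 i z - f2 i z); lra.
Qed.

Lemma parallelogram f1 f2 z : sqn (fun i z => f2 i z - f1 i z) z +
  4 * sqn (fun i z => (f1 i z + f2 i z) / 2) z = 2 * (sqn f1 z + sqn f2 z).
Proof.
by rewrite /sqn -big_split !mulr_sumr -big_split /=; apply: eq_bigr => i _; field.
Qed.

Local Notation E f := (\int[mu]_z (sqn f z)%:E)%E.

Variables (g : nat -> V) (D : R).
Hypothesis mg : forall k i, measurable_fun setT (g k i).
Hypothesis gD : forall k, (E (g k) <= D%:E)%E.

Lemma hull_measurable N f : hull g N f -> forall i, measurable_fun setT (f i).
Proof.
elim=> [k _ i|f1 f2 _ h1 _ h2 i]; first exact: mg.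
by apply: measurable_funM; [apply: measurable_funD|exact: measurable_cst].
Qed.

Let mE f : (forall i, measurable_fun setT (f i)) ->
  measurable_fun setT (fun z => (sqn f z)%:E).
Proof. by move=> mf; apply/measurable_EFinP; exact: measurable_sqn. Qed.

Let E0 f : (0 <= E f)%E.
Proof. by apply: integral_ge0 => z _; rewrite lee_fin sqn_ge0. Qed.

Let ED f1 f2 : (forall i, measurable_fun setT (f1 i)) -> (forall i, measurable_fun setT (f2 i)) ->
  (\int[mu]_z (sqn f1 z + sqn f2 z)%:E = E f1 + E f2)%E.
Proof.
move=> m1 m2; under eq_integral do rewrite EFinD.
by rewrite ge0_integralD //; do ?[exact: mE|by move=> z _; rewrite lee_fin sqn_ge0].
Qed.

Let EZ c f : 0 <= c -> (forall i, measurable_fun setT (f i)) ->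
  (\int[mu]_z (c * sqn f z)%:E = c%:E * E f)%E.
Proof.
move=> c0 mf; under eq_integral do rewrite EFinM.
by rewrite ge0_integralZl_EFin //; do ?[exact: mE|by move=> z _; rewrite lee_fin sqn_ge0].
Qed.

Lemma hull_energy N f : hull g N f -> (E f <= D%:E)%E.
Proof.
elim=> [k _|f1 f2 H1 h1 H2 h2]; first exact: gD.
have m1 := hull_measurable H1; have m2 := hull_measurable H2.
apply: (@le_trans _ _ (\int[mu]_z (2^-1 * sqn f1 z + 2^-1 * sqn f2 z)%:E)%E).
  apply: ge0_le_integral => //.
  - by move=> z _; rewrite lee_fin sqn_ge0.
  - by apply: mE => i; apply: measurable_funM; [apply: measurable_funD|exact: measurable_cst].
  - by apply/measurable_EFinP; apply: measurable_funD; apply: measurable_funM; 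
      rewrite ?measurable_cst //; exact: measurable_sqn.
  - by move=> z _; rewrite lee_fin; apply: (le_trans (sqn_mid _ _ _)); lra.
under eq_integral do rewrite EFinD.
rewrite ge0_integralD //; last 4 first.
- by move=> z _; rewrite lee_fin mulr_ge0 ?sqn_ge0.
- by apply/measurable_EFinP; apply: measurable_funM; rewrite ?measurable_cst //; exact: measurable_sqn.
- by move=> z _; rewrite lee_fin mulr_ge0 ?sqn_ge0.
- by apply/measurable_EFinP; apply: measurable_funM; rewrite ?measurable_cst //; exact: measurable_sqn.
rewrite !EZ // ?invr_ge0 ?ler0n //.
have h : (0 <= (2^-1)%:E :> \bar R)%E by rewrite lee_fin invr_ge0.
apply: (le_trans (leeD (lee_wpmul2l h h1) (lee_wpmul2l h h2))).
by rewrite -EFinM -EFinD lee_fin; lra.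
Qed.

(* Nearly minimal elements of the shrinking convex hulls of the tails form a
   Cauchy sequence, by the parallelogram identity. *)
Lemma hull_cauchy : exists f : nat -> V, (forall k, hull g k (f k)) /\
  forall k, (E (fun i z => f k.+1 i z - f k i z)%R <= (6 * 8^-1 ^+ k)%:E)%E.
Proof.
pose e f := fine (E f).
have Ee N f : hull g N f -> E f = (e f)%:E.
  move=> hf; rewrite fineK // ge0_fin_numE //; exact: le_lt_trans (hull_energy hf) (ltry _).
have e0 f : 0 <= e f by exact: fine_ge0.
have eD N f : hull g N f -> e f <= D.
  by move=> hf; rewrite -lee_fin -(Ee _ _ hf); exact: hull_energy hf.
pose S N := [set e f | f in hull g N].
have S0 N : S N !=set0 by exists (e (g N)); exists (g N) => //; exact: hull_gen.
have lS N : has_lbound (S N) by exists 0 => _ [f _ <-].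
have hS N : has_inf (S N) by split.
pose dd N := inf (S N).
have dle N f : hull g N f -> dd N <= e f.
  by move=> hf; apply: ge_inf => //; exists f.
have dD N : dd N <= D.
  by apply: le_trans (dle N (g N) _) (eD N _ _); exact: hull_gen.
have dmono N N' : (N <= N')%N -> dd N <= dd N'.
  by move=> NN'; apply: lb_le_inf => // _ [f hf <-]; apply: dle; exact: hull_sub hf.
pose ds := sup (range dd).
have hsup : has_sup (range dd) by split; [exists (dd 0%N); exists 0%N|exists D => _ [N _ <-]].
have dk k : 0 < (8^-1 : R) ^+ k by rewrite exprn_gt0.
have /choice[M HM] : forall k, exists M, ds - 8^-1 ^+ k < dd M.
  move=> k; have [_ [M _ <-] h] := sup_adherent (dk k) hsup; by exists M.
(* The partial sums make [N] nondecreasing while it stays above k and [M k]. *)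
pose N k := (k + \sum_(i < k.+1) M i)%N.
have MN k : (M k <= N k)%N by rewrite /N big_ord_recr /= !addnA leq_addl.
have NN k : (N k <= N k.+1)%N.
  by rewrite /N [X in (_ <= _ + X)%N]big_ord_recr /= addSn; apply: leqW; rewrite addnA leq_addr.
have /choice[f Hf] : forall k, exists f, hull g (N k) f /\ e f < dd (N k) + 8^-1 ^+ k.
  by move=> k; have [_ [f hf <-] h] := inf_adherent (dk k) (hS (N k)); exists f.
exists f; split=> k; first by apply: hull_sub (Hf k).1; exact: leq_addr.
have [h1 e1] := Hf k; have [h2 e2] := Hf k.+1; have h2' := hull_sub (NN k) h2.
have h3 := hull_mid h1 h2'.
have m1 := hull_measurable h1; have m2 := hull_measurable h2.
have m3 := hull_measurable h3.
have m4 i : measurable_fun setT (fun z => f k.+1 i z - f k i z) by exact: measurable_funB.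
have := ED (f1 := fun i z => f k.+1 i z - f k i z)
  (f2 := fun i z => 2 * ((f k i z + f k.+1 i z) / 2)) m4 (fun i => measurable_funM (@measurable_cst _ _ _ _ setT (2 : R)) (m3 i)).
have q4 z : sqn (fun i z => 2 * ((f k i z + f k.+1 i z) / 2)) z =
    4 * sqn (fun i z => (f k i z + f k.+1 i z) / 2) z.
  by rewrite /sqn mulr_sumr; apply: eq_bigr => i _; ring.
under eq_integral do rewrite q4 parallelogram mulrDr.
under [in X in (_ = _ + X)%E -> _]eq_integral do rewrite q4.
under eq_integral do rewrite EFinD.
rewrite ge0_integralD //; last 4 first.
- by move=> z _; rewrite lee_fin mulr_ge0 ?sqn_ge0.
- by apply/measurable_EFinP; apply: measurable_funM; rewrite ?measurable_cst //; exact: measurable_sqn.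
- by move=> z _; rewrite lee_fin mulr_ge0 ?sqn_ge0.
- by apply/measurable_EFinP; apply: measurable_funM; rewrite ?measurable_cst //; exact: measurable_sqn.
rewrite !EZ // (Ee _ _ h1) (Ee _ _ h2) (Ee _ _ h3).
(* The midpoint has energy at least [dd (N k)], and [dd (N k.+1)] exceeds this by less than 8^-k; in
   all 17/4 of 8^-k, below 6. *)
have d3 := dle _ _ h3; have dS : dd (N k.+1) <= ds by apply: sup_upper_bound => //; exists (N k.+1).
have dM := dmono _ _ (MN k); have hM := HM k.
move: (E _) (E0 (fun i z => f k.+1 i z - f k i z)) => X.
case: X => [x| |] //= x0 h; rewrite lee_fin.
move: h => /eqP; rewrite -!EFinM -!EFinD eqe => /eqP h.
have := exprS (8^-1 : R) k; have := dk k; move: h d3 dS dM hM e1 e2; lra.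
Qed.

End convex_hull.

(** * Lattice functions as step functions in space and time *)

Section embedding.
Context {R : realType} (n : nat).
Local Notation Rn := 'rV[R]_n.

Lemma rV_norm_le (x : Rn) (e : R) : 0 <= e -> (forall i, `|x 0 i| <= e) -> `|x| <= e.
Proof.
move=> e0 xe; rewrite /Num.Def.normr /= mx_normrE; apply/bigmax_leP; split=> // -[j i] _ /=.
by rewrite (ord1 j); exact: xe.
Qed.

Lemma rV_coord_le (x : Rn) i : `|x 0 i| <= `|x|.
Proof.
rewrite [leRHS]/Num.Def.normr /= mx_normrE.
exact: (@le_bigmax _ _ _ 0 (fun k : 'I_1 * 'I_n => `|x k.1 k.2|) (0, i)).
Qed.

Section level.
Variable l : nat.
Local Notation half := (4 ^ l)%N.
Definition mesh : R := 2^-1 ^+ l.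
(** Level l has mesh 2^-l on the box of half-side 2^l, hence twice 4^l points per direction; [top]
    shifts this number to fit the type ['I_P.+2]. *)
Definition top : nat := (2 * 4 ^ l).-2.
Local Notation G := {ffun 'I_n -> 'I_top.+2}.
Local Notation h := mesh.

Lemma topE : top.+2 = (2 * half)%N.
Proof.
have : (0 < half)%N by rewrite expn_gt0.
by rewrite /top; case: (half) => // k _; rewrite mulnS. Qed.

Lemma mesh_gt0 : 0 < h. Proof. by rewrite exprn_gt0. Qed.

Lemma mesh2 : h ^+ 2 = (4 ^+ l)^-1.
Proof. by rewrite /h -exprM mulnC exprM -exprVn; congr (_ ^+ _); field. Qed.

Lemma mesh_half : h * half%:R = 2 ^+ l.
Proof. by rewrite /h natrX -exprMn; congr (_ ^+ _); field. Qed.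

Definition inrange (s : R) : bool := - 2 ^+ l <= s < 2 ^+ l.
Definition inbox (y : Rn) : bool := [forall i, inrange (y 0 i)].
(** Out of range, [absz] and [inZp] return meaningless values; [idx] matters only under [inbox]. *)
Definition cell_coord (s : R) : 'I_top.+2 := inZp (absz (Num.floor (2 ^+ l * s) + half%:Z)%R).
Definition idx (y : Rn) : G := [ffun i => cell_coord (y 0 i)].
Definition corner (y : Rn) : Rn := \row_i (h * (Num.floor (2 ^+ l * y 0 i))%:~R).
Definition node (x : G) : Rn := \row_i (h * ((x i)%:R - half%:R)).
Definition emb (F : G -> R) (y : Rn) : R := if inbox y then F (idx y) else 0.

Definition cell_side (k : nat) : set (measurableTypeR R) :=
  `[h * (k%:R - half%:R), h * (k%:R - half%:R) + h[.
Definition cell (x : G) : set Rn := [set y | forall i, cell_side (x i) (y 0 i)].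

Let hK : h * 2 ^+ l = 1 :> R.
Proof. by rewrite /h -exprMn mulVf ?expr1n. Qed.

Let scale (s : R) : s = h * (2 ^+ l * s).
Proof. by rewrite mulrA hK mul1r. Qed.

Lemma floor_range s : inrange s -> [/\ (0 <= Num.floor (2 ^+ l * s) + half%:Z)%R,
  (absz (Num.floor (2 ^+ l * s) + half%:Z)%R < top.+2)%N &
  (cell_coord s)%:R - half%:R = (Num.floor (2 ^+ l * s))%:~R :> R].
Proof.
move=> /andP[s1 s2]; have p0 : 0 < (2 : R) ^+ l by rewrite exprn_gt0.
have pp : (2 : R) ^+ l * 2 ^+ l = half%:R by rewrite natrX -exprMn; congr (_ ^+ _); ring.
have f1 : - half%:Z <= Num.floor (2 ^+ l * s).
  by rewrite floor_ge_int mulrNz -pmulrn -pp -mulrN ler_pM2l.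
have f2 : Num.floor (2 ^+ l * s) < half%:Z.
  by rewrite floor_lt_int -pmulrn -pp ltr_pM2l.
have e0 : 0 <= Num.floor (2 ^+ l * s) + half%:Z by rewrite -lerBlDr sub0r.
have lt : (absz (Num.floor (2 ^+ l * s) + half%:Z)%R < top.+2)%N.
  by rewrite topE -ltz_nat gez0_abs // mul2n -addnn PoszD ltrD2r.
split=> //; rewrite /cell_coord /= modn_small // natr_absz ger0_norm // rmorphD /=.
by rewrite -pmulrn addrK.
Qed.

Lemma node_idx y : inbox y -> node (idx y) = corner y.
Proof.
move=> /forallP yb; apply/rowP => i; rewrite !mxE ffunE.
by have [_ _ ->] := floor_range (yb i).
Qed.

Lemma corner_bound y i : corner y 0 i <= y 0 i < corner y 0 i + h.
Proof.
rewrite mxE [X in _ <= X](scale (y 0 i)) [X in X < _](scale (y 0 i)) -[X in _ + X]mulr1 -mulrDr.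
rewrite ler_pM2l ?mesh_gt0 // ltr_pM2l ?mesh_gt0 //.
by have := floor_itv (2 ^+ l * y 0 i); rewrite intrD.
Qed.

Lemma corner_dist y : `|corner y - y| <= h.
Proof.
apply: rV_norm_le => [|i]; first exact: ltW mesh_gt0.
have := corner_bound y i; rewrite !mxE => /andP[h1 h2].
by rewrite ler_norml; apply/andP; split; lra.
Qed.

Lemma cellP x y : cell x y <-> inbox y /\ idx y = x.
Proof.
have p0 : 0 < (2 : R) ^+ l by rewrite exprn_gt0.
split=> [cxy|[/forallP yb <-] i]; last first.
  rewrite /cell_side /= in_itv /= ffunE; have [_ _ ->] := floor_range (yb i).
  by have := corner_bound y i; rewrite mxE.
have F i : Num.floor (2 ^+ l * y 0 i) = (x i)%:Z - half%:Z.
  apply: floor_def; have := cxy i; rewrite /cell_side /= in_itv /= => /andP[h1 h2].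
  rewrite !intrD mulrNz -!pmulrn -(ler_pM2l mesh_gt0) -(ltr_pM2l mesh_gt0).
  by rewrite -scale h1 [X in _ < X]mulrDr mulr1 h2.
have yb : inbox y.
  apply/forallP => i; have := cxy i; rewrite /cell_side /= in_itv /= => /andP[h1 h2].
  rewrite /inrange; apply/andP; split.
    apply: le_trans h1; rewrite mulrBr mesh_half -[leLHS]add0r lerD2r.
    by rewrite mulr_ge0 // ltW ?mesh_gt0.
  apply: (lt_le_trans h2); rewrite -[X in _ + X]mulr1 -mulrDr -mesh_half ler_pM2l ?mesh_gt0 //.
  have : ((x i).+1)%:R <= (2 * half)%:R :> R by rewrite ler_nat -topE; exact: ltn_ord.
  by rewrite -natr1 natrM; lra.
split=> //; apply/ffunP => i; rewrite ffunE; apply: val_inj => /=.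
rewrite /cell_coord F subrK /= modn_small //; exact: ltn_ord.
Qed.

Lemma embE F y : emb F y = \sum_x F x * \1_(cell x) y.
Proof.
rewrite /emb; case: ifPn => [yb|yb].
  rewrite (bigD1 (idx y)) //= [in F _ * _]indicE mem_set ?mulr1; last by apply/cellP.
  rewrite big1 ?addr0 // => x xy; rewrite indicE memNset ?mulr0 // => /cellP[_ e].
  by rewrite e eqxx in xy.
rewrite big1 // => x _; rewrite indicE memNset ?mulr0 // => /cellP[yb' _].
by rewrite yb' in yb.
Qed.

Lemma measurable_cell x : measurable (cell x).
Proof.
rewrite (_ : cell x = \bigcap_(i in [set: 'I_n]) (rV_coord i @^-1` cell_side (x i))).
  apply: fin_bigcap_measurable => // i _; rewrite -[X in measurable X]setTI.
  by apply: measurable_rV_coord => //; exact: measurable_itv.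
by apply/seteqP; split => y /= Ay i; [move=> _|]; exact: Ay.
Qed.

Lemma measure_cell x : lebesgue_rV R n (cell x) = (h ^+ n)%:E.
Proof.
rewrite (@lebesgue_rV_box R n (fun i => cell_side (x i))) => [|i]; last exact: measurable_itv.
rewrite (eq_bigr (fun=> h%:E)) ?prodEFin ?prodr_const ?card_ord // => i _.
rewrite /cell_side lebesgue_measure_itv /= lte_fin ltrDl mesh_gt0 -EFinB.
by rewrite addrAC subrr add0r.
Qed.

Lemma integral_emb F : (lebesgue_rV R n).-integrable setT (fun y => (emb F y)%:E) /\
  (\int[lebesgue_rV R n]_y (emb F y)%:E = (h ^+ n * \sum_x F x)%:E)%E.
Proof.
have -> : (fun y => (emb F y)%:E) = (fun y => (\sum_x F x * \1_(cell x) y)%:E).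
  by apply/funext => y; rewrite embE.
have [i1 i2] := integral_step F measurable_cell measure_cell.
by split=> //; rewrite i2 -mulr_suml mulrC.
Qed.

Lemma measurable_emb F : measurable_fun setT (emb F).
Proof. by have [/integrableP[/measurable_EFinP]] := integral_emb F. Qed.

(** With time step 4^-l this reaches the time 2^l. *)
Definition nsteps : nat := (8 ^ l)%N.
Definition step_of (t : R) : nat := Num.trunc (4 ^+ l * t).
Definition intime (t : R) : bool := (0 <= t) && (t < 2 ^+ l).
Definition slot (j : nat) : set (measurableTypeR R) :=
  `[j%:R * h ^+ 2, j.+1%:R * h ^+ 2[.
Definition st (F : nat -> G -> R) (z : Rn * measurableTypeR R) : R :=
  if intime z.2 then emb (F (step_of z.2)) z.1 else 0.

Let h20 : 0 < h ^+ 2. Proof. by rewrite exprn_gt0 // mesh_gt0. Qed.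
Let scale2 (t : R) : t = 4 ^+ l * t * h ^+ 2.
Proof. by rewrite mesh2 mulrAC mulfV ?mul1r // expf_neq0. Qed.

Lemma step_of_bound t : 0 <= t -> (step_of t)%:R * h ^+ 2 <= t < (step_of t).+1%:R * h ^+ 2.
Proof.
move=> t0; rewrite {2}(scale2 t) {3}(scale2 t) ler_pM2r // ltr_pM2r //.
by apply: truncn_itv; rewrite mulr_ge0 // exprn_ge0.
Qed.

Lemma slotP j t : slot j t <-> 0 <= t /\ step_of t = j.
Proof.
rewrite /slot /= in_itv /=; split=> [/andP[h1 h2]|[t0 <-]]; last first.
  exact: step_of_bound.
have t0 : 0 <= t by apply: le_trans h1; rewrite mulr_ge0 // ltW.
split=> //; apply: truncn_def; rewrite -(ler_pM2r h20) -(ltr_pM2r h20) -scale2.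
by rewrite h1.
Qed.

Lemma intimeE t : intime t = (0 <= t) && (step_of t < nsteps)%N.
Proof.
rewrite /intime; have [t0|//] /= := boolP (0 <= t).
rewrite /step_of truncn_lt_nat ?mulr_ge0 ?exprn_ge0 // /nsteps natrX.
have E : 8 ^+ l = 4 ^+ l * 2 ^+ l :> R by rewrite -exprMn; congr (_ ^+ _); ring.
by rewrite E ltr_pM2l ?exprn_gt0.
Qed.

Lemma measure_slot j : lebesgue_measure (slot j) = (h ^+ 2)%:E.
Proof.
rewrite /slot lebesgue_measure_itv /= lte_fin -natr1 mulrDl mul1r ltrDl h20 -EFinB.
by rewrite addrAC subrr add0r.
Qed.

Lemma stE F z : st F z =
  \sum_(p : 'I_nsteps * G) F p.1 p.2 * \1_(cell p.2 `*` slot p.1) z.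
Proof.
have I (p : 'I_nsteps * G) : \1_(cell p.2 `*` slot p.1) z = \1_(cell p.2) z.1 * \1_(slot p.1) z.2 :> R.
  by rewrite !indicE in_setX; case: (_ \in _); case: (_ \in _); rewrite /= ?mulr1 ?mulr0.
under eq_bigr do rewrite I.
rewrite -(pair_bigA _ (fun j x => F (nat_of_ord j) x * (\1_(cell x) z.1 * \1_(slot j) z.2))) /=.
rewrite /st intimeE; case: ifPn => [/andP[t0 tj]|tj].
  rewrite (bigD1 (Ordinal tj)) //= [X in _ + X]big1 ?addr0 => [|j jt].
    rewrite embE; apply: eq_bigr => x _; rewrite [\1_(slot _) _]indicE mem_set ?mulr1 //.
    by apply/slotP.
  apply: big1 => x _; rewrite [\1_(slot _) _]indicE memNset ?mulr0 // => /slotP[_ e].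
  by case/negP: jt; apply/eqP/val_inj.
rewrite big1 // => j _; apply: big1 => x _; rewrite [\1_(slot _) _]indicE memNset ?mulr0 //.
by move=> /slotP[t0 e]; case/negP: tj; rewrite t0 e ltn_ord.
Qed.

Local Notation mu2 := (lebesgue_rV R n \x (@lebesgue_measure R))%E.

Lemma integral_st F : mu2.-integrable setT (fun z => (st F z)%:E) /\
  (\int[mu2]_z (st F z)%:E = (\sum_(j < nsteps) h ^+ 2 * (h ^+ n * \sum_x F j x))%:E)%E.
Proof.
have mA (p : 'I_nsteps * G) : measurable (cell p.2 `*` slot p.1).
  by apply: measurableX; [exact: measurable_cell|exact: measurable_itv].
have muA (p : 'I_nsteps * G) : mu2 (cell p.2 `*` slot p.1) = (h ^+ n * h ^+ 2)%:E.
  rewrite product_measure1E //; [|exact: measurable_cell|exact: measurable_itv].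
  rewrite EFinM; congr (_ * _)%E; first exact: measure_cell.
  exact: measure_slot.
have -> : (fun z => (st F z)%:E) =
    (fun z => (\sum_(p : 'I_nsteps * G) F p.1 p.2 * \1_(cell p.2 `*` slot p.1) z)%:E).
  by apply/funext => z; rewrite stE.
have [i1 i2] := integral_step (fun p : 'I_nsteps * G => F p.1 p.2) mA muA.
split=> //; rewrite i2; congr EFin.
rewrite -(pair_bigA _ (fun j x => F (nat_of_ord j) x * (h ^+ n * h ^+ 2))) /=.
by apply: eq_bigr => j _; rewrite -mulr_suml; ring.
Qed.

Lemma measurable_st F : measurable_fun setT (st F).
Proof. by have [/integrableP[/measurable_EFinP]] := integral_st F. Qed.

End level.
End embedding.

Lemma integral_leD d (T : measurableType d) (R : realType) (mu : {measure set T -> \bar R})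
  (f g1 g2 : T -> R) (c1 c2 : R) :
  measurable_fun setT f -> measurable_fun setT g1 -> measurable_fun setT g2 ->
  (forall z, 0 <= g1 z) -> (forall z, 0 <= g2 z) -> (forall z, 0 <= f z <= g1 z + g2 z) ->
  (\int[mu]_z (g1 z)%:E <= c1%:E)%E -> (\int[mu]_z (g2 z)%:E <= c2%:E)%E ->
  (\int[mu]_z (f z)%:E <= (c1 + c2)%:E)%E.
Proof.
move=> mf m1 m2 p1 p2 fg i1 i2; apply: (@le_trans _ _ (\int[mu]_z ((g1 z)%:E + (g2 z)%:E))%E).
  apply: ge0_le_integral => //.
  - by move=> z _; rewrite lee_fin; case/andP: (fg z).
  - exact/measurable_EFinP.
  - by apply: emeasurable_funD; exact/measurable_EFinP.
  - by move=> z _; rewrite -EFinD lee_fin; case/andP: (fg z).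
rewrite ge0_integralD //; try exact/measurable_EFinP.
- by rewrite EFinD; exact: leeD.
- by move=> z _; rewrite lee_fin.
- by move=> z _; rewrite lee_fin.
Qed.

(** * Extraction of a fast subsequence *)

Lemma pigeonhole_infinite (F : finType) (c : nat -> F) (S : set nat) :
  (forall N, exists2 l, (N <= l)%N & S l) ->
  exists x, forall N, exists2 l, (N <= l)%N & S l /\ c l = x.
Proof.
move=> infS; apply: contrapT => H.
have /choice[B HB] : forall x : F, exists N, forall l, (N <= l)%N -> S l -> c l <> x.
  move=> x; apply: contrapT => Hx; apply: H; exists x => N; apply: contrapT => HN.
  apply: Hx; exists N => l Nl Sl cl; apply: HN; by exists l.
have [l Nl Sl] := infS (\max_x B x)%N.
by apply: (HB (c l) l _ Sl erefl); apply: leq_trans Nl; exact: leq_bigmax.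
Qed.

(** Total boundedness in combinatorial form: at each precision p, late levels of the same colour are
    close, and there are finitely many colours. Nested infinite colour classes give a diagonal
    sequence, of which only consecutive terms are compared. *)
Lemma cauchy_extract (close : nat -> nat -> nat -> Prop) (low : nat -> nat) :
  (forall p, exists (F : finType) (c : nat -> F) (L : nat), forall l l',
     (L <= l)%N -> (L <= l')%N -> c l = c l' -> close p l l') ->
  exists phi : nat -> nat, forall k,
    [/\ (low k <= phi k)%N, (phi k < phi k.+1)%N & close k (phi k) (phi k.+1)].
Proof.
move=> H; pose inf (S : set nat) := forall N, exists2 l, (N <= l)%N & S l.
have step p (S : set nat) : exists S' : set nat, inf S ->
    [/\ inf S', S' `<=` S & forall l l', S' l -> S' l' -> close p l l'].
  have [infS|] := pselect (inf S); last by exists S.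
  have [F [c [L HL]]] := H p; have [x Hx] := pigeonhole_infinite c infS.
  exists [set l | [/\ S l, c l = x & (L <= l)%N]] => _; split.
  - move=> N; have [l Nl [Sl cl]] := Hx (maxn N L).
    by exists l; [exact: leq_trans (leq_maxl _ _) Nl|split=> //; exact: leq_trans (leq_maxr _ _) Nl].
  - by move=> l [].
  - by move=> l l' [_ cl Ll] [_ cl' Ll']; apply: HL => //; rewrite cl cl'.
have /choice[nx Hnx] : forall pS : nat * set nat, exists S', inf pS.2 ->
    [/\ inf S', S' `<=` pS.2 & forall l l', S' l -> S' l' -> close pS.1 l l'].
  by move=> [p S]; exact: step.
pose Sq := fix Sq k := if k is k'.+1 then nx (k'.+1, Sq k') else nx (0%N, setT).
have infT : inf setT by move=> N; exists N.
have HS k : inf (Sq k) /\ forall l l', Sq k l -> Sq k l' -> close k l l'.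
  elim: k => [|k [IH _]] /=; first by have [] := Hnx (0%N, setT) infT.
  by have [] := Hnx (k.+1, Sq k) IH.
have Ssub k : Sq k.+1 `<=` Sq k by have [] := Hnx (k.+1, Sq k) (HS k).1.
have /choice[pick Hp] : forall kN : nat * nat, exists l, (kN.2 <= l)%N /\ Sq kN.1 l.
  by move=> [k N]; have [l] := (HS k).1 N; exists l.
pose phi := fix phi k := if k is k'.+1 then pick (k'.+1, maxn (low k'.+1) (phi k').+1)
  else pick (0%N, low 0%N).
have Sphi k : Sq k (phi k).
  by case: k => [|k] /=; [have [] := Hp (0%N, low 0%N)|have [] := Hp (k.+1, maxn (low k.+1) (phi k).+1)].
exists phi => k; split.
- case: k => [|k] /=; first by have [] := Hp (0%N, low 0%N).
  by have [+ _] := Hp (k.+1, maxn (low k.+1) (phi k).+1); apply: leq_trans; exact: leq_maxl.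
- by have [+ _] := Hp (k.+1, maxn (low k.+1) (phi k).+1); apply: leq_trans; exact: leq_maxr.
- by apply: (HS k).2 => //; apply: Ssub.
Qed.

Lemma pow4_large (R : realType) (X e : R) : 0 < e -> exists a : nat, X <= e * 4 ^+ a.
Proof.
move=> e0; exists (Num.trunc `|X / e|).+1; rewrite mulrC -ler_pdivrMr //.
have h0 : 0 <= `|X / e| by [].
have /andP[_ h] := truncn_itv h0; apply: (le_trans (ler_norm _)); apply: (le_trans (ltW h)).
by rewrite -natrX ler_nat ltnW // ltn_expl.
Qed.

(** * Coarse cells inside a finer lattice *)

Section refinement.
Context {R : realType} (n : nat).
Variables (p l : nat).
Hypothesis pl : (p <= l)%N.
Local Notation Gp := {ffun 'I_n -> 'I_(top p).+2}.
Local Notation G := {ffun 'I_n -> 'I_(top l).+2}.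
Local Notation r := (2 ^ (l - p))%N.
Local Notation s := (4 ^ (l - p))%N.
Local Notation Rn := 'rV[R]_n.

(** The lowest fine point of a coarse cell. Indices are counted from the corner of the box, which
    moves with the level: the index is r (X - 4^p) + 4^l, and 4^l = r 2^(l+p). *)
Definition up (X : Gp) : G := [ffun i => inZp (r * (X i + 2 ^ (l + p) - 4 ^ p))].

Lemma step_of_coarse (t : R) : 0 <= t -> step_of p t = (step_of l t %/ s)%N.
Proof.
move=> t0; have s0 : (0 < s)%N by rewrite expn_gt0.
have h0 : 0 <= 4 ^+ l * t by rewrite mulr_ge0 // exprn_ge0.
have e : 4 ^+ l * t = 4 ^+ p * t * s%:R by rewrite natrX mulrAC -exprD subnKC.
apply: truncn_def; have /andP[h1 h2] := truncn_itv h0; rewrite -/(step_of l t) in h1 h2.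
have sr : 0 < s%:R :> R by rewrite ltr0n.
apply/andP; split.
  rewrite -(ler_pM2r sr) -e; apply: le_trans h1; rewrite -natrM ler_nat; exact: leq_divM.
rewrite -(ltr_pM2r sr) -e; apply: (lt_le_trans h2); rewrite -natrM ler_nat.
exact: ltn_ceil.
Qed.

Lemma inrange_coarse (y : R) : inrange p y -> inrange l y.
Proof.
move=> /andP[h1 h2]; have h : (2 : R) ^+ p <= 2 ^+ l by rewrite ler_eXn2l // ltr1n.
by apply/andP; split; lra.
Qed.

Lemma idx_coarse (y : Rn) : inbox p y ->
  idx l y - offset r (idx l y) = up (idx p y).
Proof.
move=> /forallP yb; apply/eqP; rewrite subr_eq; apply/eqP/ffunP => i; rewrite !ffunE.
have [f0 fl ef] := floor_range (yb i); have [F0 Fl eF] := floor_range (inrange_coarse (yb i)).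
rewrite /cell_coord.
set X := absz (_ + (4 ^ p)%N%:Z); set x := absz (_ + (4 ^ l)%N%:Z).
have eX : (X : int) = Num.floor (2 ^+ p * y 0 i) + (4 ^ p)%N by rewrite /X gez0_abs.
have ex : (x : int) = Num.floor (2 ^+ l * y 0 i) + (4 ^ l)%N by rewrite /x gez0_abs.
have r0 : (0 < r)%N by rewrite expn_gt0.
have rr : 0 < r%:R :> R by rewrite ltr0n.
have e : 2 ^+ l * y 0 i = 2 ^+ p * y 0 i * r%:R by rewrite natrX mulrAC -exprD subnKC.
have e22 k : (4 ^ k = 2 ^ (2 * k))%N by rewrite expnM.
have p42 : (4 ^ p <= 2 ^ (l + p))%N.
  by rewrite e22 leq_exp2l // mul2n -addnn leq_add2r.
have e4 : (r * 2 ^ (l + p))%N = (4 ^ l)%N.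
  by rewrite -expnD e22; congr (_ ^ _)%N; lia.
set f := Num.floor (2 ^+ p * y 0 i) in eX *; set F := Num.floor (2 ^+ l * y 0 i) in ex *.
have /andP[a1 a2] := floor_itv (2 ^+ p * y 0 i); rewrite -/f in a1 a2.
have b1 : f * r%:Z <= F.
  by rewrite floor_ge_int e intrM -pmulrn ler_pM2r.
have b2 : F < (f + 1) * r%:Z.
  by rewrite floor_lt_int e intrM -pmulrn ltr_pM2r.
have key : exists2 o : nat, (o < r)%N & x = (r * (X + 2 ^ (l + p) - 4 ^ p) + o)%N.
  exists (absz (F - f * r%:Z)%R); first by rewrite -ltz_nat gez0_abs ?subr_ge0 //; lia.
  apply/eqP; rewrite -eqz_nat PoszD gez0_abs ?subr_ge0 // PoszM -subzn; last first.
    by apply: leq_trans p42 _; exact: leq_addl.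
  rewrite PoszD eX ex -e4 PoszM; apply/eqP; ring.
have [k0 klt xE] := key.
set Q := (r * _)%N in xE *.
have xo : ((Q + k0) %% r = k0)%N by rewrite /Q mulnC modnMDl modn_small.
have tx : (Q + k0 < (top l).+2)%N by rewrite -xE.
have -> : nat_of_ord (inZp X : 'I_(top p).+2) = X by rewrite /= modn_small.
rewrite -/Q xE.
apply: val_inj => /=; rewrite (modn_small tx) xo modnDml modnDmr (modn_small tx).
by [].
Qed.

End refinement.

(** * Restriction to boxes and time intervals *)

Section masks.
Context {R : realType} (n : nat).
Local Notation Rn := 'rV[R]_n.
Local Notation G l := {ffun 'I_n -> 'I_(top l).+2}.
Local Notation mu := (lebesgue_rV R n).
Local Notation mu2 := (mu \x (@lebesgue_measure R))%E.

Lemma sum_truncated (f : nat -> R) (N M : nat) : (forall j, 0 <= f j) ->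
  \sum_(j < N) (if (j < M)%N then f j else 0) <= \sum_(j < M) f j.
Proof.
move=> f0; rewrite -big_mkcond /=; have [NM|MN] := leqP N M.
  rewrite (big_ord_widen_cond M (fun j => (j < M)%N) f NM) big_mkcond /=.
  by apply: ler_sum => j _; case: ifP.
rewrite (big_ord_widen_cond N xpredT f (ltnW MN)) /=.
exact: lexx.
Qed.

(** The bound 2^a is a multiple of the mesh, so a box of level a is a union of grid cells of every
    level, and restricting a step function to it leaves a step function. *)
Lemma inrange_corner l a (y : Rn) i : inrange a (corner l y 0 i) = inrange a (y 0 i).
Proof.
have h0 := @mesh_gt0 R l; have e : @mesh R l * 2 ^+ l = 1 by rewrite /mesh -exprMn mulVf ?expr1n.
have p0 : 0 < (2 : R) ^+ l by rewrite exprn_gt0.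
have F (k : int) : (k%:~R <= 2 ^+ l * y 0 i) = (k%:~R <= 2 ^+ l * corner l y 0 i).
  by rewrite mxE mulrA [2 ^+ l * mesh l]mulrC e mul1r ler_int floor_ge_int.
have E : 2 ^+ a = @mesh R l * (2 ^ (a + l))%N%:Z%:~R.
  by rewrite -pmulrn natrX exprD mulrCA e mulr1.
have S (s : R) : (2 ^+ a <= s) = ((2 ^ (a + l))%N%:Z%:~R <= 2 ^+ l * s).
  by rewrite -[RHS](ler_pM2l h0) -E mulrA e mul1r.
have S' (s : R) : (- 2 ^+ a <= s) = ((- (2 ^ (a + l))%N%:Z)%:~R <= 2 ^+ l * s).
  by rewrite -[RHS](ler_pM2l h0) mulrNz mulrN -E mulrA e mul1r.
by rewrite /inrange !ltNge !S !S' !F.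
Qed.

Lemma inbox_corner l a (y : Rn) : inbox a (corner l y) = inbox a y.
Proof. by apply/forallP/forallP => H i; have := H i; rewrite inrange_corner. Qed.

Lemma st_if l (b : nat -> G l -> bool) (f : nat -> G l -> R) z :
  st (fun j (x : G l) => if b j x then f j x else 0) z =
  if b (step_of l z.2) (idx l z.1) then st f z else 0.
Proof.
by rewrite /st /emb; case: ifP => _; case: ifP => _ //; case: ifP.
Qed.

Definition before (T : nat) (t : R) : bool := (0 <= t) && (t < T%:R).

Lemma beforeE l T (t : R) : before T t = (0 <= t) && (step_of l t < T * 4 ^ l)%N.
Proof.
rewrite /before; have [t0|//] /= := boolP (0 <= t).
rewrite /step_of truncn_lt_nat ?mulr_ge0 ?exprn_ge0 //.
by rewrite natrM natrX mulrC ltr_pM2r ?exprn_gt0.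
Qed.

Lemma st_neg l (f : nat -> G l -> R) z : z.2 < 0 -> st f z = 0.
Proof. by move=> z0; rewrite /st /intime leNgt z0. Qed.

Lemma st_mask l a T (c : bool) (f : nat -> G l -> R) z :
  (if before T z.2 && (inbox a z.1 == c) then st f z else 0) =
  st (fun j (x : G l) => if (j < T * 4 ^ l)%N && (inbox a (@node R n l x) == c) then f j x else 0) z.
Proof.
rewrite (st_if (fun j (x : G l) => (j < T * 4 ^ l)%N && (inbox a (@node R n l x) == c))).
rewrite (beforeE l); have [z0|z0] := leP 0 z.2; last by rewrite st_neg // !if_same.
rewrite andTb; have [zb|zb] := boolP (inbox l z.1).
  by rewrite (node_idx zb) inbox_corner.
by rewrite /st /emb (negbTE zb) !if_same.
Qed.

Definition box a : set Rn := [set y | inbox a y].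

Lemma boxE a : box a = [set y | forall i, ([set` `[- 2 ^+ a, 2 ^+ a[%R] : set (measurableTypeR R)) (y 0 i)].
Proof.
apply/seteqP; split=> y /= H; first by move=> i; move/forallP: H => /(_ i); rewrite in_itv.
by apply/forallP => i; have := H i; rewrite in_itv.
Qed.

Lemma measurable_box a : measurable (box a).
Proof.
rewrite (_ : box a = \bigcap_(i in [set: 'I_n]) (rV_coord i @^-1` [set` `[- 2 ^+ a, 2 ^+ a[%R])).
  apply: fin_bigcap_measurable => // i _; rewrite -[X in measurable X]setTI.
  by apply: measurable_rV_coord => //; exact: measurable_itv.
by rewrite boxE; apply/seteqP; split => y /= Ay i; [move=> _|]; exact: Ay.
Qed.

Definition box_volume a : R := (2 * 2 ^+ a) ^+ n.

Lemma measure_box a : mu (box a) = (box_volume a)%:E.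
Proof.
rewrite boxE (@lebesgue_rV_box R n (fun=> [set` `[- 2 ^+ a, 2 ^+ a[%R])) => [|i]; last exact: measurable_itv.
rewrite (eq_bigr (fun=> (2 * 2 ^+ a)%:E)) ?prodEFin ?prodr_const ?card_ord // => i _.
rewrite lebesgue_measure_itv /= lte_fin.
have p0 : 0 < (2 : R) ^+ a by rewrite exprn_gt0.
rewrite (_ : - 2 ^+ a < 2 ^+ a); last by lra.
by rewrite -EFinB; congr EFin; ring.
Qed.

Lemma card_box l a : @mesh R l ^+ n * #|[pred x : G l | inbox a (@node R n l x)]|%:R <= box_volume a.
Proof.
have [i1 i2] := integral_emb (fun x : G l => if inbox a (@node R n l x) then 1 else 0 : R).
rewrite -sum1_card natr_sum [X in _ * X](_ : _ = \sum_(x : G l) (if inbox a (@node R n l x) then 1 else 0)); last first.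
  by rewrite big_mkcond; apply: eq_bigr.
rewrite -lee_fin -i2 -measure_box -[X in (_ <= mu X)%E]setIT -integral_indic //; last exact: measurable_box.
apply: ge0_le_integral => //.
- by move=> y _; rewrite lee_fin /emb; case: ifP => // _; case: ifP.
- by case/integrableP: i1.
- by apply/measurable_EFinP; apply: measurable_indic; exact: measurable_box.
- move=> y _; rewrite lee_fin indicE /emb; case: ifPn => // yb; rewrite (node_idx yb) inbox_corner.
  by case: ifPn => // ya; rewrite mem_set.
Qed.

Definition slab a T : set (Rn * measurableTypeR R) := box a `*` [set` `[0, T%:R[%R].

Lemma slabP a T z : (z \in slab a T) = before T z.2 && (inbox a z.1 == true).
Proof.
rewrite /slab; apply/idP/andP => [|[z2 z1]].
  by rewrite inE => -[/= z1]; rewrite in_itv /= /before => ->; rewrite z1.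
by apply/mem_set; split; [exact: (eqP z1)|rewrite /= in_itv].
Qed.

Lemma measurable_slab a T : measurable (slab a T).
Proof. by apply: measurableX; [exact: measurable_box|exact: measurable_itv]. Qed.

Lemma measure_slab a T : mu2 (slab a T) = (box_volume a * T%:R)%:E.
Proof.
rewrite product_measure1E //; last exact: measurable_box.
rewrite EFinM; congr (_ * _)%E; first exact: measure_box.
have E : lebesgue_measure ([set` `[0, T%:R[%R] : set R) = T%:R%:E :> \bar R.
  rewrite lebesgue_measure_itv /= lte_fin; case: ifPn; first by rewrite sube0.
  by case: T => // T; rewrite ltr0n.
exact: E.
Qed.

End masks.

(** * Moment bounds uniform in the level *)

Section compactness.
Context {R : realType} (n : nat) (n0 : (0 < n)%N).
Local Notation Rn := 'rV[R]_n.
Local Notation G l := {ffun 'I_n -> 'I_(top l).+2}.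
Local Notation mu := (lebesgue_rV R n).
Local Notation mu2 := (mu \x (@lebesgue_measure R))%E.
Local Notation h l := (@mesh R l).
Variables (m chi M0 m0 A C D Mom : R) (l0 : nat).
Variables (U V : forall l, nat -> G l -> R) (q : nat -> nat -> R).
Arguments U : clear implicits.
Arguments V : clear implicits.
Hypothesis ctr : forall l, (l0 <= l)%N -> forall J,
  controlled m chi M0 m0 A (h l) C (U l) (V l) (q l) J.
Hypothesis HD : forall l, (l0 <= l)%N -> forall J,
  \sum_(j < J) h l ^+ n * dform (pw m (U l j)) (pw m (U l j)) <= D.
Hypothesis HM : forall l, (l0 <= l)%N ->
  h l ^+ n * \sum_(x : G l) V l 0%N x * moment (h l) (4 ^ l) x +
  (h l * (4 ^ l)%:R) ^+ 2 * (q l 0%N - h l ^+ n * \sum_(x : G l) V l 0%N x) <= Mom.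

(** At level l the squared half-side is 4^l: besides the moment, the mass lost through the wall is
    bounded, by a multiple of 4^-l, and this identifies the rate computed from q with the one
    computed from the mass. *)
Lemma moment_time (T : R) : 0 <= T -> exists2 K : R, 0 <= K & forall l j, (l0 <= l)%N ->
  j%:R * h l ^+ 2 <= T ->
  h l ^+ n * \sum_(x : G l) V l j x * moment (h l) (4 ^ l) x <= K /\
  4 ^+ l * (q l j - h l ^+ n * \sum_(x : G l) V l j x) <= K.
Proof.
move=> T0; pose b := chi * M0 * C `^ (m + 2 / n%:R - 1).
have c0 := ctr (leqnn l0) 0; have [[m1 chi0 M00 _ _] _ _ _ _] := c0.
have C0 := K_ge0 c0; have b0 : 0 <= b by rewrite /b; have := ltW chi0; have := ltW M00; nneg.
pose K1 := Mom + T * ((2 * n)%:R * (C `^ (m - 1) * M0)).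
have pos l j : (l0 <= l)%N -> 0 <= h l ^+ n * (\sum_(x : G l) V l j x * moment (h l) (4 ^ l) x) /\
    0 <= (h l * (4 ^ l)%:R) ^+ 2 * (q l j - h l ^+ n * \sum_(x : G l) V l j x).
  move=> ll; split.
    rewrite mulr_ge0 ?exprn_ge0 ?(ltW (mesh_gt0 _)) // sumr_ge0 // => x _.
    by rewrite mulr_ge0 ?moment_ge0 // (V_ge0 (ctr ll 0)).
  by rewrite mulr_ge0 ?sqr_ge0 // subr_ge0; exact: (mass_le_q n0 (ctr ll 0)).
have Mom0 : 0 <= Mom.
  by apply: le_trans (HM (leqnn l0)); have [h1 h2] := pos l0 0%N (leqnn _); exact: addr_ge0.
have K10 : 0 <= K1 by rewrite /K1; have := ltW M00; nneg.
exists (expR (b * T) * K1); first by rewrite mulr_ge0 ?expR_ge0.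
move=> l j ll jT; have B := moment_bound n0 (ctr ll) j (topE l).
rewrite -/b in B; have h20 : 0 <= h l ^+ 2 by exact: sqr_ge0.
have Z : h l ^+ n * (\sum_(x : G l) V l j x * moment (h l) (4 ^ l) x) +
    (h l * (4 ^ l)%:R) ^+ 2 * (q l j - h l ^+ n * \sum_(x : G l) V l j x) <= expR (b * T) * K1.
  apply: (le_trans B); apply: ler_pM.
  - by apply: exprn_ge0; rewrite addr_ge0 // mulr_ge0.
  - have [h1 h2] := pos l 0%N ll; have := ltW M00 => M0'; apply: addr_ge0; first exact: addr_ge0.
    by nneg.
  - apply: (@le_trans _ _ (expR (h l ^+ 2 * b) ^+ j)).
      by apply: lerXn2r; rewrite ?nnegrE ?expR_ge0 ?expR_ge1Dx // addr_ge0 // mulr_ge0.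
    rewrite -expRM_natl ler_expR mulrA [b * T]mulrC; exact: ler_wpM2r.
  - rewrite /K1; apply: lerD; first exact: HM.
    rewrite -[(2 * n)%:R * _ * _]mulrA mulrCA [h l ^+ 2 * _]mulrC !mulrA.
    have X : 0 <= (2 * n)%:R * (C `^ (m - 1) * M0) by have := ltW M00; nneg.
    have := ler_wpM2r X jT; lra.
have e : (h l * (4 ^ l)%:R) ^+ 2 = 4 ^+ l :> R.
  by rewrite mesh_half -exprM mulnC exprM -natrX.
have [h1 h2] := pos l j ll; rewrite e in Z h2.
by split; apply: le_trans Z; rewrite ?lerDl ?lerDr.
Qed.

End compactness.

(** * Precompactness of the densities *)

Section compactness.
Context {R : realType} (n : nat) (n0 : (0 < n)%N).
Local Notation Rn := 'rV[R]_n.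
Local Notation G l := {ffun 'I_n -> 'I_(top l).+2}.
Local Notation mu := (lebesgue_rV R n).
Local Notation mu2 := (mu \x (@lebesgue_measure R))%E.
Local Notation h l := (@mesh R l).
Variables (m chi M0 m0 A C D Mom : R) (l0 : nat).
Variables (U V : forall l, nat -> G l -> R) (q : nat -> nat -> R).
Arguments U : clear implicits.
Arguments V : clear implicits.
Hypothesis ctr : forall l, (l0 <= l)%N -> forall J,
  controlled m chi M0 m0 A (h l) C (U l) (V l) (q l) J.
Hypothesis HD : forall l, (l0 <= l)%N -> forall J,
  \sum_(j < J) h l ^+ n * dform (pw m (U l j)) (pw m (U l j)) <= D.
Hypothesis HM : forall l, (l0 <= l)%N ->
  h l ^+ n * \sum_(x : G l) V l 0%N x * moment (h l) (4 ^ l) x +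
  (h l * (4 ^ l)%:R) ^+ 2 * (q l 0%N - h l ^+ n * \sum_(x : G l) V l 0%N x) <= Mom.

Let m1 : 1 < m. Proof. by have [[]] := ctr (leqnn l0) 0. Qed.
Let M00 : 0 < M0. Proof. by have [[]] := ctr (leqnn l0) 0. Qed.
Let C0 : 0 <= C. Proof. exact: (K_ge0 (ctr (leqnn l0) 0)). Qed.
Let D0 : 0 <= D. Proof. by apply: le_trans (HD (leqnn l0) 0); rewrite big_ord0. Qed.
Let b0 : 0 <= chi * M0 * C `^ (m + 2 / n%:R - 1).
Proof. by have [[_ c0 _ _ _]] := ctr (leqnn l0) 0; have := ltW c0; have := ltW M00; nneg. Qed.
Let uC l j x : (l0 <= l)%N -> 0 <= U l j x <= C.
Proof. by move=> ll; exact: (bound_U (ctr ll)). Qed.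

Lemma st_bound l (f : nat -> G l -> R) (B : R) : 0 <= B -> (forall j x, 0 <= f j x <= B) ->
  forall z, 0 <= st f z <= B.
Proof.
move=> B0 fB z; rewrite /st /emb; case: ifP => _; last by rewrite lexx.
by case: ifP => _ //; rewrite lexx.
Qed.

(** Chebyshev's inequality: outside the box of half-side 2^a the moment weight is at least 4^a. *)
Lemma tail_bound T : exists2 K : R, 0 <= K & forall l a, (l0 <= l)%N ->
  (\int[mu2]_z (if before T z.2 && (inbox a z.1 == false) then st (U l) z else 0)%:E <=
   (T%:R * (K / 4 ^+ a))%:E)%E.
Proof.
have [K K0 HK] := moment_time n0 ctr HM (ler0n R T).
exists K => // l a ll; have hp := @mesh_gt0 R l; have h2 : 0 < h l ^+ 2 by rewrite exprn_gt0.
have hn : 0 < h l ^+ n by rewrite exprn_gt0.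
under eq_integral do rewrite st_mask.
have [_ ->] := integral_st (fun j (x : G l) => if (j < T * 4 ^ l)%N && (inbox a (@node R n l x) == false) then U l j x else 0).
rewrite lee_fin.
have Ka : 0 <= h l ^+ 2 * (K / 4 ^+ a) by nneg.
apply: (@le_trans _ _ (\sum_(j < nsteps l) (if (j < T * 4 ^ l)%N then h l ^+ 2 * (K / 4 ^+ a) else 0))).
  apply: ler_sum => j _; case: ifPn => jT; last first.
    by rewrite big1 ?mulr0 // => x _; rewrite (negbTE jT).
  rewrite ler_pM2l // ler_pdivlMr ?exprn_gt0 //.
  have jT' : j.+1%:R * h l ^+ 2 <= T%:R.
    rewrite mesh2 ler_pdivrMr ?exprn_gt0 // -natrX -natrM ler_nat; exact: jT.
  (* The moments are known for V, and [U l j] is at most [V l j.+1]. *)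
  have [+ _] := HK l j.+1 ll jT'; apply: le_trans.
  rewrite -mulrA ler_pM2l // mulr_suml; apply: ler_sum => x _ /=.
  have /andP[u0 _] := uC j x ll; have uV := U_leV_next (ctr ll 0) j x.
  have V0 : 0 <= V l j.+1 x by exact: le_trans uV.
  case: ifPn => [/eqP nb|_]; last by rewrite mul0r mulr_ge0 ?moment_ge0.
  apply: ler_pM => //; move/negbT: nb; rewrite negb_forall => /existsP[i ni].
  rewrite /moment (bigD1 i) //=.
  apply: (@le_trans _ _ (position (h l) (4 ^ l) i x ^+ 2)); last first.
    by rewrite lerDl sumr_ge0 // => k _; exact: sqr_ge0.
  move: ni; rewrite /inrange mxE -/(position (h l) (4 ^ l) i x) negb_and -ltNge -leNgt.
  have <- : (2 ^+ a) ^+ 2 = 4 ^+ a :> R by rewrite -exprM mulnC exprM; congr (_ ^+ _); ring.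
  have p0 : 0 <= (2 : R) ^+ a by rewrite exprn_ge0.
  by case/orP => ni; [rewrite -[leRHS]sqrrN|]; apply: lerXn2r; rewrite ?nnegrE //; lra.
apply: (le_trans (sum_truncated (nsteps l) (T * 4 ^ l) (fun=> Ka))).
by rewrite sumr_const card_ord -[leLHS]mulr_natl mesh2 mulrA natrM natrX mulfK // expf_neq0.
Qed.

Definition sampling_const (e : R) (T : nat) : R :=
  2 * (e `^ (- m) * (T%:R * (chi * M0 * C `^ (m + 2 / n%:R - 1) * C `^ m * M0) + 2 * D)) +
  4 ^+ n * (e `^ (1 - 2 * m) * (n%:R * D)).

(** The sample takes one value of U per space-time cell of the fixed level p, whatever l: it lies in
    a bounded part of a finite-dimensional space, while the error is uniform in l. The cells have
    side 2^-p and duration 4^-p, whence the factor 4^-p. *)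
Lemma coarse_approx (e : R) a T p l : 0 < e -> (a <= p)%N -> (T <= 2 ^ p)%N ->
  (l0 <= l)%N -> (p <= l)%N ->
  exists S : nat -> G p -> R, (forall j X, 0 <= S j X <= C) /\
  (\int[mu2]_z (if before T z.2 && (inbox a z.1 == true) then `|st (U l) z - st S z| else 0)%:E <=
   ((2 + 4 ^+ n) * e * (@box_volume R n a * T%:R) + sampling_const e T / 4 ^+ p)%:E)%E.
Proof.
move=> e0 ap Tp ll pl; have hp := @mesh_gt0 R l; have h2 : 0 < h l ^+ 2 by rewrite exprn_gt0.
have hn : 0 < h l ^+ n by rewrite exprn_gt0.
set r := (2 ^ (l - p))%N; set s := (4 ^ (l - p))%N.
have rN : (0 < r <= (top l).+2)%N.
  rewrite expn_gt0 topE /=; apply: (@leq_trans (4 ^ l)); last by rewrite leq_pmull.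
  apply: (@leq_trans (2 ^ l)); first by rewrite leq_exp2l // leq_subr.
  by case: (l) => // l1; rewrite leq_exp2r.
have s0 : (0 < s)%N by rewrite expn_gt0.
pose B := [pred x : G l | inbox a (@node R n l x)].
have [v [k [vr ks Hs]]] := sampling n0 (ctr ll) (HD ll) B (T * 4 ^ p) e0 rN s0.
exists (fun j X => U l (j * s + k)%N (up l X + v)); split; first by move=> j X; exact: uC.
pose f j (x : G l) := `|U l j x - U l ((j %/ s) * s + k)%N (x - offset r x + v)|.
have E z : (if before T z.2 && (inbox a z.1 == true) then
      `|st (U l) z - st (fun j (X : G p) => U l (j * s + k)%N (up l X + v)) z| else 0) =
    (if before T z.2 && (inbox a z.1 == true) then st f z else 0).
  case: ifP => // /andP[/andP[t0 tT] /eqP /forallP ya].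
  have yp : inbox p z.1 by apply/forallP => i; exact: inrange_coarse ap _ (ya i).
  have yl : inbox l z.1 by apply/forallP => i; exact: inrange_coarse (leq_trans ap pl) _ (ya i).
  have tp : z.2 < 2 ^+ p by apply: (lt_le_trans tT); rewrite -natrX ler_nat.
  have tl : z.2 < 2 ^+ l by apply: (lt_le_trans tp); rewrite ler_eXn2l // ltr1n.
  rewrite /st /intime t0 tp tl /= /emb yp yl /f.
  by rewrite (step_of_coarse pl t0) (idx_coarse pl yp).
under eq_integral do rewrite E st_mask.
have [_ ->] := integral_st (fun j (x : G l) => if (j < T * 4 ^ l)%N && (inbox a (@node R n l x) == true) then f j x else 0).
rewrite lee_fin.
have F0 j : 0 <= h l ^+ 2 * (h l ^+ n * \sum_(x in B) f j x).
  apply: mulr_ge0; [exact: ltW|apply: mulr_ge0; [exact: ltW|apply: sumr_ge0 => x _; exact: normr_ge0]].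
apply: (@le_trans _ _ (\sum_(j < nsteps l) (if (j < T * 4 ^ l)%N then h l ^+ 2 * (h l ^+ n * \sum_(x in B) f j x) else 0))).
  apply: ler_sum => j _; case: ifPn => jT; last first.
    by rewrite big1 ?mulr0 // => x _; rewrite (negbTE jT).
  apply: le_of_eq; congr (_ * (_ * _)); rewrite [RHS]big_mkcond; apply: eq_bigr => x _.
  by rewrite inE /= eqb_id.
apply: (le_trans (sum_truncated (nsteps l) (T * 4 ^ l) F0)).
have TT : (T * 4 ^ l = T * 4 ^ p * s)%N by rewrite -mulnA -expnD subnKC.
rewrite TT -(sum_blocks (fun j => h l ^+ 2 * (h l ^+ n * \sum_(x in B) f j x))).
have hs : s%:R * h l ^+ 2 = (4 ^+ p)^-1 :> R.
  have -> : 4 ^+ p = 4 ^+ l / s%:R :> R.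
    by rewrite natrX -{1}(subnKC pl) exprD mulfK // expf_neq0.
  by rewrite mesh2 invfM invrK mulrC.
have hr : (r%:R * h l) ^+ 2 = (4 ^+ p)^-1 :> R.
  by rewrite exprMn -hs -natrX /r /s -expnM mulnC expnM.
have hT : (T * 4 ^ p * s)%:R * h l ^+ 2 = T%:R :> R.
  by rewrite natrM -mulrA hs natrM natrX mulfK // expf_neq0.
apply: (@le_trans _ _ (2 * (e * (h l ^+ n * #|B|%:R) * T%:R +
      e `^ (- m) * ((4 ^+ p)^-1 * (T%:R * (chi * M0 * C `^ (m + 2 / n%:R - 1) * C `^ m * M0) + 2 * D)))
    + 4 ^+ n * (e * (h l ^+ n * #|B|%:R) * T%:R +
      e `^ (1 - 2 * m) * (n%:R * (4 ^+ p)^-1 * D)))).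
  rewrite hT hs hr in Hs; apply: le_trans Hs.
  apply: ler_sum => i _; apply: ler_sum => l' _; rewrite ler_pM2l // ler_pM2l //.
  by apply: ler_sum => x _; rewrite /f divnMDl // divn_small // addn0.
have := @card_box R n l a; rewrite -/B => cB.
have X0 : 0 <= (2 + 4 ^+ n) * e * T%:R by have := ltW e0; nneg.
have := ler_wpM2l X0 cB; rewrite /sampling_const; set c := _ * #|_|%:R.
move: (e `^ _) (e `^ _) (_ * M0) ((4 ^+ p)^-1) => a1 a2 a3 a4 Hc.
lra.
Qed.

(** The colour of a level is its sample rounded to multiples of [eta]. Two levels of the same colour
    differ by two tails of eps / 8, two sampling errors of eps / 4 and one rounding error of eps /
    8. *)
Lemma density_precompact T (eps : R) : 0 < eps -> exists (F : finType) (c : nat -> F) (L : nat),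
  forall l l', (L <= l)%N -> (L <= l')%N -> c l = c l' ->
  (\int[mu2]_z (if before T z.2 then `|st (U l) z - st (U l') z| else 0)%:E <= eps%:E)%E.
Proof.
move=> e0; have [K K0 HK] := tail_bound T.
have e8 : 0 < eps / 8 by rewrite divr_gt0.
(* The box is chosen from the tails, then [e] from its volume, then [p] from [e]; [eta] again
   depends on the volume. *)
have [a Ha] := pow4_large (T%:R * K) e8.
set vT := @box_volume R n a * T%:R.
have vT0 : 0 <= vT by rewrite mulr_ge0 // exprn_ge0 // mulr_ge0 // exprn_ge0.
pose e := eps / 8 / ((2 + 4 ^+ n) * (vT + 1)).
have n4 : 0 < (2 + 4 ^+ n : R) by rewrite addr_gt0 // exprn_gt0.
have vT1 : 0 < vT + 1 by lra.
have ep : 0 < e by rewrite /e; gt0.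
have ev : (2 + 4 ^+ n) * e * vT <= eps / 8.
  have -> : (2 + 4 ^+ n) * e * vT = eps / 8 * (vT / (vT + 1)).
    by rewrite /e; field; rewrite !gt_eqF.
  by rewrite ler_piMr ?(ltW e8) // ler_pdivrMr //; lra.
have [p1 Hp1] := pow4_large (sampling_const e T) e8.
pose p := (p1 + a + T)%N.
have Hp : sampling_const e T / 4 ^+ p <= eps / 8.
  rewrite ler_pdivrMr ?exprn_gt0 //; apply: (le_trans Hp1); rewrite ler_pM2l // ler_eXn2l ?ltr1n //.
  by rewrite /p -addnA leq_addr.
have ap : (a <= p)%N by rewrite /p addnAC leq_addl.
have Tp : (T <= 2 ^ p)%N.
  by apply: (@leq_trans (2 ^ T)); [exact/ltnW/ltn_expl|rewrite leq_exp2l // leq_addl].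
pose eta := eps / 8 / (vT + 1); have eta0 : 0 < eta by rewrite /eta; gt0.
pose L := maxn l0 p.
have /choice[S HS] : forall l, exists S : nat -> G p -> R, (L <= l)%N ->
    (forall j X, 0 <= S j X <= C) /\
    (\int[mu2]_z (if before T z.2 && (inbox a z.1 == true) then `|st (U l) z - st S z| else 0)%:E <=
     (eps / 8 + eps / 8)%:E)%E.
  move=> l; have [Ll|] := boolP (L <= l)%N; last by exists (fun _ _ => 0).
  move: Ll; rewrite /L geq_max => /andP[ll pl].
  have [S [S1 S2]] := coarse_approx ep ap Tp ll pl; exists S => _; split=> //.
  by apply: (le_trans S2); rewrite lee_fin; apply: lerD.
pose Q := Num.trunc (C / eta).
pose c l : {ffun 'I_(nsteps p) * G p -> 'I_Q.+1} :=
  [ffun jX : 'I_(nsteps p) * G p => inord (Num.trunc (S l jX.1 jX.2 / eta))].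
exists _, c, L => l l' Ll Ll' cl.
have [S1 I1] := HS l Ll; have [S2 I2] := HS l' Ll'.
have ll : (l0 <= l)%N by exact: leq_trans (leq_maxl _ _) Ll.
have ll' : (l0 <= l')%N by exact: leq_trans (leq_maxl _ _) Ll'.
have close j X : (j < nsteps p)%N -> `|S l j X - S l' j X| <= eta.
  move=> jn; move/ffunP: cl => /(_ (Ordinal jn, X)); rewrite !ffunE /= => /(congr1 val).
  have tr (x : R) : 0 <= x <= C -> [/\ (Num.trunc (x / eta))%:R * eta <= x,
      x < (Num.trunc (x / eta)).+1%:R * eta & (Num.trunc (x / eta) < Q.+1)%N].
    move=> /andP[x0 xC]; have xe : 0 <= x / eta by rewrite divr_ge0 // ltW.
    have /andP[t1 t2] := truncn_itv xe; rewrite -ler_pdivlMr // -ltr_pdivrMr //; split=> //.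
    by rewrite ltnS /Q; apply: le_truncn; rewrite ler_pM2r // invr_gt0.
  have [t1 t2 t3] := tr _ (S1 j X); have [t1' t2' t3'] := tr _ (S2 j X).
  rewrite /= !inordK // => E; rewrite E in t1 t2.
  move: t1 t2 t1' t2'; rewrite -natr1 mulrDl mul1r => ? ? ? ?.
  by rewrite ler_norml; apply/andP; split; lra.
have mst l1 (f : nat -> G l1 -> R) := @measurable_st R n l1 f.
have mB : measurable_fun setT (fun z : Rn * measurableTypeR R => before T z.2).
  rewrite /before; apply: measurable_and.
    by apply: measurable_fun_ler => //; exact: measurable_snd.
  by apply: measurable_fun_ltr => //; exact: measurable_snd.
have mI : measurable_fun setT (fun z : Rn * measurableTypeR R => inbox a z.1).
  apply: (measurable_fun_bool true); rewrite setTI.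
  have -> : (fun z : Rn * measurableTypeR R => inbox a z.1) @^-1` [set true] = box a `*` setT.
    by apply/seteqP; split=> [z /= zb|z /= [zb _]].
  by apply: measurableX => //; exact: measurable_box.
pose gi l1 (S' : nat -> G p -> R) (z : Rn * measurableTypeR R) : R :=
  if before T z.2 && (inbox a z.1 == true) then `|st (U l1) z - st S' z| else 0.
pose go l1 (z : Rn * measurableTypeR R) : R :=
  if before T z.2 && (inbox a z.1 == false) then st (U l1) z else 0.
have mgi l1 S' : measurable_fun setT (gi l1 S').
  rewrite /gi; apply: measurable_fun_ifT; last exact: measurable_cst.
    apply: measurable_and => //; under eq_fun do rewrite eqb_id; exact: mI.
  by apply: measurableT_comp => //; exact: measurable_funB.
have mgo l1 : measurable_fun setT (go l1).
  rewrite /go; apply: measurable_fun_ifT; last exact: measurable_cst; last exact: mst.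
  apply: measurable_and => //; under eq_fun do rewrite eqbF_neg; exact: measurable_neg.
have gi0 l1 S' z : 0 <= gi l1 S' z by rewrite /gi; case: ifP.
have go0 l1 z : (l0 <= l1)%N -> 0 <= go l1 z.
  move=> h1; rewrite /go; case: ifP => // _.
  by have /andP[] := st_bound C0 (fun j x => uC j x h1) z.
have T8 l1 : (l0 <= l1)%N -> (\int[mu2]_z (go l1 z)%:E <= (eps / 8)%:E)%E.
  move=> h1; apply: (le_trans (HK l1 a h1)); rewrite lee_fin mulrA ler_pdivrMr ?exprn_gt0 //.
pose sl z : R := eta * \1_(@slab R n a T) z.
have msl : measurable_fun setT sl.
  by apply: measurable_funM => //; apply: measurable_indic; exact: measurable_slab.
have sl0 z : 0 <= sl z by rewrite mulr_ge0 // ltW.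
have Isl : (\int[mu2]_z (sl z)%:E <= (eps / 8)%:E)%E.
  rewrite /sl; under eq_integral do rewrite EFinM.
  rewrite ge0_integralZl_EFin //; last 2 first.
  - by apply/measurable_EFinP; apply: measurable_indic; exact: measurable_slab.
  - exact: ltW.
  rewrite integral_indic //; last exact: measurable_slab.
  rewrite setIT; apply: (@le_trans _ _ (eta%:E * vT%:E)%E).
    apply: lee_wpmul2l; first by rewrite lee_fin ltW.
    by rewrite le_eqVlt; apply/orP; left; apply/eqP; exact: measure_slab.
  rewrite -EFinM lee_fin /eta mulrAC ler_pdivrMr //.
  by apply: ler_wpM2l; [exact: ltW|rewrite lerDl].
have md : measurable_fun setT (fun z : Rn * measurableTypeR R =>
    if before T z.2 then `|st (U l) z - st (U l') z| else 0).
  apply: measurable_fun_ifT => //.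
  by apply: measurableT_comp => //; exact: measurable_funB.
apply: (@le_trans _ _ ((eps / 8 + eps / 8) + ((eps / 8 + eps / 8) + (eps / 8 + (eps / 8 + eps / 8))))%:E); last by rewrite lee_fin; lra.
have mA (f g : Rn * measurableTypeR R -> R) : measurable_fun setT f -> measurable_fun setT g ->
  measurable_fun setT (fun z => f z + g z) by move=> ? ?; exact: measurable_funD.
have A1 := mA _ _ (mgo l) (mgo l'); have A2 := mA _ _ msl A1; have A3 := mA _ _ (mgi l' (S l')) A2.
have g1 z := addr_ge0 (go0 l z ll) (go0 l' z ll').
have g2 z := addr_ge0 (sl0 z) (g1 z).
have g3 z := addr_ge0 (gi0 l' (S l') z) (g2 z).
apply: (integral_leD md (mgi l (S l)) A3 (gi0 l (S l)) g3 _ I1); last first.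
  apply: (integral_leD A3 (mgi l' (S l')) A2 (gi0 l' (S l')) g2 _ I2) => [z|]; first by rewrite g3 /=.
  apply: (integral_leD A2 msl A1 sl0 g1 _ Isl) => [z|]; first by rewrite g2 /=.
  apply: (integral_leD A1 (mgo l) (mgo l') _ _ _ (T8 _ ll) (T8 _ ll')) => z; [exact: go0|exact: go0|].
  by rewrite g1 /=.
move=> z; case: ifPn => [zT|zT]; last by rewrite lexx addr_ge0.
rewrite normr_ge0 /=; rewrite /gi /go /sl indicE slabP zT /=.
have [zi|zi] := boolP (inbox a z.1) => /=; rewrite ?mulr0 ?mulr1 ?add0r ?addr0; last first.
  apply: (le_trans (ler_normB _ _)); rewrite !ger0_norm //.
    by have /andP[] := st_bound C0 (fun j x => uC j x ll') z.
  by have /andP[] := st_bound C0 (fun j x => uC j x ll) z.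
have cS : `|st (S l) z - st (S l') z| <= eta.
  rewrite /st; case: ifPn => [|_]; last by rewrite subrr normr0 ltW.
  rewrite intimeE => /andP[_ jn]; rewrite /emb; case: ifPn => _; first exact: close.
  by rewrite subrr normr0 ltW.
move: cS; have -> : st (U l) z - st (U l') z = (st (U l) z - st (S l) z) + (st (S l) z - st (S l') z)
  - (st (U l') z - st (S l') z) by ring.
move=> cS; apply: (le_trans (ler_normB _ _)).
by have := ler_normD (st (U l) z - st (S l) z) (st (S l) z - st (S l') z); lra.
Qed.

End compactness.

(** * Difference quotients of test functions *)

Section difference_quotients.
Context {R : realType} (V : normedModType R).
Variables (f : V -> R) (v : V).
Hypothesis fd : forall x, derivable f x v.
Hypothesis dc : continuous ('D_v f).

Lemma mean_value x h : 0 < h -> exists s : R, 0 <= s <= h /\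
  f (x + h *: v) - f x = h * 'D_v f (x + s *: v).
Proof.
move=> h0; pose g (s : R) : R := f (x + s *: v).
have E (s : R) : (fun t : R => t^-1 *: ((g \o shift s) (t *: (1 : R)) - g s)) =
    (fun t : R => t^-1 *: ((f \o shift (x + s *: v)) (t *: v) - f (x + s *: v))).
  apply/funext => t /=; rewrite /g /shift /= -[t *: (1 : R)]/(t * 1) mulr1.
  by rewrite scalerDl addrCA.
have dg (s : R) : is_derive s (1 : R) g ('D_v f (x + s *: v)).
  apply: DeriveDef; first by rewrite /derivable E; exact: fd.
  by rewrite /derive E.
have cg : {within `[0, h], continuous g}.
  by apply: derivable_within_continuous => s _; have [] := dg s.
have [c ch e] := MVT h0 (fun s _ => dg s) cg.
exists c; split; first by move: ch; rewrite in_itv /= => /andP[/ltW -> /ltW ->].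
by move: e; rewrite /g scale0r addr0 subr0 mulrC.
Qed.

(** Both the base point and the step move, as they do at the corners of the cells; the mean value
    theorem replaces the quotient by the continuous derivative at a nearby point. *)
Lemma quotient_cvg (x_ : nat -> V) (h_ : nat -> R) x :
  x_ k @[k --> \oo] --> x -> h_ k @[k --> \oo] --> 0 -> (forall k, 0 < h_ k) ->
  (f (x_ k + h_ k *: v) - f (x_ k)) / h_ k @[k --> \oo] --> 'D_v f x.
Proof.
move=> xc hc h0; have /choice[s Hs] := fun k => mean_value (x_ k) (h0 k).
have -> : (fun k => (f (x_ k + h_ k *: v) - f (x_ k)) / h_ k) =
    (fun k => 'D_v f (x_ k + s k *: v)).
  by apply/funext => k; have [_ ->] := Hs k; rewrite mulrAC mulfV ?mul1r // gt_eqF.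
have sc : s k @[k --> \oo] --> 0.
  apply: (@squeeze_cvgr _ _ _ _ (fun=> 0) h_ _ _ _ (cvg_cst 0) hc).
  by apply: nearW => k; have [] := Hs k.
have xs : x_ k + s k *: v @[k --> \oo] --> x.
  rewrite -[X in _ --> X]addr0 -(scale0r v); apply: cvgD => //.
  by apply: cvgZr_tmp.
exact: (cvg_comp _ _ xs (@dc x)).
Qed.

(** In space-time [P] is the half-space of nonnegative times, where alone a test function is known
    to vanish off [K]; [Kb] is an enlargement of [K] that contains the points given by the mean
    value theorem. *)
Lemma quotient_bound (P K Kb : set V) : compact Kb ->
  (forall z s, K z -> `|s| <= 1 -> Kb (z + s *: v)) ->
  (forall z s, P z -> 0 <= s -> P (z + s *: v)) ->
  (forall z, P z -> ~ K z -> f z = 0) ->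
  exists2 B, 0 <= B & forall z h, P z -> 0 < h <= 1 -> `|f (z + h *: v) - f z| <= B * h.
Proof.
move=> cK KKb PP f0.
have /compact_bounded[M [Mr HM]] : compact ('D_v f @` Kb).
  by apply: continuous_compact => //; exact: continuous_subspaceT.
have HB z : Kb z -> `|'D_v f z| <= `|M| + 1.
  by move=> Kz; apply: (HM (`|M| + 1)); [rewrite ltr_pwDr ?ler_norm|exists z].
exists (`|M| + 1); first by rewrite addr_ge0.
move=> z h Pz /andP[h0 h1].
have [s [/andP[s0 sh] e]] := mean_value z h0.
have [Kz|nKz] := pselect (K z).
  rewrite e normrM [`|h|]gtr0_norm // mulrC ler_pM2r //; apply: HB; apply: KKb => //.
  by rewrite ger0_norm //; exact: le_trans h1.
have [Kz|nKz'] := pselect (K (z + h *: v)).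
  rewrite e normrM [`|h|]gtr0_norm // mulrC ler_pM2r //; apply: HB.
  have -> : z + s *: v = (z + h *: v) + (s - h) *: v by rewrite scalerBl addrA addrAC addrK.
  by apply: KKb => //; rewrite ler0_norm ?subr_le0 // opprB; lra.
rewrite !f0 ?subrr ?normr0 ?mulr_ge0 ?addr_ge0 // ?(ltW h0) //.
by apply: PP => //; exact: ltW.
Qed.

End difference_quotients.

(** * Bounded sets and convergence of corners and instants *)

Section bounded_support.
Context {R : realType} (n : nat).
Local Notation Rn := 'rV[R]_n.

Definition cube (M : R) : set Rn := [set y | forall i, `[- M, M]%classic (y ord0 i)].

Lemma compact_cube M : compact (cube M).
Proof. exact: (@rV_compact R n (fun=> `[- M, M]%classic) (fun _ => @segment_compact R (- M) M)). Qed.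

Lemma cubeP M y : 0 <= M -> cube M y <-> `|y| <= M.
Proof.
move=> M0; split=> [H|H i] /=.
  by apply: rV_norm_le => // i; rewrite ler_norml; have := H i; rewrite /= in_itv.
rewrite in_itv /= -ler_norml; apply: le_trans H; exact: rV_coord_le.
Qed.

Lemma outside_inbox a (y : Rn) : ~~ inbox a y -> 2 ^+ a <= `|y|.
Proof.
rewrite negb_forall => /existsP[i]; rewrite negb_and -ltNge -leNgt => H.
apply: le_trans (rV_coord_le y i); case/orP: H => h; last exact: le_trans (ler_norm _).
by rewrite -normrN; apply: le_trans (ler_norm _); lra.
Qed.

Lemma compact_norm_bound (W : normedModType R) (K : set W) : compact K ->
  exists M : nat, forall z, K z -> `|z| <= M%:R.
Proof.
move=> /compact_bounded[M [Mr HM]]; exists (Num.trunc (`|M| + 1)).+1 => z Kz.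
apply: (@le_trans _ _ (`|M| + 1)).
  by apply: HM => //; rewrite ltr_pwDr ?ler_norm.
by have /andP[_ /ltW] := truncn_itv (addr_ge0 (normr_ge0 M) ler01).
Qed.

Lemma norm_delta (i : 'I_n) : `|delta_mx 0 i : Rn| <= 1.
Proof.
apply: rV_norm_le => // j; rewrite mxE eqxx /=; case: (_ == _); by rewrite ?normr1 ?normr0.
Qed.

Lemma mesh_cvg0 (phi : nat -> nat) : (forall k, (k <= phi k)%N) ->
  @mesh R (phi k) @[k --> \oo] --> 0.
Proof.
move=> kp; apply: (@squeeze_cvgr _ _ _ _ (fun=> 0) (fun k => 2^-1 ^+ k) _ _ _ (cvg_cst 0)).
  apply: nearW => k; rewrite ltW ?mesh_gt0 //= /mesh; apply: ler_wiXn2l => //; by rewrite ?invr_ge0 ?invf_le1 ?ler1n.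
by apply: cvg_expr; rewrite ger0_norm ?invr_ge0 // invf_lt1 ?ltr1n.
Qed.

Lemma corner_cvg (phi : nat -> nat) (y : Rn) : (forall k, (k <= phi k)%N) ->
  corner (phi k) y @[k --> \oo] --> y.
Proof.
move=> kp; apply/cvgrPdist_le => e e0; have /cvgrPdist_le/(_ e e0) := mesh_cvg0 kp.
apply: filterS => k; rewrite sub0r normrN => H; rewrite distrC.
by apply: (le_trans (corner_dist _ _)); apply: le_trans H; exact: ler_norm.
Qed.

Definition instant l (t : R) : R := (step_of l t)%:R * mesh l ^+ 2.

Lemma instant_bound l t : 0 <= t -> 0 <= instant l t /\ instant l t <= t < instant l t + mesh l ^+ 2.
Proof.
move=> t0; have := step_of_bound l t0; rewrite -natr1 mulrDl mul1r => ->; split=> //.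
by rewrite mulr_ge0 // sqr_ge0.
Qed.

Lemma instant_cvg (phi : nat -> nat) t : 0 <= t -> (forall k, (k <= phi k)%N) ->
  instant (phi k) t @[k --> \oo] --> t.
Proof.
move=> t0 kp; have hc := mesh_cvg0 kp.
have h2 : @mesh R (phi k) ^+ 2 @[k --> \oo] --> 0.
  by rewrite -(mul0r (0 : R)) ; under eq_fun do rewrite expr2; exact: cvgM.
apply: (@squeeze_cvgr _ _ _ _ (fun k => t - @mesh R (phi k) ^+ 2) (fun=> t)); last exact: cvg_cst.
  by apply: nearW => k; have [_ /andP[h1 h3]] := instant_bound (phi k) t0; rewrite h1 andbT lerBlDr ltW.
by rewrite -[X in _ --> X]subr0; apply: cvgB => //; exact: cvg_cst.
Qed.

End bounded_support.

(** * Exact identities at a fixed level *)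

Section level_identities.
Context {R : realType} (n : nat) (n0 : (0 < n)%N).
Local Notation Rn := 'rV[R]_n.
Variable l : nat.
Local Notation G := {ffun 'I_n -> 'I_(top l).+2}.
Local Notation mu := (lebesgue_rV R n).
Local Notation mu2 := (mu \x (@lebesgue_measure R))%E.
Local Notation h := (@mesh R l).
Variables (m chi M0 m0 A C D : R).
Variables (U V : nat -> G -> R) (q : nat -> R).
Hypothesis ctr : forall J, controlled m chi M0 m0 A h C U V q J.
Hypothesis HD : forall J, \sum_(j < J) h ^+ n * dform (pw m (U j)) (pw m (U j)) <= D.
Local Notation w j := (pw m (U j)).
Local Notation alpha := (m + 2 / n%:R).
Local Notation e_ i := (delta_mx 0 i : Rn).

Let hp : 0 < h. Proof. exact: mesh_gt0. Qed.
Let hn : 0 < h ^+ n. Proof. by rewrite exprn_gt0. Qed.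
Let h2 : 0 < h ^+ 2. Proof. by rewrite exprn_gt0. Qed.
Let hne : h != 0. Proof. by rewrite gt_eqF. Qed.
Let m1 : 1 < m. Proof. by have [[]] := ctr 0. Qed.

Definition gradient i := st (fun j x => h^-1 * dd i (w j) x).
Definition rate (t : R) : R := reaction_rate chi M0 (q (step_of l t)).

Lemma st_op1 (op : R -> R) (F : nat -> G -> R) z : op 0 = 0 ->
  op (st F z) = st (fun j x => op (F j x)) z.
Proof. by move=> o0; rewrite /st /emb; case: ifP => // _; case: ifP. Qed.

Lemma emb_node (F : G -> R) (p : Rn -> R) y :
  emb F y * p (corner l y) = emb (fun x => F x * p (node x)) y.
Proof. by rewrite /emb; case: ifP => [zb|_]; [rewrite node_idx|rewrite mul0r]. Qed.

Lemma emb_sum (I : finType) (F : I -> G -> R) y :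
  \sum_i emb (F i) y = emb (fun x => \sum_i F i x) y.
Proof. by rewrite /emb; case: ifP => // _; rewrite big1. Qed.

Lemma st_sum (I : finType) (F : I -> nat -> G -> R) z :
  \sum_i st (F i) z = st (fun j x => \sum_i F i j x) z.
Proof. by rewrite /st; case: ifP => [_|_]; [exact: emb_sum|rewrite big1]. Qed.

Lemma Rintegral_emb (F : G -> R) : \int[mu]_y emb F y = h ^+ n * \sum_x F x.
Proof. by rewrite /Rintegral (integral_emb F).2. Qed.

Lemma Rintegral_st (F : nat -> G -> R) :
  \int[mu2]_z st F z = \sum_(j < nsteps l) h ^+ 2 * (h ^+ n * \sum_x F j x).
Proof. by rewrite /Rintegral (integral_st F).2. Qed.

Lemma gradient_energy : (\int[mu2]_z (sqn gradient z)%:E <= D%:E)%E.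
Proof.
have E z : sqn gradient z = st (fun j x => \sum_i (h^-1 * dd i (w j) x) ^+ 2) z.
  rewrite /sqn -st_sum; apply: eq_bigr => i _.
  by rewrite /gradient (st_op1 (op := fun r : R => r ^+ 2)) // expr0n.
under eq_integral do rewrite E.
rewrite (integral_st _).2 lee_fin; apply: le_trans (HD (nsteps l)).
apply: ler_sum => j _; rewrite mulrCA ler_pM2l // dformE exchange_big mulr_sumr /=.
by apply: ler_sum => x _; rewrite mulr_sumr; apply: ler_sum => i _; rewrite exprMn mulrA -exprMn mulfV // expr1n mul1r.
Qed.

Lemma node_prev (x : G) i : ~~ wall x -> @node R n l (x - ev i) = node x - h *: e_ i.
Proof.
move=> xw; apply/rowP => k; rewrite !mxE !ffunE eqxx andTb.
have x0 : (0 < x k)%N.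
  by rewrite lt0n; apply: contra xw => xi; apply/existsP; exists k; exact: xi.
have [->|ki] := eqVneq k i; last by rewrite subr0 mulr0 subr0.
have [xi0] : (0 < x i)%N by rewrite lt0n; apply: contra xw => xi; apply/existsP; exists i; exact: xi.
have -> : nat_of_ord (x i - 1)%R = (x i).-1.
  have := ltn_ord (x i); case: (x i) xi0 => -[//|b] /= bP _ _.
  rewrite (@modn_small 1) // subn1 /= (@modn_small (top l).+1) // addSnnS modnDr.
  by rewrite modn_small // ltnW.
by rewrite (_ : true%:R = 1 :> R) // -[in RHS](prednK xi0) -natr1; ring.
Qed.

Lemma node_next (x : G) i : ((x i).+1 < (top l).+2)%N -> @node R n l (x + ev i) = node x + h *: e_ i.
Proof.
move=> xt; apply/rowP => k; rewrite !mxE !ffunE eqxx andTb.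
have [->|ki] := eqVneq k i; last by rewrite !addr0 mulr0 addr0.
have -> : nat_of_ord (x i + 1)%R = (x i).+1 by rewrite /= (@modn_small 1) // modn_small addn1.
by rewrite (_ : true%:R = 1 :> R) // -natr1; ring.
Qed.

(** Summation by parts in space. On the wall, where the previous node would wrap around, the term
    vanishes with U. The quotient is based at the previous point, in the form required by
    [quotient_cvg]. *)
Lemma space_identity (p : Rn -> R) i t : 0 <= t < 2 ^+ l ->
  \int[mu]_y (gradient i (y, t) * p (corner l y)) =
  - \int[mu]_y (st U (y, t) `^ m * ((p (corner l y - h *: e_ i + h *: e_ i) - p (corner l y - h *: e_ i)) / h)).
Proof.
move=> /andP[t0 tl]; set j := step_of l t.
have E1 y : gradient i (y, t) * p (corner l y) = emb (fun x => h^-1 * dd i (w j) x * p (node x)) y.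
  by rewrite /gradient /st /intime /= t0 tl /= emb_node.
have E2 y : st U (y, t) `^ m * ((p (corner l y - h *: e_ i + h *: e_ i) - p (corner l y - h *: e_ i)) / h) =
    emb (fun x => w j x * ((p (node x) - p (node x - h *: e_ i)) / h)) y.
  rewrite -(emb_node (w j) (fun c => (p c - p (c - h *: e_ i)) / h)) subrK; congr (_ * _).
  rewrite /st /intime /= t0 tl /= /emb /pw; case: ifP => // _.
  by rewrite powR0 // gt_eqF //; move: m1; lra.
under eq_Rintegral do rewrite E1.
under [in RHS]eq_Rintegral do rewrite E2.
rewrite !Rintegral_emb -mulrN; congr (_ * _); rewrite -sumrN.
transitivity (\sum_(x : G) h^-1 * (w j x * (p (node (x - ev i)) - p (node x)))).
  have -> : \sum_(x : G) h^-1 * dd i (w j) x * p (node x) =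
      h^-1 * (\sum_(x : G) w j (x + ev i) * p (node x) - \sum_x w j x * p (node x)).
    by rewrite -sumrB mulr_sumr; apply: eq_bigr => x _; rewrite /dd; ring.
  rewrite -(sum_shift (fun x : G => w j (x + ev i) * p (node x)) (- ev i)) -sumrB mulr_sumr.
  by apply: eq_bigr => x _; rewrite subrK; ring.
apply: eq_bigr => x _; have [xw|xw] := boolP (wall x).
  by rewrite /pw (U_wall (ctr 0)) // powR0 ?mul0r ?mulr0 ?oppr0 // gt_eqF //; move: m1; lra.
by rewrite node_prev //; field.
Qed.

(** The implicit step and the explicit reaction are tested with the same [zeta j], and Abel
    summation moves the time difference to [zeta]; the end term vanishes with [zeta J]. *)
Lemma lattice_weak (zeta : nat -> G -> R) (J : nat) : (forall j x, wall x -> zeta j x = 0) ->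
  (forall x, zeta J x = 0) ->
  \sum_(j < J) h ^+ n * dform (w j) (zeta j) -
  \sum_(j < J) h ^+ 2 * (h ^+ n * \sum_x reaction_rate chi M0 (q j) * U j x `^ alpha * zeta j x) =
  h ^+ n * \sum_x V 0%N x * zeta 0%N x +
  \sum_(j < J) h ^+ n * \sum_x V j.+1 x * (zeta j.+1 x - zeta j x).
Proof.
move=> zw zJ.
have S j : dform (w j) (zeta j) = \sum_x V j x * zeta j x - \sum_x U j x * zeta j x.
  have := step_test (step_ok (ctr 0) j) (V_wall n0 (ctr 0) j) (zw j).
  by rewrite mulN1r => e; rewrite -[LHS]opprK -e -sumrN -sumrB; apply: eq_bigr => x _; ring.
have [_ _ [_ _ HV _] _ _] := ctr 0.
have S2 j : h ^+ 2 * (\sum_x reaction_rate chi M0 (q j) * U j x `^ alpha * zeta j x) =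
    \sum_x V j.+1 x * zeta j x - \sum_x U j x * zeta j x.
  by rewrite mulr_sumr -sumrB; apply: eq_bigr => x _; rewrite HV; ring.
pose a j := \sum_x V j x * zeta j x.
have S3 j : h ^+ n * dform (w j) (zeta j) -
   h ^+ 2 * (h ^+ n * \sum_x reaction_rate chi M0 (q j) * U j x `^ alpha * zeta j x) -
   h ^+ n * \sum_x V j.+1 x * (zeta j.+1 x - zeta j x) = h ^+ n * (a j - a j.+1).
  rewrite [h ^+ 2 * _]mulrCA S2 S -!mulrBr; congr (_ * _).
  have -> : \sum_x V j.+1 x * (zeta j.+1 x - zeta j x) = a j.+1 - \sum_x V j.+1 x * zeta j x.
    by rewrite /a -sumrB; apply: eq_bigr => x _; ring.
  by rewrite /a; ring.
apply/eqP; rewrite -subr_eq -!sumrB; apply/eqP.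
rewrite (eq_bigr _ (fun (j : 'I_J) _ => S3 j)) -mulr_sumr; congr (_ * _).
rewrite -(big_mkord xpredT (fun j => a j - a j.+1)).
rewrite (eq_bigr (fun j => (- a j.+1) - (- a j))); last by move=> j _; ring.
rewrite (telescope_sumr (fun j => - a j)) // /a big1 => [|x _]; first by rewrite oppr0 add0r opprK.
by rewrite zJ mulr0.
Qed.

(** For a < l and T <= 2^l the function p vanishes on the wall and at the final time, so its
    restriction to the lattice is admissible in [lattice_weak]. *)
Lemma weak_identity (p : Rn * R -> R) (a T : nat) : (a < l)%N -> (T <= 2 ^ l)%N ->
  (forall y s, 0 <= s -> ~~ inbox a y || (T%:R <= s) -> p (y, s) = 0) ->
  \int[mu2]_z st (fun j x => \sum_i h^-1 * dd i (w j) x * ((p (node x + h *: e_ i, j%:R * h ^+ 2) - p (node x, j%:R * h ^+ 2)) / h)) z -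
  \int[mu2]_z st (fun j x => reaction_rate chi M0 (q j) * U j x `^ alpha * p (node x, j%:R * h ^+ 2)) z =
  \int[mu]_y emb (fun x => V 0%N x * p (node x, 0)) y +
  \int[mu2]_z st (fun j x => V j.+1 x * ((p (node x, j%:R * h ^+ 2 + h ^+ 2) - p (node x, j%:R * h ^+ 2)) / h ^+ 2)) z.
Proof.
move=> al Tl p0; rewrite !Rintegral_st Rintegral_emb.
pose zeta (j : nat) (x : G) := p (node x, j%:R * h ^+ 2).
have s0 (j : nat) : 0 <= j%:R * h ^+ 2 by rewrite mulr_ge0 // ltW.
have pl : (2 : R) ^+ a < 2 ^+ l by rewrite ltr_eXn2l // ltr1n.
have pa : 0 < (2 : R) ^+ a by rewrite exprn_gt0.
have out (y : Rn) i : (y 0 i < - 2 ^+ a) || (2 ^+ a <= y 0 i) -> ~~ inbox a y.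
  by move=> H; rewrite negb_forall; apply/existsP; exists i; rewrite negb_and -ltNge -leNgt.
have zw j x : wall x -> zeta j x = 0.
  move=> /existsP[i /eqP xi]; apply: p0 => //; rewrite (out _ i) // mxE xi sub0r mulrN mesh_half.
  by apply/orP; left; lra.
have zJ x : zeta (nsteps l) x = 0.
  apply: p0 => //; apply/orP; right; rewrite mesh2 /nsteps natrX.
  have -> : 8 ^+ l / 4 ^+ l = (2 ^ l)%:R :> R.
    by rewrite natrX -exprVn -exprMn; congr (_ ^+ _); field.
  by rewrite ler_nat.
have := lattice_weak zw zJ.
have E1 (j : nat) : h ^+ 2 * (h ^+ n * \sum_x \sum_i h^-1 * dd i (w j) x *
    ((p (node x + h *: e_ i, j%:R * h ^+ 2) - p (node x, j%:R * h ^+ 2)) / h)) = h ^+ n * dform (w j) (zeta j).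
  rewrite mulrCA; congr (_ * _); rewrite exchange_big /dform mulr_sumr; apply: eq_bigr => i _ /=.
  rewrite mulr_sumr; apply: eq_bigr => x _.
  (* At the far side of the box the neighbour on the torus is a wall point, while the true neighbour
     lies outside the support; both values are 0. *)
  have -> : p (node x + h *: e_ i, j%:R * h ^+ 2) = zeta j (x + ev i).
    have [xt|xt] := ltnP (x i).+1 (top l).+2; first by rewrite /zeta node_next.
    have xe : (x i).+1 = (top l).+2 by apply/eqP; rewrite eqn_leq xt ltn_ord.
    rewrite zw; last first.
      apply/existsP; exists i; rewrite !ffunE eqxx; apply/eqP/val_inj => /=.
      by rewrite (@modn_small 1) // addn1 xe modnn.
    apply: p0 => //; rewrite (out _ i) // !mxE !eqxx /=.
    apply/orP; right; rewrite mulr1 -[X in _ + X]mulr1 -mulrDr.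
    have -> : (x i)%:R - (4 ^ l)%:R + 1 = (4 ^ l)%:R :> R.
      have : ((x i).+1)%:R = (2 * 4 ^ l)%:R :> R by rewrite xe topE.
      by rewrite -natr1 natrM; lra.
    by rewrite mesh_half ltW.
  by rewrite /dd /zeta; field.
rewrite (eq_bigr _ (fun (j : 'I_(nsteps l)) _ => E1 j)) => e; rewrite e.
congr (_ + _).
  by congr (_ * _); apply: eq_bigr => x _; rewrite /zeta mul0r.
apply: eq_bigr => j _; rewrite [RHS]mulrCA; congr (_ * _); rewrite mulr_sumr; apply: eq_bigr => x _.
by rewrite /zeta -natr1 mulrDl mul1r; field.
Qed.

Lemma mass_at t : 0 <= t -> (\int[mu]_y (st U (y, t))%:E <= M0%:E)%E.
Proof.
move=> t0; have [it|it] := boolP (@intime R l t).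
  under eq_integral do rewrite /st /= it.
  by rewrite (integral_emb _).2 lee_fin; exact: (bound_mass_U n0 ctr).
under eq_integral do rewrite /st /= (negbTE it).
by rewrite integral0 lee_fin ltW //; have [[]] := ctr 0.
Qed.

(** The rate is computed from q, which exceeds the mass by what was lost through the wall. The
    reaction leaves this loss unchanged, so its bound at the next step can be used. *)
Lemma rate_mass K t : 0 <= t < 2 ^+ l ->
  4 ^+ l * (q (step_of l t).+1 - h ^+ n * \sum_x V (step_of l t).+1 x) <= K ->
  0 <= rate t <= chi * M0 /\
  `|rate t - chi * (M0 - \int[mu]_y st U (y, t))| <= chi * (K / 4 ^+ l).
Proof.
move=> /andP[t0 tl]; set j := step_of l t => HK; have chi0 : 0 < chi by have [[]] := ctr 0.
split; first by rewrite (kap_ge0 (ctr 0)) (kap_le (ctr 0)).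
have -> : \int[mu]_y st U (y, t) = h ^+ n * \sum_x U j x.
  by rewrite -Rintegral_emb; apply: eq_Rintegral => y _; rewrite /st /intime /= t0 tl.
have qM := q_leM0 n0 (ctr j) (leqnSn j).
have qU : h ^+ n * \sum_x U j x <= q j.
  exact: le_trans (mass_U_leV n0 (ctr 0) j) (mass_le_q n0 (ctr 0) j).
rewrite /rate -/j /reaction_rate max_l ?subr_ge0 // -mulrBr normrM gtr0_norm // ler_pM2l //.
have -> : M0 - q j - (M0 - h ^+ n * \sum_x U j x) = - (q j - h ^+ n * \sum_x U j x) by ring.
rewrite normrN ger0_norm ?subr_ge0 // ler_pdivlMr ?exprn_gt0 // mulrC; apply: le_trans HK.
by rewrite (mass_V_next (ctr 0)) ler_pM2l ?exprn_gt0 //; apply: le_of_eq; ring.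
Qed.

(** In the time slot of t, U is at most the next V, whose time exceeds t: the decay factor is that
    of t itself, without loss. *)
Lemma power_at k Ck t : 1 < k -> 0 <= Ck -> 0 <= t ->
  (forall j, h ^+ n * \sum_x V j x `^ k <= Ck * (1 + j%:R * h ^+ 2) `^ (- ((k - 1) / (m + 2 / n%:R - 1)))) ->
  (\int[mu]_y (st U (y, t) `^ k)%:E <= (Ck * (1 + t) `^ (- ((k - 1) / (m + 2 / n%:R - 1))))%:E)%E.
Proof.
move=> k1 Ck0 t0 H; have kz : k != 0 by rewrite gt_eqF //; lra.
have E y : st U (y, t) `^ k = st (fun j x => U j x `^ k) (y, t).
  by rewrite (st_op1 (op := fun r : R => r `^ k)) // powR0.
under eq_integral do rewrite E.
have [it|it] := boolP (@intime R l t); last first.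
  under eq_integral do rewrite /st /= (negbTE it).
  by rewrite integral0 lee_fin mulr_ge0 ?powR_ge0.
under eq_integral do rewrite /st /= it.
rewrite (integral_emb _).2 lee_fin; set j := step_of l t.
apply: (@le_trans _ _ (h ^+ n * \sum_x V j.+1 x `^ k)).
  rewrite ler_pM2l //; apply: ler_sum => x _; apply: powR_le; [lra|exact: (U_ge0 (ctr 0))|].
  exact: (U_leV_next (ctr 0)).
apply: (le_trans (H _)); apply: ler_wpM2l => //.
have a0 : 0 < 2 / n%:R :> R by rewrite divr_gt0 // ltr0n.
rewrite !powRN lef_pV2 ?posrE ?powR_gt0 //; first last.
- by move: t0; lra.
- by rewrite ltr_wpDr // mulr_ge0 // ltW.
have /andP[_ tj] := step_of_bound l t0.
apply: powR_le; [|lra|by rewrite lerD2l ltW].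
by rewrite divr_ge0 //; move: m1; lra.
Qed.

End level_identities.

(** * Measurability of compact sets and further preliminaries *)

Section preliminaries.
Context {R : realType} (n : nat).
Local Notation Rn := 'rV[R]_n.
Local Notation mu := (lebesgue_rV R n).
Local Notation mu2 := (mu \x (@lebesgue_measure R))%E.
Local Notation e_ i := (delta_mx 0 i : Rn).

Lemma same_cell_dist l (y y' : Rn) : inbox l y -> inbox l y' -> idx l y = idx l y' ->
  `|y - y'| <= 2 * @mesh R l.
Proof.
move=> yb yb' e; have c : corner l y = corner l y' by rewrite -!node_idx // e.
have -> : y - y' = (corner l y' - y') - (corner l y - y) by rewrite c opprB [RHS]addrC subrKA.
apply: (le_trans (ler_normB _ _)).
by have := corner_dist l y; have := corner_dist l y'; lra.
Qed.

(** The sigma-algebra is generated by the coordinates; being closed, [K] is the intersection over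
    the levels of the unions of the cells that meet it, each of which is measurable. *)
Lemma measurable_compact (K : set Rn) : compact K -> measurable K.
Proof.
move=> cK; have [M HM] := compact_norm_bound cK.
have Kb l y : (M < l)%N -> K y -> inbox l y.
  move=> Ml Ky; apply: contraT => /outside_inbox h; have := le_trans h (HM _ Ky).
  by rewrite leNgt -natrX ltr_nat (ltn_trans Ml) // ltn_expl.
pose F l (x : {ffun 'I_n -> 'I_(top l).+2}) : R :=
  if `[< exists y', [/\ K y', inbox l y' & idx l y' = x] >] then 1 else 0.
have -> : K = \bigcap_(l in [set l | (M < l)%N]) ((@emb R n l (F l)) @^-1` [set 1]).
  apply/seteqP; split=> y; [move=> Ky l /= Ml|move=> Ky].
    rewrite /emb (Kb l) // /F asboolT //; exists y; split=> //; exact: Kb.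
  have clK : closed K by apply: compact_closed => //; exact: norm_hausdorff.
  apply: clK => B /nbhs_ballP[e e0 HB].
  have /cvgrPdist_lt/(_ (e / 2)) := @mesh_cvg0 R id (fun=> leqnn _).
  rewrite divr_gt0 // => /(_ isT)[N _ HN].
  pose l := (N + M.+1)%N; have Ml : (M < l)%N by rewrite /l leq_addl.
  have := Ky l Ml; rewrite /emb /F /=; case: ifPn => [yb|_]; last by move=> /esym/eqP; rewrite oner_eq0.
  case: asboolP => [[y' [Ky' yb' e']] _|_]; last by move=> /esym/eqP; rewrite oner_eq0.
  exists y'; split=> //; apply: HB; rewrite -ball_normE /=.
  apply: (le_lt_trans (same_cell_dist yb yb' (esym e'))).
  have := HN l (leq_addr _ _); rewrite sub0r normrN gtr0_norm ?mesh_gt0 //; lra.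
apply: bigcap_measurableType => l _; rewrite -[X in measurable X]setTI.
by apply: measurable_emb.
Qed.

(** The way from the corner to y changes one coordinate at a time, since only increments along
    coordinate directions are bounded. *)
Lemma lipschitz_corner (psi : Rn -> R) (B : 'I_n -> R) l y : (forall i, 0 <= B i) ->
  (forall i z h, 0 < h <= 1 -> `|psi (z + h *: e_ i) - psi z| <= B i * h) ->
  `|psi (corner l y) - psi y| <= (\sum_i B i) * mesh l.
Proof.
move=> B0 HB; pose Y (j : nat) : Rn := \row_i (if (i < j)%N then y 0 i else corner l y 0 i).
have Y0 : Y 0%N = corner l y by apply/rowP => i; rewrite mxE.
have Yn : Y n = y by apply/rowP => i; rewrite mxE ltn_ord.
have step (i : 'I_n) : `|psi (Y i.+1) - psi (Y i)| <= B i * mesh l.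
  have /andP[c1 c2] := corner_bound l y i.
  have -> : Y i.+1 = Y i + (y 0 i - corner l y 0 i) *: e_ i.
    apply/rowP => k; rewrite !mxE eqxx andTb ltnS leq_eqVlt.
    have [->|ki] := eqVneq k i; first by rewrite eqxx ltnn /= mulr1 addrC subrK.
    by rewrite /= mulr0 addr0 val_eqE (negbTE ki).
  have [e|ne] := eqVneq (y 0 i - corner l y 0 i) 0.
    by rewrite e scale0r addr0 subrr normr0 mulr_ge0 // ltW ?mesh_gt0.
  have h0 : 0 < y 0 i - corner l y 0 i by rewrite lt_neqAle eq_sym ne subr_ge0.
  have h1 : y 0 i - corner l y 0 i <= mesh l by lra.
  have m1 : mesh l <= 1 :> R by rewrite /mesh exprn_ile1 ?invr_ge0 ?invf_le1 ?ler1n.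
  apply: le_trans (HB i _ _ _) _; first by rewrite h0 (le_trans h1).
  by rewrite ler_wpM2l.
have tel (j : nat) : (j <= n)%N -> psi (Y j) - psi (Y 0%N) = \sum_(i < n | (i < j)%N) (psi (Y i.+1) - psi (Y i)).
  move=> jn; rewrite -(telescope_sumr (fun j => psi (Y j)) (leq0n j)) big_mkord.
  by rewrite (big_ord_widen _ (fun i => psi (Y i.+1) - psi (Y i)) jn).
rewrite distrC -Y0 -{1}Yn tel // mulr_suml big_mkcond /=.
apply: (le_trans (ler_norm_sum _ _ _)); apply: ler_sum => i _; rewrite ltn_ord; exact: step.
Qed.

Lemma slice_space (p : Rn * R -> R) x t i :
  'D_(e_ i) (fun y => p (y, t)) x = 'D_((e_ i, 0) : Rn * R) p (x, t).
Proof.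
rewrite /derive; suff -> : (fun s : R => s^-1 *: (((fun y => p (y, t)) \o shift x) (s *: e_ i) - p (x, t))) =
  (fun s : R => s^-1 *: ((p \o shift (x, t)) (s *: ((e_ i, 0) : Rn * R)) - p (x, t))) by [].
apply/funext => s /=; congr (_ *: (p _ - _)); rewrite /shift /=; congr pair.
by transitivity (s *: (0 : R) + t); [rewrite scaler0 add0r|].
Qed.

Lemma slice_time (p : Rn * R -> R) x t :
  derive1 (fun s => p (x, s)) t = 'D_((0, 1) : Rn * R) p (x, t).
Proof.
rewrite derive1E /derive.
suff -> : (fun s : R => s^-1 *: (((fun s => p (x, s)) \o shift t) (s *: 1) - p (x, t))) =
  (fun s : R => s^-1 *: ((p \o shift (x, t)) (s *: ((0, 1) : Rn * R)) - p (x, t))) by [].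
apply/funext => s /=; congr (_ *: (p _ - _)); rewrite /shift /=; congr pair.
by transitivity (s *: (0 : Rn) + x); [rewrite scaler0 add0r|].
Qed.

Lemma powR_lipschitz (k M a b : R) : 1 <= k -> 0 <= a <= M -> 0 <= b <= M ->
  `|a `^ k - b `^ k| <= k * M `^ (k - 1) * `|a - b|.
Proof.
move=> k1; wlog ab : a b / a <= b.
  move=> H ha hb; have [ab|/ltW ba] := leP a b; first exact: H.
  by rewrite distrC [`|a - b|]distrC; apply: H.
move=> /andP[a0 aM] /andP[b0 bM].
have ak : a `^ k <= b `^ k by apply: powR_le => //; lra.
rewrite ler0_norm ?subr_le0 // ler0_norm ?subr_le0 // !opprB.
have := powR_tangent k1 b0 a0.
have Mb : b `^ (k - 1) <= M `^ (k - 1) by apply: powR_le => //; lra.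
have X : 0 <= k * (b - a) by rewrite mulr_ge0 ?subr_ge0 //; lra.
by have := ler_wpM2l X Mb; lra.
Qed.

End preliminaries.

(** * One integrable function dominating all sequences *)

Section limit.
Context {R : realType} (n : nat).
Local Notation Rn := 'rV[R]_n.
Local Notation Z := (Rn * measurableTypeR R)%type.
Local Notation mu := (lebesgue_rV R n).
Local Notation dt := (@lebesgue_measure R).
Local Notation mu2 := (mu \x (@lebesgue_measure R))%E.
Local Notation e_ i := (delta_mx 0 i : Rn).

Variables (lv : nat -> nat) (u : nat -> Z -> R) (g : nat -> 'I_n -> Z -> R) (D C : R).
Hypothesis lv2 : forall k, (2 * k <= lv k)%N.
Hypothesis mu_k : forall k, measurable_fun setT (u k).
Hypothesis mg : forall k i, measurable_fun setT (g k i).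
Hypothesis uC : forall k z, 0 <= u k z <= C.
Hypothesis gD : forall k, (\int[mu2]_z (sqn (g k) z)%:E <= D%:E)%E.
Hypothesis fast : forall k,
  (\int[mu2]_z (if before k z.2 then `|u k z - u k.+1 z| else 0)%:E <= (8^-1 ^+ k)%:E)%E.

Local Notation mk k := (@mesh R (lv k)).

Lemma measurable_before k : measurable_fun setT (fun z : Z => before k z.2).
Proof.
rewrite /before; apply: measurable_and.
  by apply: measurable_fun_ler => //; exact: measurable_snd.
by apply: measurable_fun_ltr => //; exact: measurable_snd.
Qed.

(** Four contributions: the increments of the densities, those of the convex combinations, the
    fluxes times the mesh, and the first combination. The third makes mesh times flux tend to 0
    pointwise, which is the error of moving a test function to the corners, although the fluxes are
    bounded only in L^2 of space-time. *)
Lemma dominating_sum : exists (f : nat -> 'I_n -> Z -> R) (W : Z -> \bar R),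
  [/\ forall k, hull g k (f k), measurable_fun setT W, forall z, (0 <= W z)%E,
      (\int[mu2]_z W z < +oo)%E &
      [/\ forall k z, before k z.2 -> ((4 ^+ k * `|u k.+1 z - u k z|)%:E <= W z)%E,
          forall k i z, ((4 ^+ k * (f k.+1 i z - f k i z) ^+ 2)%:E <= W z)%E,
          forall k i z, ((4 ^+ k * (mk k * g k i z) ^+ 2)%:E <= W z)%E &
          forall z, ((sqn (f 0%N) z)%:E <= W z)%E]].
Proof.
have [f [hf If]] := hull_cauchy mg gD.
have mf k i : measurable_fun setT (f k i) := hull_measurable mg (hf k) i.
pose w1 k (z : Z) : R := if before k z.2 then `|u k z - u k.+1 z| else 0.
have mw1 k : measurable_fun setT (w1 k).
  apply: measurable_fun_ifT => //; first exact: measurable_before.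
  by apply: measurableT_comp => //; exact: measurable_funB.
have w10 k z : 0 <= w1 k z by rewrite /w1; case: ifP.
have iw1 k : (\int[mu2]_z (w1 k z)%:E <= (1 * 8^-1 ^+ k)%:E)%E by rewrite mul1r; exact: fast.
have [W1 [mW1 W10 IW1 HW1]] := fast_sum mw1 w10 iw1.
have mw2 k : measurable_fun setT (sqn (fun i z => f k.+1 i z - f k i z)).
  by apply: measurable_sqn => i; exact: measurable_funB.
have [W2 [mW2 W20 IW2 HW2]] := fast_sum mw2 (fun k z => sqn_ge0 _ z) If.
have D0 : 0 <= D.
  rewrite -lee_fin; apply: le_trans (gD 0%N); apply: integral_ge0 => z _.
  by rewrite lee_fin sqn_ge0.
have mw3 k : measurable_fun setT (fun z => mk k ^+ 2 * sqn (g k) z).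
  by apply: measurable_funM => //; exact: measurable_sqn.
have w30 k z : 0 <= mk k ^+ 2 * sqn (g k) z by rewrite mulr_ge0 ?sqr_ge0 ?sqn_ge0.
have iw3 k : (\int[mu2]_z (mk k ^+ 2 * sqn (g k) z)%:E <= (D * 8^-1 ^+ k)%:E)%E.
  under eq_integral do rewrite EFinM.
  rewrite ge0_integralZl_EFin //; [|by move=> z _; rewrite lee_fin sqn_ge0|by apply/measurable_EFinP; exact: measurable_sqn|exact: sqr_ge0].
  have m0 : (0 <= (mk k ^+ 2)%:E)%E by rewrite lee_fin sqr_ge0.
  apply: (le_trans (lee_wpmul2l m0 (gD k))); rewrite -EFinM lee_fin mulrC; apply: ler_wpM2l => //.
  (* By 2 k <= lv k the squared mesh is at most 16^-k, below 8^-k. *)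
  rewrite mesh2 exprVn lef_pV2 ?posrE ?exprn_gt0 //.
  apply: (@le_trans _ _ (4 ^+ (2 * k))); last by rewrite ler_eXn2l ?ltr1n.
  by rewrite exprM; apply: lerXn2r; rewrite ?nnegrE ?exprn_ge0 // -natrX ler_nat.
have [W3 [mW3 W30 IW3 HW3]] := fast_sum mw3 w30 iw3.
pose W4 z := (sqn (f 0%N) z)%:E.
have mW4 : measurable_fun setT W4 by apply/measurable_EFinP; exact: measurable_sqn.
have W40 z : (0 <= W4 z)%E by rewrite lee_fin sqn_ge0.
have IW4 : (\int[mu2]_z W4 z < +oo)%E.
  by apply: le_lt_trans (hull_energy mg gD (hf 0%N)) _; exact: ltry.
exists f, (fun z => (W1 z + W2 z + W3 z + W4 z)%E); split => //.
- by do 3!apply: emeasurable_funD => //.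
- by move=> z; do 3!apply: adde_ge0 => //.
- rewrite ge0_integralD //; last 2 first.
  + by move=> z _; do 2!apply: adde_ge0 => //.
  + by do 2!apply: emeasurable_funD => //.
  rewrite ge0_integralD //; last 2 first.
  + by move=> z _; apply: adde_ge0.
  + by apply: emeasurable_funD.
  by rewrite ge0_integralD //; do 3!apply: lte_add_pinfty => //.
have A1 z : (W1 z <= W1 z + W2 z + W3 z + W4 z)%E.
  by rewrite -!addeA leeDl //; do 2!apply: adde_ge0 => //.
have A2 z : (W2 z <= W1 z + W2 z + W3 z + W4 z)%E.
  by rewrite [(W1 z + _)%E]addeC -!addeA leeDl //; do 2!apply: adde_ge0 => //.
have A3 z : (W3 z <= W1 z + W2 z + W3 z + W4 z)%E.
  by rewrite -addeA addeC -addeA leeDl //; do 2!apply: adde_ge0 => //.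
have A4 z : (W4 z <= W1 z + W2 z + W3 z + W4 z)%E.
  by rewrite leeDr //; do 2!apply: adde_ge0 => //.
have sq1 (F : 'I_n -> Z -> R) i z : F i z ^+ 2 <= sqn F z.
  by rewrite /sqn (bigD1 i) //= lerDl; apply: sumr_ge0 => j _; exact: sqr_ge0.
split=> [k z kz|k i z|k i z|z].
- by apply: le_trans (A1 z); apply: le_trans (HW1 k z); rewrite /w1 kz distrC.
- apply: le_trans (A2 z); apply: le_trans (HW2 k z); rewrite lee_fin ler_pM2l ?exprn_gt0 //.
  exact: (sq1 (fun i z => f k.+1 i z - f k i z)).
- apply: le_trans (A3 z); apply: le_trans (HW3 k z); rewrite lee_fin ler_pM2l ?exprn_gt0 //.
  by rewrite exprMn ler_pM2l ?exprn_gt0 ?mesh_gt0.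
- exact: A4.
Qed.

End limit.

(** * Points and times of convergence *)

Section good_points.
Context {R : realType} (n : nat).
Local Notation Rn := 'rV[R]_n.
Local Notation Z := (Rn * measurableTypeR R)%type.
Local Notation mu := (lebesgue_rV R n).
Local Notation dt := (@lebesgue_measure R).
Local Notation mu2 := (mu \x (@lebesgue_measure R))%E.
Variable W : Z -> \bar R.
Hypothesis mW : measurable_fun setT W.
Hypothesis W0 : forall z, (0 <= W z)%E.
Hypothesis IW : (\int[mu2]_z W z < +oo)%E.

(** Almost every time qualifies by Tonelli's theorem; on such a slice [W] is an integrable majorant,
    which gives dominated convergence at that time. *)
Definition good_time (t : measurableTypeR R) : bool := (\int[mu]_x W (x, t) < +oo)%E.
Definition good (z : Z) : bool := (0 <= z.2) && good_time z.2 && (W z < +oo)%E.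

Let mI : measurable_fun setT (fun t : measurableTypeR R => \int[mu]_x W (x, t))%E.
Proof.
change (measurable_fun setT (fubini_G mu W)); exact: measurable_fun_fubini_tonelli_G.
Qed.

Lemma measurable_slice t : measurable_fun setT (fun x => W (x, t)).
Proof. by apply: measurableT_comp mW _; exact: measurable_pair2. Qed.

Lemma measurable_good : measurable_fun setT good.
Proof.
rewrite /good; apply: measurable_and; last by apply: measurable_fun_lte => //; exact: measurable_cst.
apply: measurable_and; first by apply: measurable_fun_ler => //; exact: measurable_snd.
rewrite /good_time; apply: measurable_fun_lte; last exact: measurable_cst.
by apply: (measurableT_comp mI); exact: measurable_snd.
Qed.

Lemma ae_good_time : \forall t \ae dt, good_time t.
Proof.
have I : dt.-integrable setT (fun t => \int[mu]_x W (x, t))%E.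
  apply/integrableP; split; first exact: mI.
  under eq_integral do rewrite gee0_abs ?integral_ge0 //.
  have E : (\int[mu2]_z W z = \int[dt]_t fubini_G mu W t)%E.
    by rewrite fubini_tonelli1 //; exact: fubini_tonelli.
  by move: IW; rewrite E.
have := integrable_ae measurableT I; apply: filterS => t /(_ Logic.I).
by rewrite ge0_fin_numE // integral_ge0.
Qed.

Lemma ae_good : \forall z \ae mu2, 0 <= z.2 -> good z.
Proof.
have [N [mN N0 HN]] := ae_good_time.
have I : mu2.-integrable setT W.
  apply/integrableP; split=> //; under eq_integral do rewrite gee0_abs //.
  exact: IW.
have A1 : \forall z \ae mu2, good_time z.2.
  exists (setT `*` N); split.
  - by apply: measurableX.
  - have -> : mu2 (setT `*` N) = (mu setT * dt N)%E by rewrite product_measure1E.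
    by rewrite [dt N]N0 mule0.
  - by move=> z /= nz; split=> //; exact: HN.
have A2 := integrable_ae measurableT I.
apply: filterS2 A1 A2 => z h1 h2 z0; rewrite /good z0 h1 /=.
by rewrite -ge0_fin_numE // h2.
Qed.

Lemma slice_integrable t : good_time t -> mu.-integrable setT (fun x => W (x, t)).
Proof.
move=> gt; apply/integrableP; split; first exact: measurable_slice.
by under eq_integral do rewrite gee0_abs //.
Qed.

Lemma ae_good_slice t : 0 <= t -> good_time t -> \forall x \ae mu, good (x, t).
Proof.
move=> t0 gt; have := integrable_ae measurableT (slice_integrable gt).
apply: filterS => x /(_ Logic.I) h; rewrite /good /= t0 gt /=.
by rewrite -ge0_fin_numE.
Qed.

(* Sequences converging at the good points only are made to converge everywhere
   by cutting them off elsewhere. *)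
Lemma dominated_good (F : nat -> Z -> R) (F0 : Z -> R) (H : Z -> \bar R) :
  (forall k, measurable_fun setT (F k)) -> mu2.-integrable setT H ->
  (forall z, (0 <= H z)%E) ->
  (forall k z, good z -> (`|(F k z)%:E| <= H z)%E) ->
  (forall k z, z.2 < 0 -> F k z = 0) ->
  (forall z, good z -> F k z @[k --> \oo] --> F0 z) ->
  (forall z, ~~ good z -> F0 z = 0) ->
  [/\ measurable_fun setT F0, mu2.-integrable setT (EFin \o F0) &
    \int[mu2]_z F k z @[k --> \oo] --> \int[mu2]_z F0 z].
Proof.
move=> mF iH H0 FH Fneg Fc F00; pose F' k z := if good z then F k z else 0.
have mF' k : measurable_fun setT (F' k).
  by apply: measurable_fun_ifT => //; exact: measurable_good.
have F'c z : F' k z @[k --> \oo] --> F0 z.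
  have [gz|gz] := boolP (good z).
    have -> : (fun k => F' k z) = (fun k => F k z) by apply/funext => k; rewrite /F' gz.
    exact: Fc.
  have -> : (fun k => F' k z) = (fun=> 0) by apply/funext => k; rewrite /F' (negbTE gz).
  by rewrite F00 //; exact: cvg_cst.
have mF0 : measurable_fun setT F0 by apply: (measurable_fun_cvg mF') => z _; exact: F'c.
have HH z k : (`|(F' k z)%:E| <= H z)%E.
  by rewrite /F'; case: ifPn => [gz|_]; [exact: FH|rewrite abse0].
have [i0 c0] := Rdominated (mu := mu2) mF' mF0 (aeW _ F'c) iH (aeW _ HH).
split=> //; have -> : (fun k => \int[mu2]_z F k z) = (fun k => \int[mu2]_z F' k z); last exact: c0.
apply/funext => k; rewrite /Rintegral; congr fine; apply: ae_eq_integral => //.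
- exact/measurable_EFinP.
- exact/measurable_EFinP.
- have [N [mN N0 HN]] := ae_good; exists N; split=> // z /= nz; apply: HN => /= gz; apply: nz => _.
  rewrite /F'; have [z0|z0] := leP 0 z.2; first by rewrite gz.
  by rewrite Fneg //; case: ifP.
Qed.
End good_points.

(** * Weak limits along convex combinations *)

Section hull_functionals.
Context d (T : measurableType d) {R : realType} (mu : {measure set T -> \bar R}) (I : finType).

(** Being within e of [ell] is a convex condition on F, so it passes from the tail of g to its hull:
    the strongly convergent combinations compute the weak limit of g. *)
Lemma hull_functional (g f : nat -> I -> T -> R) (P : I -> T -> R) (ell L : R) :
  (forall k, mu.-integrable setT (fun z => (\sum_i g k i z * P i z)%:E)) ->
  (forall k, hull g k (f k)) ->
  \int[mu]_z (\sum_i g k i z * P i z) @[k --> \oo] --> ell ->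
  \int[mu]_z (\sum_i f k i z * P i z) @[k --> \oo] --> L -> L = ell.
Proof.
move=> ig hf gl fL; apply: (@cvg_unique _ (@Rhausdorff R) _ _ _ _ fL).
apply/cvgrPdist_le => e e0; have /cvgrPdist_le/(_ e e0)[N _ HN] := gl.
exists N => // k /= Nk; have := hull_sub Nk (hf k).
suff H F : hull g N F -> mu.-integrable setT (fun z => (\sum_i F i z * P i z)%:E) /\
    `|ell - \int[mu]_z (\sum_i F i z * P i z)| <= e by move=> /H[].
elim=> [k' Nk'|f1 f2 _ [i1 h1] _ [i2 h2]]; first by split=> //; exact: HN.
have E z : (\sum_i (f1 i z + f2 i z) / 2 * P i z) =
    2^-1 * (\sum_i f1 i z * P i z) + 2^-1 * (\sum_i f2 i z * P i z).
  by rewrite !mulr_sumr -big_split; apply: eq_bigr => i _ /=; field.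
have j1 : mu.-integrable setT (EFin \o (fun z => 2^-1 * (\sum_i f1 i z * P i z))).
  have -> : EFin \o (fun z => 2^-1 * (\sum_i f1 i z * P i z)) =
    (fun z => (2^-1)%:E * (\sum_i f1 i z * P i z)%:E)%E by apply/funext => z /=; rewrite EFinM.
  exact: integrableZl.
have j2 : mu.-integrable setT (EFin \o (fun z => 2^-1 * (\sum_i f2 i z * P i z))).
  have -> : EFin \o (fun z => 2^-1 * (\sum_i f2 i z * P i z)) =
    (fun z => (2^-1)%:E * (\sum_i f2 i z * P i z)%:E)%E by apply/funext => z /=; rewrite EFinM.
  exact: integrableZl.
split.
  have -> : (fun z => (\sum_i (f1 i z + f2 i z) / 2 * P i z)%:E) =
    (fun z => ((2^-1 * (\sum_i f1 i z * P i z))%:E + (2^-1 * (\sum_i f2 i z * P i z))%:E)%E).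
    by apply/funext => z; rewrite E EFinD.
  exact: integrableD.
under eq_Rintegral do rewrite E.
rewrite RintegralD // RintegralZl // RintegralZl //.
set a := \int[mu]_z _ in h1 *; set b := \int[mu]_z _ in h2 *.
move: h1 h2; rewrite !ler_norml => /andP[h1 h2] /andP[h3 h4].
by apply/andP; split; lra.
Qed.

End hull_functionals.

(** * The limit density and the limit flux *)

Section limit_functions.
Context {R : realType} (n : nat).
Local Notation Rn := 'rV[R]_n.
Local Notation Z := (Rn * measurableTypeR R)%type.
Variables (u : nat -> Z -> R) (f : nat -> 'I_n -> Z -> R) (W : Z -> \bar R) (C : R).
Hypothesis W0 : forall z, (0 <= W z)%E.
Hypothesis uC : forall k z, 0 <= u k z <= C.
Hypothesis Wu : forall k z, before k z.2 -> ((4 ^+ k * `|u k.+1 z - u k z|)%:E <= W z)%E.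
Hypothesis Wf : forall k i z, ((4 ^+ k * (f k.+1 i z - f k i z) ^+ 2)%:E <= W z)%E.
Hypothesis Wf0 : forall z, ((sqn (f 0%N) z)%:E <= W z)%E.

(** The value 0 off the good points makes the bounds hold at every point, which the estimates
    claimed for every single time require. *)
Definition limit_u z : R := if good W z then limn (fun k => u k z) else 0.
Definition limit_g i z : R := if good W z then limn (fun k => f k i z) else 0.

Lemma good_fine z : good W z -> W z = (fine (W z))%:E.
Proof. by move=> /andP[_ h]; rewrite fineK // ge0_fin_numE. Qed.

Lemma good_time0 z : good W z -> 0 <= z.2.
Proof. by move=> /andP[/andP[]]. Qed.

Lemma fineW0 z : 0 <= fine (W z). Proof. exact: fine_ge0. Qed.

Lemma limit_u_rate z : good W z -> u k z @[k --> \oo] --> limit_u z /\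
  forall k, z.2 < k%:R -> `|limit_u z - u k z| <= 2 * 2^-1 ^+ k * fine (W z).
Proof.
move=> gz; have z0 := good_time0 gz.
have H k0 : z.2 < k0%:R -> forall k, (k0 <= k)%N -> `|u k.+1 z - u k z| <= 2^-1 ^+ k * fine (W z).
  move=> zk k kk; have bk : before k z.2.
    by rewrite /before z0 (lt_le_trans zk) // ler_nat.
  have := Wu bk; rewrite (good_fine gz) lee_fin => h.
  apply: (@le_trans _ _ (4^-1 ^+ k * fine (W z))).
    by rewrite exprVn ler_pdivlMl ?exprn_gt0.
  apply: ler_wpM2r; first exact: fineW0.
  by apply: lerXn2r; rewrite ?nnegrE ?invr_ge0 // lef_pV2 ?posrE // ler_nat.
rewrite /limit_u gz; split.
  have [c _] := fast_cvg (H (Num.trunc z.2).+1 (proj2 (andP (truncn_itv z0)))).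
  exact: c.
move=> k zk; have [_ r] := fast_cvg (H k zk); exact: r.
Qed.

Lemma limit_g_rate i z : good W z -> f k i z @[k --> \oo] --> limit_g i z /\
  forall k, `|limit_g i z - f k i z| <= 2 * 2^-1 ^+ k * Num.sqrt (fine (W z)).
Proof.
move=> gz; have H k : (0 <= k)%N -> `|f k.+1 i z - f k i z| <= 2^-1 ^+ k * Num.sqrt (fine (W z)).
  move=> _; have := Wf k i z; rewrite (good_fine gz) lee_fin => h.
  rewrite exprVn ler_pdivlMl ?exprn_gt0 // -(@ler_pXn2r _ 2) ?nnegrE ?mulr_ge0 ?exprn_ge0 ?sqrtr_ge0 //.
  rewrite sqr_sqrtr ?fineW0 // exprMn real_normK ?num_real //; apply: le_trans h.
  by rewrite -exprM mulnC exprM (_ : 2 ^+ 2 = 4) //; ring.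
have [c r] := fast_cvg H; rewrite /limit_g gz; split=> [|k]; first exact: c.
exact: r.
Qed.

Lemma limit_u_bound z : 0 <= limit_u z <= C.
Proof.
have C0 : 0 <= C by have /andP[h1 h2] := uC 0%N z; exact: le_trans h2.
have [gz|gz] := boolP (good W z); last by rewrite /limit_u (negbTE gz) lexx.
have [c _] := limit_u_rate gz; rewrite -(cvg_lim (@Rhausdorff R) c).
have cc : cvgn (fun k => u k z) by apply/cvg_ex; eexists; exact: c.
apply/andP; split.
  by apply: limr_ge => //; apply: nearW => k; case/andP: (uC k z).
by apply: limr_le => //; apply: nearW => k; case/andP: (uC k z).
Qed.

Lemma limit_g_energy z : sqn limit_g z <= (2 + 8 * n%:R) * fine (W z).
Proof.
have [gz|gz] := boolP (good W z); last first.
  rewrite /sqn big1 => [|i _]; last by rewrite /limit_g (negbTE gz) expr0n.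
  by rewrite mulr_ge0 ?fineW0 // addr_ge0 // mulr_ge0.
apply: (@le_trans _ _ (\sum_(i < n) (2 * f 0%N i z ^+ 2 + 8 * fine (W z)))).
  apply: ler_sum => i _; have [_ /(_ 0%N)] := limit_g_rate i gz; rewrite expr0 mulr1 => h.
  have h2 : (limit_g i z - f 0%N i z) ^+ 2 <= 4 * fine (W z).
    rewrite -real_normK ?num_real // (_ : 4 * fine (W z) = (2 * Num.sqrt (fine (W z))) ^+ 2); last first.
      by rewrite exprMn sqr_sqrtr ?fineW0 //; ring.
    by apply: lerXn2r; rewrite ?nnegrE ?mulr_ge0 ?sqrtr_ge0.
  by have := sqr_ge0 (limit_g i z - 2 * f 0%N i z); nra.
rewrite big_split /= -mulr_sumr sumr_const card_ord -[X in _ + X]mulr_natl.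
have := Wf0 z; rewrite (good_fine gz) lee_fin /sqn => h.
by have := fineW0 z; lra.
Qed.

End limit_functions.

(** * Criteria of integrability and convergence *)

Lemma integrable_le d (T : measurableType d) (R : realType) (mu : {measure set T -> \bar R})
  (F : T -> R) (H : T -> \bar R) : measurable_fun setT F -> mu.-integrable setT H ->
  (forall z, (`|(F z)%:E| <= H z)%E) -> mu.-integrable setT (EFin \o F).
Proof.
move=> mF iH FH; apply: (le_integrable measurableT _ _ iH); first exact/measurable_EFinP.
by move=> z _ /=; apply: (le_trans (FH z)); exact: lee_abs.
Qed.

Lemma integrable_finite d (T : measurableType d) (R : realType) (mu : {measure set T -> \bar R})
  (A : set T) (a B : R) : measurable A -> mu A = a%:E -> mu.-integrable setT (fun z => (B * \1_A z)%:E).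
Proof.
move=> mA muA; under eq_fun do rewrite EFinM; apply: integrableZl => //.
apply/integrableP; split; first by apply/measurable_EFinP; exact: measurable_indic.
under eq_integral do rewrite gee0_abs ?lee_fin //.
by rewrite integral_indic // setIT muA ltry.
Qed.

Lemma cvg_zero_le (R : realType) (a c : nat -> R) : (forall k, `|a k| <= c k) ->
  c k @[k --> \oo] --> 0 -> a k @[k --> \oo] --> 0.
Proof.
move=> ac /cvgrPdist_le c0; apply/cvgrPdist_le => e e0; have := c0 e e0; apply: filterS => k.
rewrite !sub0r !normrN => h; apply: (le_trans (ac k)); exact: le_trans (ler_norm _) h.
Qed.

Lemma cvg_bound (R : realType) (a : nat -> R) (l c : R) : (forall k, `|a k| <= c) ->
  a k @[k --> \oo] --> l -> `|l| <= c.
Proof.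
move=> ac al; rewrite -(cvg_lim (@Rhausdorff R) (cvg_norm al)); apply: limr_le.
  by apply/cvg_ex; eexists; exact: (cvg_norm al).
exact: nearW.
Qed.

Lemma measurable_corner (R : realType) (n a l : nat) (p : 'rV[R]_n -> R) : (a <= l)%N ->
  (forall y, ~~ inbox a y -> p (corner l y) = 0) ->
  measurable_fun setT (fun y => p (corner l y)).
Proof.
move=> al p0; have -> : (fun y => p (corner l y)) = emb (fun x => p (@node R n l x)).
  apply/funext => y; rewrite /emb; case: ifPn => yb; first by rewrite node_idx.
  apply: p0; apply: contra yb => /forallP ya; apply/forallP => i.
  by apply: (inrange_coarse al); exact: ya.
exact: measurable_emb.
Qed.

Lemma cvg_eventually (R : realType) (a c : nat -> R) (l : R) (N : nat) :
  (forall k, (N <= k)%N -> a k = c k) -> c k @[k --> \oo] --> l -> a k @[k --> \oo] --> l.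
Proof.
move=> ac /cvgrPdist_le cl; apply/cvgrPdist_le => e e0; have [M _ HM] := cl e e0.
exists (maxn N M) => // k /=; rewrite geq_max => /andP[Nk Mk]; rewrite ac //; exact: HM.
Qed.

(** * Passage to the limit *)

Section passage.
Context {R : realType} (n : nat).
Local Notation Rn := 'rV[R]_n.
Local Notation Z := (Rn * measurableTypeR R)%type.
Local Notation mu := (lebesgue_rV R n).
Local Notation dt := (@lebesgue_measure R).
Local Notation mu2 := (mu \x (@lebesgue_measure R))%E.
Local Notation e_ i := (delta_mx 0 i : Rn).

Variables (lv : nat -> nat) (u v : nat -> Z -> R) (rt : nat -> Z -> R) (g f : nat -> 'I_n -> Z -> R).
Variables (W : Z -> \bar R) (C D M0 chi m alpha b : R).
Hypothesis mW : measurable_fun setT W.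
Hypothesis W0 : forall z, (0 <= W z)%E.
Hypothesis IW : (\int[mu2]_z W z < +oo)%E.
Hypothesis uC : forall k z, 0 <= u k z <= C.
Hypothesis Wu : forall k z, before k z.2 -> ((4 ^+ k * `|u k.+1 z - u k z|)%:E <= W z)%E.
Hypothesis Wf : forall k i z, ((4 ^+ k * (f k.+1 i z - f k i z) ^+ 2)%:E <= W z)%E.
Hypothesis Wg : forall k i z, ((4 ^+ k * (@mesh R (lv k) * g k i z) ^+ 2)%:E <= W z)%E.
Hypothesis Wf0 : forall z, ((sqn (f 0%N) z)%:E <= W z)%E.
Hypothesis lv2 : forall k, (2 * k <= lv k)%N.
Hypothesis mu_k : forall k, measurable_fun setT (u k).
Hypothesis mv_k : forall k, measurable_fun setT (v k).
Hypothesis mrt : forall k, measurable_fun setT (rt k).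
Hypothesis mg : forall k i, measurable_fun setT (g k i).
Hypothesis gD : forall k, (\int[mu2]_z (sqn (g k) z)%:E <= D%:E)%E.
Hypothesis hf : forall k, hull g k (f k).
Hypothesis iu : forall k t, mu.-integrable setT (fun x => (u k (x, t))%:E).
Hypothesis massu : forall k t, 0 <= t -> (\int[mu]_x (u k (x, t))%:E <= M0%:E)%E.
Hypothesis vu : forall k z, `|v k z - u k z| <= @mesh R (lv k) * b.
Hypothesis rtM : forall k z, 0 <= rt k z <= chi * M0.
Hypothesis rtc : forall x t, 0 <= t ->
  rt k (x, t) - chi * (M0 - \int[mu]_y u k (y, t)) @[k --> \oo] --> 0.
Hypothesis m1 : 1 < m.
Hypothesis al1 : 1 < alpha.
Hypothesis b0 : 0 <= b.

Local Notation uu := (limit_u u W).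
Local Notation gg := (limit_g f W).

Let C0 : 0 <= C.
Proof. by have /andP[h1 h2] := uC 0%N (0, 0); exact: le_trans h2. Qed.

Lemma measurable_limit_u : measurable_fun setT uu.
Proof.
apply: (measurable_fun_cvg (h := fun k z => if good W z then u k z else 0)) => [k|z _].
  by apply: measurable_fun_ifT => //; exact: measurable_good.
have [gz|gz] := boolP (good W z); last by rewrite /limit_u (negbTE gz); exact: cvg_cst.
by have [] := limit_u_rate W0 Wu gz.
Qed.

Lemma measurable_limit_g i : measurable_fun setT (gg i).
Proof.
have mf k j := hull_measurable mg (hf k) j.
apply: (measurable_fun_cvg (h := fun k z => if good W z then f k i z else 0)) => [k|z _].
  by apply: measurable_fun_ifT => //; exact: measurable_good.
have [gz|gz] := boolP (good W z); last by rewrite /limit_g (negbTE gz); exact: cvg_cst.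
by have [] := limit_g_rate W0 Wf i gz.
Qed.

Let mslice (F : Z -> R) t : measurable_fun setT F -> measurable_fun setT (fun x => F (x, t)).
Proof. by move=> mF; apply: measurableT_comp mF _; exact: measurable_pair2. Qed.

(** From the rank k0 > t on, the densities on the slice are at most u k0 + 4 W at good points, which
    is integrable there; powers are covered, being Lipschitz on [0, C] and 0 at 0. *)
Lemma slice_limit (op : R -> R) (L : R) t : 0 <= t -> good_time W t ->
  measurable_fun setT op -> 0 <= L -> op 0 = 0 ->
  (forall x y, 0 <= x <= C -> 0 <= y <= C -> `|op x - op y| <= L * `|x - y|) ->
  mu.-integrable setT (fun x => (op (uu (x, t)))%:E) /\
  \int[mu]_x op (u k (x, t)) @[k --> \oo] --> \int[mu]_x op (uu (x, t)).
Proof.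
move=> t0 gt mop L0 op0 opL; pose k0 := (Num.trunc t).+1.
have tk0 : t < k0%:R by have /andP[] := truncn_itv t0.
have tk k : t < (k + k0)%:R by apply: (lt_le_trans tk0); rewrite ler_nat leq_addl.
pose H x : \bar R := (L%:E * ((u k0 (x, t))%:E + 4%:E * W (x, t)))%E.
have iH : mu.-integrable setT H.
  by apply: integrableZl => //; apply: integrableD => //; apply: integrableZl => //; exact: slice_integrable.
have bound x k : good W (x, t) -> u (k + k0)%N (x, t) <= u k0 (x, t) + 4 * fine (W (x, t)).
  move=> gz; have [_ r] := limit_u_rate W0 Wu gz.
  have := r _ (tk k); have := r _ (tk 0%N); rewrite add0n !ler_norml => /andP[h1 h2] /andP[h3 h4].
  have w0 := fineW0 W0 (x, t).
  have p1 : 2 * 2^-1 ^+ k0 * fine (W (x, t)) <= 2 * fine (W (x, t)).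
    by rewrite ler_wpM2r // ler_piMr // exprn_ile1 ?invr_ge0 ?invf_le1 ?ler1n.
  have p2 : 2 * 2^-1 ^+ (k + k0) * fine (W (x, t)) <= 2 * fine (W (x, t)).
    by rewrite ler_wpM2r // ler_piMr // exprn_ile1 ?invr_ge0 ?invf_le1 ?ler1n.
  by lra.
have ag := ae_good_slice mW W0 t0 gt.
have cv : \forall x \ae mu, op (u (k + k0)%N (x, t)) @[k --> \oo] --> op (uu (x, t)).
  apply: filterS ag => x gx; apply/cvgrPdist_le => e e0.
  have [+ _] := limit_u_rate W0 Wu gx; rewrite -(cvg_shiftn k0) => /cvgrPdist_le/(_ (e / (L + 1))).
  have L1 : 0 < L + 1 by rewrite ltr_wpDl.
  rewrite divr_gt0 // => /(_ isT); apply: filterS => k hk.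
  apply: (le_trans (opL _ _ (limit_u_bound W0 uC Wu _) (uC _ _))).
  apply: (@le_trans _ _ ((L + 1) * (e / (L + 1)))); first by apply: ler_pM => //; rewrite lerDl.
  by rewrite mulrC divfK // gt_eqF.
have bd : \forall x \ae mu, forall k, (`|(op (u (k + k0)%N (x, t)))%:E| <= H x)%E.
  apply: filterS ag => x gx k.
  have -> : H x = (L * (u k0 (x, t) + 4 * fine (W (x, t))))%:E by rewrite /H {1}(good_fine W0 gx).
  rewrite lee_fin; have z0 : 0 <= (0 : R) <= C by rewrite lexx C0.
  have := opL _ _ (uC (k + k0)%N (x, t)) z0; rewrite op0 !subr0 => /le_trans; apply.
  apply: ler_wpM2l => //; rewrite ger0_norm ?bound //.
  by case/andP: (uC (k + k0)%N (x, t)).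
have [i1 c1] := Rdominated (fun k => measurableT_comp mop (mslice t (mu_k (k + k0)%N)))
  (measurableT_comp mop (mslice t measurable_limit_u)) cv iH bd.
by split=> //; rewrite -(cvg_shiftn k0).
Qed.

Lemma slice_mass t : 0 <= t -> good_time W t ->
  [/\ mu.-integrable setT (fun x => (uu (x, t))%:E),
      \int[mu]_x u k (x, t) @[k --> \oo] --> \int[mu]_x uu (x, t) &
      \int[mu]_x uu (x, t) <= M0].
Proof.
move=> t0 gt; have [] := slice_limit (op := id) (L := 1) t0 gt; rewrite ?mul1r //.
  by move=> x y _ _; rewrite mul1r.
move=> i c; split=> //; rewrite -(cvg_lim (@Rhausdorff R) c); apply: limr_le.
  by apply/cvg_ex; eexists; exact: c.
apply: nearW => k; rewrite -lee_fin /Rintegral fineK ?integrable_fin_num //; exact: massu.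
Qed.

Lemma slice_power (k B : R) t : 1 < k -> 0 <= t -> good_time W t ->
  (forall j, (\int[mu]_x (u j (x, t) `^ k)%:E <= B%:E)%E) ->
  (\int[mu]_x (uu (x, t) `^ k)%:E <= B%:E)%E.
Proof.
move=> k1 t0 gt HB.
have [i c] : mu.-integrable setT (fun x => (uu (x, t) `^ k)%:E) /\
    \int[mu]_x (u j (x, t) `^ k) @[j --> \oo] --> \int[mu]_x (uu (x, t) `^ k).
  apply: (slice_limit (op := fun r => r `^ k) (L := k * C `^ (k - 1))) => //.
  - by rewrite mulr_ge0 ?powR_ge0 //; lra.
  - by rewrite powR0 // gt_eqF //; lra.
  - by move=> x y hx hy; apply: powR_lipschitz => //; lra.
have -> : (\int[mu]_x (uu (x, t) `^ k)%:E)%E = (\int[mu]_x (uu (x, t) `^ k))%:E.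
  by rewrite /Rintegral fineK // integrable_fin_num.
rewrite lee_fin -(cvg_lim (@Rhausdorff R) c); apply: limr_le.
  by apply/cvg_ex; eexists; exact: c.
apply: nearW => j; rewrite -lee_fin /Rintegral fineK; first exact: HB.
rewrite ge0_fin_numE; first by apply: (le_lt_trans (HB j)); exact: ltry.
by apply: integral_ge0 => x _; rewrite lee_fin powR_ge0.
Qed.

Lemma slice_bounded (F : nat -> Rn -> R) (F0 : Rn -> R) t a B : 0 <= t -> good_time W t ->
  (forall k, measurable_fun setT (F k)) -> measurable_fun setT F0 ->
  (forall k x, `|F k x| <= B * \1_(@box R n a) x) ->
  (forall x, good W (x, t) -> F k x @[k --> \oo] --> F0 x) ->
  mu.-integrable setT (EFin \o F0) /\ \int[mu]_x F k x @[k --> \oo] --> \int[mu]_x F0 x.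
Proof.
move=> t0 gt mF mF0 FB Fc.
apply: (Rdominated mF mF0 _ (integrable_finite B (@measurable_box R n a) (@measure_box R n a))).
  by apply: filterS (ae_good_slice mW W0 t0 gt) => x; exact: Fc.
by apply: aeW => x k; rewrite lee_fin.
Qed.

Lemma gradient_small k i z : good W z ->
  `|@mesh R (lv k) * g k i z| <= 2^-1 ^+ k * (1 + fine (W z)).
Proof.
move=> gz; have w0 := fineW0 W0 z; set x := @mesh R (lv k) * g k i z.
have h : 4 ^+ k * x ^+ 2 <= fine (W z) by rewrite -lee_fin -good_fine //; exact: Wg.
have h2 : (2 ^+ k * `|x|) ^+ 2 <= fine (W z).
  by rewrite exprMn real_normK ?num_real // -exprM mulnC exprM (_ : 2 ^+ 2 = 4) //; ring.
rewrite exprVn ler_pdivlMl ?exprn_gt0 //.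
have := sqr_ge0 (2 ^+ k * `|x| - 1); rewrite sqrrB1; lra.
Qed.

Lemma hull_bound k i z : good W z -> `|f k i z| <= 3 + (4 + 8 * n%:R) * fine (W z).
Proof.
move=> gz; have [_ /(_ k)] := limit_g_rate W0 Wf i gz; have w0 := fineW0 W0 z.
set s := Num.sqrt _ => r; have s0 : 0 <= s by exact: sqrtr_ge0.
have ss : s ^+ 2 = fine (W z) by rewrite sqr_sqrtr.
have s1 : s <= 1 + fine (W z) by rewrite -ss; have := sqr_ge0 (s - 1); rewrite sqrrB1; lra.
have p1 : 2 * 2^-1 ^+ k * s <= 2 * s.
  by rewrite ler_wpM2r // ler_piMr // exprn_ile1 ?invr_ge0 ?invf_le1 ?ler1n.
have gE : `|gg i z| <= 1 + (2 + 8 * n%:R) * fine (W z).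
  have := limit_g_energy W0 Wf Wf0 z; rewrite /sqn (bigD1 i) //= => h.
  have h0 : 0 <= \sum_(j < n | j != i) gg j z ^+ 2 by apply: sumr_ge0 => j _; exact: sqr_ge0.
  have := sqr_ge0 (`|gg i z| - 1); rewrite sqrrB1 real_normK ?num_real //.
  by have := normr_ge0 (gg i z); lra.
have := ler_distD 0 (f k i z) (gg i z); rewrite subr0.
have := ler_normD (f k i z - gg i z) (gg i z); rewrite subrK distrC; lra.
Qed.

Let psi_single (F : 'I_n -> Rn -> R) (psi : Rn -> R) i x :
  \sum_j F j x * (if j == i then psi x else 0) = F i x * psi x.
Proof.
by rewrite (bigD1 i) //= eqxx big1 ?addr0 // => j /negbTE ->; rewrite mulr0.
Qed.

(** At a fixed time the fluxes have no bound; only mesh times flux is controlled, which suffices to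
    replace psi at the corners by psi. The limit [ell], known from summation by parts, is carried
    over to the convex combinations; these converge pointwise under an integrable majorant, which
    identifies the limit flux. *)
Lemma slice_functional (psi : Rn -> R) (psik : nat -> Rn -> R) t a i Bp L1 ell :
  0 <= t -> good_time W t ->
  (forall k, mu.-integrable setT (fun x => (g k i (x, t))%:E)) ->
  measurable_fun setT psi -> (forall k, measurable_fun setT (psik k)) -> 0 <= L1 -> 0 <= Bp ->
  (forall x, `|psi x| <= Bp * \1_(@box R n a) x) ->
  (forall k x, `|psik k x - psi x| <= L1 * @mesh R (lv k) * \1_(@box R n a) x) ->
  \int[mu]_x (g k i (x, t) * psik k x) @[k --> \oo] --> ell ->
  \int[mu]_x (gg i (x, t) * psi x) = ell.
Proof.
move=> t0 gt ig mpsi mpsik L10 Bp0 pB pL gl.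
have ag := ae_good_slice mW W0 t0 gt.
have iW := slice_integrable mW W0 gt.
have box1 x : 0 <= (\1_(@box R n a) x : R) <= 1 by rewrite indicE; case: (_ \in _); rewrite /= ?lexx ?ler01.
have mgs k : measurable_fun setT (fun x => g k i (x, t)) := mslice t (mg k i).
have Bd (F : Rn -> R) (G : Rn -> R) (B : R) : mu.-integrable setT (EFin \o F) -> measurable_fun setT F ->
    measurable_fun setT G -> (forall x, `|G x| <= B) -> mu.-integrable setT (EFin \o (fun x => F x * G x)).
  move=> iF mF mG GB; have B0 : 0 <= B := le_trans (normr_ge0 _) (GB 0).
  apply: (@integrable_le _ _ _ _ _ (fun x => B%:E * `|(F x)%:E|)%E).
  - exact: measurable_funM.
  - by apply: integrableZl => //; exact: integrable_abse.
  - by move=> x; rewrite /= -EFinM lee_fin normrM mulrC; apply: ler_wpM2r.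
have mesh1 k : @mesh R (lv k) <= 1 by rewrite /mesh exprn_ile1 ?invr_ge0 ?invf_le1 ?ler1n.
have ipsi k : mu.-integrable setT (EFin \o (fun x => g k i (x, t) * psi x)).
  apply: (Bd (fun x => g k i (x, t)) psi Bp (ig k) (mgs k) mpsi) => x.
  by apply: (le_trans (pB x)); rewrite ler_piMr //; case/andP: (box1 x).
have idif k : mu.-integrable setT (EFin \o (fun x => g k i (x, t) * (psik k x - psi x))).
  apply: (Bd (fun x => g k i (x, t)) (fun x => psik k x - psi x) L1 (ig k) (mgs k) (measurable_funB (mpsik k) mpsi)) => x.
  have /andP[x0 x1] := box1 x.
  by apply: (le_trans (pL k x)); rewrite -mulrA ler_piMr // mulr_ile1 // ltW ?mesh_gt0.
have dif0 : \int[mu]_x (g k i (x, t) * (psik k x - psi x)) @[k --> \oo] --> 0.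
  have [|||_] := @Rdominated _ _ _ mu (fun k x => g k i (x, t) * (psik k x - psi x)) (fun=> 0)
    (fun x => (L1 * \1_(@box R n a) x)%:E + L1%:E * W (x, t))%E
    (fun k => measurable_funM (mgs k) (measurable_funB (mpsik k) mpsi)) (@measurable_cst _ _ _ _ _ _).
  - have key k x : good W (x, t) -> `|g k i (x, t) * (psik k x - psi x)| <=
        L1 * (2^-1 ^+ k * (1 + fine (W (x, t)))) * \1_(@box R n a) x.
      move=> gx; rewrite normrM; apply: (le_trans (ler_wpM2l (normr_ge0 _) (pL k x))).
      rewrite mulrA; apply: ler_wpM2r; first by case/andP: (box1 x).
      rewrite mulrCA; apply: ler_wpM2l => //; have := gradient_small k i gx.
      by rewrite normrM gtr0_norm ?mesh_gt0 // mulrC.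
    apply: filterS ag => x gx.
    apply: cvg_zero_le => [k|]; first exact: key.
    rewrite -(mul0r (\1_(@box R n a) x)); apply: cvgMl.
    rewrite -(mulr0 L1); apply: cvgMr; rewrite -(mul0r (1 + fine (W (x, t)))); apply: cvgMl.
    by apply: cvg_expr; rewrite ger0_norm ?invr_ge0 // invf_lt1 ?ltr1n.
  - apply: integrableD => //; last exact: integrableZl.
    exact: (integrable_finite L1 (@measurable_box R n a) (@measure_box R n a)).
  - apply: filterS ag => x gx k; rewrite (good_fine W0 gx) -EFinM -EFinD lee_fin normrM.
    apply: (le_trans (ler_wpM2l (normr_ge0 _) (pL k x))).
    have := gradient_small k i gx; rewrite normrM gtr0_norm ?mesh_gt0 // => h.
    have w0 := fineW0 W0 (x, t).
    have h2 : 2^-1 ^+ k * (1 + fine (W (x, t))) <= 1 + fine (W (x, t)).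
      by rewrite ler_piMl ?addr_ge0 // exprn_ile1 ?invr_ge0 ?invf_le1 ?ler1n.
    have /andP[x0 x1] := box1 x.
    set y := \1_(_) x in x0 x1 *.
    rewrite (_ : `|g k i (x, t)| * (L1 * mesh (lv k) * y) = L1 * (mesh (lv k) * `|g k i (x, t)| * y)); last by ring.
    rewrite -mulrDr; apply: ler_wpM2l => //.
    have h3 := ler_wpM2r x0 (le_trans h h2).
    have h4 : fine (W (x, t)) * y <= fine (W (x, t)) by rewrite ler_piMr.
    by lra.
  - by rewrite Rintegral_cst // mul0r.
have gl' : \int[mu]_x (\sum_j g k j (x, t) * (if j == i then psi x else 0)) @[k --> \oo] --> ell.
  have -> : (fun k => \int[mu]_x (\sum_j g k j (x, t) * (if j == i then psi x else 0))) =
      (fun k => \int[mu]_x (g k i (x, t) * psik k x) - \int[mu]_x (g k i (x, t) * (psik k x - psi x))).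
    apply/funext => k; under eq_Rintegral do rewrite (psi_single (fun j x => g k j (x, t))).
    have -> : (fun x => g k i (x, t) * psik k x) = (fun x => g k i (x, t) * psi x + g k i (x, t) * (psik k x - psi x)).
      by apply/funext => x; ring.
    by rewrite RintegralD // addrK.
  by rewrite -(subr0 ell); apply: cvgB.
have w0 x := fineW0 W0 (x, t).
have fl : \int[mu]_x (\sum_j f k j (x, t) * (if j == i then psi x else 0)) @[k --> \oo] -->
    \int[mu]_x (gg i (x, t) * psi x).
  have -> : (fun k => \int[mu]_x (\sum_j f k j (x, t) * (if j == i then psi x else 0))) =
      (fun k => \int[mu]_x (f k i (x, t) * psi x)).
    by apply/funext => k; apply: eq_Rintegral => x _; rewrite (psi_single (fun j x => f k j (x, t))).
  pose c : R := Bp * (4 + 8 * n%:R).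
  have [|||_] := @Rdominated _ _ _ mu (fun k x => f k i (x, t) * psi x) (fun x => gg i (x, t) * psi x)
    (fun x => (3 * Bp * \1_(@box R n a) x)%:E + c%:E * W (x, t))%E
    (fun k => measurable_funM (mslice t (hull_measurable mg (hf k) i)) mpsi)
    (measurable_funM (mslice t (measurable_limit_g i)) mpsi).
  - apply: filterS ag => x gx; apply: cvgMl.
    by have [] := limit_g_rate W0 Wf i gx.
  - apply: integrableD => //; last exact: integrableZl.
    exact: (integrable_finite (3 * Bp) (@measurable_box R n a) (@measure_box R n a)).
  - apply: filterS ag => x gx k; rewrite (good_fine W0 gx) -EFinM -EFinD lee_fin normrM.
    have /andP[x0 x1] := box1 x; have hb := hull_bound k i gx; have wx := w0 x.
    have N0 : 0 <= (4 + 8 * n%:R) * fine (W (x, t)) by rewrite mulr_ge0 // addr_ge0 // mulr_ge0.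
    apply: (le_trans (ler_pM (normr_ge0 _) (normr_ge0 _) hb (pB x))); rewrite mulrDl /c.
    have : (4 + 8 * n%:R) * fine (W (x, t)) * (Bp * \1_(@box R n a) x) <= (4 + 8 * n%:R) * fine (W (x, t)) * Bp.
      by apply: ler_wpM2l => //; rewrite ler_piMr.
    by lra.
  - by [].
apply: (hull_functional (g := fun k j x => g k j (x, t)) (f := fun k j x => f k j (x, t)) _ _ gl' fl).
  move=> k; under eq_fun do rewrite (psi_single (fun j x => g k j (x, t))); exact: ipsi.
have hs F k : hull g k F -> hull (fun k j x => g k j (x, t)) k (fun j x => F j (x, t)).
  elim=> [k' kk'|f1 f2 _ h1 _ h2]; last exact: (hull_mid h1 h2).
  exact: (@hull_gen _ _ _ _ (fun k j x => g k j (x, t)) _ k').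
by move=> k; exact: hs.
Qed.

(** Both sides of the discrete identity pass to the limit at the given time: the right-hand side by
    bounded convergence on a box, the left-hand side through [slice_functional]. *)
Lemma weak_gradient_at t : 0 <= t -> good_time W t ->
  (forall k i, mu.-integrable setT (fun x => (g k i (x, t))%:E)) ->
  (forall k (p : Rn -> R) i, t < 2 ^+ lv k ->
    \int[mu]_y (g k i (y, t) * p (corner (lv k) y)) =
    - \int[mu]_y (u k (y, t) `^ m * ((p (corner (lv k) y - mesh (lv k) *: e_ i + mesh (lv k) *: e_ i) -
       p (corner (lv k) y - mesh (lv k) *: e_ i)) / mesh (lv k)))) ->
  weak_gradient (fun x => uu (x, t) `^ m) (fun x => \row_i gg i (x, t)).
Proof.
move=> t0 gt ig SI.
have [im _] : mu.-integrable setT (fun x => (uu (x, t) `^ m)%:E) /\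
    \int[mu]_x (u j (x, t) `^ m) @[j --> \oo] --> \int[mu]_x (uu (x, t) `^ m).
  apply: (slice_limit (op := fun r => r `^ m) (L := m * C `^ (m - 1))) => //.
  - by rewrite mulr_ge0 ?powR_ge0 //; move: m1; lra.
  - by rewrite powR0 // gt_eqF //; move: m1; lra.
  - by move=> x y hx hy; apply: powR_lipschitz => //; move: m1; lra.
have outa M (y : Rn) : ~~ inbox M.+3 y -> M.+3%:R < `|y|.
  move=> /outside_inbox; apply: lt_le_trans; by rewrite -natrX ltr_nat ltn_expl.
split=> [K cK|K i cK|psi K i psiC cK psi0].
- by apply: (integrableS measurableT (measurable_compact cK)).
- have [M HM] := compact_norm_bound cK; pose a := M.+3.
  have ya y : K y -> inbox a y.
    move=> Ky; apply: contraT => /outa h; have := lt_le_trans h (HM _ Ky).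
    by rewrite ltr_nat; lia.
  have iF : mu.-integrable setT (EFin \o (fun x => gg i (x, t) * \1_(@box R n a) x)).
    apply: (@integrable_le _ _ _ _ _ (fun x => (1 * \1_(@box R n a) x)%:E + (2 + 8 * n%:R)%:E * W (x, t))%E).
    + apply: measurable_funM; first exact: mslice (measurable_limit_g i).
      by apply: measurable_indic; exact: measurable_box.
    + apply: integrableD => //; last by apply: integrableZl => //; exact: slice_integrable.
      exact: (integrable_finite 1 (@measurable_box R n a) (@measure_box R n a)).
    + move=> x; rewrite indicE; case: (x \in box a) => /=; last first.
        rewrite mulr0 normr0 mulr0 add0e mule_ge0 // lee_fin addr_ge0 // mulr_ge0 //.
      rewrite mulr1 mul1r; have [gx|gx] := boolP (good W (x, t)); last first.
        rewrite /limit_g (negbTE gx) normr0 adde_ge0 ?lee_fin // mule_ge0 // lee_fin addr_ge0 // mulr_ge0 //.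
      rewrite (good_fine W0 gx) -EFinM -EFinD lee_fin.
      have := limit_g_energy W0 Wf Wf0 (x, t); rewrite /sqn (bigD1 i) //= => h.
      have h0 : 0 <= \sum_(j < n | j != i) gg j (x, t) ^+ 2 by apply: sumr_ge0 => j _; exact: sqr_ge0.
      have := sqr_ge0 (`|gg i (x, t)| - 1); rewrite sqrrB1 real_normK ?num_real //.
      by have := normr_ge0 (gg i (x, t)); lra.
  have iK := integrableS measurableT (measurable_compact cK) (@subsetT _ K) iF.
  apply: (le_integrable (measurable_compact cK) _ _ iK).
    apply/measurable_EFinP; apply: (measurable_funS measurableT) => //.
    by under eq_fun do rewrite mxE; exact: mslice (measurable_limit_g i).
  move=> x Kx /=; rewrite mxE indicE mem_set ?mulr1 //; exact: ya.
have [cpsi dpsi] := psiC 1%N; have [dd [cd _]] := dpsi (e_ i).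
(* The margin leaves room for the corner and its previous neighbour, at distance at most 2 from the
   point. *)
have [M HM] := compact_norm_bound cK; pose a := M.+3.
have far (y y' : Rn) : ~~ inbox a y -> `|y' - y| <= 2 -> psi y' = 0.
  move=> /outa h h'; apply: psi0 => /HM h2.
  have := ler_normB y' (y' - y); rewrite opprB addrC subrK => h3.
  have : (M.+3)%:R = M%:R + 3 :> R by rewrite -addn3 natrD.
  by lra.
have /choice[B HB] : forall j : 'I_n, exists B, 0 <= B /\
    forall z h, 0 < h <= 1 -> `|psi (z + h *: e_ j) - psi z| <= B * h.
  move=> j; have [ddj [cdj _]] := dpsi (e_ j).
  have [||||B B0 HB] := @quotient_bound R _ psi (e_ j) ddj cdj setT K (@cube R n (M%:R + 1)).
  + exact: compact_cube.
  + move=> z s Kz s1; apply/cubeP; first by rewrite addr_ge0.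
    apply: (le_trans (ler_normD _ _)); apply: lerD; first exact: HM.
    rewrite normrZ mulr_ile1 //; exact: norm_delta.
  + by [].
  + by move=> z _; exact: psi0.
  by exists B; split=> // z h; exact: HB.
have B0 j : 0 <= B j := (HB j).1; have HB' j := (HB j).2.
pose L1 := \sum_j B j; have L10 : 0 <= L1 by apply: sumr_ge0.
have mesh1 l : @mesh R l <= 1 by rewrite /mesh exprn_ile1 ?invr_ge0 ?invf_le1 ?ler1n.
have mp l : 0 < @mesh R l := mesh_gt0 l.
have cor2 l (y : Rn) : `|corner l y - y| <= 2.
  by apply: (le_trans (corner_dist l y)); apply: (le_trans (mesh1 l)); rewrite ler1n.
have cor2' l y : `|corner l y - @mesh R l *: e_ i - y| <= 2.
  rewrite addrAC; apply: (le_trans (ler_normB _ _)).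
  have h1 := le_trans (corner_dist l y) (mesh1 l).
  have h2 : `|@mesh R l *: e_ i| <= 1.
    by rewrite normrZ gtr0_norm // mulr_ile1 // ?(ltW (mp l)) //; exact: norm_delta.
  by rewrite (_ : 2 = 1 + 1 :> R) //; exact: lerD.
have lvk k : (k <= lv k)%N by apply: leq_trans (lv2 k); rewrite mul2n -addnn leq_addr.
pose quot l (y : Rn) := (psi (corner l y - mesh l *: e_ i + mesh l *: e_ i) - psi (corner l y - mesh l *: e_ i)) / mesh l.
have quot0 l y : ~~ inbox a y -> quot l y = 0.
  move=> yb; rewrite /quot subrK (far _ _ yb (cor2 l y)) (far _ _ yb (cor2' l y)).
  by rewrite subrr mul0r.
have mquot l : (a <= l)%N -> measurable_fun setT (quot l).
  move=> al; apply: (@measurable_corner _ _ a l (fun c => (psi (c - mesh l *: e_ i + mesh l *: e_ i) - psi (c - mesh l *: e_ i)) / mesh l) al) => y yb.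
  exact: (quot0 l y yb).
have quotc (phi : nat -> nat) y : (forall k, (k <= phi k)%N) -> quot (phi k) y @[k --> \oo] --> 'D_(e_ i) psi y.
  move=> hphi; apply: quotient_cvg => //; last exact: mesh_cvg0.
  rewrite -[X in _ --> X]subr0; apply: cvgB; first exact: corner_cvg.
  by rewrite -(scale0r (e_ i)); apply: cvgZr_tmp; exact: mesh_cvg0.
have ak k : (k <= k + a)%N by rewrite leq_addr.
have mpsi : measurable_fun setT psi.
  apply: (measurable_fun_cvg (h := fun k y => psi (corner (k + a)%N y))) => [k|y _].
    by apply: (measurable_corner (a := a)); [rewrite leq_addl|move=> y yb; exact: far yb (cor2 _ _)].
  by apply: continuous_cvg; [exact: cpsi|exact: (@corner_cvg R n (fun k => (k + a)%N))].
have mD : measurable_fun setT ('D_(e_ i) psi).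
  apply: (measurable_fun_cvg (h := fun k y => quot (k + a)%N y)) => [k|y _].
    by apply: mquot; rewrite leq_addl.
  exact: (quotc (fun k => (k + a)%N)).
have [Bp Bp0 HBp] : exists2 Bp, 0 <= Bp & forall x, `|psi x| <= Bp * \1_(@box R n a) x.
  have /compact_norm_bound[Bp HBp] : compact (psi @` K).
    by apply: continuous_compact => //; exact: continuous_subspaceT.
  exists Bp%:R => // x; rewrite indicE; have [xa|xa] := boolP (inbox a x); last first.
    by rewrite (far x x xa) ?subrr ?normr0 ?mulr_ge0.
  rewrite mem_set // mulr1; have [Kx|nKx] := pselect (K x); first by apply: HBp; exists x.
  by rewrite psi0 // normr0.
have qB l x : `|quot l x| <= B i * \1_(@box R n a) x.
  rewrite indicE; have [xa|xa] := boolP (inbox a x); last first.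
    by rewrite quot0 // normr0 mulr_ge0.
  rewrite mem_set // mulr1 /quot normrM normfV [`|mesh l|]gtr0_norm // ler_pdivrMr //.
  by apply: HB'; rewrite mp mesh1.
pose F k x := u k (x, t) `^ m * (if (a <= lv k)%N then quot (lv k) x else 0).
have mF k : measurable_fun setT (F k).
  apply: measurable_funM; first by apply: measurableT_comp (measurable_powR m) (mslice t (mu_k k)).
  by case: leqP => // al; exact: mquot.
have mF0 : measurable_fun setT (fun x => uu (x, t) `^ m * 'D_(e_ i) psi x).
  apply: measurable_funM => //.
  exact: measurableT_comp (measurable_powR m) (mslice t measurable_limit_u).
have FB k x : `|F k x| <= (C `^ m * B i) * \1_(@box R n a) x.
  rewrite normrM -mulrA; apply: ler_pM => //.
    rewrite ger0_norm ?powR_ge0 //; have /andP[h1 h2] := uC k (x, t).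
    by apply: powR_le => //; move: m1; lra.
  by case: leqP => // _; rewrite normr0 mulr_ge0 // indicE; case: (_ \in _).
have evl : \forall k \near \oo, (a <= lv k)%N.
  by exists a => // k /= ak'; exact: leq_trans ak' (lvk k).
have Fc x : good W (x, t) -> F k x @[k --> \oo] --> uu (x, t) `^ m * 'D_(e_ i) psi x.
  move=> gx; apply: cvgM.
    have [uc _] := limit_u_rate W0 Wu gx.
    apply/cvgrPdist_le => e e0; pose L := m * C `^ (m - 1) + 1.
    have L0 : 0 < L by rewrite ltr_wpDl // mulr_ge0 ?powR_ge0 //; move: m1; lra.
    move/cvgrPdist_le : uc => /(_ (e / L)); rewrite divr_gt0 // => /(_ isT); apply: filterS => k hk.
    have mm : 1 <= m by move: m1; lra.
    apply: (le_trans (powR_lipschitz mm (limit_u_bound W0 uC Wu _) (uC _ _))).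
    apply: (@le_trans _ _ (L * (e / L))); last by rewrite mulrC divfK // gt_eqF.
    apply: ler_pM => //; first by rewrite mulr_ge0 ?powR_ge0 //; move: m1; lra.
    by rewrite lerDl.
  apply: (cvg_eventually (N := a) (c := fun k => quot (lv k) x)); last exact: (quotc lv x lvk).
  by move=> k ak'; rewrite (leq_trans ak' (lvk k)).
have [_ lim] := slice_bounded t0 gt mF mF0 FB Fc.
(* The first levels, smaller than a, are given psi itself to keep measurability; only the tail
   matters. *)
pose psik k x := if (a <= lv k)%N then psi (corner (lv k) x) else psi x.
have mpsik k : measurable_fun setT (psik k).
  rewrite /psik; case: leqP => // al.
  by apply: (measurable_corner (a := a)) => // y yb; exact: far yb (cor2 _ _).
have pL k x : `|psik k x - psi x| <= L1 * @mesh R (lv k) * \1_(@box R n a) x.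
  rewrite indicE; have [xa|xa] := boolP (inbox a x); last first.
    rewrite /psik (far x x xa) ?subrr ?normr0 // (far _ _ xa (cor2 _ _)) if_same subrr normr0.
    by rewrite !mulr_ge0 // ltW.
  rewrite mem_set // mulr1 /psik; case: leqP => _.
    by rewrite subrr normr0 mulr_ge0 // ltW.
  by apply: lipschitz_corner => // j z hh; exact: (HB j).2.
have SI' : \int[mu]_x (g k i (x, t) * psik k x) @[k --> \oo] --> - \int[mu]_x (uu (x, t) `^ m * 'D_(e_ i) psi x).
  apply: (cvg_eventually (N := maxn a (Num.trunc t).+1) (c := fun k => - \int[mu]_x F k x)); last exact: cvgN lim.
  move=> k; rewrite geq_max => /andP[ak' tk].
  have al : (a <= lv k)%N := leq_trans ak' (lvk k).
  have tl : t < 2 ^+ lv k.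
    have /andP[_ h] := truncn_itv t0; apply: (lt_trans h); rewrite -natrX ltr_nat.
    by apply: (leq_ltn_trans (leq_trans tk (lvk k))); exact: ltn_expl.
  rewrite /psik al (SI k psi i tl); congr (- _); apply: eq_Rintegral => x _.
  by rewrite /F al.
rewrite -[LHS]opprK; congr (- _); apply/esym.
have S := slice_functional t0 gt (fun k => ig k i) mpsi mpsik L10 Bp0 HBp pL SI'.
have e1 : \int[mu]_x ((\row_i0 gg i0 (x, t)) 0 i * psi x) = \int[mu]_x (gg i (x, t) * psi x).
  by apply: eq_Rintegral => x _; rewrite mxE.
by rewrite e1 S; congr (- _); apply: eq_Rintegral => x _; rewrite /grad mxE.
Qed.

(** Three terms converge by domination, so the identity forces the limit [ell] of the fourth, in
    which the fluxes converge only weakly. As the quotients Q k tend to P in L^2 and the fluxes are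
    bounded there, P may replace Q k; [hull_functional] then transfers [ell] to the limit flux. *)
Lemma weak_form (Q : nat -> 'I_n -> Z -> R) (Q0 Qt : nat -> Z -> R) (P : 'I_n -> Z -> R)
    (p0 pt : Z -> R) (u0 : Rn -> R) (q0 : nat -> Rn -> R) (q : Rn -> R) a T B k1 :
  0 <= chi -> 0 <= M0 -> 0 <= B ->
  (forall k i, measurable_fun setT (Q k i)) -> (forall k, measurable_fun setT (Q0 k)) ->
  (forall k, measurable_fun setT (Qt k)) -> (forall k, measurable_fun setT (q0 k)) ->
  measurable_fun setT q ->
  (forall k i z, `|Q k i z| <= B * \1_(@slab R n a T) z) ->
  (forall k z, `|Q0 k z| <= B * \1_(@slab R n a T) z) ->
  (forall k z, `|Qt k z| <= B * \1_(@slab R n a T) z) -> (forall k y, `|q0 k y| <= B) ->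
  (forall i z, Q k i z @[k --> \oo] --> P i z) ->
  (forall z, good W z -> Q0 k z @[k --> \oo] --> p0 z) ->
  (forall z, good W z -> Qt k z @[k --> \oo] --> pt z) ->
  (forall y, q0 k y @[k --> \oo] --> q y) ->
  mu.-integrable setT (EFin \o u0) ->
  (forall k i, mu2.-integrable setT (EFin \o g k i)) ->
  (forall k, (k1 <= k)%N ->
    \int[mu2]_z (\sum_i g k i z * Q k i z) - \int[mu2]_z (rt k z * u k z `^ alpha * Q0 k z) =
    \int[mu]_y (u0 y * q0 k y) + \int[mu2]_z (v k z * Qt k z)) ->
  let kap z := chi * (M0 - \int[mu]_y uu (y, z.2)) in
  [/\ mu2.-integrable setT (EFin \o (fun z => \sum_i gg i z * P i z)),
      mu2.-integrable setT (EFin \o (fun z => kap z * uu z `^ alpha * p0 z)),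
      mu2.-integrable setT (EFin \o (fun z => uu z * pt z)) &
      \int[mu2]_z (\sum_i gg i z * P i z) - \int[mu2]_z (kap z * uu z `^ alpha * p0 z) =
      \int[mu]_y (u0 y * q y) + \int[mu2]_z (uu z * pt z)].
Proof using All.
move=> chi0 M00 B0 mQ mQ0 mQt mq0 mq QB Q0B QtB q0B Qc Q0c Qtc q0c iu0 ig WI kap.
have islab c := integrable_finite c (@measurable_slab R n a T) (@measure_slab R n a T).
have sl01 z : 0 <= (\1_(@slab R n a T) z : R) <= 1 by rewrite indicE; case: (_ \in _); rewrite /= ?lexx ?ler01.
have neg z : z.2 < 0 -> \1_(@slab R n a T) z = 0 :> R.
  by move=> z0; rewrite indicE slabP /before leNgt z0.
have a1 : 1 <= alpha by move: al1; lra.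
have uc z : good W z -> u k z @[k --> \oo] --> uu z by move=> gz; have [] := limit_u_rate W0 Wu gz.
have mesh1 l : @mesh R l <= 1 by rewrite /mesh exprn_ile1 ?invr_ge0 ?invf_le1 ?ler1n.
have lvk k : (k <= lv k)%N by apply: leq_trans (lv2 k); rewrite mul2n -addnn leq_addr.
have ucp z : good W z -> u k z `^ alpha @[k --> \oo] --> uu z `^ alpha.
  move=> gz; apply/cvgrPdist_le => e e0; pose L := alpha * C `^ (alpha - 1) + 1.
  have L00 : 0 <= alpha * C `^ (alpha - 1) by rewrite mulr_ge0 ?powR_ge0 //; lra.
  have L0 : 0 < L by rewrite ltr_wpDl.
  move/cvgrPdist_le : (uc z gz) => /(_ (e / L)); rewrite divr_gt0 // => /(_ isT); apply: filterS => k hk.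
  apply: (le_trans (powR_lipschitz a1 (limit_u_bound W0 uC Wu _) (uC _ _))).
  apply: (@le_trans _ _ (L * (e / L))); last by rewrite mulrC divfK // gt_eqF.
  by apply: ler_pM => //; rewrite lerDl.
have [_ i2 c2] : [/\ measurable_fun setT (fun z => kap z * uu z `^ alpha * p0 z),
    mu2.-integrable setT (EFin \o (fun z => kap z * uu z `^ alpha * p0 z)) &
    \int[mu2]_z (rt k z * u k z `^ alpha * Q0 k z) @[k --> \oo] --> \int[mu2]_z (kap z * uu z `^ alpha * p0 z)].
  apply: (dominated_good mW W0 IW _ (islab (chi * M0 * C `^ alpha * B))).
  - move=> k; apply: measurable_funM => //; apply: measurable_funM => //.
    exact: measurableT_comp (measurable_powR alpha) (mu_k k).
  - by move=> z; rewrite lee_fin mulr_ge0 ?mulr_ge0 ?powR_ge0 //; case/andP: (sl01 z).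
  - move=> k z _; rewrite lee_fin !normrM -[leRHS]mulrA; apply: ler_pM => //.
    apply: ler_pM => //; first by have /andP[h1 h2] := rtM k z; rewrite ger0_norm.
    rewrite ger0_norm ?powR_ge0 //; have /andP[h1 h2] := uC k z; apply: powR_le => //; lra.
  - move=> k z z0; have := Q0B k z; rewrite neg // mulr0 normr_le0 => /eqP ->; by rewrite mulr0.
  - move=> [x t] gz; have t0 := good_time0 gz; have gt : good_time W t by move: gz => /andP[/andP[]].
    apply: cvgM; last exact: Q0c.
    apply: cvgM; last exact: ucp.
    have [_ mc _] := slice_mass t0 gt.
    (* The rate is compared with the mass deficit, which converges at good times. *)
    have -> : (fun k => rt k (x, t)) = (fun k => (rt k (x, t) - chi * (M0 - \int[mu]_y u k (y, t))) +
        chi * (M0 - \int[mu]_y u k (y, t))) by apply/funext => k; rewrite subrK.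
    rewrite -[kap _]add0r; apply: cvgD; first exact: rtc.
    by apply: cvgMr; apply: cvgB => //; exact: cvg_cst.
  - move=> z gz; rewrite /limit_u (negbTE gz) powR0 ?mulr0 ?mul0r // gt_eqF //; lra.
have [_ i4 c4] : [/\ measurable_fun setT (fun z => uu z * pt z),
    mu2.-integrable setT (EFin \o (fun z => uu z * pt z)) &
    \int[mu2]_z (v k z * Qt k z) @[k --> \oo] --> \int[mu2]_z (uu z * pt z)].
  apply: (dominated_good mW W0 IW _ (islab ((C + b) * B))).
  - by move=> k; exact: measurable_funM.
  - by move=> z; rewrite lee_fin mulr_ge0 ?mulr_ge0 ?addr_ge0 //; case/andP: (sl01 z).
  - move=> k z _; rewrite lee_fin normrM -[leRHS]mulrA; apply: ler_pM => //.
    have := vu k z; have /andP[h1 h2] := uC k z => h3.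
    have h4 : mesh (lv k) * b <= b by rewrite ler_piMl.
    have := ler_normD (v k z - u k z) (u k z); rewrite subrK [`|u k z|]ger0_norm //; lra.
  - move=> k z z0; have := QtB k z; rewrite neg // mulr0 normr_le0 => /eqP ->; by rewrite mulr0.
  - move=> z gz; apply: cvgM; last exact: Qtc.
    have -> : (fun k => v k z) = (fun k => (v k z - u k z) + u k z) by apply/funext => k; rewrite subrK.
    rewrite -[uu z]add0r; apply: cvgD; last exact: uc.
    apply: cvg_zero_le => [k|]; first exact: vu.
    by rewrite -(mul0r b); apply: cvgMl; exact: mesh_cvg0.
  - by move=> z gz; rewrite /limit_u (negbTE gz) mul0r.
have mu0 : measurable_fun setT u0 by apply/measurable_EFinP; case/integrableP: iu0.
have [_ c3] : mu.-integrable setT (EFin \o (fun y => u0 y * q y)) /\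
    \int[mu]_y (u0 y * q0 k y) @[k --> \oo] --> \int[mu]_y (u0 y * q y).
  apply: (@Rdominated _ _ _ mu (fun k y => u0 y * q0 k y) (fun y => u0 y * q y) (fun y => B%:E * `|(u0 y)%:E|)%E).
  - by move=> k; exact: measurable_funM.
  - exact: measurable_funM.
  - by apply: aeW => y; apply: cvgMr; exact: q0c.
  - by apply: integrableZl => //; exact: integrable_abse.
  - by apply: aeW => y k; rewrite -EFinM lee_fin normrM mulrC; apply: ler_wpM2r.
have PB i z : `|P i z| <= B * \1_(@slab R n a T) z by apply: cvg_bound (Qc i z) => k; exact: QB.
have mP i : measurable_fun setT (P i).
  by apply: (measurable_fun_cvg (h := fun k => Q k i)) => // z _; exact: Qc.
have slB z : B * \1_(@slab R n a T) z <= B by rewrite ler_piMr //; case/andP: (sl01 z).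
have Bd (F G : Z -> R) : mu2.-integrable setT (EFin \o F) -> measurable_fun setT F ->
    measurable_fun setT G -> (forall z, `|G z| <= B * \1_(@slab R n a T) z) ->
    mu2.-integrable setT (EFin \o (fun z => F z * G z)).
  move=> iF mF mG GB; apply: (@integrable_le _ _ _ _ _ (fun z => B%:E * `|(F z)%:E|)%E).
  - exact: measurable_funM.
  - by apply: integrableZl => //; exact: integrable_abse.
  - move=> z; rewrite /= -EFinM lee_fin normrM mulrC; apply: ler_wpM2r => //.
    exact: le_trans (GB z) (slB z).
have isum (F : 'I_n -> Z -> R) : (forall i, mu2.-integrable setT (EFin \o F i)) ->
    mu2.-integrable setT (EFin \o (fun z => \sum_i F i z)).
  move=> iF; have -> : EFin \o (fun z => \sum_i F i z) = (fun z => (\sum_i (F i z)%:E)%E).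
    by apply/funext => z /=; rewrite sumEFin.
  by apply: integrable_sum => // i _; exact: iF.
have igP k : mu2.-integrable setT (EFin \o (fun z => \sum_i g k i z * P i z)).
  by apply: isum => i; apply: Bd.
have igQ k : mu2.-integrable setT (EFin \o (fun z => \sum_i g k i z * Q k i z)).
  by apply: isum => i; apply: Bd.
pose E k z := \sum_i (P i z - Q k i z) ^+ 2.
have mE k : measurable_fun setT (E k).
  by apply: measurable_sum => i; apply: measurable_funX; exact: measurable_funB.
have [iE cE] : (forall k, mu2.-integrable setT (EFin \o E k)) /\ \int[mu2]_z E k z @[k --> \oo] --> 0.
  pose H z : \bar R := ((n%:R * (2 * B) ^+ 2) * \1_(@slab R n a T) z)%:E.
  have EB k z : (`|(E k z)%:E| <= H z)%E.
    rewrite lee_fin ger0_norm; last by apply: sumr_ge0 => i _; exact: sqr_ge0.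
    rewrite -mulrA -[n in n%:R]card_ord mulr_natl -sumr_const; apply: ler_sum => i _.
    have hP := PB i z; have hQ := QB k i z; have /andP[y0 y1] := sl01 z.
    have := ler_normB (P i z) (Q k i z) => hD.
    have h1 : `|P i z - Q k i z| <= 2 * B * \1_(@slab R n a T) z by lra.
    rewrite -real_normK ?num_real //; apply: (@le_trans _ _ ((2 * B * \1_(@slab R n a T) z) ^+ 2)).
      by apply: lerXn2r; rewrite ?nnegrE ?mulr_ge0.
    by rewrite exprMn ler_wpM2l ?sqr_ge0 // expr2 ler_piMr.
  split=> [k|]; first exact: integrable_le (mE k) (islab _) (EB k).
  have [||||_] := @Rdominated _ _ _ mu2 E (fun=> 0) H mE.
  - exact: measurable_cst.
  - apply: aeW => z; rewrite /E -[X in _ --> X](_ : \sum_(i < n) 0 = 0); last by rewrite big1.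
    apply: (cvgn_sum (f := fun i k => (P i z - Q k i z) ^+ 2) (l := fun=> 0)) => i; rewrite -[X in _ --> X](mulr0 (0 : R)).
    have h : P i z - Q k i z @[k --> \oo] --> (0 : R).
      by rewrite -(subrr (P i z)); apply: cvgB => //; exact: cvg_cst.
    by under eq_fun do rewrite expr2; exact: cvgM.
  - exact: islab.
  - by apply: aeW => z k; exact: EB.
  - by rewrite Rintegral_cst // mul0r.
pose ell := \int[mu]_y (u0 y * q y) + \int[mu2]_z (uu z * pt z) + \int[mu2]_z (kap z * uu z `^ alpha * p0 z).
have cQ : \int[mu2]_z (\sum_i g k i z * Q k i z) @[k --> \oo] --> ell.
  apply: (cvg_eventually (N := k1) (c := fun k => \int[mu]_y (u0 y * q0 k y) +
    \int[mu2]_z (v k z * Qt k z) + \int[mu2]_z (rt k z * u k z `^ alpha * Q0 k z))).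
    by move=> k hk; rewrite -(WI k hk) subrK.
  exact: cvgD (cvgD c3 c4) c2.
have D0 : 0 <= D.
  rewrite -lee_fin; apply: le_trans (gD 0%N); apply: integral_ge0 => z _.
  by rewrite lee_fin sqn_ge0.
have cP : \int[mu2]_z (\sum_i g k i z * P i z) @[k --> \oo] --> ell.
  rewrite -[ell]addr0.
  have -> : (fun k => \int[mu2]_z (\sum_i g k i z * P i z)) = (fun k =>
      \int[mu2]_z (\sum_i g k i z * Q k i z) + (\int[mu2]_z (\sum_i g k i z * P i z) - \int[mu2]_z (\sum_i g k i z * Q k i z))).
    by apply/funext => k; rewrite addrC subrK.
  apply: cvgD => //; apply/cvgrPdist_le => e e0.
  (* Young's inequality with weight [de]: the fluxes contribute at most de D <= e / 2, and the L^2
     error divided by [de] contributes the other half. *)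
  pose de := e / (2 * (D + 1)); have de0 : 0 < de by rewrite divr_gt0 // mulr_gt0 // ltr_wpDl.
  have hpos : 0 < e / 2 * de by rewrite mulr_gt0 // divr_gt0.
  move/cvgrPdist_le : cE => /(_ (e / 2 * de) hpos).
  apply: filterS => k; rewrite sub0r normrN => hE.
  rewrite sub0r normrN -RintegralB //.
  have iPQ : mu2.-integrable setT (EFin \o (fun z => \sum_i g k i z * P i z - \sum_i g k i z * Q k i z)).
    exact: (integrableB measurableT (igP k) (igQ k)).
  apply: (le_trans (le_normr_Rintegral _ _)) => //.
  have isq : mu2.-integrable setT (EFin \o sqn (g k)).
    apply/integrableP; split; first by apply/measurable_EFinP; exact: measurable_sqn.
    under eq_integral do rewrite gee0_abs ?lee_fin ?sqn_ge0 //.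
    by apply: (le_lt_trans (gD k)); exact: ltry.
  have iZ1 : mu2.-integrable setT (EFin \o (fun z => de * sqn (g k) z)).
    by rewrite (_ : EFin \o _ = (fun z => de%:E * (sqn (g k) z)%:E)%E) //; exact: integrableZl.
  have iEk := iE k.
  have iZ2 : mu2.-integrable setT (EFin \o (fun z => de^-1 * E k z)).
    by rewrite (_ : EFin \o _ = (fun z => (de^-1)%:E * (E k z)%:E)%E) //; exact: integrableZl.
  apply: (@le_trans _ _ (\int[mu2]_z (de * sqn (g k) z + de^-1 * E k z))).
    apply: le_Rintegral => //.
    - exact: (integrable_norm iPQ).
    - exact: (integrableD measurableT iZ1 iZ2).
    - move=> z _; rewrite -sumrB; apply: (le_trans (ler_norm_sum _ _ _)).
      rewrite /sqn /E !mulr_sumr -big_split /=; apply: ler_sum => i _.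
      rewrite -mulrBr normrM; move: (g k i z) (P i z - Q k i z) => x y.
      have hx : x ^+ 2 = `|x| ^+ 2 by rewrite real_normK ?num_real.
      have hy : y ^+ 2 = `|y| ^+ 2 by rewrite real_normK ?num_real.
      have key (d p r : R) : 0 < d -> 0 <= p -> 0 <= r -> p * r <= d * p ^+ 2 + d^-1 * r ^+ 2.
        move=> d0 p0' r0; rewrite -(ler_pM2l d0) mulrDr !mulrA mulfV ?gt_eqF // mul1r.
        by have := sqr_ge0 (d * p - r); have := mulr_ge0 (mulr_ge0 (ltW d0) p0') r0; nra.
      by rewrite hx hy; exact: key.
  rewrite RintegralD // RintegralZl // RintegralZl //.
  have h1 : \int[mu2]_z sqn (g k) z <= D.
    by rewrite -lee_fin /Rintegral fineK ?integrable_fin_num //; exact: gD.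
  have h2 : \int[mu2]_z E k z <= e / 2 * de by exact: le_trans (ler_norm _) hE.
  have h3 : de^-1 * \int[mu2]_z E k z <= e / 2 by rewrite ler_pdivrMl // mulrC.
  have h4 : de * \int[mu2]_z sqn (g k) z <= e / 2.
    apply: (le_trans (ler_wpM2l (ltW de0) h1)); rewrite /de mulrAC ler_pdivrMr ?mulr_gt0 ?ltr_wpDl //.
    by have : 0 < e by []; nra.
  by rewrite [leRHS](splitr e); exact: lerD.
pose c : R := n%:R * B * (4 + 8 * n%:R).
have w0 z := fineW0 W0 z.
have iWz : mu2.-integrable setT W.
  by apply/integrableP; split=> //; under eq_integral do rewrite gee0_abs //; exact: IW.
have [iG cG] : mu2.-integrable setT (EFin \o (fun z => \sum_i gg i z * P i z)) /\
    \int[mu2]_z (\sum_i f k i z * P i z) @[k --> \oo] --> \int[mu2]_z (\sum_i gg i z * P i z).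
  apply: (@Rdominated _ _ _ mu2 (fun k z => \sum_i f k i z * P i z) (fun z => \sum_i gg i z * P i z)
    (fun z => ((3 * n%:R * B) * \1_(@slab R n a T) z)%:E + c%:E * W z)%E).
  - by move=> k; apply: measurable_sum => i; apply: measurable_funM => //; exact: (hull_measurable mg (hf k)).
  - by apply: measurable_sum => i; apply: measurable_funM => //; exact: measurable_limit_g.
  - have [E0 [mE0 muE0 subE0]] := ae_good mW W0 IW; exists E0; split=> //; apply: subset_trans subE0; apply: subsetC => z gz.
    apply: (cvgn_sum (f := fun i k => f k i z * P i z) (l := fun i => gg i z * P i z)) => i; have [z0|z0] := leP 0 z.2.
      by apply: cvgMl; have [] := limit_g_rate W0 Wf i (gz z0).
    have -> : P i z = 0 by apply/eqP; rewrite -normr_le0; have := PB i z; rewrite neg // mulr0.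
    by under eq_fun do rewrite mulr0; rewrite mulr0; exact: cvg_cst.
  - have iS := islab (3 * n%:R * B).
    have icW : mu2.-integrable setT (fun z => c%:E * W z)%E by exact: integrableZl.
    exact: (integrableD measurableT iS icW).
  - have [E0 [mE0 muE0 subE0]] := ae_good mW W0 IW; exists E0; split=> //; apply: subset_trans subE0; apply: subsetC => z gz k; have /andP[y0 y1] := sl01 z.
    have c0 : 0 <= c by rewrite /c !mulr_ge0 // addr_ge0 // mulr_ge0.
    have [z0|z0] := leP 0 z.2; last first.
      rewrite big1 ?abse0 ?adde_ge0 ?mule_ge0 ?lee_fin ?mulr_ge0 // => i _.
      have -> : P i z = 0 by apply/eqP; rewrite -normr_le0; have := PB i z; rewrite neg // mulr0.
      by rewrite mulr0.
    rewrite (good_fine W0 (gz z0)) -EFinM -EFinD lee_fin; apply: (le_trans (ler_norm_sum _ _ _)).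
    have -> : 3 * n%:R * B * \1_(@slab R n a T) z + c * fine (W z) =
        \sum_(i < n) (3 * B * \1_(@slab R n a T) z + B * (4 + 8 * n%:R) * fine (W z)).
      by rewrite sumr_const card_ord -[RHS]mulr_natl /c; ring.
    apply: ler_sum => i _; rewrite normrM.
    apply: (le_trans (ler_pM (normr_ge0 _) (normr_ge0 _) (hull_bound k i (gz z0)) (PB i z))).
    have key (s w' nn : R) : 0 <= s <= 1 -> 0 <= w' -> 0 <= nn ->
        (3 + nn * w') * (B * s) <= 3 * B * s + B * nn * w'.
      move=> /andP[s0 s1] w0' nn0; rewrite mulrDl mulrA lerD2l.
      have h : nn * w' * (B * s) <= nn * w' * B.
        by apply: ler_wpM2l; [exact: mulr_ge0|rewrite ler_piMr].
      by apply: (le_trans h); rewrite (_ : nn * w' * B = B * nn * w') //; ring.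
    by apply: key; [exact: sl01|exact: w0|rewrite addr_ge0 // mulr_ge0].
have := hull_functional (fun k => igP k) hf cP cG => ->.
by split=> //; rewrite /ell addrK.
Qed.

End passage.

(** * Discretisation of the initial datum *)

Section initial_datum.
Context {R : realType} (n : nat) (n0 : (0 < n)%N).
Local Notation Rn := 'rV[R]_n.
Local Notation mu := (lebesgue_rV R n).
Variables (w : Rn -> R) (A : R).
Hypothesis mw : measurable_fun setT w.
Hypothesis wA : forall y, 0 <= w y <= A.
Hypothesis iw : mu.-integrable setT (EFin \o w).
Variable l : nat.
Local Notation G := {ffun 'I_n -> 'I_(top l).+2}.
Local Notation h := (@mesh R l).

Definition cell_average (x : G) : R :=
  if wall x then 0 else (h ^+ n)^-1 * \int[mu]_y (w y * \1_(@cell R n l x) y).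

Let hn0 : 0 < h ^+ n. Proof. by rewrite exprn_gt0 // mesh_gt0. Qed.

Let ind01 (x : G) y : 0 <= (\1_(@cell R n l x) y : R) <= 1.
Proof. by rewrite indicE; case: (_ \in _); rewrite /= ?lexx ?ler01. Qed.

Lemma integrable_mul_bounded (F : Rn -> R) B : measurable_fun setT F -> (forall y, `|F y| <= B) ->
  mu.-integrable setT (EFin \o (fun y => w y * F y)).
Proof.
move=> mF FB; apply: (@integrable_le _ _ _ _ _ (fun y => B%:E * (w y)%:E)%E).
- exact: measurable_funM.
- exact: integrableZl.
- move=> y; have /andP[w0 _] := wA y.
  by rewrite -EFinM lee_fin normrM ger0_norm // mulrC ler_wpM2r.
Qed.

Let icell (x : G) (c : R) : mu.-integrable setT (EFin \o (fun y => w y * (c * \1_(@cell R n l x) y))).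
Proof.
apply: (@integrable_mul_bounded _ `|c|).
  by apply: measurable_funM => //; exact: measurable_indic (measurable_cell x).
move=> y; rewrite normrM ler_piMr //; have /andP[h1 h2] := ind01 x y; by rewrite ger0_norm.
Qed.

Lemma integral_mul_emb (F : G -> R) : mu.-integrable setT (EFin \o (fun y => w y * emb F y)) /\
  \int[mu]_y (w y * emb F y) = \sum_x F x * \int[mu]_y (w y * \1_(@cell R n l x) y).
Proof.
pose E x y := w y * (F x * \1_(@cell R n l x) y).
have S (s : seq G) : mu.-integrable setT (EFin \o (fun y => \sum_(x <- s) E x y)) /\
    \int[mu]_y (\sum_(x <- s) E x y) = \sum_(x <- s) \int[mu]_y E x y.
  elim: s => [|x s [IH1 IH2]].
    have -> : (fun y => \sum_(x <- [::]) E x y) = cst 0 by apply/funext => y; rewrite big_nil.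
    by rewrite big_nil; split; [exact: integrable0|rewrite /Rintegral integral0].
  have -> : (fun y => \sum_(z <- x :: s) E z y) = (fun y => E x y + \sum_(z <- s) E z y).
    by apply/funext => y; rewrite big_cons.
  split; first exact: (integrableD measurableT (icell x (F x)) IH1).
  by rewrite big_cons -IH2 -RintegralD //; exact: icell.
have -> : (fun y => w y * emb F y) = (fun y => \sum_x E x y).
  by apply/funext => y; rewrite embE mulr_sumr.
have [h1 h2] := S (index_enum G); split=> //; rewrite h2; apply: eq_bigr => x _.
rewrite -RintegralZl //; last first.
  by have := icell x 1; rewrite (_ : (fun y => w y * (1 * _)) = (fun y => w y * \1_(@cell R n l x) y)) //; apply/funext => y; rewrite mul1r.
by apply: eq_Rintegral => y _; rewrite /E mulrCA.
Qed.

Lemma average_sum (F : G -> R) : h ^+ n * (\sum_x cell_average x * F x) =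
  \int[mu]_y (w y * emb (fun x => if wall x then 0 else F x) y).
Proof.
rewrite (integral_mul_emb _).2 mulr_sumr; apply: eq_bigr => x _; rewrite /cell_average.
case: ifP => _; first by rewrite !mul0r mulr0.
by rewrite !mulrA mulfV ?gt_eqF // mul1r mulrC.
Qed.

Lemma average_initial : initial A (\int[mu]_y w y) h cell_average.
Proof.
split=> [x|x xw|].
- rewrite /cell_average; case: ifP => _.
    by rewrite lexx; have /andP[h1 h2] := wA 0; exact: le_trans h1 h2.
  rewrite mulr_ge0 ?invr_ge0 ?(ltW hn0) //=; last first.
    by apply: Rintegral_ge0 => y _; rewrite mulr_ge0 //; have /andP[] := wA y.
  rewrite ler_pdivrMl // mulrC.
  have i1 := integrable_finite 1 (@measurable_cell R n l x) (measure_cell _).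
  have i1' : mu.-integrable setT (EFin \o (fun y => A * (\1_(@cell R n l x) y : R))).
    exact: (integrable_finite A (@measurable_cell R n l x) (measure_cell _)).
  have -> : A * h ^+ n = \int[mu]_y (A * \1_(@cell R n l x) y).
    rewrite RintegralZl //; last by move: i1; under eq_fun do rewrite mul1r.
    have mc := @measurable_cell R n l x.
    have e : (\int[mu]_y (\1_(@cell R n l x) y)%:E = (h ^+ n)%:E)%E.
      by rewrite integral_indic // setIT; exact: measure_cell.
    by rewrite /Rintegral e.
  apply: le_Rintegral => //.
    by have := icell x 1; rewrite (_ : (fun y => w y * (1 * _)) = (fun y => w y * \1_(@cell R n l x) y)) //; apply/funext => y; rewrite mul1r.
  by move=> y _; have /andP[_ h2] := wA y; have /andP[h3 _] := ind01 x y; rewrite ler_wpM2r.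
- by rewrite /cell_average xw.
- have -> : \sum_x cell_average x = \sum_x cell_average x * 1 by apply: eq_bigr => x _; rewrite mulr1.
  rewrite average_sum; apply: le_Rintegral => //; first exact: (integral_mul_emb _).1.
  move=> y _; have /andP[w0 _] := wA y; rewrite ler_piMr // /emb; case: ifP => // _; by case: ifP.
Qed.

(** Points missed by the averages, outside the box or in a wall cell, have a coordinate of size at
    least 2^l - 1, so the charge 4^l is at most 2 |y|^2 + 2 n; elsewhere the corner is within 1 of y
    in each coordinate, with the same bound. *)
Lemma average_moment : mu.-integrable setT (fun y => (w y * (2 * dotv y y + 2 * n%:R))%:E) ->
  h ^+ n * (\sum_x cell_average x * moment h (4 ^ l) x) +
    (h * (4 ^ l)%:R) ^+ 2 * (\int[mu]_y w y - h ^+ n * (\sum_x cell_average x)) <=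
  \int[mu]_y (w y * (2 * dotv y y + 2 * n%:R)).
Proof.
move=> iM; have -> : \sum_x cell_average x = \sum_x cell_average x * 1 by apply: eq_bigr => x _; rewrite mulr1.
rewrite !average_sum mesh_half.
pose F1 (x : G) := if wall x then 0 else moment h (4 ^ l) x; pose F2 (x : G) : R := if wall x then 0 else 1.
rewrite -/F1 -/F2.
have [i1 _] := integral_mul_emb F1; have [i2 _] := integral_mul_emb F2.
set S := (2 ^+ l) ^+ 2.
have i3 : mu.-integrable setT (EFin \o (fun y => w y - w y * emb F2 y)) by exact: (integrableB measurableT iw i2).
have i4 : mu.-integrable setT (EFin \o (fun y => S * (w y - w y * emb F2 y))) by rewrite (_ : EFin \o _ = (fun y => S%:E * (w y - w y * emb F2 y)%:E)%E) //; exact: integrableZl.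
rewrite -RintegralB // -RintegralZl // -RintegralD //; apply: le_Rintegral => //.
  exact: (integrableD measurableT i1 i4).
move=> y _; have /andP[w0 _] := wA y.
have -> : w y * emb F1 y + S * (w y - w y * emb F2 y) = w y * (emb F1 y + S * (1 - emb F2 y)) by ring.
apply: ler_wpM2l => //.
have n1 : 1 <= n%:R :> R by rewrite ler1n.
have p1 : 1 <= 2 ^+ l :> R by rewrite -natrX ler1n expn_gt0.
have h1 : h <= 1 by rewrite /mesh exprn_ile1 ?invr_ge0 ?invf_le1 ?ler1n.
have coord i : y 0 i ^+ 2 <= dotv y y.
  rewrite /dotv (bigD1 i) //= -expr2 lerDl; apply: sumr_ge0 => j _; rewrite -expr2; exact: sqr_ge0.
have far i : y 0 i < - 2 ^+ l + 1 \/ 2 ^+ l <= y 0 i -> S <= 2 * dotv y y + 2 * n%:R.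
  move=> H; have := coord i; suff : S <= 2 * y 0 i ^+ 2 + 2 by move: n1; lra.
  rewrite /S; move: p1 H; move: (2 ^+ l) (y 0 i) => a s a1 [H|H]; last by nra.
  have := sqr_ge0 (a - 2); have : (a - 1) ^+ 2 <= s ^+ 2 by nra.
  rewrite !expr2; nra.
rewrite /emb; case: ifPn => [yb|]; last first.
  rewrite negb_forall => /existsP[i]; rewrite negb_and -ltNge -leNgt => H.
  rewrite add0r subr0 mulr1; apply: (far i); case/orP: H => H; [left|by right].
  by apply: (lt_le_trans H); rewrite lerDl.
have nc := node_idx yb; rewrite /F1 /F2; case: ifPn => [/existsP[i /eqP xi]|_].
  rewrite add0r subr0 mulr1; apply: (far i); left.
  have /andP[_] := @corner_bound R n l y i; rewrite -nc mxE xi /= sub0r mulrN mesh_half => hc.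
  by apply: (lt_le_trans hc); rewrite lerD2l.
rewrite subrr mulr0 addr0 /moment /position /dotv mulr_sumr.
have -> : 2 * n%:R = \sum_(i < n) (2 : R) by rewrite sumr_const card_ord mulr_natr.
rewrite -big_split /=; apply: ler_sum => i _.
have -> : h * ((idx l y i)%:R - (4 ^ l)%:R) = corner l y 0 i by rewrite -nc mxE.
have /andP[] := @corner_bound R n l y i; move: (corner l y 0 i) (y 0 i) h1 => c s; have := @mesh_gt0 R l.
move: (h) => e e0 e1 c1 c2; have := sqr_ge0 (s + (s - c)); have : 0 <= s - c <= 1 by lra.
move=> /andP[d0 d1]; rewrite !expr2; nra.
Qed.

End initial_datum.

(** * The limit is a global weak solution *)

Lemma st_prod (R : realType) (n l : nat) (F F' : nat -> {ffun 'I_n -> 'I_(top l).+2} -> R) z :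
  st F z * st F' z = st (fun j x => F j x * F' j x) z.
Proof. by rewrite /st /emb; case: ifP => _; [case: ifP => _|]; rewrite ?mul0r. Qed.

Lemma st_corner (R : realType) (n l : nat) (p : 'rV[R]_n -> R -> R) (z : 'rV[R]_n * measurableTypeR R) :
  st (fun j (x : {ffun 'I_n -> 'I_(top l).+2}) => p (node x) (j%:R * @mesh R l ^+ 2)) z =
  if intime l z.2 && inbox l z.1 then p (corner l z.1) (instant l z.2) else 0.
Proof. by rewrite /st /emb; case: ifP => _ //=; case: ifP => // zb; rewrite (node_idx zb). Qed.

Lemma Rintegral_time (R : realType) (T : R) (F : measurableTypeR R -> R) : (forall t, ~ time T%:E t -> F t = 0) ->
  \int[@lebesgue_measure R]_(t in time T%:E) F t = \int[@lebesgue_measure R]_t F t.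
Proof.
move=> F0; rewrite Rintegral_mkcond; apply: eq_Rintegral => t _; rewrite patchE.
by case: ifPn => // /negP tT; rewrite F0 // => h; apply: tT; exact/mem_set.
Qed.

Lemma time_itv (R : realType) (T : R) : time T%:E = `]0, T[%classic.
Proof.
by apply/seteqP; split=> t; rewrite /time /= in_itv /= lte_fin; [case=> -> ->|move/andP].
Qed.

Section solution.
Context {R : realType} (n : nat) (n0 : (0 < n)%N).
Local Notation Rn := 'rV[R]_n.
Local Notation Z := (Rn * measurableTypeR R)%type.
Local Notation mu := (lebesgue_rV R n).
Local Notation dt := (@lebesgue_measure R).
Local Notation mu2 := (mu \x (@lebesgue_measure R))%E.
Local Notation e_ i := (delta_mx 0 i : Rn).
Local Notation G l := {ffun 'I_n -> 'I_(top l).+2}.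
Variables (m chi M0 m0 A C D Mom : R) (l0 : nat).
Variables (U V : forall l, nat -> G l -> R) (q : nat -> nat -> R).
Arguments U : clear implicits.
Arguments V : clear implicits.
Hypothesis ctr : forall l, (l0 <= l)%N -> forall J, controlled m chi M0 m0 A (@mesh R l) C (U l) (V l) (q l) J.
Hypothesis HD : forall l, (l0 <= l)%N -> forall J,
  \sum_(j < J) @mesh R l ^+ n * dform (pw m (U l j)) (pw m (U l j)) <= D.
Hypothesis HM : forall l, (l0 <= l)%N ->
  @mesh R l ^+ n * (\sum_x V l 0%N x * moment (@mesh R l) (4 ^ l) x) +
  (@mesh R l * (4 ^ l)%:R) ^+ 2 * (q l 0%N - @mesh R l ^+ n * (\sum_x V l 0%N x)) <= Mom.
Variable lv : nat -> nat.
Hypothesis lvl : forall k, (l0 <= lv k)%N.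
Hypothesis lv2 : forall k, (2 * k <= lv k)%N.
Local Notation alpha := (m + 2 / n%:R).

Definition density k : Z -> R := st (U (lv k)).
Definition density_next k : Z -> R := st (fun j => V (lv k) j.+1).
Definition flux k : 'I_n -> Z -> R := gradient m (U (lv k)).
Definition reaction k : Z -> R := st (fun j (_ : G (lv k)) => reaction_rate chi M0 (q (lv k) j)).

Variables (f : nat -> 'I_n -> Z -> R) (W : Z -> \bar R).
Hypothesis mW : measurable_fun setT W.
Hypothesis W0 : forall z, (0 <= W z)%E.
Hypothesis IW : (\int[mu2]_z W z < +oo)%E.
Hypothesis Wz : forall z : Z, z.2 = 0 -> W z = +oo%E.
Hypothesis Wu : forall k z, before k z.2 -> ((4 ^+ k * `|density k.+1 z - density k z|)%:E <= W z)%E.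
Hypothesis Wf : forall k i z, ((4 ^+ k * (f k.+1 i z - f k i z) ^+ 2)%:E <= W z)%E.
Hypothesis Wg : forall k i z, ((4 ^+ k * (@mesh R (lv k) * flux k i z) ^+ 2)%:E <= W z)%E.
Hypothesis Wf0 : forall z, ((sqn (f 0%N) z)%:E <= W z)%E.
Hypothesis hf : forall k, hull flux k (f k).

Local Notation uu := (limit_u density W).
Local Notation gg := (limit_g f W).
Let b : R := chi * M0 * C `^ (alpha - 1) * C.

Let ctrk k J := ctr (lvl k) J.
Let m1 : 1 < m. Proof. by have [[]] := ctrk 0 0. Qed.
Let chi0 : 0 < chi. Proof. by have [[]] := ctrk 0 0. Qed.
Let M00 : 0 < M0. Proof. by have [[]] := ctrk 0 0. Qed.
Let C0 : 0 <= C. Proof. exact: (K_ge0 (ctrk 0 0)). Qed.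
Let a0 : 0 < 2 / n%:R :> R. Proof. by rewrite divr_gt0 // ltr0n. Qed.
Let al1 : 1 < alpha. Proof. by move: m1 a0; lra. Qed.
Let b0 : 0 <= b. Proof. by rewrite /b !mulr_ge0 ?powR_ge0 // ltW. Qed.
Let mesh1 l : @mesh R l <= 1. Proof. by rewrite /mesh exprn_ile1 ?invr_ge0 ?invf_le1 ?ler1n. Qed.
Let mesh0 l : 0 < @mesh R l. Proof. exact: mesh_gt0. Qed.
Let lvk k : (k <= lv k)%N. Proof. by apply: leq_trans (lv2 k); rewrite mul2n -addnn leq_addr. Qed.

Let uC k z : 0 <= density k z <= C.
Proof. by apply: st_bound => // j x; exact: bound_U (ctrk k) j x. Qed.

Let mu_k k : measurable_fun setT (density k). Proof. exact: measurable_st. Qed.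
Let mv_k k : measurable_fun setT (density_next k). Proof. exact: measurable_st. Qed.
Let mrt k : measurable_fun setT (reaction k). Proof. exact: measurable_st. Qed.
Let mg k i : measurable_fun setT (flux k i). Proof. exact: measurable_st. Qed.
Let gD k : (\int[mu2]_z (sqn (flux k) z)%:E <= D%:E)%E.
Proof. by apply: gradient_energy => J; exact: HD. Qed.

Let islice l (F : nat -> G l -> R) t : mu.-integrable setT (fun x => (st F (x, t))%:E).
Proof.
rewrite /st /=; case: (intime l t); first exact: (integral_emb _).1.
exact: integrable0.
Qed.

Let iu k t : mu.-integrable setT (fun x => (density k (x, t))%:E). Proof. exact: islice. Qed.

Let massu k t : 0 <= t -> (\int[mu]_x (density k (x, t))%:E <= M0%:E)%E.
Proof. by move=> t0; exact: (mass_at n0 (ctrk k)). Qed.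

Let vu k z : `|density_next k z - density k z| <= @mesh R (lv k) * b.
Proof.
have h0 := mesh0 (lv k); have hb : 0 <= @mesh R (lv k) * b by rewrite mulr_ge0 // ltW.
rewrite /density_next /density /st /emb; case: ifP => _; last by rewrite subrr normr0.
case: ifP => _; last by rewrite subrr normr0.
set j := step_of _ _; set x := idx _ _.
have h1 := U_leV_next (ctrk k j) j x; have h2 := V_next_le n0 (ctrk k) j x.
have /andP[u0 uc] := bound_U (ctrk k) j x.
rewrite ger0_norm ?subr_ge0 //; apply: (le_trans h2).
rewrite expr2 -!mulrA ler_pM2l // /b -!mulrA mulrCA ler_pM2l // mulrCA ler_pM2l // mulrCA.
apply: ler_wpM2l; first exact: powR_ge0.
by rewrite -[leRHS]mul1r; apply: ler_pM => //; exact: ltW.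
Qed.

Let rtM k z : 0 <= reaction k z <= chi * M0.
Proof.
apply: st_bound => [|j _]; first by rewrite mulr_ge0 // ltW.
by rewrite (kap_ge0 (ctrk k j)) (kap_le (ctrk k j)).
Qed.

Let big_level (r : R) : exists N, forall k, (N <= k)%N -> r < 2 ^+ lv k.
Proof.
exists (Num.trunc `|r|).+1 => k Nk; have /andP[_ h] := truncn_itv (normr_ge0 r).
apply: (le_lt_trans (ler_norm r)); apply: (lt_le_trans h); rewrite -natrX ler_nat.
by apply: (leq_trans (leq_trans Nk (lvk k))); apply: ltnW; exact: ltn_expl.
Qed.

Let inside (x : Rn) (t : R) : 0 <= t -> exists N, forall k, (N <= k)%N -> intime (lv k) t && inbox (lv k) x.
Proof.
move=> t0; have [N1 H1] := big_level t; have [N2 H2] := big_level `|x|.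
exists (maxn N1 N2) => k; rewrite geq_max => /andP[k1 k2]; rewrite /intime t0 H1 //=.
by apply/negPn/negP => /outside_inbox; rewrite leNgt H2.
Qed.

Let rtc x t : 0 <= t ->
  reaction k (x, t) - chi * (M0 - \int[mu]_y density k (y, t)) @[k --> \oo] --> 0.
Proof.
move=> t0; have t1 : 0 <= t + 1 by rewrite addr_ge0.
have [K K0 HK] := moment_time n0 ctr HM t1; have [N HN] := inside x t0.
pose c k := reaction k (x, t) - chi * (M0 - \int[mu]_y density k (y, t)).
apply: (cvg_eventually (N := N) (c := fun k => if (N <= k)%N then c k else 0)) => [k ->//|].
apply: (@cvg_zero_le _ _ (fun k => (chi * K) * @mesh R (lv k))); last first.
  by rewrite -(mulr0 (chi * K)); apply: cvgMr; exact: mesh_cvg0.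
move=> k; have hK : 0 <= chi * K * @mesh R (lv k) by rewrite !mulr_ge0 // ltW.
case: leqP => [Nk|_]; last by rewrite normr0.
have /andP[it ib] := HN k Nk; have /andP[ht _] := step_of_bound (lv k) t0.
(* The loss is read off at the next step, whose time may exceed t but not t + 1. *)
have hT : (step_of (lv k) t).+1%:R * @mesh R (lv k) ^+ 2 <= t + 1.
  by rewrite -natr1 mulrDl mul1r; apply: lerD => //; rewrite exprn_ile1 // ltW.
have [_ hq] := HK (lv k) _ (lvl k) hT.
have [_ hr] := rate_mass n0 (ctrk k) it hq.
have -> : c k = rate (lv k) chi M0 (q (lv k)) t - chi * (M0 - \int[mu]_y density k (y, t)).
  by rewrite /c /reaction /st /emb /= it ib.
apply: (le_trans hr); rewrite -!mulrA; apply: ler_wpM2l; first exact: ltW.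
by rewrite ler_wpM2l // -mesh2 expr2 ler_piMl // ltW.
Qed.

(** As [W] is infinite at time 0, the limits vanish for t <= 0, and integrals over positive times
    agree with integrals over all times. *)
Let good_pos z : good W z -> 0 < z.2.
Proof.
move=> gz; rewrite lt_neqAle (good_time0 gz) andbT; apply/eqP => z0.
by have := good_fine W0 gz; rewrite Wz.
Qed.

Let uu_bad z : ~~ good W z -> uu z = 0. Proof. by rewrite /limit_u => /negbTE ->. Qed.
Let gg_bad i z : ~~ good W z -> gg i z = 0. Proof. by rewrite /limit_g => /negbTE ->. Qed.
Let uuC z : 0 <= uu z <= C. Proof. exact: limit_u_bound W0 uC Wu z. Qed.
Let muu : measurable_fun setT uu. Proof. exact: measurable_limit_u. Qed.
Let mgg i : measurable_fun setT (gg i). Proof. exact: (measurable_limit_g (g := flux)). Qed.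

Lemma limit_u_mass t : 0 <= t -> (\int[mu]_x (uu (x, t))%:E <= M0%:E)%E.
Proof.
move=> t0; have [gt|gt] := boolP (good_time W t).
  have [iut _ h] := slice_mass mW W0 uC Wu mu_k iu massu t0 gt.
  by move: h; rewrite -lee_fin /Rintegral fineK // integrable_fin_num.
rewrite integral0_eq ?lee_fin ?ltW // => x _; rewrite uu_bad //.
by rewrite /good /= (negbTE gt) andbF.
Qed.

Lemma limit_u_power (k Ck t : R) : 1 < k -> 0 <= Ck -> 0 <= t ->
  (forall l, (l0 <= l)%N -> forall j, @mesh R l ^+ n * (\sum_x V l j x `^ k) <=
    Ck * (1 + j%:R * @mesh R l ^+ 2) `^ (- ((k - 1) / (m + 2 / n%:R - 1)))) ->
  (\int[mu]_x (uu (x, t) `^ k)%:E <= (Ck * (1 + t) `^ (- ((k - 1) / (m + 2 / n%:R - 1))))%:E)%E.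
Proof.
move=> k1 Ck0 t0 HV; have [gt|gt] := boolP (good_time W t).
  apply: (slice_power mW W0 uC Wu mu_k iu k1 t0 gt) => j.
  by apply: (power_at n0 (ctrk j)) => // i; exact: HV.
rewrite integral0_eq ?lee_fin ?mulr_ge0 ?powR_ge0 // => x _; rewrite uu_bad ?powR0 //.
  by rewrite gt_eqF //; move: k1; lra.
by rewrite /good /= (negbTE gt) andbF.
Qed.

Lemma limit_L1Linfty T : Linfty_L1Linfty T%:E uu.
Proof.
split; first exact: measurable_funTS.
exists (M0 + C); apply: aeW => t [/ltW t0 _]; rewrite /norm_L1Linfty EFinD; apply: leeD.
  have e : (\int[mu]_x `|(EFin \o (fun x => uu (x, t))) x| = \int[mu]_x (uu (x, t))%:E)%E.
    by apply: eq_integral => x _; rewrite /= ger0_norm //; have /andP[] := uuC (x, t).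
  by rewrite Lnorm1 e; exact: limit_u_mass.
rewrite unlock; case: ifP => _; last by rewrite lee_fin.
apply/ess_sup_inf.ess_supP; apply: aeW => x; have /andP[h1 h2] := uuC (x, t).
by rewrite /= lee_fin ger0_norm.
Qed.

Lemma limit_L2_H1 T : 0 < T -> L2_H1 T%:E (fun z => uu z `^ m) (fun z => \row_i gg i z).
Proof.
move=> T0; have mum : measurable_fun setT (fun z => uu z `^ m).
  by apply: measurableT_comp (measurable_powR m) muu.
have mgr : measurable_fun setT (fun z => \row_i gg i z : Rn).
  apply: measurable_fun_rV => i.
  have -> : rV_coord i \o (fun z : Z => \row_i gg i z : Rn) = gg i.
    by apply/funext => z; rewrite /rV_coord /= mxE.
  exact: mgg.
have mT : measurable (time T%:E : set (measurableTypeR R)).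
  by rewrite time_itv.
  have mST : measurable (@spacetime R n T%:E) by exact: measurableX.
split; [exact: measurable_funTS|exact: measurable_funTS| |].
(* u^(2m) is at most c u, and u is integrable by the mass bound; the flux part is bounded through
   [W]. *)
- pose c := C `^ (m - 1) * C `^ m; have c0 : 0 <= c by rewrite mulr_ge0 ?powR_ge0.
  pose F z := uu z * \1_(@spacetime R n T%:E) z.
  have F0 z : 0 <= F z by rewrite mulr_ge0 //; [have /andP[] := uuC z].
  have mF : measurable_fun setT F by apply: measurable_funM => //; exact: measurable_indic.
  have IF : (\int[mu2]_z (F z)%:E <= (M0 * T)%:E)%E.
    have mF' : measurable_fun setT (fun z : Z => (F z)%:E) by exact/measurable_EFinP.
    have F0' z : (0 <= (F z)%:E)%E by rewrite lee_fin.
    rewrite fubini_tonelli2 //.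
    apply: (@le_trans _ _ (\int[dt]_t (M0 * \1_(time T%:E : set (measurableTypeR R)) t)%:E)%E).
      apply: ge0_le_integral => //.
      - by move=> t _; apply: integral_ge0 => x _; rewrite lee_fin.
      - change (measurable_fun setT (fubini_G mu (fun z : Z => (F z)%:E))); exact: measurable_fun_fubini_tonelli_G.
      - by apply/measurable_EFinP; apply: measurable_funM => //; exact: measurable_indic.
      - move=> t _; rewrite /fubini_G /F indicE; have [tT|tT] := boolP (t \in _); last first.
          rewrite mulr0 integral0_eq // => x _; rewrite indicE memNset ?mulr0 // => -[_ h].
          by move: tT; rewrite mem_set.
        rewrite mulr1; move: (tT); rewrite inE => -[/ltW t0 _]; apply: le_trans (limit_u_mass t0).
        apply: ge0_le_integral => //.
        + by move=> x _; exact: (F0' (x, t)).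
        + apply/measurable_EFinP; apply: measurableT_comp mF _; exact: measurable_pair2.
        + apply/measurable_EFinP; apply: measurableT_comp muu _; exact: measurable_pair2.
        + by move=> x _; rewrite lee_fin ler_piMr //; have /andP[] := uuC (x, t).
    under eq_integral do rewrite EFinM; rewrite ge0_integralZl ?lee_fin ?(ltW M00) //; last first.
      by apply/measurable_EFinP; exact: measurable_indic.
    rewrite integral_indic // setIT time_itv.
    rewrite EFinM; apply: lee_wpmul2l; first by rewrite lee_fin ltW.
    have lT : dt `]0, T[%classic = T%:E by rewrite lebesgue_measure_itv /= lte_fin T0 -EFinD subr0.
    by rewrite le_eqVlt; apply/orP; left; apply/eqP; exact: lT.
  rewrite integral_mkcond.
  apply: (@le_lt_trans _ _ (\int[mu2]_z (c%:E * (F z)%:E + (2 + 8 * n%:R)%:E * W z))%E).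
    apply: ge0_le_integral => //.
    + move=> z _; rewrite patchE; case: ifP => // _; rewrite lee_fin addr_ge0 ?sqr_ge0 //.
      by apply: sumr_ge0 => i _; rewrite -expr2 sqr_ge0.
    + apply/(measurable_restrictT _ mST); apply: measurable_funTS; apply/measurable_EFinP.
      apply: measurable_funD; first exact: measurable_funX.
      have -> : (fun z => dotv (\row_i gg i z) (\row_i gg i z)) = (fun z => \sum_i gg i z * gg i z).
        by apply/funext => z; apply: eq_bigr => i _; rewrite mxE.
      by apply: measurable_sum => i; exact: measurable_funM.
    + apply: emeasurable_funD; first by apply/measurable_EFinP; exact: measurable_funM.
      by apply: measurable_funeM.
    + move=> z _; have hR : (0 <= c%:E * (F z)%:E + (2 + 8 * n%:R)%:E * W z)%E.
        by rewrite adde_ge0 // mule_ge0 // lee_fin // addr_ge0 // mulr_ge0.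
      rewrite patchE; case: ifPn => // zT.
      have [gz|gz] := boolP (good W z); last first.
        rewrite uu_bad // powR0 ?gt_eqF //; last by move: m1; lra.
        rewrite expr0n /= add0r; apply: le_trans hR; rewrite lee_fin /dotv big1 // => i _.
        by rewrite !mxE gg_bad // mulr0.
      rewrite (good_fine W0 gz) -!EFinM -EFinD lee_fin; apply: lerD.
        rewrite /F indicE zT mulr1 /c; have /andP[u0 uc] := uuC z.
        have hm : uu z `^ m = uu z `^ (m - 1) * uu z.
          have [->|un] := eqVneq (uu z) 0; first by rewrite powR0 ?mulr0 // gt_eqF //; move: m1; lra.
          transitivity (uu z `^ (m - 1) * uu z `^ 1); last by rewrite powRr1.
          by rewrite -powRD ?subrK // un implybT.
        have m1' : 0 <= m - 1 by move: m1; lra.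
        have mm : 0 <= m by move: m1; lra.
        rewrite expr2 {2}hm mulrA; apply: ler_wpM2r => //; rewrite mulrC; apply: ler_pM; rewrite ?powR_ge0 //; exact: powR_le.
      have := limit_g_energy W0 Wf Wf0 z; apply: le_trans; apply: le_of_eq; apply: eq_bigr => i _.
      by rewrite !mxE expr2.
  have C2 : (0 <= (2 + 8 * n%:R : R)%:E)%E by rewrite lee_fin addr_ge0 // mulr_ge0.
  have c0' : (0 <= c%:E)%E by rewrite lee_fin.
  have F0' z : (0 <= (F z)%:E)%E by rewrite lee_fin.
  have mF' : measurable_fun setT (fun z => (F z)%:E) by exact/measurable_EFinP.
  have mcF : measurable_fun setT (fun z => (c%:E * (F z)%:E)%E) by exact: measurable_funeM.
  have mdW : measurable_fun setT (fun z => ((2 + 8 * n%:R)%:E * W z)%E) by exact: measurable_funeM.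
  have e1 : (\int[mu2]_z (c%:E * (F z)%:E) = c%:E * \int[mu2]_z (F z)%:E)%E by rewrite ge0_integralZl.
  have e2 : (\int[mu2]_z ((2 + 8 * n%:R)%:E * W z) = (2 + 8 * n%:R)%:E * \int[mu2]_z W z)%E by rewrite ge0_integralZl.
  rewrite ge0_integralD //; try by move=> z _; exact: mule_ge0.
  rewrite e1 e2; apply: lte_add_pinfty; apply: lte_mul_pinfty => //.
  by apply: (le_lt_trans IF); exact: ltry.
- have := ae_good_time mW W0 IW; apply: filterS => t gt [/ltW t0 _].
  apply: (weak_gradient_at mW W0 IW uC Wu Wf Wg Wf0 lv2 mu_k mg hf iu m1 al1 b0 t0 gt).
    by move=> k i; exact: islice.
  by move=> k p i tk; apply: (space_identity (ctrk k)) => //; rewrite t0.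
Qed.

Variable w : Rn -> R.
Hypothesis iw : mu.-integrable setT (EFin \o w).
Hypothesis V0E : forall l, (l0 <= l)%N -> forall F : G l -> R,
  @mesh R l ^+ n * (\sum_x V l 0%N x * F x) = \int[mu]_y (w y * emb (fun x => if wall x then 0 else F x) y).

Let shift_space (y : Rn) (s h : R) (i : 'I_n) :
  ((y, s) : Rn * R) + h *: ((e_ i, 0) : Rn * R) = (y + h *: e_ i, s).
Proof. by congr pair; rewrite /= ?scaler0 ?addr0. Qed.

Let shift_time (y : Rn) (s h : R) : ((y, s) : Rn * R) + h *: ((0, 1) : Rn * R) = (y, s + h).
Proof. by congr pair; rewrite /= ?scaler0 ?addr0 // /GRing.scale /= mulr1. Qed.

(** Corners and instants turn phi and its difference quotients into bounded step functions supported
    in one slab, so that [weak_form] applies; the rest restricts its integrals to ]0, T[ and takes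
    the factor depending on time alone out of the space integral. *)
Lemma limit_weak (T : R) phi : test_function T%:E phi ->
  \int[dt]_(t in time T%:E) \int[mu]_x
     dotv (\row_i gg i (x, t)) (grad (fun y => phi (y, t)) x)
  - chi * \int[dt]_(t in time T%:E)
      ((\int[mu]_x (uu (x, t) `^ alpha * phi (x, t))) * (M0 - \int[mu]_x uu (x, t)))
  = \int[mu]_x (w x * phi (x, 0))
    + \int[dt]_(t in time T%:E) \int[mu]_x (uu (x, t) * derive1 (fun s => phi (x, s)) t).
Proof.
move=> [[cphi Dphi] [K [cK KT phi0]]].
have alp : 0 < alpha := lt_trans ltr01 al1.
have al0 : alpha != 0 by rewrite gt_eqF.
have fd e := (Dphi e).1; have dc e := (Dphi e).2.1.
have [M HM'] := compact_norm_bound cK; pose a := M.+3.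
have Ma : M%:R + 1 < 2 ^+ a :> R.
  rewrite -natrX natr1 ltr_nat; apply: (@ltn_trans a); [exact: leqnSn|exact: ltn_expl].
have Kn z : K z -> `|z.1| <= M%:R /\ `|z.2| <= M%:R.
  by move=> /HM'; rewrite prod_normE ge_max => /andP[].
have far1 y s : 0 <= s -> M%:R < `|y| -> phi (y, s) = 0.
  by move=> s0 yM; apply: phi0 => // /Kn[/= h _]; move: yM; rewrite ltNge h.
have far2 y s : 0 <= s -> M%:R < s -> phi (y, s) = 0.
  move=> s0 sM; apply: phi0 => // /Kn[_ /= h]; move: sM; rewrite ltNge => /negP; apply.
  exact: le_trans (ler_norm _) h.
have outa (y : Rn) : ~~ inbox a y -> M%:R + 1 < `|y| by move=> /outside_inbox; exact: (lt_le_trans Ma).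
have pz (y : Rn) (s : R) : 0 <= s -> ~~ inbox a y || (a%:R <= s) -> phi (y, s) = 0.
  move=> s0 /orP[/outa h|h]; first by apply: far1 => //; move: h; lra.
  by apply: far2 => //; apply: lt_le_trans h; rewrite ltr_nat /a !ltnS leqW.
have QB (e : Rn * R) : `|e.1| <= 1 -> `|e.2| <= 1 -> 0 <= e.2 -> exists2 B : R, 0 <= B &
    forall z h, 0 <= z.2 -> 0 < h <= 1 -> `|phi (z + h *: e) - phi z| <= B * h.
  move=> e1 e2 e3; pose Kb : set (Rn * R) := @cube R n (M%:R + 1) `*` `[- (M%:R + 1), M%:R + 1].
  apply: (quotient_bound (fd e) (dc e) (P := [set z | 0 <= z.2]) (K := K) (Kb := Kb)) => //.
  - by apply: compact_setX; [exact: compact_cube|exact: segment_compact].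
  - move=> z s /Kn[h1 h2] s1; have M1 : 0 <= M%:R + 1 :> R by rewrite addr_ge0.
    split; first apply/(cubeP _ M1); rewrite /=.
      apply: (le_trans (ler_normD _ _)); apply: lerD => //; rewrite normrZ.
      by rewrite -[leRHS]mulr1; apply: ler_pM.
    rewrite in_itv /= -ler_norml; apply: (le_trans (ler_normD _ _)); apply: lerD => //; rewrite normrM.
    by rewrite -[leRHS]mulr1; apply: ler_pM.
  - by move=> z s /= z0 s0; rewrite addr_ge0 // mulr_ge0.
have QBi (i : 'I_n) : exists B : R, 0 <= B /\ forall z h, 0 <= z.2 -> 0 < h <= 1 ->
    `|phi (z + h *: ((e_ i, 0) : Rn * R)) - phi z| <= B * h.
  by have [||//|B B0 HB] := QB (e_ i, 0); rewrite /= ?norm_delta ?normr0 //; exists B.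
have [Bi HBi] := choice QBi.
have [||//|Bt Bt0 HBt] := QB (0, 1); rewrite /= ?normr0 ?normr1 //.
have /compact_norm_bound[Bp HBp] : compact (phi @` K).
  by apply: continuous_compact => //; exact: continuous_subspaceT.
pose B := (\sum_i Bi i) + Bt + Bp%:R.
have S0 : 0 <= \sum_i Bi i by apply: sumr_ge0 => i _; exact: (HBi i).1.
have B0 : 0 <= B by rewrite !addr_ge0.
have BiB i : Bi i <= B.
  rewrite /B (bigD1 i) //= -!addrA lerDl !addr_ge0 //; apply: sumr_ge0 => j _; exact: (HBi j).1.
have phiB z : 0 <= z.2 -> `|phi z| <= B.
  move=> z0; apply: (@le_trans _ _ Bp%:R); last by rewrite /B lerDr addr_ge0.
  have [Kz|nKz] := pselect (K z); first by apply: HBp; exists z.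
  by rewrite phi0 // normr0.
pose qs i l (y : Rn) (s : R) := (phi (y + @mesh R l *: e_ i, s) - phi (y, s)) / @mesh R l.
pose qt l (y : Rn) (s : R) := (phi (y, s + @mesh R l ^+ 2) - phi (y, s)) / @mesh R l ^+ 2.
pose lift l (p : Rn -> R -> R) : Z -> R := st (fun j (x : G l) => p (node x) (j%:R * @mesh R l ^+ 2)).
have liftE l p z : lift l p z = if intime l z.2 && inbox l z.1 then p (corner l z.1) (instant l z.2) else 0.
  exact: st_corner.
have mesh20 l : 0 < @mesh R l ^+ 2 by rewrite exprn_gt0.
have mesh21 l : @mesh R l ^+ 2 <= 1 by rewrite exprn_ile1 // ltW.
have liftB l (p : Rn -> R -> R) z : (forall y s, 0 <= s -> `|p y s| <= B) ->
    (forall y s, 0 <= s -> ~~ inbox a y -> p y s = 0) -> (forall y s, 0 <= s -> M%:R + 1 < s -> p y s = 0) ->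
    `|lift l p z| <= B * \1_(@slab R n a a) z.
  move=> pB p1 p2; have h0 : 0 <= B * \1_(@slab R n a a) z by rewrite mulr_ge0.
  rewrite liftE; case: ifPn => [/andP[/andP[t0 tl] ib]|_]; last by rewrite normr0.
  have [i0 /andP[i1 i2]] := instant_bound l t0; rewrite indicE slabP.
  have [za|za] := boolP (inbox a z.1); last first.
    have -> : p (corner l z.1) (instant l z.2) = 0 by apply: p1 => //; rewrite inbox_corner.
    by rewrite normr0 mulr_ge0.
  rewrite /before t0 andTb; have [zt|zt] := ltP z.2 a%:R; first by rewrite mulr1; exact: pB.
  have -> : p (corner l z.1) (instant l z.2) = 0.
    by apply: p2 => //; have := mesh21 l; move: zt; rewrite /a -!natr1; move: i2; lra.
  by rewrite normr0 mulr_ge0.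
have corner_norm i l (y : Rn) : ~~ inbox a y -> M%:R < `|y + @mesh R l *: e_ i|.
  move=> /outa h; have := ler_normB (y + @mesh R l *: e_ i) (@mesh R l *: e_ i).
  rewrite addrK normrZ (gtr0_norm (mesh0 l)) => h2.
  have h3 : @mesh R l * `|e_ i| <= @mesh R l by rewrite ler_piMr ?norm_delta // ltW.
  by have := mesh1 l; move: h h2 h3; lra.
have qsB i l z : `|lift l (qs i l) z| <= B * \1_(@slab R n a a) z.
  apply: liftB => [y s s0|y s s0 ya|y s s0 sM]; rewrite /qs.
  - rewrite normrM normfV [`|mesh l|]gtr0_norm // ler_pdivrMr // -shift_space.
    apply: (le_trans ((HBi i).2 (y, s) _ s0 _)); first by rewrite mesh0 mesh1.
    by apply: ler_wpM2r => //; exact: ltW.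
  - rewrite !far1 ?subrr ?mul0r //; first by have := outa _ ya; lra.
    exact: corner_norm.
  - by rewrite !far2 ?subrr ?mul0r //; move: sM; lra.
have qtB l z : `|lift l (qt l) z| <= B * \1_(@slab R n a a) z.
  apply: liftB => [y s s0|y s s0 ya|y s s0 sM]; rewrite /qt.
  - rewrite normrM normfV [`|mesh l ^+ 2|]gtr0_norm // ler_pdivrMr // -shift_time.
    apply: (le_trans (HBt (y, s) _ s0 _)); first by rewrite mesh20 mesh21.
    by apply: ler_wpM2r; [exact: ltW|rewrite /B addrAC lerDr addr_ge0].
  - have h := outa _ ya; rewrite !far1 ?subrr ?mul0r ?addr_ge0 // ?ltW //; move: h; lra.
  - have h := mesh20 l; rewrite !far2 ?subrr ?mul0r ?addr_ge0 // ?ltW //; move: sM h; lra.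
have ppB l z : `|lift l (fun y s => phi (y, s)) z| <= B * \1_(@slab R n a a) z.
  apply: liftB => [y s s0|y s s0 ya|y s s0 sM]; first exact: phiB.
    by rewrite pz // ya.
  by rewrite far2 //; move: sM; lra.
have mlift l p : measurable_fun setT (lift l p) by exact: measurable_st.
have pairc (x_ : nat -> Rn) (s_ : nat -> R) (y : Rn) (s : R) : x_ k @[k --> \oo] --> y -> s_ k @[k --> \oo] --> s ->
    ((x_ k, s_ k) : Rn * R) @[k --> \oo] --> ((y, s) : Rn * R).
  move=> /cvgrPdist_le c1 /cvgrPdist_le c2; apply/cvgrPdist_le => e e0.
  by apply: filterS2 (c1 e e0) (c2 e e0) => k g1 g2; rewrite prod_normE ge_max g1 g2.
have phic (x_ : nat -> Rn * R) (z : Rn * R) : x_ k @[k --> \oo] --> z -> phi (x_ k) @[k --> \oo] --> phi z.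
  by move=> h; exact: (cvg_comp _ _ h (cphi z)).
have Xc (z : Z) : 0 <= z.2 -> ((corner (lv k) z.1, instant (lv k) z.2) : Rn * R) @[k --> \oo] --> ((z.1, z.2) : Rn * R).
  by move=> z0; apply: pairc; [exact: corner_cvg|exact: instant_cvg].
have lc (p : nat -> Rn -> R -> R) (z : Z) (r : R) : 0 <= z.2 ->
    p k (corner (lv k) z.1) (instant (lv k) z.2) @[k --> \oo] --> r -> lift (lv k) (p k) z @[k --> \oo] --> r.
  move=> z0; have [N HN] := inside z.1 z0; apply: (cvg_eventually (N := N)) => k Nk.
  by rewrite liftE HN.
(* Cut at negative times, where phi is unconstrained and the lattice quotients vanish. *)
pose P i (z : Z) := if 0 <= z.2 then 'D_((e_ i, 0) : Rn * R) phi (z.1, z.2) else 0.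
pose pt (z : Z) := 'D_((0, 1) : Rn * R) phi (z.1, z.2).
have neg l p z : z.2 < 0 -> lift l p z = 0 by move=> z0; rewrite liftE /intime leNgt z0.
have Qc i z : lift (lv k) (qs i (lv k)) z @[k --> \oo] --> P i z.
  rewrite /P; case: leP => z0; last by under eq_fun do rewrite neg //; exact: cvg_cst.
  apply: (lc (fun k => qs i (lv k))) => //; rewrite /qs; under eq_fun do rewrite -shift_space.
  apply: (quotient_cvg (fd _) (dc _) (Xc z z0) (h_ := fun k => @mesh R (lv k))) => //; exact: mesh_cvg0.
have Qtc z : good W z -> lift (lv k) (qt (lv k)) z @[k --> \oo] --> pt z.
  move=> /good_time0 z0; apply: (lc (fun k => qt (lv k))) => //; rewrite /qt.
  under eq_fun do rewrite -shift_time.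
  apply: (quotient_cvg (fd _) (dc _) (Xc z z0) (h_ := fun k => @mesh R (lv k) ^+ 2)) => //.
  rewrite -[X in _ --> X](mulr0 (0 : R)); under eq_fun do rewrite expr2.
  by apply: cvgM; exact: mesh_cvg0.
have Q0c (z : Z) : good W z -> lift (lv k) (fun y s => phi (y, s)) z @[k --> \oo] --> phi (z.1, z.2).
  move=> /good_time0 z0; apply: (lc (fun _ y s => phi (y, s))) => //.
  by apply: phic; exact: Xc.
pose q0 l (y : Rn) := emb (fun x : G l => phi (node x, 0)) y.
have q0c y : q0 (lv k) y @[k --> \oo] --> phi (y, 0).
  have [N HN] := inside y (lexx 0).
  apply: (cvg_eventually (N := N) (c := fun k => phi (corner (lv k) y, 0))).
    by move=> k /HN /andP[_ ib]; rewrite /q0 /emb ib node_idx.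
  apply: phic; apply: pairc; [exact: corner_cvg|exact: cvg_cst].
have q0B l y : `|q0 l y| <= B.
  by rewrite /q0 /emb; case: ifP => _; [exact: phiB|rewrite normr0].
have mq0 l : measurable_fun setT (q0 l) by exact: measurable_emb.
have mq : measurable_fun setT (fun y : Rn => phi (y, 0)).
  by apply: (measurable_fun_cvg (h := fun k => q0 (lv k))) => // y _; exact: q0c.
have ig k i : mu2.-integrable setT (EFin \o flux k i) by exact: (integral_st _).1.
have WI k : (a.+1 <= k)%N ->
    \int[mu2]_z (\sum_i flux k i z * lift (lv k) (qs i (lv k)) z) -
      \int[mu2]_z (reaction k z * density k z `^ alpha * lift (lv k) (fun y s => phi (y, s)) z) =
    \int[mu]_y (w y * q0 (lv k) y) + \int[mu2]_z (density_next k z * lift (lv k) (qt (lv k)) z).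
  move=> ak; have al : (a < lv k)%N := leq_trans ak (lvk k).
  have a2 : (a <= 2 ^ lv k)%N by apply: ltnW; apply: (ltn_trans al); exact: ltn_expl.
  have wid := weak_identity n0 (ctrk k) al a2 pz.
  have e1 : \int[mu2]_z (\sum_i flux k i z * lift (lv k) (qs i (lv k)) z) = \int[mu2]_z st (fun j (x : G (lv k)) =>
      \sum_i (@mesh R (lv k))^-1 * dd i (pw m (U (lv k) j)) x * qs i (lv k) (node x) (j%:R * @mesh R (lv k) ^+ 2)) z.
    apply: eq_Rintegral => z _; rewrite -st_sum; apply: eq_bigr => i _; exact: st_prod.
  have e2 : \int[mu2]_z (reaction k z * density k z `^ alpha * lift (lv k) (fun y s => phi (y, s)) z) =
      \int[mu2]_z st (fun j (x : G (lv k)) => reaction_rate chi M0 (q (lv k) j) * U (lv k) j x `^ alpha *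
        phi (node x, j%:R * @mesh R (lv k) ^+ 2)) z.
    apply: eq_Rintegral => z _; rewrite (st_op1 (op := fun r => r `^ alpha)); last first.
      by rewrite powR0.
    by rewrite /reaction /lift !st_prod.
  have e3 : \int[mu2]_z (density_next k z * lift (lv k) (qt (lv k)) z) = \int[mu2]_z st (fun j (x : G (lv k)) =>
      V (lv k) j.+1 x * qt (lv k) (node x) (j%:R * @mesh R (lv k) ^+ 2)) z.
    by apply: eq_Rintegral => z _; exact: st_prod.
  have e4 : \int[mu]_y (w y * q0 (lv k) y) = \int[mu]_y emb (fun x : G (lv k) => V (lv k) 0%N x * phi (node x, 0)) y.
    (* Wall nodes carry no average of the datum, and phi vanishes there. *)
    rewrite Rintegral_emb (V0E (lvl k)); apply: eq_Rintegral => y _; congr (_ * _); rewrite /q0.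
    congr (emb _ y); apply/funext => x; case: ifPn => // /existsP[i /eqP xi].
    apply: pz => //; apply/orP; left; apply/forallPn; exists i; rewrite /inrange mxE xi sub0r mulrN mesh_half.
    by rewrite lerN2 negb_and -ltNge; apply/orP; left; rewrite -!natrX ltr_nat ltn_exp2l.
  by rewrite e1 e2 e3 e4.
have [i1 i2 i4 lim_id] := weak_form mW W0 IW uC Wu Wf Wg Wf0 lv2 mu_k mv_k mrt mg gD hf iu massu vu rtM rtc m1 al1 b0
  (ltW chi0) (ltW M00) B0 (fun k i => mlift (lv k) (qs i (lv k))) (fun k => mlift (lv k) (fun y s => phi (y, s)))
  (fun k => mlift (lv k) (qt (lv k))) (fun k => mq0 (lv k)) mq (fun k i => qsB i (lv k)) (fun k => ppB (lv k))
  (fun k => qtB (lv k)) (fun k => q0B (lv k)) Qc Q0c Qtc q0c iw ig WI.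
have notT (t : R) : ~ time T%:E t -> t <= 0 \/ T <= t.
  move=> h; have [t0|] := leP t 0; first by left.
  by have [|tT t0] := leP T t; [right|case: h].
have phiT (x : Rn) (t : R) : 0 < t -> T <= t -> phi (x, t) = 0.
  move=> t0 tT; apply: phi0; first exact: ltW.
  by move=> /KT[_]; rewrite /= lte_fin ltNge tT.
(* Forward in time from t >= T phi vanishes, and the derivative is a limit of forward quotients; e.2
   >= 0 keeps them there. *)
have derT (x : Rn) (t : R) (e : Rn * R) : 0 < t -> T <= t -> 0 <= e.2 -> 'D_(e : Rn * R) phi (x, t) = 0.
  move=> t0 tT e0.
  have c1 : (fun _ : nat => (x, t) : Rn * R) k @[k --> \oo] --> ((x, t) : Rn * R) by exact: cvg_cst.
  have h := quotient_cvg (fd e) (dc e) c1 (mesh_cvg0 (R := R) (phi := id) (fun k => leqnn k)) (fun k => mesh0 k).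
  have h2 : (fun k => (phi ((x, t) + @mesh R k *: e) - phi (x, t)) / @mesh R k) = cst 0.
    apply/funext => k; have hk : 0 <= @mesh R k * e.2 by rewrite mulr_ge0 // ltW.
    have -> : ((x, t) : Rn * R) + @mesh R k *: e = (x + @mesh R k *: e.1, t + @mesh R k * e.2) by [].
    by rewrite !phiT ?subrr ?mul0r //; move: t0 tT hk; lra.
  rewrite -(cvg_lim (@Rhausdorff R) h) h2; apply: cvg_lim; [exact: Rhausdorff|exact: cvg_cst].
have int0 (F : Rn -> R) : (forall x, F x = 0) -> \int[mu]_x F x = 0.
  by move=> F0; transitivity (\int[mu]_x (0 : R)); [exact: eq_Rintegral|rewrite Rintegral_cst // mul0r].
have late (t : R) : 0 < t -> t <= 0 \/ T <= t -> T <= t.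
  by move=> t0 [h|//]; move: t0; rewrite ltNge h.
have bad x (t : R) : t <= 0 -> ~~ good W (x, t).
  by move=> t0; apply/negP => /good_pos /=; rewrite ltNge t0.
have E1 : \int[dt]_(t in time T%:E) \int[mu]_x dotv (\row_i gg i (x, t)) (grad (fun y => phi (y, t)) x) =
    \int[mu2]_z (\sum_i gg i z * P i z).
  rewrite -(Rfubini i1) -(Rintegral_time (T := T)) => [|t /notT tT].
    apply: eq_Rintegral => t; rewrite inE => -[t0 _]; apply: eq_Rintegral => x _.
    rewrite /dotv /grad; apply: eq_bigr => i _.
    by rewrite !mxE slice_space /P /= (ltW t0).
  apply: int0 => x; rewrite big1 // => i _.
  have [t0|t0] := leP t 0; first by rewrite gg_bad ?mul0r // bad.
  have d0 := derT x t ((e_ i, 0) : Rn * R) t0 (late t t0 tT) (lexx 0).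
  by rewrite /P /= (ltW t0) d0 mulr0.
have E4 : \int[dt]_(t in time T%:E) \int[mu]_x (uu (x, t) * derive1 (fun s => phi (x, s)) t) =
    \int[mu2]_z (uu z * pt z).
  rewrite -(Rfubini i4) -(Rintegral_time (T := T)) => [|t /notT tT].
    apply: eq_Rintegral => t _; apply: eq_Rintegral => x _; by rewrite slice_time.
  apply: int0 => x.
  have [t0|t0] := leP t 0; first by rewrite uu_bad ?mul0r // bad.
  have d0 := derT x t ((0, 1) : Rn * R) t0 (late t t0 tT) ler01.
  by rewrite /pt /= d0 mulr0.
pose H (z : Z) := (M0 - \int[mu]_y uu (y, z.2)) * (uu z `^ alpha * phi (z.1, z.2)).
have HE z : H z = chi^-1 * (chi * (M0 - \int[mu]_y uu (y, z.2)) * uu z `^ alpha * phi (z.1, z.2)).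
  by rewrite /H -!mulrA mulKf // gt_eqF.
have i2' : mu2.-integrable setT (EFin \o H).
  rewrite (_ : EFin \o H = (fun z => (chi^-1)%:E * (chi * (M0 - \int[mu]_y uu (y, z.2)) * uu z `^ alpha * phi (z.1, z.2))%:E)%E).
    exact: integrableZl.
  by apply/funext => z; rewrite -EFinM -HE.
have E2 : chi * \int[dt]_(t in time T%:E) ((\int[mu]_x (uu (x, t) `^ alpha * phi (x, t))) * (M0 - \int[mu]_x uu (x, t))) =
    \int[mu2]_z (chi * (M0 - \int[mu]_y uu (y, z.2)) * uu z `^ alpha * phi (z.1, z.2)).
  have -> : \int[mu2]_z (chi * (M0 - \int[mu]_y uu (y, z.2)) * uu z `^ alpha * phi (z.1, z.2)) = chi * \int[mu2]_z H z.
    rewrite -RintegralZl //; apply: eq_Rintegral => z _; by rewrite HE mulVKf // gt_eqF.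
  congr (chi * _); rewrite -(Rfubini i2') -(Rintegral_time (T := T)) => [|t /notT tT].
    apply: eq_Rintegral => t; rewrite inE => -[t0 _]; rewrite /H /= mulrC RintegralZl //.
    have ib := integrable_finite (C `^ alpha * B) (@measurable_box R n a) (@measure_box R n a).
    have mp : measurable_fun setT (fun x : Rn => phi (x, t)).
      apply: (measurable_fun_cvg (h := fun k x => lift (lv k) (fun y s => phi (y, s)) (x, t))) => [k|x _].
        by apply: measurableT_comp (mlift _ _) _; exact: measurable_pair2.
      apply: (lc (fun _ y s => phi (y, s))); first exact: ltW.
      by apply: phic; exact: (Xc (x, t) (ltW t0)).
    apply: (integrable_le _ ib).
      apply: measurable_funM => //; apply: measurableT_comp (measurable_powR alpha) _.
      by apply: measurableT_comp muu _; exact: measurable_pair2.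
    move=> x; rewrite lee_fin normrM -mulrA; have /andP[u0 uc] := uuC (x, t).
    apply: ler_pM => //; first by rewrite ger0_norm ?powR_ge0 //; apply: powR_le => //; exact: ltW.
    rewrite indicE; have [xa|xa] := boolP (inbox a x).
      by rewrite mem_set // mulr1; apply: phiB; exact: ltW.
    have -> : phi (x, t) = 0 by apply: pz; [exact: ltW|rewrite xa].
    by rewrite normr0 mulr_ge0.
  apply: int0 => x; rewrite /H /=.
  have [t0|t0] := leP t 0.
    by rewrite uu_bad ?bad // powR0 ?mul0r ?mulr0.
  by rewrite (phiT x t t0 (late t t0 tT)) !mulr0.
by rewrite E1 E2 E4; exact: lim_id.
Qed.

Lemma limit_solution : global_weak_solution m alpha chi M0 w uu.
Proof.
move=> T T0; split; [|exact: limit_L1Linfty|].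
  by move=> x t _ _; have /andP[] := uuC (x, t).
exists (fun z => \row_i gg i z); first exact: limit_L2_H1.
by move=> phi; exact: limit_weak.
Qed.

End solution.

(** * Reduction to a bounded datum and conclusion *)

(** The datum has its bounds only almost everywhere, while the scheme needs them at every point; it
    starts from a truncation that agrees with the datum almost everywhere. *)
Lemma datum_truncation (R : realType) (n : nat) (u0 : 'rV[R]_n -> R) (A : R) :
  measurable_fun setT u0 -> (\forall x \ae lebesgue_rV R n, 0 <= u0 x) ->
  norm_L1Linfty u0 = A%:E -> 0 <= A /\
  exists w : 'rV[R]_n -> R, [/\ measurable_fun setT w, forall y, 0 <= w y <= A,
    forall y, `|w y| <= `|u0 y| & \forall x \ae lebesgue_rV R n, w x = u0 x].
Proof.
move=> mu0 u00 eA; have N1 := Lnorm_ge0 (lebesgue_rV R n) 1 (EFin \o u0).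
have No := Lnorm_ge0 (lebesgue_rV R n) +oo%E (EFin \o u0).
have A0 : 0 <= A by rewrite -lee_fin -eA; exact: adde_ge0.
have NA : ('N[lebesgue_rV R n]_+oo[EFin \o u0] <= A%:E)%E by rewrite -eA; exact: leeDr.
split=> //; exists (fun y => Num.min (Num.max (u0 y) 0) A); split.
- by apply: measurable_minr => //; exact: measurable_maxr.
- by move=> y; rewrite le_min ge_min lexx orbT andbT A0 le_max lexx orbT.
- move=> y; rewrite ger0_norm; last by rewrite le_min A0 le_max lexx orbT.
  by rewrite ge_min ge_max ler_norm normr_ge0.
- have uA : \forall x \ae lebesgue_rV R n, u0 x <= A.
    move: NA; rewrite unlock; case: ifPn => [_|T0 _].
      move/ess_sup_inf.ess_supP; apply: filterS => x /=; rewrite lee_fin; exact: le_trans (ler_norm _).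
    (* The norm is 0 by convention on a space of measure 0, where every property holds almost
       everywhere. *)
    exists setT; split=> //; apply/eqP; rewrite eq_le measure_ge0 andbT leNgt; exact: T0.
  apply: filterS2 u00 uA => x h1 h2; rewrite max_l // min_l //.
Qed.

Lemma Rintegral_ae (R : realType) (n : nat) (f g F : 'rV[R]_n -> R) :
  measurable_fun setT f -> measurable_fun setT g -> measurable_fun setT F ->
  (\forall x \ae lebesgue_rV R n, f x = g x) ->
  \int[lebesgue_rV R n]_x (f x * F x) = \int[lebesgue_rV R n]_x (g x * F x).
Proof.
move=> mf mg mF fg; rewrite /Rintegral; congr fine; apply: ae_eq_integral => //.
- by apply/measurable_EFinP; exact: measurable_funM.
- by apply/measurable_EFinP; exact: measurable_funM.
- by apply: filterS fg => x -> _.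
Qed.

Lemma mesh_eventually (R : realType) (e : R) : 0 < e -> exists l0, forall l, (l0 <= l)%N -> @mesh R l <= e.
Proof.
move=> e0; have /cvgrPdist_le/(_ e e0)[l0 _ H] := mesh_cvg0 (R := R) (phi := id) (fun k => leqnn k).
exists l0 => l /H /=; rewrite sub0r normrN; exact: le_trans (ler_norm _).
Qed.

(** The hyperplane t = 0 is null, so raising [W] there costs nothing, and time 0 is removed from the
    good points. *)
Lemma infinite_at_time0 (R : realType) (n : nat) (W : 'rV[R]_n * measurableTypeR R -> \bar R) :
  measurable_fun setT W -> (forall z, (0 <= W z)%E) ->
  (\int[(lebesgue_rV R n \x @lebesgue_measure R)%E]_z W z < +oo)%E ->
  exists W', [/\ measurable_fun setT W', forall z, (W z <= W' z)%E,
    (\int[(lebesgue_rV R n \x @lebesgue_measure R)%E]_z W' z < +oo)%E &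
    forall z : 'rV[R]_n * measurableTypeR R, z.2 = 0 -> W' z = +oo%E].
Proof.
move=> mW W0 IW; set mu2 := (lebesgue_rV R n \x @lebesgue_measure R)%E.
pose N : set ('rV[R]_n * measurableTypeR R) := setT `*` [set 0].
have mN : measurable N by apply: measurableX => //; exact: measurable_set1.
have N0 : mu2 N = 0%E.
  rewrite /mu2 product_measure1E //; transitivity (lebesgue_rV R n setT * 0)%E; last exact: mule0.
  by congr (_ * _)%E; exact: (@lebesgue_measure_set1 R 0).
pose W' z : \bar R := if z \in N then +oo%E else W z.
have mW' : measurable_fun setT W'.
  apply: measurable_fun_ifT => //; apply: (measurable_fun_bool true); rewrite setTI.
  by rewrite (_ : _ @^-1` _ = N) //; apply/seteqP; split => z /=; [exact: set_mem|exact: mem_set].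
exists W'; split=> //.
- by move=> z; rewrite /W'; case: ifP => // _; exact: leey.
- rewrite (_ : (\int[mu2]_z W' z = \int[mu2]_z W z)%E) //; apply: ae_eq_integral => //.
  exists N; split=> // z /= h; apply: contrapT => nz; apply: h => _; rewrite /W' ifN //.
  by apply/negP; rewrite inE.
- by move=> z z0; rewrite /W' mem_set //; split.
Qed.

Local Open Scope ring_scope.

Theorem theorem1p6 (R : realType) (n : nat) (m alpha chi M0 : R)
    (hn : (3 <= n)%N) (hm : 1 < m) (halpha : alpha = m + 2 / n%:R)
    (hchi : 0 < chi) (hM0 : 0 < M0) (hM : M0 <= M_star n m alpha chi)
    (m0 A : R) :
  (* the constants depend on the data only through m0 and
     A = ||u0||_{L^1 \cap L^oo}, besides n, m, chi, M0 (and k for C1) *)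
  exists (C1 : R -> R) (C2 : R),
    forall u0 : 'rV[R]_n -> R,
      measurable_fun setT u0 ->
      (\forall x \ae lebesgue_rV R n, 0 <= u0 x) ->
      (lebesgue_rV R n).-integrable setT
        (fun x => ((1 + dotv x x) * u0 x)%:E) ->
      ('N[lebesgue_rV R n]_+oo[EFin \o u0] < +oo)%E ->
      has_L2_gradient (fun x => u0 x `^ m) ->
      m0 = \int[lebesgue_rV R n]_x u0 x ->
      m0 < M0 ->
      norm_L1Linfty u0 = A%:E ->
      exists u : 'rV[R]_n * R -> R,
        global_weak_solution m alpha chi M0 u0 u /\
        forall t : R, 0 < t ->
          (forall k : R, 1 < k ->
             ('N[lebesgue_rV R n]_(k%:E)[EFin \o (fun x => u (x, t))] <=
              (C1 k * (1 + t) `^ (- ((k - 1) / (k * (m + 2 / n%:R - 1)))))%:E)%E)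
          /\ ('N[lebesgue_rV R n]_+oo[EFin \o (fun x => u (x, t))] <= C2%:E)%E.
Proof.
have n0 : (0 < n)%N by exact: leq_trans hn.
have a0 : 0 < 2 / n%:R :> R by rewrite divr_gt0 // ltr0n.
have mass u0 (w : 'rV[R]_n -> R) : measurable_fun setT u0 -> measurable_fun setT w ->
    (\forall x \ae lebesgue_rV R n, w x = u0 x) -> \int[lebesgue_rV R n]_x u0 x = \int[lebesgue_rV R n]_x w x.
  move=> h1 h2 h3; have := Rintegral_ae h2 h1 (@measurable_cst _ _ 'rV[R]_n R setT 1) h3.
  by under eq_Rintegral do rewrite mulr1; move=> ->; apply: eq_Rintegral => x _; rewrite mulr1.
(* The constants are chosen before the datum; if [m0] and [A] fit no datum, any constants do. *)
have [adm|nadm] := pselect (admissible m chi M0 m0 A); last first.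
  exists (fun=> 0), 0 => u0 mu0 u00 _ _ _ em m0M eA; exfalso; apply: nadm.
  have [A0 [w [mw wA _ wu]]] := datum_truncation mu0 u00 eA.
  split=> //; rewrite (ltW m0M) andbT em (mass _ _ mu0 mw wu).
  by apply: Rintegral_ge0 => y _; have /andP[] := wA y.
have [C [h1 [C0 /andP[h10 h11] Hc]]] := scheme_controlled n0 adm.
have m1' : 1 < m + 1 by move: hm; lra.
(* For k = m + 1 the exponent (k + m - 1) / 2 is m: the dissipation is the energy of u^m. *)
have [Y [D [Y0 D0 HDk]]] := power_bound n0 adm m1'.
have [Ck HCk] : exists Ck : R -> R, forall k, 1 < k -> 0 < Ck k /\
    forall P h K (U V : nat -> {ffun 'I_n -> 'I_P.+2} -> R) q J, controlled m chi M0 m0 A h K U V q J -> h <= 1 ->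
    forall j, (j <= J.+1)%N -> h ^+ n * (\sum_x V j x `^ k) <=
      Ck k * (1 + j%:R * h ^+ 2) `^ (- ((k - 1) / (m + 2 / n%:R - 1))).
  suff /choice[Ck H] : forall k, exists c : R, 1 < k -> 0 < c /\
      forall P h K (U V : nat -> {ffun 'I_n -> 'I_P.+2} -> R) q J, controlled m chi M0 m0 A h K U V q J -> h <= 1 ->
      forall j, (j <= J.+1)%N -> h ^+ n * (\sum_x V j x `^ k) <=
        c * (1 + j%:R * h ^+ 2) `^ (- ((k - 1) / (m + 2 / n%:R - 1))) by exists Ck.
  move=> k; have [k1|k1] := ltP 1 k; last by exists 0.
  by have [c c0 H] := power_decay n0 adm k1; exists c.
exists (fun k => Ck k `^ k^-1), C => u0 mu0 u00 iu2 _ _ em m0M eA.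
have [A0 [w [mw wA wu0 wu]]] := datum_truncation mu0 u00 eA.
have dot0 (x : 'rV[R]_n) : 0 <= dotv x x by apply: sumr_ge0 => i _; rewrite -expr2 sqr_ge0.
have mdot : measurable_fun setT (fun x : 'rV[R]_n => dotv x x).
  apply: measurable_sum => i.
  by apply: measurable_funM; exact: (measurable_rV_coord i).
have iu2a := integrable_abse iu2.
have iu0 : (lebesgue_rV R n).-integrable setT (EFin \o u0).
  apply: (integrable_le mu0 iu2a) => x /=; rewrite lee_fin normrM ler_peMl //.
  by rewrite ger0_norm ?addr_ge0 // lerDl.
have iw : (lebesgue_rV R n).-integrable setT (EFin \o w).
  apply: (integrable_le mw (integrable_abse iu0)) => x /=; by rewrite lee_fin.
have iM : (lebesgue_rV R n).-integrable setT (fun y => (w y * (2 * dotv y y + 2 * n%:R))%:E).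
  apply: (@integrable_le _ _ _ _ (fun y => w y * (2 * dotv y y + 2 * n%:R))
    (fun x => (2 * n%:R)%:E * `|((1 + dotv x x) * u0 x)%:E|)%E).
  - apply: measurable_funM => //; apply: measurable_funD => //; exact: measurable_funM.
  - exact: integrableZl.
  - move=> x; rewrite -EFinM lee_fin !normrM mulrC mulrA; apply: ler_pM => //.
    rewrite !ger0_norm ?addr_ge0 ?mulr_ge0 // mulrDr mulr1 addrC lerD2l -mulrA ler_wpM2l //.
    by rewrite ler_peMl // ler1n.
have em' : m0 = \int[lebesgue_rV R n]_x w x by rewrite em; exact: mass.
have [l0 Hl0] := mesh_eventually h10.
have Hs l : exists s : (nat -> {ffun 'I_n -> 'I_(top l).+2} -> R) * (nat -> {ffun 'I_n -> 'I_(top l).+2} -> R) * (nat -> R),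
    scheme m chi M0 m0 (@mesh R l) s.1.1 s.1.2 s.2 /\ s.1.2 0%N = cell_average w (l := l).
  have [v0 vw _] := average_initial mw wA iw l.
  have [U [V [q H]]] := scheme_exists n0 M0 m0 (@mesh R l) hm (ltW hchi) (fun x => proj1 (andP (v0 x))) vw.
  by exists ((U, V), q).
pose S l := projT1 (cid (Hs l)); have HS l := projT2 (cid (Hs l)).
pose U l := (S l).1.1; pose V l := (S l).1.2; pose q l := (S l).2.
have HV l : V l 0%N = cell_average w (l := l) by case: (HS l).
have ctr l : (l0 <= l)%N -> forall J, controlled m chi M0 m0 A (@mesh R l) C (U l) (V l) (q l) J.
  move=> ll; apply: Hc; [by rewrite mesh_gt0 Hl0|by case: (HS l)|].
  by rewrite HV em'; exact: average_initial.
have HD l : (l0 <= l)%N -> forall J, \sum_(j < J) @mesh R l ^+ n * dform (pw m (U l j)) (pw m (U l j)) <= D.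
  move=> ll [|J]; first by rewrite big_ord0 ltW.
  have [_] := HDk _ _ _ _ _ _ _ (ctr l ll J).
  by rewrite (_ : (m + 1 + m - 1) / 2 = m) //; field.
have HM l : (l0 <= l)%N -> @mesh R l ^+ n * (\sum_x V l 0%N x * moment (@mesh R l) (4 ^ l) x) +
    (@mesh R l * (4 ^ l)%:R) ^+ 2 * (q l 0%N - @mesh R l ^+ n * (\sum_x V l 0%N x)) <=
    \int[lebesgue_rV R n]_y (w y * (2 * dotv y y + 2 * n%:R)).
  move=> ll; have -> : q l 0%N = m0 by have [[]] := HS l.
  by rewrite HV em'; exact: average_moment.
(* The averages are those of [w], but the weak formulation is wanted with [u0]; the integrals
   agree. *)
have V0E l : (l0 <= l)%N -> forall F : {ffun 'I_n -> 'I_(top l).+2} -> R,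
    @mesh R l ^+ n * (\sum_x V l 0%N x * F x) =
    \int[lebesgue_rV R n]_y (u0 y * emb (fun x => if wall x then 0 else F x) y).
  move=> _ F; rewrite HV (average_sum mw wA iw); apply: Rintegral_ae => //; exact: measurable_emb.
have e8 p : 0 < (8^-1 : R) ^+ p by rewrite exprn_gt0 // invr_gt0.
(* The precision 8^-p at stage p is what [fast_sum] requires, and the levels are at least 2 k for
   the sake of the mesh. *)
have [lv Hlv] := cauchy_extract (fun k => maxn l0 (2 * k))
  (fun p => density_precompact n0 ctr HD HM p (e8 p)).
have lvl k : (l0 <= lv k)%N by have [h _ _] := Hlv k; exact: leq_trans (leq_maxl _ _) h.
have lv2 k : (2 * k <= lv k)%N by have [h _ _] := Hlv k; exact: leq_trans (leq_maxr _ _) h.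
have [f [W0 [hf mW0 W00 IW0 [Wu Wf Wg Wf0]]]] := dominating_sum lv2 (u := density U lv) (g := flux m U lv)
  (fun k => measurable_st _) (fun k i => measurable_st _)
  (fun k => gradient_energy (HD _ (lvl k))) (fun k => let: And3 _ _ h := Hlv k in h).
have [W [mW WW IW Wz]] := infinite_at_time0 mW0 W00 IW0.
have W0' z : (0 <= W z)%E by exact: le_trans (W00 z) (WW z).
have Wu' k (z : 'rV[R]_n * measurableTypeR R) hz := le_trans (Wu k z hz) (WW z).
have Wf' k i z := le_trans (Wf k i z) (WW z).
have Wg' k i z := le_trans (Wg k i z) (WW z).
have Wf0' z := le_trans (Wf0 z) (WW z).
exists (limit_u (density U lv) W); split.
  rewrite halpha.
  by eapply limit_solution; eassumption.
have uC k z : 0 <= density U lv k z <= C.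
  by apply: st_bound => [|j x]; [exact: ltW|exact: bound_U (ctr _ (lvl k)) j x].
have uuC z := limit_u_bound W0' uC Wu' z.
move=> t t0; split=> [k k1|]; last first.
  rewrite unlock; case: ifP => _; last by rewrite lee_fin ltW.
  apply/ess_sup_inf.ess_supP; apply: aeW => x; have /andP[g1 g2] := uuC (x, t).
  by rewrite /= lee_fin ger0_norm.
have [Ck0 HCkk] := HCk k k1; have k0 : 0 < k by move: k1; lra.
have mesh1 l : @mesh R l <= 1 by rewrite /mesh exprn_ile1 ?invr_ge0 ?invf_le1 ?ler1n.
have hC : 0 <= Ck k := ltW Ck0; have ht := ltW t0.
have dec l : (l0 <= l)%N -> forall j, @mesh R l ^+ n * (\sum_x V l j x `^ k) <=
    Ck k * (1 + j%:R * @mesh R l ^+ 2) `^ (- ((k - 1) / (m + 2 / n%:R - 1))).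
  by move=> ll j; exact: (HCkk _ _ _ _ _ _ _ (ctr l ll j) (mesh1 l) j (leqnSn j)).
have P : (\int[lebesgue_rV R n]_x (limit_u (density U lv) W (x, t) `^ k)%:E <=
    (Ck k * (1 + t) `^ (- ((k - 1) / (m + 2 / n%:R - 1))))%:E)%E by eapply limit_u_power; eassumption.
rewrite unlock.
have -> : (\int[lebesgue_rV R n]_x `|(EFin \o (fun y => limit_u (density U lv) W (y, t))) x| `^ k =
    \int[lebesgue_rV R n]_x (limit_u (density U lv) W (x, t) `^ k)%:E)%E.
  by apply: eq_integral => x _; rewrite /= ger0_norm //; have /andP[] := uuC (x, t).
set X := (1 + t) `^ _ in P.
apply: (@le_trans _ _ ((Ck k * X)%:E `^ k^-1)%E).
  apply: gt0_ler_poweR => //; rewrite ?invr_ge0 ?(ltW k0) // in_itv /= leey andbT.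
    by apply: integral_ge0 => x _; rewrite lee_fin powR_ge0.
  by rewrite lee_fin mulr_ge0 ?powR_ge0 // ltW.
rewrite poweR_EFin lee_fin powRM ?powR_ge0 ?(ltW Ck0) // /X -powRrM.
rewrite (_ : - ((k - 1) / (m + 2 / n%:R - 1)) * k^-1 = - ((k - 1) / (k * (m + 2 / n%:R - 1)))) //.
by rewrite mulNr -mulrA -invfM [k * _]mulrC.
Qed.
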